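(* Let $r\in\{0,\ldots,d-1\}$, $\alpha\in(0,1)$, $\beta\in(0,1]$, $L>0$. Consider the asymptotics $M\to\infty$, where $n$, $h$, $\underline\lambda_r\ge0$ can vary arbitrarily with $M$ subject to $\mathrm{BIAS}_0^\Sigma(h)\le C\varepsilon_{n,h}^2$ for some constant $C>0$ independent of $M$. Let $$\varphi_{\alpha,1}=\mathbf 1\big(\lambda_{r+1}(\widehat C^{t,h})>\kappa_{\alpha,1}\big),\qquad\kappa_{\alpha,1}=\Big(B_w+(2\pi)^{-1/2}M^{3/2}\,q_{1-\alpha;\lambda_{max}(GOE(d-r))}\Big)\varepsilon_{n,h}^2,$$ where $q_{1-\alpha;\lambda_{max}(GOE(d-r))}$ is the $(1-\alpha)$-quantile of $\lambda_{max}(Z)$ for $Z\sim GOE(d-r)$. Then $\varphi_{\alpha,1}$ is an asymptotically uniform level-$\alpha$ test: $$\limsup_{M\to\infty}\ \sup_{\Sigma\in\mathcal H_0(I_{t,h},\beta,L,\underline\lambda_r)}\mathbb P_\Sigma(\varphi_{\alpha,1}=1)\le\alpha.$$ This remains true for $\varphi_{\alpha,2}=\mathbf 1\big(\lambda_{r+1}(\widehat C^{t,h})>\kappa_{\alpha,2}\big)$ in place of $\varphi_{\alpha,1}$, with the critical value $\kappa_{\alpha,2}=q_{1-\alpha,\Lambda_M}\,\varepsilon_{n,h}^2$, where $q_{1-\alpha,\Lambda_M}$ is the $(1-\alpha)$-quantile of $$\Lambda_M=\lambda_{max}\Big(\sum_{j\ge1}w_jj^2\,\zeta_j\zeta_j^\top\Big)\quad\text{with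 independent }\zeta_j\sim N(0,I_{d-r}).$$
   Context: Setting. Let $d\ge1$, $\eta>0$, $n\in\mathbb N$. $\mathbb R^{d\times d}_{spd}$ denotes the symmetric positive semi-definite $d\times d$ matrices; $\lambda_{max}(S)=\lambda_1(S)\ge\cdots\ge\lambda_d(S)$ are the ordered eigenvalues of a symmetric matrix $S$; $\|\cdot\|$ is the spectral norm. Let $X(t)=X(0)+\int_0^t\sigma(s)\,dB(s)$, $t\in[0,1]$, with a given initial value $X(0)$, a $p$-dimensional standard Brownian motion $B$, deterministic $\sigma\in L^2([0,1];\mathbb R^{d\times p})$, and $\Sigma(t)=\sigma(t)\sigma(t)^\top$. One observes $dY(t)=X(t)\,dt+\eta n^{-1/2}\,dW(t)$, $t\in[0,1]$, with a $d$-dimensional standard Brownian motion $W$ independent of $X$. $\mathbb P_\Sigma$ denotes the law of the observations. For $t\in[0,1)$, $h\in(0,1-t]$ let $I_{t,h}=[t,t+h]$, and for $j\ge1$ let $\Phi_j(s)=\sqrt{2/h}\sin(j\pi(s-t)/h)$, $S_j=\int_{I_{t,h}}\Phi_j'(s)\,dY(s)\in\mathbb R^d$, $\varepsilon_{n,h}=\pi h^{-1}\eta n^{-1/2}$. (The joint law of $(S_j)_{j\ge1}$ depends on $\Sigma$ only through its restriction to $I_{t,h}$.) For $M\ge1$ define $w_j=c_wM^{-1}(1+j^2/M^2)^{-2}$, $j\ge1$, with $c_w>0$ such that $\sum_{j\ge1}w_j=1$, and $\widehat C^{t,h}=\sum_{j\ge1}w_jS_jS_j^\top$, $B_w=\sum_{j\ge1}w_jj^2$.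 For an interval $I$, $C^\beta(I,L)=\{\Sigma:I\to\mathbb R^{d\times d}_{spd}\,:\,\|\Sigma(t)-\Sigma(s)\|\le L|t-s|^\beta\ \forall t,s\in I\}$. The null hypothesis is $$\mathcal H_0(I_{t,h},\beta,L,\underline\lambda_r)=\{\Sigma\in C^\beta(I_{t,h},L)\,:\,\mathrm{rank}(\Sigma(s))\le r,\ \lambda_r(\Sigma(s))\ge\underline\lambda_r\text{ for all }s\in I_{t,h}\}$$ (for $r=0$ the condition on $\lambda_r$ is void), and $\mathrm{BIAS}_0^\Sigma(h)=\min\big(2Lh^\beta,(r+4)L^2h^{2\beta}/\underline\lambda_r\big)$, with the second term read as $+\infty$ if $\underline\lambda_r=0$. $GOE(m)$ is the law of the symmetric random $m\times m$ matrix $Z$ with independent $Z_{i,j}$ for $j\ge i$, $Z_{j,i}=Z_{i,j}$, $Z_{i,i}\sim N(0,2)$, $Z_{i,j}\sim N(0,1)$ for $j>i$. *)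

(* Defs.v *)
From HB Require Import structures.
From mathcomp Require Import all_boot all_order all_algebra.
From mathcomp Require Import all_classical all_reals all_analysis.

Set Implicit Arguments.
Unset Strict Implicit.
Unset Printing Implicit Defensive.

Import Order.TTheory GRing.Theory Num.Theory.
Import numFieldNormedType.Exports.

Local Open Scope classical_set_scope.
Local Open Scope ring_scope.

(* Sum over j >= 1; meaningful when the series converges. *)
Definition sum_ge1 {R : realType} (u : nat -> R) : R :=
  limn (fun N => \sum_(1 <= j < N) u j).

(* The eigenvalues with multiplicity, in decreasing order: the unique decreasing
   list that splits the characteristic polynomial ([::] if it does not split
   over R, which does not happen for a symmetric matrix). *)
Definition eigvals {R : realType} {m : nat} (A : 'M[R]_m) : seq R :=
  xget [::] [set s : seq R | sorted (fun x y => y <= x) s /\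
                             char_poly A = \prod_(x <- s) ('X - x%:P)].

(* lambda_k(A), numbered from k = 1. *)
Definition eigval {R : realType} {m : nat} (A : 'M[R]_m) (k : nat) : R :=
  nth 0 (eigvals A) k.-1.

Definition lambda_max {R : realType} {m : nat} (A : 'M[R]_m) : R := eigval A 1.

Definition spectral_norm {R : realType} {m : nat} (A : 'M[R]_m) : R :=
  Num.sqrt (lambda_max (A^T *m A)).

Definition psd {R : realType} {m : nat} (A : 'M[R]_m) : Prop :=
  A^T = A /\ forall v : 'cV[R]_m, 0 <= (v^T *m A *m v) 0 0.

Definition weighted_gram {R : realType} {m : nat} (a : nat -> R)
    (v : nat -> 'cV[R]_m) : 'M[R]_m :=
  \matrix_(i, k) sum_ge1 (fun j => a j * (v j *m (v j)^T) i k).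

Definition mutually_independent {R : realType} {disp : measure_display}
    {T : measurableType disp} (P : probability T R) (I : eqType)
    (X : I -> T -> R) : Prop :=
  forall (J : seq I) (A : I -> set R), uniq J -> (forall i, measurable (A i)) ->
    P (\bigcap_(i in [set` J]) X i @^-1` A i) =
    (\big[*%E/1]_(i <- J) P (X i @^-1` A i))%E.

(* X ~ N(0, v) with v > 0; normal_prob takes the standard deviation. *)
Definition centered_gaussian {R : realType} {disp : measure_display}
    {T : measurableType disp} (P : probability T R) (v : R) (X : T -> R) : Prop :=
  measurable_fun setT X /\
  forall A : set R, measurable A -> P (X @^-1` A) = normal_prob 0 (Num.sqrt v) A.

(* Independent random vectors zeta_j ~ N(0, I_m), i.e. all the coordinates of
   all the vectors are independent and standard normal. *)
Definition iid_standard_gaussian {R : realType} {disp : measure_display}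
    {T : measurableType disp} (P : probability T R) {m : nat}
    (zeta : nat -> T -> 'cV[R]_m) : Prop :=
  mutually_independent P
    (fun (ji : nat * 'I_m) (w : T) => zeta ji.1 w ji.2 0) /\
  forall j i, centered_gaussian P 1 (fun w => zeta j w i 0).

Definition is_GOE {R : realType} {disp : measure_display}
    {T : measurableType disp} (P : probability T R) {m : nat}
    (Z : T -> 'M[R]_m) : Prop :=
  [/\ forall w, (Z w)^T = Z w,
      mutually_independent P
        (fun (ij : {ij : 'I_m * 'I_m | (ij.1 <= ij.2)%N}) (w : T) =>
           Z w (val ij).1 (val ij).2),
      forall i, centered_gaussian P 2 (fun w => Z w i i) &
      forall i j : 'I_m, (i < j)%N -> centered_gaussian P 1 (fun w => Z w i j)].

Definition quantile {R : realType} {disp : measure_display}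
    {T : measurableType disp} (P : probability T R) (V : T -> R) (a : R) : R :=
  inf [set x : R | (a%:E <= P [set w | (V w <= x)%R])%E].

Definition random_vectors {R : realType} {disp : measure_display}
    {T : measurableType disp} {m : nat} (X : R -> T -> 'cV[R]_m) : Prop :=
  forall s i, 0 <= s <= 1 -> measurable_fun setT (fun w => X s w i 0).

Definition continuous_paths {R : realType} {T : Type} {m : nat}
    (X : R -> T -> 'cV[R]_m) : Prop :=
  forall w i, {within `[0, 1], continuous (fun s : R => X s w i 0)}.

Definition brownian_motion {R : realType} {disp : measure_display}
    {T : measurableType disp} (P : probability T R) {m : nat}
    (B : R -> T -> 'cV[R]_m) : Prop :=
  [/\ random_vectors B,
      forall w, B 0 w = 0,
      continuous_paths B &
      forall (k : nat) (u : nat -> R), 0 <= u 0%N -> u k <= 1 ->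
        (forall l, (l < k)%N -> u l < u l.+1) ->
        mutually_independent P
          (fun (il : 'I_m * 'I_k) (w : T) =>
             B (u il.2.+1) w il.1 0 - B (u il.2) w il.1 0) /\
        forall (i : 'I_m) (l : 'I_k),
          centered_gaussian P (u l.+1 - u l)
            (fun w => B (u l.+1) w i 0 - B (u l) w i 0)].

Definition process_sigma_algebra {R : realType} {T : Type} {m : nat}
    (X : R -> T -> 'cV[R]_m) : set (set T) :=
  <<s [set A | exists (s : R) (i : 'I_m) (U : set R),
         [/\ 0 <= s <= 1, measurable U & A = (fun w => X s w i 0) @^-1` U]] >>.

Definition independent_processes {R : realType} {disp : measure_display}
    {T : measurableType disp} (P : probability T R) {m k : nat}
    (X : R -> T -> 'cV[R]_m) (W : R -> T -> 'cV[R]_k) : Prop :=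
  forall A C, process_sigma_algebra X A -> process_sigma_algebra W C ->
    P (A `&` C) = (P A * P C)%E.

(* The list g encodes the step function sum_((c, (a, b)) in g) c 1_(]a, b]). *)
Definition step_fun {R : realType} (g : seq (R * (R * R))) (s : R) : R :=
  \sum_(q <- g) q.1 * \1_`]q.2.1, q.2.2] s.

Definition step_integral {R : realType} {T : Type} (b : R -> T -> R)
    (g : seq (R * (R * R))) (w : T) : R :=
  \sum_(q <- g) q.1 * (b q.2.2 w - b q.2.1 w).

(* Z is a version of int_0^t f(s) db(s), for f deterministic in L^2([0, t]) and
   b a scalar Brownian motion: the L^2(P)-limit of the integrals of step
   functions that converge to f in L^2([0, t]). *)
Definition wiener_integral {R : realType} {disp : measure_display}
    {T : measurableType disp} (P : probability T R) (b : R -> T -> R)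
    (f : R -> R) (t : R) (Z : T -> R) : Prop :=
  measurable_fun setT Z /\
  exists g : nat -> seq (R * (R * R)),
    [/\ forall k q, q \in g k -> 0 <= q.2.1 /\ q.2.1 <= q.2.2 <= t,
        (\int[@lebesgue_measure R]_(s in `[0%R, t])
            ((f s - step_fun (g k) s) ^+ 2)%:E)%E @[k --> \oo] --> 0%E &
        'E_P[(fun w => (Z w - step_integral b (g k) w) ^+ 2)%R]%E
          @[k --> \oo] --> 0%E].

Definition square_integrable {R : realType} {d p : nat}
    (sigma : R -> 'M[R]_(d, p)) : Prop :=
  forall i k, measurable_fun (`[0, 1] : set R) (fun s => sigma s i k) /\
    (\int[@lebesgue_measure R]_(s in `[0%R, 1%R]) ((sigma s i k) ^+ 2)%:E < +oo)%E.

(* X(0) is any random vector; it may be deterministic and it may depend on B. *)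
Definition wiener_driven {R : realType} {disp : measure_display}
    {T : measurableType disp} (P : probability T R) {d p : nat}
    (sigma : R -> 'M[R]_(d, p)) (B : R -> T -> 'cV[R]_p)
    (X : R -> T -> 'cV[R]_d) : Prop :=
  forall t i, 0 <= t <= 1 ->
    exists Z : 'I_p -> T -> R,
      (forall k, wiener_integral P (fun s w => B s w k 0)
                   (fun s => sigma s i k) t (Z k)) /\
      {ae P, forall w, X t w i 0 = X 0 w i 0 + \sum_k Z k w}.

Record signal_noise_model {R : realType} {disp : measure_display}
    {T : measurableType disp} (P : probability T R) {d p : nat}
    (sigma : R -> 'M[R]_(d, p)) (B : R -> T -> 'cV[R]_p)
    (X W : R -> T -> 'cV[R]_d) : Prop := SignalNoiseModel {
  model_sigma : square_integrable sigma ;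
  model_B : brownian_motion P B ;
  model_X_measurable : random_vectors X ;
  model_X_continuous : continuous_paths X ;
  model_X : wiener_driven P sigma B X ;
  model_W : brownian_motion P W ;
  model_indep : independent_processes P X W }.

(* dY = X dt + eta n^(-1/2) dW, started from Y(0) = 0; only the increments of
   Y are used. *)
Definition observation {R : realType} {T : Type} {d : nat} (eta : R) (n : nat)
    (X W : R -> T -> 'cV[R]_d) (u : R) (w : T) : 'cV[R]_d :=
  \col_i (\int[@lebesgue_measure R]_(s in `[0, u]) X s w i 0 +
          eta * n%:R `^ (- 2^-1) * W u w i 0).

(* The possible values of P_Sigma(y satisfies phi), where Sigma is given on I
   and y is the observed path. Any realisation of the model is allowed whose
   volatility satisfies sigma sigma^T = Sigma on I. This is a singleton when phi
   uses only the statistics S_j of I and Sigma has such an extension. *)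
Definition P_of {R : realType} {d : nat} (eta : R) (n : nat) (I : set R)
    (Sigma : R -> 'M[R]_d) (phi : (R -> 'cV[R]_d) -> Prop) : set (\bar R) :=
  [set x | exists (p : nat) (disp : measure_display) (T : measurableType disp)
      (P : probability T R) (sigma : R -> 'M[R]_(d, p))
      (B : R -> T -> 'cV[R]_p) (X W : R -> T -> 'cV[R]_d),
    [/\ signal_noise_model P sigma B X W,
        forall s, I s -> sigma s *m (sigma s)^T = Sigma s &
        x = P [set w | phi (fun u => observation eta n X W u w)]]].

Definition Phi {R : realType} (t h : R) (j : nat) (s : R) : R :=
  Num.sqrt (2 / h) * sin (j%:R * pi * (s - t) / h).

(* int_t^(t+h) f dy as the limit of left-point Riemann sums over equidistant
   partitions. For the smooth integrands Phi_j' and a continuous path y this is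
   the pathwise Riemann-Stieltjes integral, so S_j is a function of y. *)
Definition path_integral {R : realType} {d : nat} (t h : R) (f : R -> R)
    (y : R -> 'cV[R]_d) : 'cV[R]_d :=
  \col_i limn (fun k : nat =>
    \sum_(l < k) f (t + l%:R * h / k%:R) *
      (y (t + l.+1%:R * h / k%:R) i 0 - y (t + l%:R * h / k%:R) i 0)).

Definition S_stat {R : realType} {d : nat} (t h : R) (y : R -> 'cV[R]_d)
    (j : nat) : 'cV[R]_d :=
  path_integral t h (derive1 (Phi t h j)) y.

Definition eps {R : realType} (eta : R) (n : nat) (h : R) : R :=
  pi * h^-1 * eta * n%:R `^ (- 2^-1).

Definition unnormalized_weight {R : realType} (M : R) (j : nat) : R :=
  M^-1 * (1 + j%:R ^+ 2 / M ^+ 2) ^- 2.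

Definition c_w {R : realType} (M : R) : R :=
  (sum_ge1 (unnormalized_weight M))^-1.

Definition weight {R : realType} (M : R) (j : nat) : R :=
  c_w M * unnormalized_weight M j.

Definition B_w {R : realType} (M : R) : R :=
  sum_ge1 (fun j => weight M j * j%:R ^+ 2).

Definition C_hat {R : realType} {d : nat} (t h M : R) (y : R -> 'cV[R]_d) :
    'M[R]_d :=
  weighted_gram (weight M) (S_stat t h y).

Definition rejects {R : realType} {d : nat} (r : nat) (t h M kappa : R)
    (y : R -> 'cV[R]_d) : Prop :=
  kappa < eigval (C_hat t h M y) r.+1.

Definition kappa1 {R : realType} (eta : R) (n : nat) (h M qGOE : R) : R :=
  (B_w M + (2 * pi) `^ (- 2^-1) * M `^ (3 / 2) * qGOE) * eps eta n h ^+ 2.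

Definition Lambda {R : realType} {T : Type} {m : nat}
    (zeta : nat -> T -> 'cV[R]_m) (M : R) (w : T) : R :=
  lambda_max (weighted_gram (fun j => weight M j * j%:R ^+ 2)
                            (fun j => zeta j w)).

Definition kappa2 {R : realType} (eta : R) (n : nat) (h qLambda : R) : R :=
  qLambda * eps eta n h ^+ 2.

Definition holder_psd {R : realType} {d : nat} (I : set R) (beta L : R) :
    set (R -> 'M[R]_d) :=
  [set Sigma | (forall s, I s -> psd (Sigma s)) /\
     forall s u, I s -> I u ->
       spectral_norm (Sigma u - Sigma s) <= L * `|u - s| `^ beta].

Definition H0 {R : realType} {d : nat} (r : nat) (I : set R) (beta L lam : R) :
    set (R -> 'M[R]_d) :=
  [set Sigma | holder_psd I beta L Sigma /\
     forall s, I s -> (\rank (Sigma s) <= r)%N /\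
       ((0 < r)%N -> lam <= eigval (Sigma s) r)].

(* For lam = 0 the second term of the minimum is +oo. *)
Definition bias0 {R : realType} (r : nat) (beta L lam h : R) : R :=
  if lam == 0 then 2 * L * h `^ beta
  else Num.min (2 * L * h `^ beta)
               ((r%:R + 4) * L ^+ 2 * h `^ (2 * beta) / lam).

Definition size_of_test {R : realType} (d r : nat) (eta beta L : R) (n : nat)
    (t h lam M kappa : R) : \bar R :=
  ereal_sup [set x | exists2 Sigma : R -> 'M[R]_d,
    H0 r `[t, t + h] beta L lam Sigma &
    P_of eta n `[t, t + h] Sigma (rejects r t h M kappa) x].

(* Main.v *)
(* On the orthogonal complement of the range of Sigma(t), of dimension at least d - r, the signal is
   small: a unit vector o there has o^T Sigma(s) o <= bias0 <= C eps^2 on the window, by Hoelder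
   continuity alone, or, with the eigenvalue gap, to second order. By Courant-Fischer the (r+1)-st
   eigenvalue of the weighted covariance is at most the largest eigenvalue of its compression to
   that complement. The compressed coefficients are eps j zeta_j plus the signal part. The zeta_j,
   cosine integrals of Brownian motion, are i.i.d. standard Gaussian, being limits of
   Riemann-Stieltjes sums. Integrating by parts and using the Ito isometry, the signal contributes
   O(M eps^2) in mean, cross terms included, whereas the statistic fluctuates at the scale M^(3/2)
   eps^2.

   It remains to control lambda_max (sum_j w_j j^2 zeta_j zeta_j^T) at its (1 - alpha)-quantile. The
   normalised matrix is compared with a GOE matrix by Lindeberg's replacement argument, tested
   against products of one-dimensional smooth functions and then against indicators of grid cells;
   the scale (2 pi)^(-1/2) M^(3/2) comes from comparing the sum of w_j^2 j^4 with an integral.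
   Shifting the trace coordinates of the GOE (Gaussian tilting) shows that lambda_max(GOE) puts
   little mass on short intervals, which absorbs both the approximation error and the signal. *)

Require Import Defs.
From HB Require Import structures.
From mathcomp Require Import all_boot all_order all_algebra all_fingroup.
From mathcomp Require Import all_classical all_reals all_analysis.
From mathcomp Require Import measurable_realfun.
From mathcomp Require Import ring lra zify.
From mathcomp Require Import complex.

Set Implicit Arguments.
Unset Strict Implicit.
Unset Printing Implicit Defensive.

Import Order.TTheory GRing.Theory Num.Theory.
Import numFieldNormedType.Exports.

Local Open Scope classical_set_scope.
Local Open Scope ring_scope.

(** * Ordered eigenvalues *)

Section linear_algebra.
Context {R : realType}.

(** All laws are compared with one reference, the GOE of size [d - r], with constants fixed before
    the probability space. This makes the level uniform: [Sigma] and the realisation of the model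
    enter only through the size of the signal, and the Gaussian vectors extracted from the noise
    have the same law whatever they are. The series over the frequencies are cut at an index [N]
    depending on [M], beyond which the weights [w_j j^2] add up to at most 1, so every central limit
    argument concerns a finite sum.

    Lindeberg's argument is used twice: for the convergence to the GOE, and to show that finitely
    many Brownian integrals are jointly normal. In this way one-dimensional Gaussian integrals
    (moments, convolution, tilting) suffice; characteristic functions and the multivariate normal
    law never appear.

    Indicators are approximated on a grid, so largest eigenvalues are compared only up to a shift of
    the threshold. At a quantile this shift has to be paid for, which is why the GOE must give short
    intervals a mass linear in their length. *)

Definition qform {m : nat} (A : 'M[R]_m) (v : 'cV[R]_m) : R := (v^T *m A *m v) 0 0.
Definition sqnorm {m : nat} (v : 'cV[R]_m) : R := \sum_i v i 0 ^+ 2.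

Lemma sqnormE m (v : 'cV[R]_m) : (v^T *m v) 0 0 = sqnorm v.
Proof. by rewrite mxE; apply: eq_bigr => i _; rewrite mxE expr2. Qed.

Lemma sqnorm_ge0 m (v : 'cV[R]_m) : 0 <= sqnorm v.
Proof. by apply: sumr_ge0 => i _; rewrite sqr_ge0. Qed.

Lemma sqnorm_gt0 m (v : 'cV[R]_m) : v != 0 -> 0 < sqnorm v.
Proof.
move=> v0; rewrite lt0r sqnorm_ge0 andbT; apply: contra v0.
rewrite psumr_eq0; last by move=> i _; rewrite sqr_ge0.
move=> /allP h; apply/eqP/matrixP => i j; rewrite ord1 mxE.
by have := h i (mem_index_enum _); rewrite /= sqrf_eq0 => /eqP.
Qed.

(** Over [R[i]] the matrix is hermitian, so the spectral theorem provides a real eigenvalue; as a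
    root of the characteristic polynomial, whose coefficients lie in [R], it is an eigenvalue over
    [R] as well. *)
Lemma symmetric_eigenvalue m (A : 'M[R]_m.+1) : A^T = A -> exists a, eigenvalue A a.
Proof.
move=> As; pose c : R -> R[i] := real_complex R.
pose AC := map_mx c A.
have ACr : AC \is a mxOver Num.real.
  by apply/mxOverP => i j; rewrite mxE; apply/Creal_ImP; rewrite /c -complexIm.
have ACs : AC \is symmetricmx.
  by apply/is_hermitianmxP; rewrite expr0 scale1r map_mx_id// /AC map_trmx As.
have ACh := realsym_hermsym ACs ACr.
have dr := hermitian_spectral_diag_real ACh.
have /orthomx_spectralP ACE := hermitian_normalmx ACh.
set P := spectralmx AC in ACE; set D := spectral_diag AC in ACE dr.
have Pu : P \in unitmx := spectral_unit AC.
have eD : eigenvalue AC (D 0 0).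
  apply/eigenvalueP; exists (row 0 P).
    rewrite -row_mul [in LHS]ACE !mulmxA mulmxV// mul1mx.
    by apply/rowP => j; rewrite mul_diag_mx !mxE.
  apply/eqP => r0; have : \rank P = m.+1 by apply/eqP; rewrite -row_free_unit in Pu.
  have := row_free_unit P; rewrite Pu => /row_freeP[X PX].
  have : row 0 (P *m X) = 0 by rewrite row_mul r0 mul0mx.
  by rewrite PX => /rowP/(_ 0); rewrite !mxE /= => /eqP; rewrite oner_eq0.
have /mxOverP/(_ 0 0) := dr; set x := D 0 0 in eD * => xr.
have xE : x = c (complex.Re x).
  by case: x xr {eD} => u v /Creal_ImP; rewrite -complexIm /= => -[->].
exists (complex.Re x); move: eD; rewrite !eigenvalue_root_char xE.
by rewrite -map_char_poly fmorph_root.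
Qed.

(** The Householder reflection along [v - e] exchanges the unit vectors [e] and [v]; it degenerates
    for [v = e], where the identity is taken. *)
Lemma orthogonal_first_row m (v : 'rV[R]_(1 + m)) : v *m v^T = 1%:M ->
  exists Q : 'M[R]_(1 + m), Q *m Q^T = 1%:M /\ row 0 Q = v.
Proof.
move=> v1; pose e : 'rV[R]_(1 + m) := delta_mx 0 0.
have ee : e *m e^T = 1%:M.
  by rewrite /e trmx_delta mul_delta_mx; apply/matrixP => i j; rewrite !ord1 !mxE.
have [->|ve] := eqVneq v e.
  by exists 1%:M; rewrite trmx1 mulmx1 rowE mulmx1.
pose u := v - e; pose n2 := (u *m u^T) 0 0.
have uu : u *m u^T = n2%:M by rewrite [LHS]mx11_scalar.
have n2E : n2 = 2 - 2 * (e *m v^T) 0 0.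
  have ve' : (v *m e^T) 0 0 = (e *m v^T) 0 0.
    by rewrite !mxE; apply: eq_bigr => i _; rewrite !mxE mulrC.
  have D (X Y : 'M[R]_1) : (X - Y) 0 0 = X 0 0 - Y 0 0 by rewrite !mxE.
  rewrite /n2 /u linearB/= mulmxBr !mulmxBl v1 ee !D ve' [1%:M 0 0]mxE eqxx /=; ring.
have n20 : n2 != 0.
  have un0 : u^T != 0 by rewrite trmx_eq0 subr_eq0.
  by have := sqnorm_gt0 un0; rewrite -sqnormE trmxK => /gt_eqF ->.
pose W := u^T *m u; pose Q : 'M[R]_(1 + m) := 1%:M - (2 / n2) *: W.
have Ws : W^T = W by rewrite /W trmx_mul trmxK.
have WW : W *m W = n2 *: W.
  by rewrite /W mulmxA -(mulmxA u^T) uu mul_mx_scalar scalemxAl.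
have Qs : Q^T = Q by rewrite /Q linearB/= trmx1 linearZ/= Ws.
exists Q; split.
  rewrite Qs /Q mulmxBl mul1mx mulmxBr mulmx1 -scalemxAl -scalemxAr WW.
  rewrite (_ : _ *: (_ *: (_ *: W)) = (2 / n2) *: W + (2 / n2) *: W).
    by rewrite opprB addrK subrK.
  by rewrite !scalerA -scalerDl; congr (_ *: _); field.
have eu : e *m u^T = (- (n2 / 2))%:M.
  rewrite [LHS]mx11_scalar; congr (_%:M).
  have D (X Y : 'M[R]_1) : (X - Y) 0 0 = X 0 0 - Y 0 0 by rewrite !mxE.
  by rewrite /u linearB/= mulmxBr ee n2E D [1%:M 0 0]mxE eqxx /=; field.
rewrite rowE -/e /Q mulmxBr mulmx1 -scalemxAr /W mulmxA eu mul_scalar_mx scalerA.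
rewrite (_ : _ * _ = -1); last by field.
by rewrite scaleN1r opprK /u addrC subrK.
Qed.

(** Deflation: in an orthonormal basis that starts with a unit eigenvector, symmetry makes the
    matrix block diagonal, and the induction hypothesis treats the second block. The spectral
    theorem over [R[i]] yields only a unitary change of basis, so a single eigenvalue is taken from
    it. *)
Lemma symmetric_diagonalization m (A : 'M[R]_m) : A^T = A ->
  exists (Q : 'M[R]_m) (s : 'rV[R]_m), Q *m Q^T = 1%:M /\ A = Q^T *m diag_mx s *m Q.
Proof.
elim: m A => [|m IH] A As.
  by exists 1%:M, 0; split; apply/matrixP => -[].
have [a /eigenvalueP[v vA v0]] := symmetric_eigenvalue As.
have n0 : 0 < sqnorm v^T by apply: sqnorm_gt0; rewrite trmx_eq0.
pose v' := (Num.sqrt (sqnorm v^T))^-1 *: v.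
have v'A : v' *m A = a *: v' by rewrite -scalemxAl vA scalerA mulrC -scalerA.
have v'1 : v' *m v'^T = 1%:M.
  rewrite [LHS]mx11_scalar; congr (_%:M).
  rewrite /v' linearZ/= -scalemxAl -scalemxAr scalerA mxE -{3}(trmxK v) sqnormE.
  rewrite -expr2 exprVn sqr_sqrtr ?ltW// mulVf// gt_eqF//.
have [Q [QQ rQ]] := @orthogonal_first_row m v' v'1.
have QQ' : Q^T *m Q = 1%:M by apply: mulmx1C.
have [B BQ] : exists B : 'M[R]_(1 + m), B = Q *m A *m Q^T by exists (Q *m A *m Q^T).
have Bs : B^T = B by rewrite BQ !trmx_mul trmxK As mulmxA.
have B0 : row 0 B = a *: delta_mx 0 0.
  rewrite BQ !row_mul rQ v'A -scalemxAl; congr (_ *: _).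
  by rewrite -rQ -row_mul QQ row1.
have [Q' [s' [QQ1 E1]]] := IH (drsubmx B) (etrans (trmx_drsub B) (congr1 drsubmx Bs)).
pose Q1 : 'M[R]_(1 + m) := block_mx 1%:M 0 0 Q'.
pose s1 : 'rV[R]_(1 + m) := row_mx a%:M s'.
have B00 j : B 0 j = a * (j == 0)%:R.
  by have := congr1 (fun M : 'rV_(1 + m) => M 0 j) B0; rewrite !mxE /= => ->.
have l0 : lshift m (0 : 'I_1) = 0 by apply/val_inj.
have Bur : ursubmx B = 0.
  by apply/matrixP => i j; rewrite ord1 !mxE l0 B00 mulr0.
have Bdl : dlsubmx B = 0 by rewrite -Bs -trmx_ursub Bur trmx0.
have Bul : ulsubmx B = a%:M.
  by apply/matrixP => i j; rewrite !ord1 !mxE l0 B00 !mulr1.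
have BE : B = Q1^T *m diag_mx s1 *m Q1.
  rewrite -[LHS]submxK Bur Bdl Bul E1 /Q1 /s1 diag_mx_row tr_block_mx !trmx0 trmx1.
  rewrite !mulmx_block !mul0mx !mulmx0 !mul1mx !mulmx1 !addr0 !add0r.
  by rewrite mul0mx; congr block_mx; apply/matrixP => i j; rewrite !ord1 !mxE.
have Q1Q1 : Q1 *m Q1^T = 1%:M.
  rewrite /Q1 tr_block_mx !trmx0 trmx1 mulmx_block !mul0mx !mulmx0 !mul1mx QQ1 !addr0 !add0r.
  by rewrite -scalar_mx_block.
exists (Q1 *m Q), s1; split.
  by rewrite trmx_mul mulmxA -(mulmxA Q1 Q Q^T) QQ mulmx1.
rewrite trmx_mul !mulmxA -(mulmxA _ Q1^T) -(mulmxA Q^T) -BE BQ.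
by rewrite !mulmxA QQ' mul1mx -mulmxA QQ' mulmx1.
Qed.

Lemma symmetric_diagonalization_sorted m (A : 'M[R]_m) : A^T = A ->
  exists (Q : 'M[R]_m) (s : 'rV[R]_m), [/\ Q *m Q^T = 1%:M, A = Q^T *m diag_mx s *m Q &
    forall i j : 'I_m, (i <= j)%N -> s 0 j <= s 0 i].
Proof.
move=> /symmetric_diagonalization[Q [s [QQ AE]]].
pose t := [tuple s 0 i | i < m].
pose t' := sort_tuple (fun x y : R => y <= x) t.
have : perm_eq t' t by rewrite perm_sort.
move=> /tuple_permP[p pE].
have pE' i : tnth t' i = s 0 (p i).
  by rewrite (tnth_nth 0) pE -(tnth_nth 0 (mktuple _)) !tnth_mktuple.
pose S := perm_mx p : 'M[R]_m.
have SS : S *m S^T = 1%:M by rewrite /S tr_perm_mx -perm_mxM mulgV perm_mx1.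
have SD : diag_mx (col_perm p s) *m S = S *m diag_mx s.
  apply/matrixP => i j; rewrite mul_diag_mx mul_mx_diag !mxE.
  by have [<-|] := eqVneq (p i) j; rewrite ?mulr1 ?mul1r ?mulr0 ?mul0r.
exists (S *m Q), (col_perm p s); split.
- by rewrite trmx_mul mulmxA -(mulmxA S) QQ mulmx1 SS.
- by rewrite trmx_mul !mulmxA -(mulmxA _ _ S) SD mulmxA -(mulmxA Q^T) (mulmx1C SS) mulmx1.
- move=> i j ij; rewrite !mxE -!pE' !(tnth_nth 0).
  have st : sorted (fun x y : R => y <= x) t' by apply: sort_sorted => x y; exact: le_total.
  have := sorted_leq_nth _ _ 0 st; apply => //; rewrite ?inE ?size_tuple //.
  by move=> x y z /= h1 h2; apply: le_trans h2 h1.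
Qed.

Lemma char_poly_orthogonal m (Q D : 'M[R]_m) : Q *m Q^T = 1%:M ->
  char_poly (Q^T *m D *m Q) = char_poly D.
Proof.
move=> QQ; have QQ' : Q^T *m Q = 1%:M by apply: mulmx1C.
pose q := map_mx polyC Q.
have qq : q^T *m q = 1%:M by rewrite /q map_trmx -map_mxM QQ' map_mx1.
have : char_poly_mx (Q^T *m D *m Q) = q^T *m char_poly_mx D *m q.
  rewrite /char_poly_mx mulmxBr mulmxBl !map_mxM/= -map_trmx -/q.
  by congr (_ - _); rewrite mul_mx_scalar -scalemxAl qq scalemx1.
rewrite /char_poly => ->; rewrite !det_mulmx mulrAC -det_mulmx qq det1 mul1r//.
Qed.

(** A decreasing list that splits the polynomial exists, so [xget] does not return its default. Two
    such lists are permutations of each other by unique factorisation, hence equal once sorted. *)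
Lemma eigvals_orthogonal m (Q : 'M[R]_m) (s : 'rV[R]_m) : Q *m Q^T = 1%:M ->
  (forall i j : 'I_m, (i <= j)%N -> s 0 j <= s 0 i) ->
  eigvals (Q^T *m diag_mx s *m Q) = [seq s 0 i | i : 'I_m].
Proof.
move=> QQ ss; have so : sorted (fun x y : R => y <= x) [seq s 0 i | i : 'I_m].
  apply/(sortedP 0) => i; rewrite size_map size_enum_ord => im.
  rewrite !(nth_map (Ordinal im)) -?enumT ?size_enum_ord// ?(ltnW im)//.
  by apply: ss; rewrite !nth_enum_ord// (ltnW im).
have cE : char_poly (Q^T *m diag_mx s *m Q) = \prod_(x <- [seq s 0 i | i : 'I_m]) ('X - x%:P).
  rewrite char_poly_orthogonal// char_poly_trig; last by apply: diag_mx_is_trig.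
  by rewrite big_map big_enum; apply: eq_bigr => k _; rewrite !mxE eqxx.
rewrite /eigvals.
set S := (X in xget _ X); have [st tE] : S (xget [::] S).
  by apply: (xgetI [::] (x := [seq s 0 i | i : 'I_m])); split.
move: st tE; set t := xget _ _ => st tE.
apply: (sorted_eq _ _ st so).
- by move=> x y z /= h1 h2; apply: le_trans h2 h1.
- by move=> x y /andP[h1 h2]; apply/eqP; rewrite eq_le h1 h2.
- by apply: prod_XsubC_eq; rewrite -tE.
Qed.

Lemma eigval_orthogonal m (Q : 'M[R]_m) (s : 'rV[R]_m) (k : 'I_m) : Q *m Q^T = 1%:M ->
  (forall i j : 'I_m, (i <= j)%N -> s 0 j <= s 0 i) ->
  eigval (Q^T *m diag_mx s *m Q) k.+1 = s 0 k.
Proof.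
move=> QQ ss; rewrite /eigval eigvals_orthogonal//= (nth_map k) -?enumT ?size_enum_ord//.
by rewrite nth_ord_enum.
Qed.

Lemma qform_orthogonal m (Q : 'M[R]_m) (s : 'rV[R]_m) (v : 'cV[R]_m) :
  qform (Q^T *m diag_mx s *m Q) v = \sum_i s 0 i * (Q *m v) i 0 ^+ 2.
Proof.
rewrite /qform !mulmxA -trmx_mul -mulmxA -mulmxA mulmxA mul_mx_diag mxE.
by apply: eq_bigr => i _; rewrite mxE mxE expr2 mulrCA mulrA.
Qed.

Lemma sqnorm_orthogonal m (Q : 'M[R]_m) (v : 'cV[R]_m) : Q *m Q^T = 1%:M ->
  sqnorm (Q *m v) = sqnorm v.
Proof.
by move=> QQ; rewrite -!sqnormE trmx_mul mulmxA -(mulmxA _ Q^T) (mulmx1C QQ) mulmx1.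
Qed.

(* Courant-Fischer: a subspace of dimension d - k meets the span of the first k+1 eigenvectors. *)
Lemma eigval_gt_qform d m (A : 'M[R]_d) (U : 'M[R]_(d, m)) (k : nat) (x : R) :
  A^T = A -> (d <= m + k)%N -> (k < d)%N -> U^T *m U = 1%:M -> x < eigval A k.+1 ->
  exists2 c : 'cV[R]_m, sqnorm c = 1 & x < qform A (U *m c).
Proof.
move=> As dmk kd UU xk.
have [Q [s [QQ AE ss]]] := symmetric_diagonalization_sorted As.
have sk : eigval A k.+1 = s 0 (Ordinal kd) by rewrite AE (eigval_orthogonal (Ordinal kd)).
rewrite sk in xk.
pose N : 'M[R]_(m, d) := (Q *m U)^T.
have lt (j : 'I_(d - k.+1)) : (k.+1 + j < d)%N by rewrite -ltn_subRL.
pose F : 'M[R]_(m, d - k.+1) := \matrix_(i, j) N i (Ordinal (lt j)).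
have [c c0 cN] : exists2 c : 'rV[R]_m, c != 0 & c *m F = 0.
  have rF : (\rank F < m)%N.
    by rewrite (leq_ltn_trans (rank_leq_col _))// ltn_subLR// addSn ltnS addnC.
  have : kermx F != 0 by rewrite -mxrank_eq0 mxrank_ker subn_eq0 -ltnNge.
  move=> /rowV0Pn[c cK c0]; exists c => //.
  by apply/sub_kermxP.
have cc : 0 < sqnorm c^T by apply: sqnorm_gt0; rewrite trmx_eq0.
pose c' := (Num.sqrt (sqnorm c^T))^-1 *: c^T.
have c'1 : sqnorm c' = 1.
  rewrite /sqnorm; under eq_bigr do rewrite mxE exprMn.
  by rewrite -mulr_sumr exprVn sqr_sqrtr ?ltW// mulVf// gt_eqF.
have Un : sqnorm (U *m c') = 1.
  by rewrite -sqnormE trmx_mul mulmxA -(mulmxA _ U^T) UU mulmx1 sqnormE.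
have y0 (i : 'I_d) : (k < i)%N -> (Q *m (U *m c')) i 0 = 0.
  move=> ki; rewrite /c' -!scalemxAr mxE mulmxA.
  have ik : (i - k.+1 < d - k.+1)%N by rewrite ltn_sub2r// (leq_ltn_trans ki).
  have h : (c *m N) 0 i = 0.
    have := congr1 (fun M : 'rV__ => M 0 (Ordinal ik)) cN; rewrite !mxE => hh.
    rewrite -[RHS]hh; apply: eq_bigr => a _; rewrite [F _ _]mxE; congr (_ * N _ _).
    by apply: val_inj; rewrite /= subnKC.
  have -> : (Q *m U *m c^T) i 0 = (c *m N) 0 i.
    by rewrite -[Q *m U *m c^T]trmxK mxE trmx_mul trmxK.
  by rewrite h mulr0.
exists c' => //; apply: (lt_le_trans xk).
rewrite AE qform_orthogonal -[leLHS]mulr1 -Un -(sqnorm_orthogonal _ QQ) /sqnorm mulr_sumr.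
apply: ler_sum => i _; have [ik|ki] := leqP i k.
  by apply: ler_wpM2r; rewrite ?sqr_ge0//; apply: ss.
by rewrite y0// expr0n !mulr0.
Qed.

(** The other half of Courant-Fischer: the span of the eigenvectors of index at least [k] (counted
    from 0) has dimension [d - k]. *)
Lemma eigval_le_subspace d (A : 'M[R]_d) (k : 'I_d) : A^T = A ->
  exists2 U : 'M[R]_(d, d - k), U^T *m U = 1%:M &
  forall c, qform A (U *m c) <= eigval A k.+1 * sqnorm c.
Proof.
move=> As.
have [Q [s [QQ AE ss]]] := symmetric_diagonalization_sorted As.
have sk : eigval A k.+1 = s 0 k by rewrite AE eigval_orthogonal.
have h (j : 'I_(d - k)) : (k + j < d)%N by rewrite -ltn_subRL.
pose E : 'M[R]_(d, d - k) := \matrix_(i, j) (i == Ordinal (h j))%:R.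
have EE : E^T *m E = 1%:M.
  apply/matrixP => i j; rewrite !mxE (bigD1 (Ordinal (h i)))//= big1 ?addr0.
    by rewrite !mxE eqxx mul1r -val_eqE /= eqn_add2l.
  by move=> l /negbTE li; rewrite !mxE li mul0r.
exists (Q^T *m E).
  by rewrite trmx_mul trmxK mulmxA -(mulmxA _ Q) QQ mulmx1 EE.
move=> c; rewrite sk {1}AE qform_orthogonal !mulmxA QQ mul1mx.
have <- : sqnorm (E *m c) = sqnorm c.
  by rewrite -!sqnormE trmx_mul mulmxA -(mulmxA _ E^T) EE mulmx1.
rewrite /sqnorm mulr_sumr; apply: ler_sum => i _; have [ki|ik] := leqP k i.
  by apply: ler_wpM2r; rewrite ?sqr_ge0//; apply: ss.
rewrite [X in X ^+ 2](_ : _ = 0) ?expr0n ?mulr0// mxE big1// => j _.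
rewrite mxE -val_eqE /=; case: eqP => [e|]; rewrite ?mul0r//.
by move: ik; rewrite e ltnNge leq_addr.
Qed.

(** Weyl's inequality: the subspace that caps the Rayleigh quotient of [B] caps that of [A] up to
    [x], and Courant-Fischer then excludes a larger eigenvalue of [A]. *)
Lemma eigval_lipschitz d (A B : 'M[R]_d) (k : 'I_d) (x : R) : A^T = A -> B^T = B ->
  (forall v, qform A v <= qform B v + x * sqnorm v) ->
  eigval A k.+1 <= eigval B k.+1 + x.
Proof.
move=> As Bs AB; rewrite leNgt; apply/negP => lt.
have [U UU UB] := eigval_le_subspace k Bs.
have [|c c1] := eigval_gt_qform As _ (ltn_ord k) UU lt.
  by rewrite subnK// ltnW.
apply/negP; rewrite -leNgt (le_trans (AB _))// lerD//.
  by have := UB c; rewrite c1 mulr1.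
have -> : sqnorm (U *m c) = sqnorm c.
  by rewrite -!sqnormE trmx_mul mulmxA -(mulmxA _ U^T) UU mulmx1.
by rewrite c1 mulr1.
Qed.

Lemma qform_le_lambda_max m (A : 'M[R]_m) (v : 'cV[R]_m) : A^T = A ->
  qform A v <= lambda_max A * sqnorm v.
Proof.
case: m A v => [|m] A v As.
  by rewrite /qform mxE big_ord0 /sqnorm big_ord0 mulr0.
have [Q [s [QQ AE ss]]] := symmetric_diagonalization_sorted As.
rewrite /lambda_max (_ : eigval A 1 = s 0 0); last by rewrite AE (eigval_orthogonal ord0).
rewrite {1}AE qform_orthogonal -(sqnorm_orthogonal _ QQ) mulr_sumr.
by apply: ler_sum => i _; apply: ler_wpM2r; rewrite ?sqr_ge0//; apply: ss.
Qed.

Lemma lambda_max_gt m (A : 'M[R]_m.+1) (x : R) : A^T = A -> x < lambda_max A ->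
  exists2 c : 'cV[R]_m.+1, sqnorm c = 1 & x < qform A c.
Proof.
move=> As xA; have U1 : (1%:M : 'M[R]_m.+1)^T *m 1%:M = 1%:M by rewrite trmx1 mulmx1.
have dm : (m.+1 <= m.+1 + 0)%N by rewrite addn0.
have [c c1] := eigval_gt_qform As dm (ltn0Sn m) U1 xA.
by rewrite mul1mx; exists c.
Qed.

Lemma lambda_max_le m (A : 'M[R]_m.+1) (x : R) : A^T = A ->
  (forall c, sqnorm c = 1 -> qform A c <= x) -> lambda_max A <= x.
Proof.
by move=> As h; rewrite leNgt; apply/negP => /(lambda_max_gt As)[c /h]; rewrite leNgt => /negP.
Qed.

(** If [s 0 i] were positive for some [i >= r], compressing the matrix to its first [i + 1]
    eigenvectors would give an invertible diagonal matrix of size above [r], against the rank. *)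
Lemma psd_rank_eigenvalue d r (Q : 'M[R]_d) (s : 'rV[R]_d) :
  Q *m Q^T = 1%:M -> (forall i j : 'I_d, (i <= j)%N -> s 0 j <= s 0 i) ->
  psd (Q^T *m diag_mx s *m Q) -> (\rank (Q^T *m diag_mx s *m Q) <= r)%N ->
  (forall i, 0 <= s 0 i) /\ forall i : 'I_d, (r <= i)%N -> s 0 i = 0.
Proof.
move=> QQ ss [Ss Sp] rS.
have s0 i : 0 <= s 0 i.
  have := Sp (Q^T *m delta_mx i 0); rewrite -/(qform _ _) qform_orthogonal mulmxA QQ mul1mx.
  rewrite (bigD1 i)//= big1 ?addr0; last first.
    by move=> j /negbTE ji; rewrite mxE ji /= expr0n mulr0.
  by rewrite mxE !eqxx expr1n mulr1.
split=> // i ri; apply/eqP; rewrite eq_le s0 andbT leNgt; apply/negP => si.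
pose E : 'M[R]_(i.+1, d) := \matrix_(a, b) (b == widen_ord (ltn_ord i) a)%:R.
pose D := E *m diag_mx s *m E^T.
have DE : D = diag_mx (\row_a s 0 (widen_ord (ltn_ord i) a)).
  apply/matrixP => a b; rewrite /D mul_mx_diag mxE (bigD1 (widen_ord (ltn_ord i) a))//= big1 ?addr0.
    by rewrite !mxE eqxx mul1r -val_eqE /= -val_eqE /=; case: eqP; rewrite ?mulr1 ?mulr0.
  by move=> l /negbTE la; rewrite !mxE la !mul0r.
have : \rank D = i.+1.
  apply/eqP; rewrite mxrank_unit//; rewrite unitmxE DE det_diag unitfE prodf_seq_neq0.
  apply/allP => a _; rewrite mxE gt_eqF// (lt_le_trans si)// ss//= -ltnS.
  exact: ltn_ord.
have -> : D = E *m Q *m (Q^T *m diag_mx s *m Q) *m (Q^T *m E^T).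
  by rewrite !mulmxA -(mulmxA E) QQ mulmx1 -!mulmxA (mulmxA Q) QQ mul1mx !mulmxA.
move=> rD; have : (i.+1 <= r)%N.
  rewrite -rD (leq_trans (mxrankM_maxl _ _))// (leq_trans (mxrankM_maxr _ _))//.
by rewrite ltnNge ri.
Qed.

(** Each eigenvalue [x] is zero or at least [lam], so [lam * x <= x ^+ 2]. This is the source of the
    second order bound on the signal: if [S *m v] has norm [delta], then [qform S v] is at most
    [delta ^+ 2 / lam]. *)
Lemma psd_eigval_gap d r (S : 'M[R]_d) (lam : R) (v : 'cV[R]_d) :
  psd S -> (\rank S <= r)%N -> (0 < r <= d)%N -> lam <= eigval S r ->
  lam * qform S v <= sqnorm (S *m v).
Proof.
move=> Sp rS /andP[r0 rd] lamr.
have [Q [s [QQ AE ss]]] := symmetric_diagonalization_sorted Sp.1.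
have rk : (r.-1 < d)%N by rewrite prednK.
have sr : eigval S r = s 0 (Ordinal rk).
  by rewrite AE -[r in eigval _ r](prednK r0) (eigval_orthogonal (Ordinal rk)).
rewrite AE in Sp rS; have [s0 sz] := psd_rank_eigenvalue QQ ss Sp rS.
have -> : sqnorm (S *m v) = \sum_i s 0 i ^+ 2 * (Q *m v) i 0 ^+ 2.
  rewrite {1}AE -!mulmxA (sqnorm_orthogonal (Q := Q^T)) ?trmxK; last exact: mulmx1C.
  by rewrite mul_diag_mx /sqnorm; apply: eq_bigr => i _; rewrite mxE exprMn.
rewrite {1}AE qform_orthogonal mulr_sumr; apply: ler_sum => i _.
rewrite mulrA; apply: ler_wpM2r; rewrite ?sqr_ge0// expr2.
have [ri|ir] := leqP r i; first by rewrite sz// !mulr0.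
apply: ler_wpM2r => //; apply: (le_trans lamr); rewrite sr; apply: ss.
by rewrite /= -ltnS prednK.
Qed.

Lemma sqnorm_spectral_norm d (A : 'M[R]_d) (v : 'cV[R]_d) :
  sqnorm (A *m v) <= spectral_norm A ^+ 2 * sqnorm v.
Proof.
have As : (A^T *m A)^T = A^T *m A by rewrite trmx_mul trmxK.
have -> : sqnorm (A *m v) = qform (A^T *m A) v.
  by rewrite -sqnormE /qform trmx_mul !mulmxA.
apply: (le_trans (qform_le_lambda_max _ As)); apply: ler_wpM2r; first exact: sqnorm_ge0.
rewrite /spectral_norm; have [l0|l0] := leP 0 (lambda_max (A^T *m A)).
  by rewrite sqr_sqrtr.
by rewrite (le_trans (ltW l0))// sqr_ge0.
Qed.

(** The kernel can be larger than this; exactly [d - r] orthonormal vectors are kept, so that the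
    compressed matrix has the size of the GOE matrix. *)
Lemma kernel_orthonormal d r (S : 'M[R]_d) : psd S -> (\rank S <= r)%N ->
  exists2 U : 'M[R]_(d, d - r), U^T *m U = 1%:M & S *m U = 0.
Proof.
move=> Sp rS; have [Q [s [QQ AE ss]]] := symmetric_diagonalization_sorted Sp.1.
rewrite AE in Sp rS *; have [_ sz] := psd_rank_eigenvalue QQ ss Sp rS.
have h (j : 'I_(d - r)) : (r + j < d)%N by rewrite -ltn_subRL.
pose E : 'M[R]_(d, d - r) := \matrix_(i, j) (i == Ordinal (h j))%:R.
exists (Q^T *m E).
  rewrite trmx_mul trmxK mulmxA -(mulmxA _ Q) QQ mulmx1.
  apply/matrixP => i j; rewrite !mxE (bigD1 (Ordinal (h i)))//= big1 ?addr0.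
    by rewrite !mxE eqxx mul1r -val_eqE /= eqn_add2l.
  by move=> l /negbTE li; rewrite !mxE li mul0r.
rewrite -!mulmxA (mulmxA Q) QQ mul1mx mul_diag_mx [X in _ *m X](_ : _ = 0) ?mulmx0//.
apply/matrixP => i j; rewrite !mxE; case: eqP => [->|_]; last by rewrite mulr0.
by rewrite sz ?mul0r//= leq_addr.
Qed.

End linear_algebra.

(** * Expectation and independence *)

Section expectation.
Context {R : realType} {disp : measure_display} {T : measurableType disp} (P : probability T R).
Implicit Types (f g : T -> R).

Definition integr f := P.-integrable setT (EFin \o f).
Definition Ex f : R := \int[P]_w f w.

Lemma integr_measurable f : integr f -> measurable_fun setT f.
Proof. by move=> /integrableP[/measurable_EFinP]. Qed.

Lemma integr_le f g : measurable_fun setT f -> (forall w, `|f w| <= g w) -> integr g -> integr f.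
Proof.
move=> mf fg ig; apply: (le_integrable measurableT _ _ ig) => //.
  exact/measurable_EFinP.
move=> w _ /=; rewrite lee_fin (le_trans (fg w))//; exact: ler_norm.
Qed.

Lemma integr_cst (c : R) : integr (fun=> c).
Proof. exact: finite_measure_integrable_cst. Qed.

Lemma integr_bounded f (K : R) : measurable_fun setT f -> (forall w, `|f w| <= K) -> integr f.
Proof. by move=> mf fK; apply: (integr_le mf fK); exact: integr_cst. Qed.

Lemma integrD f g : integr f -> integr g -> integr (fun w => f w + g w).
Proof. by move=> If Ig; apply: (integrableD measurableT If Ig). Qed.

Lemma integrZ (c : R) f : integr f -> integr (fun w => c * f w).
Proof. by move=> If; apply: (integrableZl measurableT c If). Qed.

Lemma integrB f g : integr f -> integr g -> integr (fun w => f w - g w).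
Proof. by move=> If Ig; apply: (integrableB measurableT If Ig). Qed.

Lemma integr_sum (I : Type) (s : seq I) (Q : pred I) (F : I -> T -> R) :
  (forall i, Q i -> integr (F i)) -> integr (fun w => \sum_(i <- s | Q i) F i w).
Proof.
move=> IF; elim: s => [|i s IH].
  by under eq_fun do rewrite big_nil; exact: integr_cst.
under eq_fun do rewrite big_cons.
by case: (boolP (Q i)) => // Qi; apply: integrD => //; exact: IF.
Qed.

Lemma integr_norm f : integr f -> integr (fun w => `|f w|).
Proof. exact: integrable_norm. Qed.

Lemma integr_mul_bounded (K : R) f g : measurable_fun setT f -> (forall w, `|f w| <= K) ->
  integr g -> integr (fun w => f w * g w).
Proof.
move=> mf fK ig; apply: (@integr_le _ (fun w => K * `|g w|)).
- by apply: measurable_funM => //; exact: integr_measurable.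
- by move=> w; rewrite normrM ler_wpM2r.
- exact/integrZ/integr_norm.
Qed.

Lemma ExD f g : integr f -> integr g -> Ex (fun w => f w + g w) = Ex f + Ex g.
Proof. exact: RintegralD. Qed.

Lemma ExB f g : integr f -> integr g -> Ex (fun w => f w - g w) = Ex f - Ex g.
Proof. exact: RintegralB. Qed.

Lemma ExZ (c : R) f : integr f -> Ex (fun w => c * f w) = c * Ex f.
Proof. exact: RintegralZl. Qed.

Lemma Ex_cst (c : R) : Ex (fun=> c) = c.
Proof. by rewrite /Ex Rintegral_cst//= probability_setT mulr1. Qed.

Lemma Ex_le f g : integr f -> integr g -> (forall w, f w <= g w) -> Ex f <= Ex g.
Proof. by move=> If Ig fg; apply: le_Rintegral. Qed.

Lemma Ex_ge0 f : (forall w, 0 <= f w) -> 0 <= Ex f.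
Proof. by move=> f0; apply: Rintegral_ge0. Qed.

Lemma Ex_sum (I : Type) (s : seq I) (Q : pred I) (F : I -> T -> R) :
  (forall i, Q i -> integr (F i)) ->
  Ex (fun w => \sum_(i <- s | Q i) F i w) = \sum_(i <- s | Q i) Ex (F i).
Proof.
move=> IF; elim: s => [|i s IH].
  by rewrite big_nil; under eq_fun do rewrite big_nil; exact: Ex_cst.
rewrite big_cons; under eq_fun do rewrite big_cons.
by case: ifP => // Qi; rewrite ExD ?IH//; [exact: IF|exact: integr_sum].
Qed.

Lemma Ex_norm_le f g : measurable_fun setT f -> integr g -> (forall w, `|f w| <= g w) ->
  `|Ex f| <= Ex g.
Proof.
move=> mf Ig fg; have If := integr_le mf fg Ig.
apply: (le_trans (le_normr_Rintegral measurableT If)).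
by apply: Ex_le => //; exact: integr_norm.
Qed.

Lemma Ex_EFin f : integr f -> (Ex f)%:E = (\int[P]_w (f w)%:E)%E.
Proof. by move=> If; rewrite /Ex /Rintegral fineK//; exact: integrable_fin_num. Qed.

Lemma integr_indic (B : set T) : measurable B -> integr (\1_B).
Proof.
move=> mB; apply: (@integr_bounded _ 1); first exact: measurable_indic.
by move=> w; rewrite indicE; case: (_ \in _); rewrite ?normr1 ?normr0.
Qed.

Lemma Ex_indic (B : set T) : measurable B -> (Ex (\1_B))%:E = P B.
Proof. by move=> mB; rewrite Ex_EFin ?integral_indic ?setIT//; exact: integr_indic. Qed.

Lemma prob_le_Ex (B : set T) f : measurable B -> integr f -> (forall w, \1_B w <= f w) ->
  (P B <= (Ex f)%:E)%E.
Proof. by move=> mB If h; rewrite -Ex_indic// lee_fin Ex_le//; exact: integr_indic. Qed.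

Lemma prob_ge_Ex (B : set T) f : measurable B -> integr f -> (forall w, f w <= \1_B w) ->
  ((Ex f)%:E <= P B)%E.
Proof. by move=> mB If h; rewrite -Ex_indic// lee_fin Ex_le//; exact: integr_indic. Qed.

Lemma measurable_gt f (c : R) : measurable_fun setT f -> measurable [set w | c < f w].
Proof.
move=> mf; rewrite (_ : [set w | _] = f @^-1` `]c, +oo[).
  by rewrite -[X in measurable X]setTI; exact: mf.
by apply/seteqP; split => w /=; rewrite in_itv/= andbT.
Qed.

Lemma measurable_le f (c : R) : measurable_fun setT f -> measurable [set w | f w <= c].
Proof.
move=> mf; rewrite (_ : [set w | _] = f @^-1` `]-oo, c]).
  by rewrite -[X in measurable X]setTI; exact: mf.
by apply/seteqP; split => w /=; rewrite in_itv.
Qed.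

Lemma integr_lty f : measurable_fun setT f -> (forall w, 0 <= f w) ->
  (\int[P]_w (f w)%:E < +oo)%E -> integr f.
Proof.
move=> mf f0 h; apply/integrableP; split; first exact/measurable_EFinP.
by under eq_integral do rewrite /= ger0_norm//.
Qed.

(* Tonelli-Fubini on the joint law, which is the product of the two laws. *)
Lemma Ex_mul_indep_mfun (F G : {mfun T >-> R}) :
  (forall A B, measurable A -> measurable B ->
     P (F @^-1` A `&` G @^-1` B) = (P (F @^-1` A) * P (G @^-1` B))%E) ->
  integr F -> integr G ->
  integr (fun w => F w * G w) /\ Ex (fun w => F w * G w) = Ex F * Ex G.
Proof.
move=> fg If Ig.
have mh : measurable_fun setT (fun w => (F w, G w)) by exact: measurable_fun_pair.
pose H : {mfun T >-> (R * R)%type} := HB.pack (fun w => (F w, G w)) (isMeasurableFun.Build _ _ _ _ _ mh).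
have HE w : H w = (F w, G w) by [].
have [m1 m1E] : exists m1 : probability R R, m1 = distribution P F by exists (distribution P F).
have [m2 m2E] : exists m2 : probability R R, m2 = distribution P G by exists (distribution P G).
have mE X : measurable X -> (m1 \x m2)%E X = distribution P H X.
  apply: product_measure_unique => A B mA mB.
  by rewrite m1E m2E /= /pushforward -fg.
move: H HE mE => H HE mE.
have mid : measurable_fun setT (EFin \o id : R -> \bar R) by exact/measurable_EFinP.
have mabs : measurable_fun setT (fun x : R => `|x|%:E) by apply/measurable_EFinP; exact: normr_measurable.
have mprod : measurable_fun setT (fun z : R * R => (z.1 * z.2)%:E).
  by apply/measurable_EFinP/measurable_funM.
have If1 : m1.-integrable setT (EFin \o id).
  apply/integrableP; split=> //; rewrite m1E ge0_integral_distribution//.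
  by have /integrableP[] := If.
have Ig1 : m2.-integrable setT (EFin \o id).
  apply/integrableP; split=> //; rewrite m2E ge0_integral_distribution//.
  by have /integrableP[] := Ig.
have I1 : (m1 \x m2)%E.-integrable setT (fun z : R * R => (z.1 * z.2)%:E).
  apply/integrable12ltyP => //=.
  have -> : (\int[m1]_x \int[m2]_y `|x * y|%:E = \int[m1]_x (`|x|%:E * \int[m2]_y `|y|%:E))%E.
    apply: eq_integral => x _; rewrite -ge0_integralZl//.
    by apply: eq_integral => y _; rewrite normrM EFinM.
  rewrite ge0_integralZr//; last exact: integral_ge0.
  have /integrableP[_ h1] := If1; have /integrableP[_ h2] := Ig1.
  by apply: lte_mul_pinfty => //; rewrite ?integral_ge0// ge0_fin_numE// integral_ge0.
have I2 : (distribution P H).-integrable setT (fun z : R * R => (z.1 * z.2)%:E).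
  apply/integrableP; split=> //; have /integrableP[_] := I1.
  by rewrite (eq_measure_integral (distribution P H))// => X mX _; exact: mE.
have I3 : integr (fun w => F w * G w).
  apply/integrableP; split; first exact/measurable_EFinP/measurable_funM.
  have /integrableP[_] := I2; rewrite ge0_integral_distribution//; last exact: measurableT_comp.
  by under eq_integral do rewrite /= HE /=.
split=> //; rewrite /Ex /Rintegral -fineM; last 2 first.
- exact: integrable_fin_num.
- exact: integrable_fin_num.
congr fine.
have -> : (\int[P]_w (F w * G w)%:E = \int[distribution P H]_z (z.1 * z.2)%:E)%E.
  rewrite integral_distribution//; first by apply: eq_integral => w _ /=; rewrite HE.
  by rewrite (_ : _ \o _ = EFin \o (fun w => F w * G w))//; apply/funext => w /=; rewrite HE.
transitivity (\int[m1 \x m2]_z (z.1 * z.2)%:E)%E.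
  by apply: eq_measure_integral => X mX _; apply/esym; exact: mE.
rewrite -integral12_prod_meas1//=.
have e1 : (\int[P]_w (F w)%:E = \int[m1]_x x%:E)%E by rewrite m1E integral_distribution.
have e2 : (\int[P]_w (G w)%:E = \int[m2]_x x%:E)%E by rewrite m2E integral_distribution.
rewrite e1 e2 -(fineK (integrable_fin_num measurableT Ig1)) -integralZr//.
apply: eq_integral => x _; rewrite fineK; last exact: (integrable_fin_num measurableT Ig1).
by rewrite -integralZl.
Qed.

Lemma Ex_mul_indep f g : measurable_fun setT f -> measurable_fun setT g ->
  (forall A B, measurable A -> measurable B ->
     P (f @^-1` A `&` g @^-1` B) = (P (f @^-1` A) * P (g @^-1` B))%E) ->
  integr f -> integr g ->
  integr (fun w => f w * g w) /\ Ex (fun w => f w * g w) = Ex f * Ex g.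
Proof.
move=> mf mg; exact: (@Ex_mul_indep_mfun (HB.pack f (isMeasurableFun.Build _ _ _ _ f mf))
  (HB.pack g (isMeasurableFun.Build _ _ _ _ g mg))).
Qed.

End expectation.

(* The sigma-algebra generated by the variables with index in J is handled through
   functions measurable from [g_sigma_algebraType (sigma_gen X J)]. *)
Section independence.
Context {R : realType} {disp : measure_display} {T : measurableType disp} (P : probability T R).
Context {I : eqType} (X : I -> T -> R).
Hypothesis mX : forall i, measurable_fun setT (X i).
Hypothesis indX : mutually_independent P X.

Definition sigma_gen (J : seq I) : set (set T) :=
  [set A | exists2 U : I -> set R, (forall i, measurable (U i)) &
     A = \bigcap_(i in [set` J]) X i @^-1` U i].

Definition adapted (J : seq I) (f : T -> R) : Prop :=
  measurable_fun setT (f : g_sigma_algebraType (sigma_gen J) -> R).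

Lemma sigma_gen_measurable J A : sigma_gen J A -> measurable A.
Proof.
move=> [U mU ->]; apply: fin_bigcap_measurable => // i _.
by rewrite -[X in measurable X]setTI; exact: mX.
Qed.

Lemma sigma_gen_sub J A : <<s sigma_gen J >> A -> measurable A.
Proof. by apply: smallest_sub => //; [exact: sigma_algebra_measurable|exact: sigma_gen_measurable]. Qed.

Lemma adapted_measurable J f : adapted J f -> measurable_fun setT f.
Proof.
move=> af _ B mB; apply: (@sigma_gen_sub J); exact: af.
Qed.

Lemma adapted_var J i (h : R -> R) : measurable_fun setT h -> i \in J -> adapted J (h \o X i).
Proof.
move=> mh iJ _ B mB; rewrite setTI; apply: sub_sigma_algebra.
exists (fun k => if k == i then h @^-1` B else setT).
  by move=> k; case: ifP => // _; rewrite -[X in measurable X]setTI; exact: mh.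
apply/seteqP; split => [w /= Bw k kJ|w /(_ i iJ)] /=; last by rewrite eqxx.
by case: eqP => // ->.
Qed.

Lemma adapted_sub (J J' : seq I) f : {subset J <= J'} -> adapted J f -> adapted J' f.
Proof.
move=> JJ af _ B mB; move: (af measurableT B mB); apply: sub_sigma_algebra2 => A [U mU ->].
exists (fun i => if i \in J then U i else setT).
  by move=> i; case: ifP.
apply/seteqP; split => w /= h i iJ; first by case: ifP => // iJ'; exact: h.
by have := h i (JJ _ iJ); rewrite iJ.
Qed.

(** As functions of [A] both sides are finite measures, a restriction of [P] and a multiple of [P].
    They agree on the generating finite intersections, which form a pi-system. *)
Lemma sigma_gen_indep J k A B : uniq (k :: J) -> <<s sigma_gen J >> A -> measurable B ->
  P (A `&` X k @^-1` B) = (P A * P (X k @^-1` B))%E.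
Proof.
move=> uk sA mB; have mkB : measurable (X k @^-1` B) by rewrite -[X in measurable X]setTI; exact: mX.
have fk : P (X k @^-1` B) \is a fin_num by apply: fin_num_measure.
pose c : {nonneg R} := NngNum (fine_ge0 (measure_ge0 P (X k @^-1` B))).
pose m1 := mrestr P mkB.
pose m2 := mscale c P.
have -> : P (A `&` X k @^-1` B) = m1 A by [].
have -> : (P A * P (X k @^-1` B))%E = m2 A by rewrite /m2 /mscale /= fineK// muleC.
apply: (@g_sigma_algebra_measure_unique _ _ _ (sigma_gen J) _ (fun=> setT)) => //.
- by move=> A'; exact: sigma_gen_measurable.
- by move=> _; exists (fun=> setT) => //; apply/seteqP; split.
- by rewrite bigcup_const.
- move=> _ _ [U mU ->] [V mV ->]; exists (fun i => U i `&` V i).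
    by move=> i; exact: measurableI.
  by rewrite -bigcapI; apply: eq_bigcapr => i _; rewrite preimage_setI.
- move=> A0 [U mU ->]; rewrite /m1 /m2 /= /mrestr /mscale /= fineK//.
  pose V i := if i == k then B else U i.
  have mV i : measurable (V i) by rewrite /V; case: ifP.
  have kJ : k \notin J by case/andP: uk.
  have VU i : i \in J -> V i = U i by move=> iJ; rewrite /V; case: eqP iJ kJ => // -> ->.
  have VkB : V k = B by rewrite /V eqxx.
  move: V mV VU VkB => V mV VU VkB.
  have := indX uk mV; rewrite big_cons VkB.
  have /indX /(_ mU) -> : uniq J by case/andP: uk.
  rewrite big_seq (eq_bigr (fun i => P (X i @^-1` U i))); last by move=> i iJ; rewrite VU.
  rewrite -big_seq => <-; congr (P _).
  apply/seteqP; split=> w /=.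
    move=> [h1 h2] i; rewrite /= inE => /predU1P[->|iJ]; first by rewrite VkB.
    by rewrite VU//; exact: h1.
  move=> h; split; last by have := h k; rewrite VkB; apply; exact: mem_head.
  by move=> i iJ; rewrite -VU//; apply: h; rewrite /= inE [_ \in J]iJ orbT.
- by move=> _; rewrite /m1 /= /mrestr setTI; apply: le_lt_trans (probability_le1 _ _) _ => //; rewrite ltry.
Qed.

Lemma Ex_adapted_mul J k f (h : R -> R) : uniq (k :: J) -> adapted J f ->
  measurable_fun setT h -> integr P f -> integr P (h \o X k) ->
  integr P (fun w => f w * h (X k w)) /\
  Ex P (fun w => f w * h (X k w)) = Ex P f * Ex P (h \o X k).
Proof.
move=> uk af mh If Ih; apply: (@Ex_mul_indep _ _ _ P f (h \o X k)) => //.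
- exact: adapted_measurable af.
- exact: measurableT_comp.
- move=> A B mA mB; rewrite comp_preimage; apply: (sigma_gen_indep uk).
  + by rewrite -[X in <<s _ >> X]setTI; exact: af.
  + by rewrite -[X in measurable X]setTI; exact: mh.
Qed.

(** The factors are split off one at a time; what remains is adapted to the indices already used,
    hence independent of the next variable. *)
Lemma Ex_prod_indep (J K : seq I) f (h : I -> R -> R) : uniq (K ++ J) -> adapted J f ->
  (forall i, measurable_fun setT (h i)) -> integr P f -> (forall i, i \in K -> integr P (h i \o X i)) ->
  [/\ adapted (K ++ J) (fun w => f w * \prod_(i <- K) h i (X i w)),
   integr P (fun w => f w * \prod_(i <- K) h i (X i w)) &
  Ex P (fun w => f w * \prod_(i <- K) h i (X i w)) = Ex P f * \prod_(i <- K) Ex P (h i \o X i)].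
Proof.
move=> uK af mh If; elim: K uK => [|k K IH] uK Ih.
  by under eq_fun do rewrite big_nil mulr1; rewrite big_nil mulr1; split.
have [|i iK|a1 i1 e1] := IH; first by case/andP: uK.
  by apply: Ih; rewrite inE iK orbT.
have E : (fun w => f w * \prod_(i <- k :: K) h i (X i w)) =
   (fun w => (f w * \prod_(i <- K) h i (X i w)) * h k (X k w)).
  by apply/funext => w; rewrite big_cons mulrCA mulrC.
rewrite E; have [|i2 e2] := Ex_adapted_mul uK a1 (mh k) i1.
  by apply: Ih; rewrite mem_head.
split=> //; last by rewrite e2 e1 big_cons mulrCA mulrC mulrA.
apply: measurable_funM.
  by apply: (@adapted_sub (K ++ J)) => // i iK; rewrite inE iK orbT.
by apply: adapted_var => //; rewrite mem_head.
Qed.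

End independence.

(** * Gaussian laws *)

Section gaussian.
Context {R : realType}.
Notation mu := (@lebesgue_measure R).
Import HBNNSimple.

(** [normal_prob] is given by its values on sets; the density reaches functions through increasing
    simple functions and monotone convergence on both sides. *)
Lemma ge0_integral_normal_prob (m s : R) (f : measurableTypeR R -> \bar R) :
  measurable_fun setT f -> (forall x, 0 <= f x)%E ->
  (\int[normal_prob m s]_x f x = \int[mu]_x (f x * (normal_pdf m s x)%:E))%E.
Proof.
move=> mf f0; pose f_ := nnsfun_approx measurableT mf.
have mpdf : measurable_fun setT (fun x : measurableTypeR R => (normal_pdf m s x)%:E).
  by apply/measurable_EFinP; exact: measurable_normal_pdf.
have p0 x : (0 <= (normal_pdf m s x)%:E)%E by rewrite lee_fin normal_pdf_ge0.
have fcvg x : (f_ n x)%:E @[n --> \oo] --> f x by exact: cvg_nnsfun_approx.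
transitivity (limn (fun n => \int[normal_prob m s]_x (f_ n x)%:E)%E).
  rewrite -monotone_convergence//=.
  - by apply: eq_integral => x _; apply/esym/cvg_lim.
  - by move=> n; exact/measurable_EFinP/measurable_funTS.
  - by move=> n x _; rewrite lee_fin.
  - by move=> x _ a b ab; rewrite lee_fin; exact/lefP/nd_nnsfun_approx.
have -> : (\int[mu]_x (f x * (normal_pdf m s x)%:E) =
    limn (fun n => \int[mu]_x ((f_ n x)%:E * (normal_pdf m s x)%:E)))%E.
  rewrite -monotone_convergence//=.
  - apply: eq_integral => x _; apply/esym/cvg_lim => //.
    by apply: cvgeZr.
  - move=> n; apply: emeasurable_funM => //.
    exact/measurable_EFinP/measurable_funTS.
  - by move=> n x _; rewrite mule_ge0// lee_fin.
  - move=> x _ a b ab; rewrite lee_pmul// ?lee_fin//; exact/lefP/nd_nnsfun_approx.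
congr (limn _); apply/funext => n.
under [LHS]eq_integral do rewrite fimfunE -fsumEFin//.
rewrite [LHS]ge0_integral_fsum//; last 2 first.
  - by move=> r; exact/measurable_EFinP/measurableT_comp.
  - by move=> r x _; rewrite EFinM nnfun_muleindic_ge0.
under [RHS]eq_integral.
  move=> x xD; rewrite fimfunE -fsumEFin// ge0_mule_fsuml; last first.
    by move=> r; rewrite EFinM nnfun_muleindic_ge0.
  over.
rewrite [RHS]ge0_integral_fsum//; last 2 first.
  - move=> r; apply: emeasurable_funM => //; exact/measurable_EFinP/measurableT_comp.
  - move=> r x _; rewrite mule_ge0//; by rewrite EFinM nnfun_muleindic_ge0.
apply: eq_fsbigr => r _.
rewrite integralZl_indic_nnsfun// integral_indic// setIT /normal_prob.
rewrite [X in (_ * X)%E]integral_mkcond.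
have mr : measurable (f_ n @^-1` [set r]) by [].
have [r0|r0] := leP 0 r.
  rewrite -ge0_integralZl//.
  - apply: eq_integral => x _; rewrite EFinM -muleA; congr (_ * _)%E.
    by rewrite patchE indicE; case: ifP => xr; rewrite ?mul1e ?mul0e.
  - by apply: (measurable_restrict _ _ _).1 => //; exact: measurable_funTS.
  - by move=> x _; apply: erestrict_ge0.
rewrite preimage_nnfun0// patch_set0 integral0 mule0.
under eq_integral do rewrite indic0 mulr0 mul0e; by rewrite integral0.
Qed.

Lemma measure_eq_halfline (m1 m2 : {measure set R -> \bar R}) : (m1 setT < +oo)%E ->
  (forall a : R, m1 `]-oo, a]%classic = m2 `]-oo, a]%classic) -> forall A, measurable A -> m1 A = m2 A.
Proof.
move=> fin h A mA.
pose G : set (set R) := [set B | exists a : R, B = `]-oo, a]%classic].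
apply: (@measure_unique _ _ _ G (fun n => `]-oo, n%:R]%classic)) => //.
- rewrite -[LHS]/(R.-ocitv.-measurable.-sigma.-measurable) RGenOInfty.measurableE eqEsubset; split.
    apply: smallest_sub; first exact: smallest_sigma_algebra.
    move=> _ [x ->]; rewrite -setCitvl.
    by apply: sigma_algebraC; apply: sub_sigma_algebra; exists x.
  apply: smallest_sub; first exact: smallest_sigma_algebra.
  move=> _ [x ->]; rewrite -setCitvr.
  by apply: sigma_algebraC; apply: sub_sigma_algebra; exists x.
- move=> _ _ [a ->] [b ->]; exists (Num.min a b).
  by apply/seteqP; split => x /=; rewrite !in_itv/= le_min; [case=> -> ->|case/andP].
- by move=> n; exists n%:R.
- apply/seteqP; split => // x _; exists (Num.trunc `|x|).+1 => //=.
  by rewrite in_itv/= (le_trans (ler_norm x))// ltW// truncnS_gt.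
- by move=> _ [a ->]; exact: h.
- by move=> k; apply: le_lt_trans fin; apply: le_measure; rewrite ?inE.
Qed.

Lemma measurable_idR : measurable_fun setT (idfun : measurableTypeR R -> R).
Proof. by move=> _ B mB; rewrite setTI. Qed.

HB.instance Definition _ := isMeasurableFun.Build _ _ _ _ (idfun : measurableTypeR R -> R) measurable_idR.

(* [normal_prob] lives on another display of the Borel sigma-algebra of R. *)
Definition gauss (m s : R) : probability R R :=
  distribution (normal_prob m s) (idfun : measurableTypeR R -> R).

Lemma gaussE (m s : R) (A : set R) :
  gauss m s A = (\int[mu]_(x in A) (normal_pdf m s x)%:E)%E.
Proof. by []. Qed.

Lemma ge0_integral_gauss (m s : R) (f : R -> \bar R) :
  measurable_fun setT f -> (forall x, 0 <= f x)%E ->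
  (\int[gauss m s]_x f x = \int[mu]_x (f x * (normal_pdf m s x)%:E))%E.
Proof.
move=> mf f0; rewrite /gauss ge0_integral_distribution//.
by rewrite -ge0_integral_normal_prob.
Qed.

Lemma gauss_affine (m s : R) (B : set R) : 0 < s -> measurable B ->
  gauss m s B = gauss 0 1 ((fun y => m + s * y) @^-1` B).
Proof.
move=> s0 mB.
have mF : measurable_fun setT (fun y : R => m + s * y).
  by apply: measurable_funD => //; exact: measurable_funM.
pose F : {mfun R >-> R} := HB.pack (fun y => m + s * y) (isMeasurableFun.Build _ _ _ _ _ mF).
transitivity (distribution (gauss 0 1) F B); last by [].
apply: (@measure_eq_halfline (gauss m s) (distribution (gauss 0 1) F) _ _ B mB) => {mB B}; first by rewrite ltey_eq (fin_num_measure (gauss m s)).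
move=> a.
pose b := (a - m) / s.
have FE : m + s * b = a by rewrite /b mulrC divfK ?gt_eqF// addrC subrK.
have pre : (fun y => m + s * y) @^-1` `]-oo, a] = `]-oo, b]%classic.
  apply/seteqP; split => x /=; rewrite !in_itv/= /b ler_pdivlMr//; lra.
transitivity (gauss 0 1 ((fun y => m + s * y) @^-1` `]-oo, a])); last by [].
rewrite pre !gaussE.
have dF x : derivable (fun y => m + s * y) x 1 by [].
have F' : (fun y : R => m + s * y)^`()%classic = cst s.
  by apply/funext => x; rewrite derive1E deriveD// derive_cst add0r deriveM// derive_cst scaler0 addr0 derive_id /= /GRing.scale/= mulr1.
have /= H := @increasing_ge0_integration_by_substitutionNy R (fun y => m + s * y) (normal_pdf m s) b.
have -> : gauss m s `]-oo, a]%classic = (\int[mu]_(x in `]-oo, (m + s * b)%R]) (normal_pdf m s x)%:E)%E.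
  by rewrite FE gaussE.
rewrite H {H}.
- apply: eq_integral => x _; rewrite F'; congr (_%:E).
  rewrite -[LHS]/(normal_pdf m s (m + s * x) * s).
  rewrite !normal_pdfE ?gt_eqF// /normal_peak /normal_fun/= subr0 mulrAC.
  have s2 : Num.sqrt (s ^+ 2 * pi *+ 2) = s * Num.sqrt (1 ^+ 2 * pi *+ 2).
    by rewrite expr1n mul1r -mulrnAr sqrtrM ?sqr_ge0// sqrtr_sqr ger0_norm// ltW.
  rewrite s2 invfM [s^-1 * _]mulrC mulfVK ?gt_eqF//.
  rewrite (_ : - (m + s * x - m) ^+ 2 / (s ^+ 2 *+ 2) = - x ^+ 2 / (1 ^+ 2 *+ 2))//.
  by field; rewrite gt_eqF.
- by move=> x y _ _ xy; rewrite ltrD2l ltr_pM2l.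
- by rewrite F' => x _; exact: cvg_cst.
- by rewrite F'; exact: is_cvg_cst.
- by rewrite F'; exact: cvg_cst.
- split; first by move=> x _.
  have cF : continuous (fun y : R => m + s * y).
    by move=> x; apply: differentiable_continuous; exact/derivable1_diffP.
  by apply: cvg_at_left_filter; exact: cF.
- by apply: (cvg_comp (fun y => s * y) (fun z => m + z) (G := -oo%R)); [exact/gt0_cvgMrNy|exact: cvg_addrl_Ny].
- by apply: continuous_subspaceT; apply: continuous_normal_pdf; rewrite gt_eqF.
- by move=> x _; exact: normal_pdf_ge0.
Qed.

Lemma ge0_integral_gauss_affine (m s : R) (f : R -> \bar R) : 0 < s ->
  measurable_fun setT f -> (forall x, 0 <= f x)%E ->
  (\int[gauss 0 1]_y f (m + s * y)%R = \int[gauss m s]_x f x)%E.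
Proof.
move=> s0 mf f0.
have mF : measurable_fun setT (fun y : R => m + s * y).
  by apply: measurable_funD => //; exact: measurable_funM.
pose F : {mfun R >-> R} := HB.pack (fun y => m + s * y) (isMeasurableFun.Build _ _ _ _ _ mF).
transitivity (\int[distribution (gauss 0 1) F]_y f y)%E.
  by rewrite ge0_integral_distribution.
by apply: eq_measure_integral => B mB _; apply/esym; exact: gauss_affine.
Qed.

(** The inequality [1 + y <= expR y] at [y = x / k], raised to the power [k]. *)
Lemma exp_dominates_power (k : nat) (x : R) : 0 <= x -> x ^+ k <= k%:R ^+ k * expR x.
Proof.
move=> x0; case: k => [|k]; first by rewrite !expr0 mul1r -expR0 ler_expR.
have -> : expR x = expR (x / k.+1%:R) ^+ k.+1.
  by rewrite -expRM_natl -mulr_natl mulrCA divff ?mulr1// pnatr_eq0.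
rewrite -exprMn; apply: lerXn2r; rewrite ?nnegrE ?mulr_ge0 ?expR_ge0//.
rewrite -ler_pdivrMl// mulrC (le_trans _ (expR_ge1Dx _))//.
by rewrite lerDr.
Qed.

Lemma normal_pdf01E (y : R) : normal_pdf 0 1 y = normal_peak 1 * expR (- (y ^+ 2 / 2)).
Proof. by rewrite normal_pdfE ?oner_eq0// /normal_fun subr0 expr1n mulNr. Qed.

(** Half of the exponent [y ^+ 2 / 2] absorbs the power and the other half is the exponent of the
    normal density with variance 2, whence [Num.sqrt 2]. All moments are thereby finite. *)
Lemma even_power_normal_pdf (k : nat) : exists2 C : R, 0 <= C &
  forall y, y ^+ k.*2 * normal_pdf 0 1 y <= C * normal_pdf 0 (Num.sqrt 2) y.
Proof.
have q2 : Num.sqrt 2 != 0 :> R by rewrite gt_eqF// sqrtr_gt0.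
have p2 := normal_peak_gt0 q2; have p1 := @normal_peak_gt0 R 1 (oner_neq0 _).
exists (normal_peak 1 / normal_peak (Num.sqrt 2) * (4 ^+ k * k%:R ^+ k)).
  by rewrite mulr_ge0 ?divr_ge0 ?normal_peak_ge0// mulr_ge0// exprn_ge0.
move=> y; rewrite normal_pdf01E normal_pdfE// /normal_fun subr0 sqr_sqrtr//.
have h := @exp_dominates_power k (y ^+ 2 / 4) (divr_ge0 (sqr_ge0 _) (ler0n _ _)).
have e : expR (- (y ^+ 2 / 2)) = expR (- (y ^+ 2 / 4)) * expR (- y ^+ 2 / (2 *+ 2)).
  by rewrite -expRD; congr expR; rewrite -mulr_natr; field.
rewrite e -mul2n exprM -(@divfK _ (4 ^+ k) _ (y ^+ 2 ^+ k)) ?expf_neq0//.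
rewrite -expr_div_n.
have -> : normal_peak 1 / normal_peak (Num.sqrt 2) * (4 ^+ k * k%:R ^+ k) *
  (normal_peak (Num.sqrt 2) * expR (- y ^+ 2 / (2 *+ 2))) =
  (k%:R ^+ k * expR (y ^+ 2 / 4)) * (4 ^+ k * (normal_peak 1 * (expR (- (y ^+ 2 / 4)) * expR (- y ^+ 2 / (2 *+ 2))))).
  by rewrite expRN; field; do ?(apply/andP; split); rewrite ?gt_eqF ?expR_gt0.
rewrite -[leLHS]mulrA; apply: ler_wpM2r => //.
by rewrite mulr_ge0 ?exprn_ge0// mulr_ge0 ?mulr_ge0 ?expR_ge0// ltW.
Qed.

Lemma measurable_power (k : nat) : measurable_fun setT (fun y : R => y ^+ k).
Proof. by apply: measurable_funX. Qed.

Lemma integr_gauss_even_power (k : nat) : integr (gauss 0 1) (fun y => y ^+ k.*2).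
Proof.
have [C C0 h] := even_power_normal_pdf k.
have pos (y : R) : 0 <= y ^+ k.*2 by rewrite -mul2n exprM exprn_ge0// sqr_ge0.
apply: integr_lty => //.
rewrite ge0_integral_gauss//; last by apply/measurable_EFinP; exact: measurable_power.
apply: (@le_lt_trans _ _ (\int[mu]_y (C%:E * (normal_pdf 0 (Num.sqrt 2) y)%:E))%E).
  apply: ge0_le_integral => //.
  - by move=> y _; rewrite mule_ge0// lee_fin// normal_pdf_ge0.
  - by apply: emeasurable_funM; apply/measurable_EFinP; [exact: measurable_power|exact: measurable_normal_pdf].
  - by apply: emeasurable_funM; apply/measurable_EFinP; [exact: measurable_cst|exact: measurable_normal_pdf].
  - by move=> y _; rewrite -!EFinM lee_fin.
rewrite ge0_integralZl//; last 2 first.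
- by apply/measurable_EFinP; exact: measurable_normal_pdf.
- by move=> y _; rewrite lee_fin normal_pdf_ge0.
by rewrite integral_normal_pdf mule1 ltry.
Qed.

Lemma integr_gauss_power (k : nat) : integr (gauss 0 1) (fun y => y ^+ k).
Proof.
apply: (@integr_le _ _ _ (gauss 0 1) _ (fun y : R => 1 + y ^+ k.*2)).
- exact: measurable_power.
- have H (z : R) : z <= 1 + z ^+ 2 by have := sqr_ge0 (z - 1); nra.
  by move=> y; rewrite -mul2n mulnC exprM -real_normK ?num_real//.
- by apply: integrD; [exact: integr_cst|exact: integr_gauss_even_power].
Qed.

Lemma is_derive_power_pdf (j : nat) (y : R) :
  is_derive y 1 (fun y => y ^+ j * normal_pdf 0 1 y)
    ((j%:R * y ^+ j.-1 - y ^+ j.+1) * normal_pdf 0 1 y).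
Proof.
have d1 : is_derive y 1 (fun y => y ^+ j) (j%:R * y ^+ j.-1).
  have := is_deriveX j (is_derive_id y (1 : R)).
  by rewrite /GRing.scale/= mulr1 (_ : id ^+ j = (fun y => y ^+ j))//; apply/funext => z; rewrite fctE.
have d0 : is_derive y 1 (fun y : R => y * y) (y + y).
  by have := is_deriveM (is_derive_id y (1 : R)) (is_derive_id y (1 : R)); rewrite /GRing.scale/= !mulr1.
pose g := - 2^-1 \*: (fun z : R => z * z).
have gE z : g z = - (z ^+ 2 / 2).
  by rewrite /g -[LHS]/(- 2^-1 * (z * z)) expr2; field.
have d2 : is_derive y 1 g (- y).
  by apply: (is_derive_eq (is_deriveZ _ d0)); rewrite /GRing.scale/=; field.
have d3 := is_derive1_comp (is_derive_expR (g y)) d2.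
have d4 := is_deriveZ (normal_peak 1) d3.
have d5 := is_deriveM d1 d4.
rewrite (_ : (fun y => _) = ((fun y => y ^+ j) * (normal_peak 1 \*: (expR \o g)))); last first.
  by apply/funext => z; rewrite normal_pdf01E -gE.
apply: (is_derive_eq d5); rewrite normal_pdf01E /GRing.scale/= -gE exprS.
rewrite -[normal_peak 1 *: expR (g y)]/(normal_peak 1 * expR (g y)).
ring.
Qed.

Lemma integral_gauss (m s : R) (f : R -> R) : integr (gauss m s) f ->
  Ex (gauss m s) f = \int[mu]_x (f x * normal_pdf m s x).
Proof.
move=> If; have mf := integr_measurable If; rewrite /Ex /Rintegral.
congr fine; rewrite integralE [RHS]integralE.
have mE : measurable_fun setT (fun x : R => (f x)%:E) by exact/measurable_EFinP.
rewrite ge0_integral_gauss//; last exact: measurable_funepos.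
rewrite ge0_integral_gauss//; last exact: measurable_funeneg.
have p0 x : (0 <= (normal_pdf m s x)%:E)%E by rewrite lee_fin normal_pdf_ge0.
congr (_ - _)%E; apply: eq_integral => x _.
  by rewrite !funeposE EFinM maxe_pMl// mul0e.
by rewrite !funenegE EFinM maxe_pMl// mul0e mulNe.
Qed.

End gaussian.

Section dct.
Context {R : realType} {disp : measure_display} {T : measurableType disp} (P : probability T R).

Lemma Ex_dct (f_ : nat -> T -> R) (f g : T -> R) :
  (forall n, measurable_fun setT (f_ n)) -> (forall w, f_ n w @[n --> \oo] --> f w) ->
  (forall n w, `|f_ n w| <= g w) -> integr P g ->
  integr P f /\ Ex P (f_ n) @[n --> \oo] --> Ex P f.
Proof.
move=> mf_ cf fg Ig; have mf : measurable_fun setT f.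
  by apply: (measurable_fun_cvg mf_) => w _; exact: cf.
have [||If _ h] := @dominated_convergence _ _ _ P setT measurableT (fun n w => (f_ n w)%:E)
  (fun w => (f w)%:E) (EFin \o g) (fun n => (measurable_EFinP _ _).2 (mf_ n))
  ((measurable_EFinP _ _).2 mf) _ Ig.
- by apply: aeW => w _; apply: cvg_EFin; [exact: nearW|exact: cf].
- by apply: aeW => w n _ /=; rewrite lee_fin.
split=> //; rewrite /Ex /Rintegral; apply: fine_cvg.
by rewrite fineK//; exact: integrable_fin_num.
Qed.
End dct.

(** * Gaussian moments and convolution *)

Section gaussian_moments.
Context {R : realType}.
Notation mu := (@lebesgue_measure R).
Notation g01 := (gauss 0 1 : probability R R).

Lemma power_pdf_bound (j : nat) : exists2 C : R, 0 <= C &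
  forall n : nat, (0 < n)%N -> `|n%:R ^+ j * normal_pdf 0 1 n%:R| <= C / n%:R /\
    `|(- n%:R) ^+ j * normal_pdf 0 1 (- n%:R)| <= C / n%:R.
Proof.
have [C C0 h] := @even_power_normal_pdf R j.+1.
have q2 : Num.sqrt 2 != 0 :> R by rewrite gt_eqF// sqrtr_gt0.
exists (C * normal_peak (Num.sqrt 2)); first by rewrite mulr_ge0// normal_peak_ge0.
move=> n n0; have n1 : 1 <= n%:R :> R by rewrite ler1n.
have n00 : 0 < n%:R :> R by rewrite ltr0n.
have key : n%:R ^+ j * normal_pdf 0 1 n%:R <= C * normal_peak (Num.sqrt 2) / n%:R.
  rewrite ler_pdivlMr// (le_trans _ (le_trans (h n%:R) _))//; last first.
    by rewrite ler_wpM2l// normal_pdf_ub.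
  rewrite mulrAC -exprSr ler_wpM2r ?normal_pdf_ge0// ler_weXn2l//.
  by rewrite -addnn leq_addr.
have e : normal_pdf 0 1 (- n%:R) = normal_pdf 0 1 n%:R :> R by rewrite !normal_pdf01E sqrrN.
rewrite e !normrM !normrX normrN -normrX !ger0_norm ?normal_pdf_ge0 ?exprn_ge0//.
Qed.

(** The integrand times the density is the derivative of [y ^+ j] times the density, so the integral
    over [[-n, n]] is a boundary term, which tends to zero. Every Gaussian moment below is computed
    from this identity. *)
Lemma gauss_ibp (j : nat) : Ex g01 (fun y => j%:R * y ^+ j.-1 - y ^+ j.+1) = 0.
Proof.
pose p (y : R) := j%:R * y ^+ j.-1 - y ^+ j.+1.
pose pn (n : nat) (y : R) := p y * \1_(`[- n%:R, n%:R] : set R) y.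
have Ip : integr g01 p.
  by apply: integrB; [apply: integrZ; exact: integr_gauss_power|exact: integr_gauss_power].
have mp := integr_measurable Ip.
have mpn n : measurable_fun setT (pn n) by apply: measurable_funM => //; exact: measurable_indic.
have bpn n w : `|pn n w| <= `|p w|.
  by rewrite /pn normrM indicE; case: (_ \in _); rewrite ?normr1 ?normr0 ?mulr1 ?mulr0.
have cpn w : pn n w @[n --> \oo] --> p w.
  apply: cvg_near_cst; exists (Num.trunc `|w|).+1 => // n /= hn.
  rewrite /pn indicE mem_set ?mulr1//= in_itv/= -ler_norml ltW//.
  by rewrite (lt_le_trans (truncnS_gt _))// ler_nat.
have [_ c] := Ex_dct mpn cpn bpn (integr_norm Ip).
have [C C0 hC] := power_pdf_bound j.
have Epn n : (0 < n)%N -> Ex g01 (pn n) = n%:R ^+ j * normal_pdf 0 1 n%:R - (- n%:R) ^+ j * normal_pdf 0 1 (- n%:R).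
  move=> n0; have nn : - n%:R < n%:R :> R by rewrite gtrN// ltr0n.
  rewrite integral_gauss; last exact: (integr_le _ (bpn n) (integr_norm Ip)).
  have dF (x : R) : is_derive x 1 (fun y => y ^+ j * normal_pdf 0 1 y) (p x * normal_pdf 0 1 x).
    exact: is_derive_power_pdf.
  have cF : continuous (fun y : R => y ^+ j * normal_pdf 0 1 y).
    by move=> x; apply: differentiable_continuous; apply/derivable1_diffP; exact: ex_derive.
  rewrite /Rintegral (_ : (\int[mu]_x _)%E = (\int[mu]_(x in `[(- n%:R)%R, n%:R%R]) (p x * normal_pdf 0 1 x)%:E)%E); last first.
    rewrite [RHS]integral_mkcond; apply: eq_integral => x _.
    by rewrite patchE /pn indicE; case: ifP => xn; rewrite ?mulr1 ?mulr0 ?mul0r.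
  rewrite (continuous_FTC2 (F := fun y => y ^+ j * normal_pdf 0 1 y))//.
  - apply: continuous_subspaceT => x; apply: cvgM.
      by apply: cvgB; [apply: cvgM; [exact: cvg_cst|exact: exprn_continuous]|exact: exprn_continuous].
    by apply: continuous_normal_pdf; exact: oner_neq0.
  - split; first by move=> x _; apply: ex_derive.
      by apply: cvg_at_right_filter; exact: cF.
    by apply: cvg_at_left_filter; exact: cF.
  - by move=> x _; rewrite derive1E; apply: derive_val.
have c0 : Ex g01 (pn n) @[n --> \oo] --> (0 : R).
  apply: norm_cvg0; apply: (@squeeze_cvgr _ _ _ _ (cst 0) (fun n : nat => (C + C) * 2 * harmonic n)).
  - exists 1%N => // n /= n0; rewrite normr_ge0/= Epn//.
    have [h1 h2] := hC n n0; rewrite (le_trans (ler_normB _ _))// (le_trans (lerD h1 h2))// -mulrDl -mulrA.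
    rewrite ler_wpM2l ?addr_ge0// /harmonic/= -ler_pdivrMl// -invfM lef_pV2 ?posrE ?mulr_gt0 ?ltr0n//.
    by rewrite -natrM ler_nat mul2n -addnn -addn1 leq_add2l.
  - exact: cvg_cst.
  - rewrite -[X in _ --> X](mulr0 ((C + C) * 2)); apply: cvgMl_tmp.
    exact: cvg_harmonic.
exact: (cvg_unique _ c c0).
Qed.

Lemma gauss_moment1 : Ex g01 (fun y => y) = 0.
Proof.
have := gauss_ibp 0; rewrite (_ : (fun y => _) = (fun y : R => -1 * y)); last first.
  by apply/funext => y; rewrite mul0r expr1 mulN1r sub0r.
by rewrite ExZ; [lra|exact: (integr_gauss_power 1)].
Qed.

Lemma gauss_moment2 : Ex g01 (fun y => y ^+ 2) = 1.
Proof.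
have := gauss_ibp 1; rewrite ExB; last 2 first.
- by apply: integrZ; exact: integr_gauss_power.
- exact: integr_gauss_power.
by under eq_fun do rewrite expr0 mulr1; rewrite Ex_cst; lra.
Qed.

Lemma normal_pdf_shift (m s x : R) : normal_pdf m s x = normal_pdf 0 s (x - m) \/ s = 0.
Proof.
have [->|s0] := eqVneq s 0; [by right|left].
by rewrite !normal_pdfE// /normal_fun subr0.
Qed.

(** Completing the square: the joint density of a standard normal [z] and of [u], normal around
    [Num.sqrt w * z] with variance [v], is the marginal density of [u] times the conditional density
    of [z]. *)
Lemma normal_pdf_mul (v w u z : R) : 0 < v -> 0 < w ->
  normal_pdf (Num.sqrt w * z) (Num.sqrt v) u * normal_pdf 0 1 z =
  normal_pdf 0 (Num.sqrt (v + w)) u *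
    normal_pdf (Num.sqrt w * u / (v + w)) (Num.sqrt (v / (v + w))) z.
Proof.
move=> v0 w0; have vw0 : 0 < v + w by exact: addr_gt0.
have r0 : 0 < v / (v + w) by exact: divr_gt0.
have pk (x : R) : 0 < x -> normal_peak (Num.sqrt x) = (Num.sqrt (x * pi *+ 2))^-1.
  by move=> x0; rewrite /normal_peak sqr_sqrtr// ltW.
have q0 (x : R) : 0 < x -> Num.sqrt x != 0 by move=> x0; rewrite gt_eqF// sqrtr_gt0.
have -> : normal_pdf 0 1 z = normal_pdf 0 (Num.sqrt 1) z by rewrite sqrtr1.
rewrite !normal_pdfE ?q0// !pk// /normal_fun !sqr_sqrtr ?ltW//.
rewrite mulrACA [RHS]mulrACA -!invfM -!expRD -!sqrtrM; last 2 first.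
- by rewrite mulrn_wge0// mulr_ge0 ?pi_ge0// ltW.
- by rewrite mulrn_wge0// mulr_ge0 ?pi_ge0// ltW.
congr ((Num.sqrt _)^-1 * expR _).
  by field; rewrite gt_eqF.
have sw : Num.sqrt w ^+ 2 = w by rewrite sqr_sqrtr// ltW.
move: (Num.sqrt w) sw => q sw; rewrite -sw in w0 vw0 r0 *.
by field; rewrite !gt_eqF.
Qed.

Lemma ge0_gauss_conv (v w : R) (f : R -> \bar R) : 0 < v -> 0 < w ->
  measurable_fun setT f -> (forall x, 0 <= f x)%E ->
  measurable_fun setT (fun z => \int[g01]_y f (Num.sqrt w * z + Num.sqrt v * y)%R)%E /\
  (\int[g01]_z \int[g01]_y f (Num.sqrt w * z + Num.sqrt v * y)%R =
   \int[g01]_u f (Num.sqrt (v + w) * u)%R)%E.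
Proof.
move=> v0 w0 mf f0.
have vw0 : 0 < v + w by exact: addr_gt0.
have r0 : 0 < v / (v + w) by exact: divr_gt0.
have q0 (x : R) : 0 < x -> Num.sqrt x != 0 by move=> x0; rewrite gt_eqF// sqrtr_gt0.
have sv0 : 0 < Num.sqrt v by rewrite sqrtr_gt0.
pose F (p : measurableTypeR R * measurableTypeR R) : \bar R :=
  (f p.2 * (normal_pdf (Num.sqrt w * p.1) (Num.sqrt v) p.2)%:E)%E.
have mF : measurable_fun setT F.
  apply: emeasurable_funM; first by apply: (measurableT_comp mf); exact: measurable_snd.
  apply/measurable_EFinP.
  rewrite (_ : (fun p => _) = (fun p : measurableTypeR R * measurableTypeR R =>
     normal_pdf 0 (Num.sqrt v) (p.2 - Num.sqrt w * p.1))); last first.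
    by apply/funext => p; case: (normal_pdf_shift (Num.sqrt w * p.1) (Num.sqrt v) p.2) => // /eqP; rewrite (negbTE (q0 _ v0)).
  apply: (measurableT_comp (measurable_normal_pdf 0 (Num.sqrt v))).
  apply: measurable_funB; first exact: measurable_snd.
  by apply: measurable_funM => //; exact: measurable_fst.
have F0 p : (0 <= F p)%E by rewrite /F mule_ge0// lee_fin normal_pdf_ge0.
have inner z : (\int[g01]_y f (Num.sqrt w * z + Num.sqrt v * y)%R = \int[mu]_u F (z, u))%E.
  by rewrite ge0_integral_gauss_affine// ge0_integral_gauss.
have mI : measurable_fun setT (fun z : R => \int[mu]_u F (z, u))%E.
  exact: (@measurable_fun_fubini_tonelli_F _ _ _ _ _ mu F).
split; first by under eq_fun do rewrite inner.
under eq_integral do rewrite inner.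
rewrite [LHS]ge0_integral_gauss//; last by move=> z; apply: integral_ge0 => u _; exact: F0.
pose G (p : measurableTypeR R * measurableTypeR R) : \bar R :=
  (F p * (normal_pdf 0 1 p.1)%:E)%E.
have mG : measurable_fun setT G.
  apply: emeasurable_funM => //; apply/measurable_EFinP.
  by apply: (measurableT_comp (measurable_normal_pdf 0 1)); exact: measurable_fst.
have G0 p : (0 <= G p)%E by rewrite /G mule_ge0// lee_fin normal_pdf_ge0.
transitivity (\int[mu]_z \int[mu]_u G (z, u))%E.
  apply: eq_integral => z _; rewrite -ge0_integralZr//; last by rewrite lee_fin normal_pdf_ge0.
  by apply: (measurableT_comp mF); exact: measurable_pair1.
rewrite (@fubini_tonelli _ _ _ _ _ mu mu G)//.
have -> : (\int[g01]_u f (Num.sqrt (v + w) * u)%R = \int[gauss 0 (Num.sqrt (v + w))]_u f u)%E.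
  have sp : 0 < Num.sqrt (v + w) by rewrite sqrtr_gt0.
  have <- := ge0_integral_gauss_affine 0 sp mf f0.
  by apply: eq_integral => u _; rewrite add0r.
rewrite ge0_integral_gauss//; apply: eq_integral => u _.
under eq_integral => z _ do rewrite /G /F /= -muleA -EFinM normal_pdf_mul// EFinM muleA.
rewrite ge0_integralZl//.
- by rewrite integral_normal_pdf mule1.
- by apply/measurable_EFinP; exact: measurable_normal_pdf.
- by move=> z _; rewrite lee_fin normal_pdf_ge0.
- by rewrite mule_ge0// lee_fin normal_pdf_ge0.
Qed.

End gaussian_moments.

(* Gaussian smoothing with variance v; [gsmooth 0 f = f]. *)
Section gsmooth.
Context {R : realType}.
Notation g01 := (gauss 0 1 : probability R R).

Definition gsmooth (v : R) (f : R -> R) (x : R) : R :=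
  Ex g01 (fun y => f (x + Num.sqrt v * y)).

Definition bounded_measurable (f : R -> R) : Prop :=
  measurable_fun setT f /\ exists K, forall x, `|f x| <= K.

Lemma bounded_measurable_affine f (a b : R) : bounded_measurable f ->
  integr g01 (fun y => f (a + b * y)).
Proof.
move=> [mf [K fK]]; apply: (@integr_bounded _ _ _ _ _ K) => //.
by apply: (measurableT_comp mf); apply: measurable_funD => //; exact: measurable_funM.
Qed.

Lemma gsmooth0 f : gsmooth 0 f = f.
Proof.
by apply/funext => x; rewrite /gsmooth sqrtr0; under eq_fun do rewrite mul0r addr0; rewrite Ex_cst.
Qed.

(** The semigroup property, which lets Gaussian increments be exchanged one at a time. Tonelli's
    theorem wants a nonnegative integrand, so [f] is raised by its bound [K] and the constant is
    subtracted at the end. *)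
Lemma gsmooth_comp (v w : R) f : 0 <= v -> 0 <= w -> bounded_measurable f ->
  bounded_measurable (gsmooth v f) /\ gsmooth w (gsmooth v f) = gsmooth (v + w) f.
Proof.
move=> v0 w0 bf; have [mf [K fK]] := bf.
have K0 : 0 <= K := le_trans (normr_ge0 _) (fK 0).
have [v1|v1] := eqVneq v 0; first by rewrite v1 gsmooth0 add0r.
have {v1}v0 : 0 < v by rewrite lt0r v1.
have gE (a b : R) : Ex g01 (fun y => f (a + b * y)) = fine (\int[g01]_y (f (a + b * y) + K)%:E)%E - K.
  have := ExD (bounded_measurable_affine a b bf) (integr_cst g01 K).
  by rewrite Ex_cst => h; apply/eqP; rewrite eq_sym subr_eq; apply/eqP.
have fK0 y : (0 <= (f y + K)%:E)%E by rewrite lee_fin -lerBlDr sub0r; have := fK y; rewrite ler_norml => /andP[].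
have key (x w' : R) : 0 < w' -> measurable_fun setT (fun z : R => gsmooth v f (x + Num.sqrt w' * z)) /\
    gsmooth w' (gsmooth v f) x = gsmooth (v + w') f x.
  move=> w'0.
  have mfx : measurable_fun setT (fun y => (f (x + y) + K)%:E).
    apply/measurable_EFinP; apply: measurable_funD => //.
    by apply: (measurableT_comp mf); exact: measurable_funD.
  have [m e] := ge0_gauss_conv v0 w'0 mfx (fun y => fK0 (x + y)).
  have E z : (\int[g01]_y (f (x + (Num.sqrt w' * z + Num.sqrt v * y)) + K)%:E)%E =
      (gsmooth v f (x + Num.sqrt w' * z) + K)%:E.
    under eq_integral do rewrite addrA.
    by rewrite /gsmooth gE subrK fineK//; apply: (integrable_fin_num measurableT);
       apply: integrD; [exact: bounded_measurable_affine|exact: integr_cst].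
  have m' : measurable_fun setT (fun z => gsmooth v f (x + Num.sqrt w' * z)).
    have : measurable_fun setT (fun z => (gsmooth v f (x + Num.sqrt w' * z) + K)%:E).
      by under eq_fun do rewrite -E.
    move=> /measurable_EFinP h.
    rewrite (_ : (fun z => _) = (fun z => (gsmooth v f (x + Num.sqrt w' * z) + K) - K)).
      exact: measurable_funB.
    by apply/funext => z; rewrite addrK.
  split=> //; have I1 : integr g01 (fun z => gsmooth v f (x + Num.sqrt w' * z)).
    apply: (@integr_bounded _ _ _ _ _ K) => // z.
    rewrite -(Ex_cst g01 K); apply: Ex_norm_le => //; last exact: integr_cst.
    exact: (integr_measurable (bounded_measurable_affine _ _ bf)).
  rewrite /gsmooth -/(gsmooth v f) gE.
  apply/eqP; rewrite eq_sym subr_eq; apply/eqP.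
  under [in LHS]eq_integral do rewrite addrC.
  have <- : Ex g01 (fun z => gsmooth v f (x + Num.sqrt w' * z) + K) = gsmooth w' (gsmooth v f) x + K.
    by rewrite ExD ?Ex_cst//; exact: integr_cst.
  rewrite /Ex /Rintegral; congr fine.
  transitivity (\int[g01]_u (f (x + Num.sqrt (v + w') * u) + K)%:E)%E.
    by apply: eq_integral => u _; rewrite addrC.
  by rewrite -e; apply: eq_integral => z _; rewrite E.
split.
  have [m _] := key 0 1 ltr01; split.
    by move: m; rewrite sqrtr1; under eq_fun do rewrite add0r mul1r.
  exists K => x; rewrite -(Ex_cst g01 K); apply: Ex_norm_le => //; last exact: integr_cst.
  exact: (integr_measurable (bounded_measurable_affine _ _ bf)).
have [->|w1] := eqVneq w 0; first by rewrite gsmooth0 addr0.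
by apply/funext => x; have [] := key x w _; rewrite ?lt0r ?w1.
Qed.

End gsmooth.

(** * Lindeberg's replacement argument *)

Section jets.
Context {R : realType}.
Notation g01 := (gauss 0 1 : probability R R).

(* f with candidates f1, f2 for its first two derivatives: only the Taylor bound of order 3
   is recorded, because it passes to Gaussian averages by linearity. *)
Record jet (K : R) (f f1 f2 : R -> R) : Prop := Jet {
  jet_meas : measurable_fun setT f ;
  jet_meas1 : measurable_fun setT f1 ;
  jet_meas2 : measurable_fun setT f2 ;
  jet_bound : forall x, `|f x| <= K ;
  jet_bound1 : forall x, `|f1 x| <= K ;
  jet_bound2 : forall x, `|f2 x| <= K ;
  jet_taylor : forall x h, `|f (x + h) - f x - f1 x * h - f2 x * h ^+ 2 / 2| <= K * `|h| ^+ 3 }.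

Lemma jet_bm K f f1 f2 : jet K f f1 f2 ->
  [/\ bounded_measurable f, bounded_measurable f1 & bounded_measurable f2].
Proof. by case=> *; split; split => //; exists K. Qed.

Lemma gsmooth_bound (v : R) (f : R -> R) (K : R) : (forall x, `|f x| <= K) ->
  measurable_fun setT f -> forall x, `|gsmooth v f x| <= K.
Proof.
move=> fK mf x; rewrite -(Ex_cst g01 K); apply: Ex_norm_le => //; last exact: integr_cst.
apply: (integr_measurable (P := g01)); apply: bounded_measurable_affine; split=> //; by exists K.
Qed.

Lemma jet_gsmooth K v f f1 f2 : 0 <= v -> jet K f f1 f2 ->
  jet K (gsmooth v f) (gsmooth v f1) (gsmooth v f2).
Proof.
move=> v0 jf; have [bf bf1 bf2] := jet_bm jf; case: jf => mf mf1 mf2 fK f1K f2K tay.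
have ms g : bounded_measurable g -> measurable_fun setT (gsmooth v g).
  by move=> bg; have [[]] := gsmooth_comp v0 (lexx 0) bg.
split; [exact: ms|exact: ms|exact: ms|exact: gsmooth_bound|exact: gsmooth_bound|exact: gsmooth_bound|].
move=> x h; have I0 := bounded_measurable_affine.
have -> : gsmooth v f (x + h) - gsmooth v f x - gsmooth v f1 x * h - gsmooth v f2 x * h ^+ 2 / 2 =
  Ex g01 (fun y => f (x + h + Num.sqrt v * y) - f (x + Num.sqrt v * y) - h * f1 (x + Num.sqrt v * y)
     - (h ^+ 2 / 2) * f2 (x + Num.sqrt v * y)).
  rewrite !ExB ?ExZ //; do ?[apply: integrB|apply: integrZ|apply: I0] => //.
  by rewrite /gsmooth; ring.
rewrite -[leRHS](Ex_cst g01); apply: Ex_norm_le; last 1 first.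
- move=> y; have := tay (x + Num.sqrt v * y) h; apply: le_trans; rewrite le_eqVlt; apply/orP; left.
  by apply/eqP; congr (`| _ |); rewrite [x + h + _]addrAC; ring.
- by apply: (integr_measurable (P := g01)); do ?[apply: integrB|apply: integrZ|apply: I0].
- exact: integr_cst.
Qed.

Definition gauss_abs3 : R := Ex g01 (fun y => `|y| ^+ 3).

Lemma integr_gauss_abs3 : integr g01 (fun y => `|y| ^+ 3).
Proof.
have := integr_norm (integr_gauss_power (R := R) 3).
by rewrite (_ : (fun w => `|w ^+ 3|) = (fun y => `|y| ^+ 3))//; apply/funext => y; rewrite normrX.
Qed.

(** The Taylor bound integrated at the increment [q * y]: the first moment removes the linear term
    and the second moment turns [f2 / 2] into [v / 2 * f2]. *)
Lemma gsmooth_expand K v f f1 f2 x : 0 <= v -> jet K f f1 f2 ->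
  `|gsmooth v f x - f x - v / 2 * f2 x| <= K * (gauss_abs3 * Num.sqrt v ^+ 3).
Proof.
move=> v0 jf; have [bf bf1 bf2] := jet_bm jf; case: jf => mf mf1 mf2 fK f1K f2K tay.
set q := Num.sqrt v; have qq : q ^+ 2 = v by rewrite sqr_sqrtr.
have i1 : integr g01 (fun y : R => y) by exact: (integr_gauss_power 1).
have i2 : integr g01 (fun y : R => y ^+ 2) by exact: integr_gauss_power.
have If := bounded_measurable_affine x q bf.
have -> : gsmooth v f x - f x - v / 2 * f2 x =
  Ex g01 (fun y => f (x + q * y) - f x - (f1 x * q) * y - (f2 x * q ^+ 2 / 2) * y ^+ 2).
  rewrite !ExB ?ExZ ?Ex_cst ?gauss_moment1 ?gauss_moment2//; do ?[apply: integrB|apply: integrZ|exact: integr_cst] => //.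
  by rewrite qq /gsmooth; ring.
have -> : K * (gauss_abs3 * q ^+ 3) = Ex g01 (fun y => (K * q ^+ 3) * `|y| ^+ 3).
  by rewrite ExZ; [rewrite /gauss_abs3; ring|exact: integr_gauss_abs3].
apply: Ex_norm_le.
- by apply: (integr_measurable (P := g01)); do ?[apply: integrB|apply: integrZ|exact: integr_cst].
- by apply: integrZ; exact: integr_gauss_abs3.
- move=> y; have -> : K * q ^+ 3 * `|y| ^+ 3 = K * `|q * y| ^+ 3.
    by rewrite normrM (ger0_norm (sqrtr_ge0 v : 0 <= q)); ring.
  by apply: le_trans (tay x (q * y)); rewrite le_eqVlt; apply/orP; left; apply/eqP; congr (`| _ |); ring.
Qed.

End jets.

(** * Second order expansion of a product *)

Section product_expansion.
Context {R : realType} {I : Type}.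
Variables (p al be ga : I -> R) (K t : R).
Hypothesis K1 : 1 <= K.
Hypothesis t0 : 0 <= t.
Hypothesis pK : forall a, `|p a| <= K.
Hypothesis alK : forall a, `|al a| <= K.
Hypothesis beK : forall a, `|be a| <= K * t.
Hypothesis gaK : forall a, `|ga a| <= K * t ^+ 2.
Hypothesis rhoK : forall a, `|p a - al a - be a - ga a| <= K * t ^+ 3.

(** [expand1] and [expand2] collect the terms of order [t] and [t ^+ 2] in the product of the
    [al + be + ga]. The recursion on the list takes the place of a double sum over pairs. *)
Fixpoint expand1 (s : seq I) : R :=
  if s is a :: s' then be a * \prod_(c <- s') al c + al a * expand1 s' else 0.

Fixpoint expand2 (s : seq I) : R :=
  if s is a :: s' then ga a * \prod_(c <- s') al c + be a * expand1 s' + al a * expand2 s' else 0.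

Lemma prod_bound (q : I -> R) (s : seq I) : (forall a, `|q a| <= K) ->
  `|\prod_(a <- s) q a| <= K ^+ size s.
Proof.
move=> qK; elim: s => [|a s IH]; first by rewrite big_nil normr1.
by rewrite big_cons normrM exprS ler_pM.
Qed.

Lemma expand1_bound s : `|expand1 s| <= (size s)%:R * K ^+ size s * t.
Proof.
elim: s => [|a s IH] /=; first by rewrite normr0 !mul0r.
have K0 : 0 <= K by rewrite (le_trans _ K1).
rewrite (le_trans (ler_normD _ _))// !normrM.
have h1 := ler_pM (normr_ge0 _) (normr_ge0 _) (beK a) (@prod_bound al s alK).
have h2 := ler_pM (normr_ge0 _) (normr_ge0 _) (alK a) IH.
by rewrite (le_trans (lerD h1 h2))// (exprS K) -[(size s).+1%:R]natr1 le_eqVlt; apply/orP; left; apply/eqP; ring.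
Qed.

Lemma expand2_bound s : `|expand2 s| <= (size s)%:R ^+ 2 * K ^+ size s * t ^+ 2.
Proof.
elim: s => [|a s IH] /=; first by rewrite normr0 expr0n !mul0r.
have K0 : 0 <= K by rewrite (le_trans _ K1).
rewrite (le_trans (ler_normD _ _))// (le_trans (lerD (ler_normD _ _) (lexx _)))// !normrM.
have h1 := ler_pM (normr_ge0 _) (normr_ge0 _) (gaK a) (@prod_bound al s alK).
have h2 := ler_pM (normr_ge0 _) (normr_ge0 _) (beK a) (expand1_bound s).
have h3 := ler_pM (normr_ge0 _) (normr_ge0 _) (alK a) IH.
rewrite (le_trans (lerD (lerD h1 h2) h3))// (exprS K) -[(size s).+1%:R]natr1.
set n := (size s)%:R; have n0 : 0 <= n :> R by [].
have P0 : 0 <= K * K ^+ size s * t ^+ 2 by rewrite !mulr_ge0// exprn_ge0.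
rewrite -subr_ge0 (_ : _ - _ = n * (K * K ^+ size s * t ^+ 2)); last by ring.
exact: mulr_ge0.
Qed.

Lemma product_expansion s :
  `|\prod_(a <- s) p a - \prod_(a <- s) al a - expand1 s - expand2 s| <=
  (size s)%:R ^+ 3 * K ^+ size s * t ^+ 3.
Proof.
elim: s => [|a s IH] /=; first by rewrite !big_nil subrr !subr0 normr0 expr0n !mul0r.
have K0 : 0 <= K by rewrite (le_trans _ K1).
rewrite !big_cons; set Pp := \prod_(c <- s) p c in IH *; set Z := \prod_(c <- s) al c in IH *.
set B := expand1 s in IH *; set G := expand2 s in IH *.
have -> : p a * Pp - al a * Z - (be a * Z + al a * B) - (ga a * Z + be a * B + al a * G) =
  p a * (Pp - Z - B - G) + (p a - al a - be a - ga a) * Z + (p a - al a - be a) * B + (p a - al a) * G.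
  by ring.
(* The size of the increments is random, so [t] is unbounded. For [t <= 1] the Taylor remainder
   decides; for [t > 1] the trivial bounds by [K] and [K * t] are already below the claimed
   order. *)
have e1 : `|p a - al a - be a| <= 3 * K * t ^+ 2.
  have [t1|t1] := leP t 1.
    rewrite -[X in `|X|](subrK (ga a)) (le_trans (ler_normD _ _))//.
    rewrite (le_trans (lerD (rhoK a) (gaK a)))//.
    have : K * t ^+ 3 <= K * t ^+ 2.
      by rewrite ler_wpM2l// exprSr ler_piMr// exprn_ge0.
    have : 0 <= K * t ^+ 2 by rewrite mulr_ge0// exprn_ge0.
    lra.
  rewrite (le_trans (ler_normB _ _))// (le_trans (lerD (ler_normB _ _) (lexx _)))//.
  rewrite (le_trans (lerD (lerD (pK a) (alK a)) (beK a)))//.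
  have : K * t <= K * t ^+ 2 by rewrite ler_wpM2l// expr2 ler_peMl// ltW.
  have : K <= K * t by rewrite ler_peMr// ltW.
  lra.
have e2 : `|p a - al a| <= 3 * K * t.
  have [t1|t1] := leP t 1.
    rewrite -[X in `|X|](subrK (be a)) (le_trans (ler_normD _ _))//.
    rewrite -[X in `|X| + _](subrK (ga a)) (le_trans (lerD (ler_normD _ _) (lexx _)))//.
    rewrite (le_trans (lerD (lerD (rhoK a) (gaK a)) (beK a)))//.
    have : K * t ^+ 3 <= K * t ^+ 2.
      by rewrite ler_wpM2l// exprSr ler_piMr// exprn_ge0.
    have : K * t ^+ 2 <= K * t by rewrite ler_wpM2l// expr2 ler_piMr.
    lra.
  rewrite (le_trans (ler_normB _ _))// (le_trans (lerD (pK a) (alK a)))//.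
  have : K <= K * t by rewrite ler_peMr// ltW.
  have : 0 <= K * t by rewrite mulr_ge0.
  lra.
rewrite (le_trans (ler_normD _ _))// (le_trans (lerD (ler_normD _ _) (lexx _)))//.
rewrite (le_trans (lerD (lerD (ler_normD _ _) (lexx _)) (lexx _)))// !normrM.
have h1 := ler_pM (normr_ge0 _) (normr_ge0 _) (pK a) IH.
have h2 := ler_pM (normr_ge0 _) (normr_ge0 _) (rhoK a) (@prod_bound al s alK).
have h3 := ler_pM (normr_ge0 _) (normr_ge0 _) e1 (expand1_bound s).
have h4 := ler_pM (normr_ge0 _) (normr_ge0 _) e2 (expand2_bound s).
rewrite (le_trans (lerD (lerD (lerD h1 h2) h3) h4))// (exprS K) -[(size s).+1%:R]natr1 le_eqVlt.
by apply/orP; left; apply/eqP; ring.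
Qed.

End product_expansion.

Lemma expand2_arith (R : realFieldType) (k x y q : R) : x <= q -> y <= k * q -> 0 <= q -> 0 <= k * q ->
  2^-1 * x + y + k ^+ 2 * q <= (k + 1) ^+ 2 * q.
Proof. by move=> ? ? ? ?; rewrite (_ : (k + 1) ^+ 2 * q = k ^+ 2 * q + 2 * (k * q) + q); [lra|ring]. Qed.

Lemma half_le (R : realFieldType) (x y : R) : 0 <= x -> x <= y -> x / 2 <= y.
Proof. by move=> ? ?; lra. Qed.

Section lindeberg.
Context {R : realType} {disp : measure_display} {T : measurableType disp} (P : probability T R).
Context {I : finType}.
Notation g01 := (gauss 0 1 : probability R R).

(* [past] is the class of bounded variables that are known before the step [X] is made. *)
Record step_conditions (past : (T -> R) -> Prop) (S X : I -> T -> R) (v m : R) : Prop := StepConditions {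
  step_past : forall b, past b -> measurable_fun setT b /\ exists K, forall w, `|b w| <= K ;
  step_mul : forall b c, past b -> past c -> past (fun w => b w * c w) ;
  step_fun_past : forall a (h : R -> R), bounded_measurable h -> past (fun w => h (S a w)) ;
  step_S : forall a, measurable_fun setT (S a) ;
  step_X : forall a, measurable_fun setT (X a) ;
  step_X3 : forall a, integr P (fun w => `|X a w| ^+ 3) ;
  step_mean : forall b a, past b -> Ex P (fun w => b w * X a w) = 0 ;
  step_cov : forall b a c K, past b -> (forall w, `|b w| <= K) ->
    `|Ex P (fun w => b w * (X a w * X c w)) - v * (a == c)%:R * Ex P b| <= m * K }.

Context (past : (T -> R) -> Prop) (S X : I -> T -> R) (v m : R).
Hypothesis stepX : step_conditions past S X v m.
Hypothesis v0 : 0 <= v.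
Hypothesis m0 : 0 <= m.
Context (K : R) (f f1 f2 : I -> R -> R).
Hypothesis K1 : 1 <= K.
Hypothesis jf : forall a, jet K (f a) (f1 a) (f2 a).

Let K0 : 0 <= K. Proof. exact: le_trans K1. Qed.

Lemma integr_step1 a : integr P (X a).
Proof.
apply: (@integr_le _ _ _ _ _ (fun w => 1 + `|X a w| ^+ 3)); first exact: (step_X stepX).
- move=> w; have [h|h] := leP `|X a w| 1; first by rewrite (le_trans h)// lerDl exprn_ge0.
  by rewrite (le_trans (ler_eXnr (isT : (0 < 3)%N) (ltW h)))// lerDr.
- by apply: integrD; [exact: integr_cst|exact: (step_X3 stepX)].
Qed.

Lemma integr_step2 a c : integr P (fun w => X a w * X c w).
Proof.
apply: (@integr_le _ _ _ _ _ (fun w => 1 + 2 * `|X a w| ^+ 3 + 2 * `|X c w| ^+ 3)).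
- by apply: measurable_funM; exact: (step_X stepX).
- have sq (z : R) : 0 <= z -> z ^+ 2 <= 1 + z ^+ 3.
    move=> z0; have [h|h] := leP z 1; first by rewrite (le_trans (exprn_ile1 2 z0 h))// lerDl exprn_ge0.
    by rewrite (le_trans (ler_weXn2l (ltW h) (isT : (2 <= 3)%N)))// lerDr.
  move=> w; rewrite normrM; have := sq _ (normr_ge0 (X a w)); have := sq _ (normr_ge0 (X c w)).
  have := sqr_ge0 (`|X a w| - `|X c w|); have := normr_ge0 (X a w); have := normr_ge0 (X c w).
  have : 0 <= `|X a w| ^+ 3 by exact: exprn_ge0.
  have : 0 <= `|X c w| ^+ 3 by exact: exprn_ge0.
  move: (`|X a w|) (`|X c w|) => x y; move: (x ^+ 3) (y ^+ 3) => x3 y3; nra.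
- apply: integrD; [apply: integrD; [exact: integr_cst|]|].
    by apply: integrZ; exact: (step_X3 stepX).
  by apply: integrZ; exact: (step_X3 stepX).
Qed.

Let bpast b g : past b -> integr P g -> integr P (fun w => b w * g w).
Proof. by move=> /(step_past stepX)[mb [B bB]]; exact: integr_mul_bounded. Qed.

Lemma step_jet a : [/\ past (fun w => f a (S a w)), past (fun w => f1 a (S a w)) & past (fun w => f2 a (S a w))].
Proof. by have [? ? ?] := jet_bm (jf a); split; exact: (step_fun_past stepX). Qed.

Lemma past_prod b s : past b -> past (fun w => b w * \prod_(a <- s) f a (S a w)).
Proof.
elim: s b => [|a s IH] b pb; first by under eq_fun do rewrite big_nil mulr1.
under eq_fun do rewrite big_cons mulrA; apply: IH.
by apply: (step_mul stepX) => //; have [] := step_jet a.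
Qed.

Let al w a := f a (S a w).
Let be w a := f1 a (S a w) * X a w.
Let ga w a := f2 a (S a w) * X a w ^+ 2 / 2.
Let gag w a := v / 2 * f2 a (S a w).

(** The free past factor [b] carries this and the next inductions: the factor contributed by the
    head of the list is absorbed into it. *)
Lemma integr_expand1 s b : past b -> integr P (fun w => b w * expand1 (al w) (be w) s) /\
  forall c, integr P (fun w => b w * (X c w * expand1 (al w) (be w) s)).
Proof.
elim: s b => [|a s IH] b pb /=.
  by split=> [|c]; (under eq_fun do rewrite ?mulr0); exact: integr_cst.
have [pf pf1 pf2] := step_jet a.
have p1 := past_prod s (step_mul stepX pb pf1); have p2 := step_mul stepX pb pf.
have [i1 i2] := IH _ p2; split=> [|c].
  rewrite (_ : (fun w => _) = (fun w => (b w * f1 a (S a w) * \prod_(c <- s) f c (S c w)) * X a w +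
     (b w * f a (S a w)) * expand1 (al w) (be w) s)); last by apply/funext => w; rewrite /be /al; ring.
  by apply: integrD => //; apply: bpast => //; exact: integr_step1.
rewrite (_ : (fun w => _) = (fun w => (b w * f1 a (S a w) * \prod_(c <- s) f c (S c w)) * (X c w * X a w) +
     (b w * f a (S a w)) * (X c w * expand1 (al w) (be w) s))); last by apply/funext => w; rewrite /be /al; ring.
by apply: integrD => //; apply: bpast => //; exact: integr_step2.
Qed.

Lemma Ex_expand1 s b : past b -> Ex P (fun w => b w * expand1 (al w) (be w) s) = 0.
Proof.
elim: s b => [|a s IH] b pb /=; first by under eq_fun do rewrite mulr0; rewrite Ex_cst.
have [pf pf1 pf2] := step_jet a.
have p1 := past_prod s (step_mul stepX pb pf1); have p2 := step_mul stepX pb pf.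
rewrite (_ : (fun w => _) = (fun w => (b w * f1 a (S a w) * \prod_(c <- s) f c (S c w)) * X a w +
     (b w * f a (S a w)) * expand1 (al w) (be w) s)); last by apply/funext => w; rewrite /be /al; ring.
rewrite ExD ?IH ?(step_mean stepX) ?addr0//; last by have [] := integr_expand1 s p2.
by apply: bpast => //; exact: integr_step1.
Qed.

(** Since [c] is not in [s], only covariances of distinct coordinates occur, and each of them is at
    most [m] times the bound on its past factor. *)
Lemma Ex_cross s c b B : past b -> (forall w, `|b w| <= B) -> c \notin s ->
  `|Ex P (fun w => b w * (X c w * expand1 (al w) (be w) s))| <= (size s)%:R * m * B * K ^+ size s.
Proof.
elim: s b B => [|a s IH] b B pb bB cs /=.
  by under eq_fun do rewrite !mulr0; rewrite Ex_cst normr0 !mul0r.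
have [pf pf1 pf2] := step_jet a.
have p1 := past_prod s (step_mul stepX pb pf1); have p2 := step_mul stepX pb pf.
rewrite (_ : (fun w => _) = (fun w => (b w * f1 a (S a w) * \prod_(c <- s) f c (S c w)) * (X c w * X a w) +
     (b w * f a (S a w)) * (X c w * expand1 (al w) (be w) s))); last by apply/funext => w; rewrite /be /al; ring.
have [i1 i2] := integr_expand1 s p2.
rewrite ExD//; last by apply: bpast => //; exact: integr_step2.
move: cs; rewrite inE negb_or => /andP[ca cs].
have h1 : `|Ex P (fun w => (b w * f1 a (S a w) * \prod_(c <- s) f c (S c w)) * (X c w * X a w))| <= m * (B * K * K ^+ size s).
  have := step_cov stepX c a p1 (K := B * K * K ^+ size s) _; rewrite (negbTE ca) mulr0 mul0r subr0; apply.
  move=> w; rewrite !normrM; apply: ler_pM => //.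
    by apply: ler_pM => //; exact: (jet_bound1 (jf a)).
  apply: (@prod_bound _ _ K (fun a => f a (S a w))) => c'; exact: (jet_bound (jf c')).
have h2 : `|Ex P (fun w => (b w * f a (S a w)) * (X c w * expand1 (al w) (be w) s))| <= (size s)%:R * m * (B * K) * K ^+ size s.
  by apply: IH => // w; rewrite normrM; apply: ler_pM => //; exact: (jet_bound (jf a)).
rewrite (le_trans (ler_normD _ _))// (le_trans (lerD h1 h2))// (exprS K) -[(size s).+1%:R]natr1.
by rewrite le_eqVlt; apply/orP; left; apply/eqP; ring.
Qed.

(** Expansion of the Gaussian replacement: smoothing has no first order term, and [gag] is its
    second order term. *)
Let be0 (w : T) (a : I) : R := 0.

Lemma integr_expand2 s b : past b -> integr P (fun w => b w * expand2 (al w) (be w) (ga w) s).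
Proof.
elim: s b => [|a s IH] b pb /=; first by (under eq_fun do rewrite mulr0); exact: integr_cst.
have [pf pf1 pf2] := step_jet a.
have p0 := past_prod s (step_mul stepX pb pf2); have p1 := step_mul stepX pb pf1.
have p2 := step_mul stepX pb pf.
rewrite (_ : (fun w => _) = (fun w =>
     2^-1 * ((b w * f2 a (S a w) * \prod_(c <- s) f c (S c w)) * (X a w * X a w)) +
     (b w * f1 a (S a w)) * (X a w * expand1 (al w) (be w) s) +
     (b w * f a (S a w)) * expand2 (al w) (be w) (ga w) s));
  last by apply/funext => w; rewrite /ga /be /al; field.
apply: integrD; last exact: IH.
by apply: integrD; [apply: integrZ; apply: bpast => //; exact: integr_step2|have [_] := integr_expand1 s p1].
Qed.

Lemma integr_past b : past b -> integr P b.
Proof. by move=> /(step_past stepX)[mb [B bB]]; exact: (@integr_bounded _ _ _ _ _ B). Qed.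

Lemma integr_expand2_gauss s b : past b ->
  integr P (fun w => b w * expand2 (al w) (be0 w) (gag w) s).
Proof.
elim: s b => [|a s IH] b pb /=; first by (under eq_fun do rewrite mulr0); exact: integr_cst.
have [pf pf1 pf2] := step_jet a.
have p0 := past_prod s (step_mul stepX pb pf2); have p2 := step_mul stepX pb pf.
rewrite (_ : (fun w => _) = (fun w =>
     v / 2 * (b w * f2 a (S a w) * \prod_(c <- s) f c (S c w)) +
     (b w * f a (S a w)) * expand2 (al w) (be0 w) (gag w) s));
  last by apply/funext => w; rewrite /gag /be0 /al; ring.
by apply: integrD; [apply: integrZ; exact: integr_past|exact: IH].
Qed.

(** A squared increment is compared with the variance [v] and a product of two different ones with
    zero; [uniq s] keeps the two kinds apart. *)
Lemma Ex_expand2 s b B : uniq s -> past b -> (forall w, `|b w| <= B) ->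
  `|Ex P (fun w => b w * expand2 (al w) (be w) (ga w) s) -
    Ex P (fun w => b w * expand2 (al w) (be0 w) (gag w) s)| <=
  (size s)%:R ^+ 2 * m * B * K ^+ size s.
Proof.
elim: s b B => [|a s IH] b B /= us pb bB.
  by under eq_fun do rewrite mulr0; rewrite !Ex_cst subrr normr0 expr0n !mul0r.
have [pf pf1 pf2] := step_jet a.
have p0 := past_prod s (step_mul stepX pb pf2); have p1 := step_mul stepX pb pf1.
have p2 := step_mul stepX pb pf.
rewrite (_ : (fun w => _) = (fun w =>
     2^-1 * ((b w * f2 a (S a w) * \prod_(c <- s) f c (S c w)) * (X a w * X a w)) +
     (b w * f1 a (S a w)) * (X a w * expand1 (al w) (be w) s) +
     (b w * f a (S a w)) * expand2 (al w) (be w) (ga w) s));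
  last by apply/funext => w; rewrite /ga /be /al; field.
rewrite (_ : (fun w => b w * (gag w a * _ + _ + _)) = (fun w =>
     v / 2 * (b w * f2 a (S a w) * \prod_(c <- s) f c (S c w)) +
     (b w * f a (S a w)) * expand2 (al w) (be0 w) (gag w) s));
  last by apply/funext => w; rewrite /gag /be0 /al; ring.
have i0 : integr P (fun w => (b w * f2 a (S a w) * \prod_(c <- s) f c (S c w)) * (X a w * X a w)).
  by apply: bpast => //; exact: integr_step2.
have i1 : integr P (fun w => (b w * f1 a (S a w)) * (X a w * expand1 (al w) (be w) s)).
  by have [_] := integr_expand1 s p1.
have i2 := integr_expand2 s p2; have i3 := integr_expand2_gauss s p2; have i4 := integr_past p0.
case/andP: us => as_ us.
rewrite !ExD ?ExZ//; do ?[apply: integrD|apply: integrZ] => //.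
set A0 := Ex P _; set A1 := Ex P _; set A2 := Ex P _; set A3 := Ex P _; set A4 := Ex P _.
have B0 (w : T) : 0 <= B by rewrite (le_trans _ (bB w)).
have pK w : `|\prod_(c <- s) f c (S c w)| <= K ^+ size s.
  by apply: (@prod_bound _ _ K (fun a => f a (S a w))) => c'; exact: (jet_bound (jf c')).
have h0 : `|A0 - v * A3| <= m * (B * K * K ^+ size s).
  have := step_cov stepX a a p0 (K := B * K * K ^+ size s) _; rewrite eqxx mulr1; apply=> w.
  rewrite !normrM; apply: ler_pM => //; apply: ler_pM => //; exact: (jet_bound2 (jf a)).
have h1 : `|A1| <= (size s)%:R * m * (B * K) * K ^+ size s.
  by apply: Ex_cross => // w; rewrite normrM; apply: ler_pM => //; exact: (jet_bound1 (jf a)).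
have h2 : `|A2 - A4| <= (size s)%:R ^+ 2 * m * (B * K) * K ^+ size s.
  by apply: IH => // w; rewrite normrM; apply: ler_pM => //; exact: (jet_bound (jf a)).
rewrite (_ : _ - _ = 2^-1 * (A0 - v * A3) + A1 + (A2 - A4)); last by field.
rewrite (le_trans (ler_normD _ _))// (le_trans (lerD (ler_normD _ _) h2))//.
rewrite normrM [`|2^-1|]ger0_norm ?invr_ge0//.
have Q0 : 0 <= m * (B * K * K ^+ size s) by rewrite (le_trans _ h0).
rewrite (exprS K) -[(size s).+1%:R]natr1.
have QE : 0 <= (size s)%:R * (m * (B * K * K ^+ size s)) by rewrite mulr_ge0.
rewrite (_ : _ * m * B * (K * _) = ((size s)%:R + 1) ^+ 2 * (m * (B * K * K ^+ size s))); last by ring.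
rewrite (_ : _ ^+ 2 * m * _ * _ = (size s)%:R ^+ 2 * (m * (B * K * K ^+ size s))); last by ring.
by apply: expand2_arith => //; rewrite (le_trans h1)// le_eqVlt; apply/orP; left; apply/eqP; ring.
Qed.

Let n : R := #|I|%:R.

Lemma sum_cube (x : I -> R) : (forall a, 0 <= x a) ->
  (\sum_a x a) ^+ 3 <= n ^+ 3 * \sum_a x a ^+ 3.
Proof.
move=> x0; have [a0 _|noI] := pickP (pred_of_simpl (@predT I)); last first.
  rewrite big1 ?expr0n/= ?mulr_ge0// ?sumr_ge0//; last by move=> a; have := noI a.
  by move=> a _; exact: exprn_ge0.
have [a _ amax] := @arg_maxP _ _ _ a0 predT x isT.
have h1 : \sum_a x a <= n * x a.
  rewrite (le_trans (ler_sum _ (fun c _ => amax c isT)))// sumr_const -mulr_natl.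
  by rewrite (eq_card (B := I)).
have h2 : x a ^+ 3 <= \sum_a x a ^+ 3.
  by rewrite (bigD1 a)//= lerDl sumr_ge0// => c _; exact: exprn_ge0.
rewrite (le_trans (_ : _ <= (n * x a) ^+ 3))//; first by rewrite lerXn2r ?nnegrE ?sumr_ge0// mulr_ge0.
by rewrite exprMn ler_wpM2l// exprn_ge0.
Qed.

Definition lindeberg_error : R :=
  n ^+ 3 * K ^+ #|I| * (n ^+ 3 * \sum_a Ex P (fun w => `|X a w| ^+ 3) +
    (1 + gauss_abs3) ^+ 3 * Num.sqrt v ^+ 3) + n ^+ 2 * K ^+ #|I| * m.

Lemma lindeberg_step :
  `|Ex P (fun w => \prod_a f a (S a w + X a w)) -
    Ex P (fun w => \prod_a gsmooth v (f a) (S a w))| <= lindeberg_error.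
Proof.
set s := index_enum I.
have us : uniq s by exact: index_enum_uniq.
have ss : size s = #|I| by rewrite cardT enumT.
pose p (w : T) a := f a (S a w + X a w); pose p' (w : T) a := gsmooth v (f a) (S a w).
(* The constant 1 is a past variable as a constant function of some [S a]. Without any index both
   products are empty and there is nothing to compare. *)
have one_past : past (fun=> 1) \/ (I -> False).
  have [[a _]|h] := pselect (exists a : I, True); last by right=> a; apply: h; exists a.
  left; apply: (step_fun_past stepX a (h := fun=> 1)); split; first exact: measurable_cst.
  by exists 1 => x; rewrite normr1.
have g3 : 0 <= gauss_abs3 :> R by apply: Ex_ge0 => y; exact: exprn_ge0.
case: one_past => [one_past|noI]; last first.
  have r0 (g : I -> R) : \prod_a g a = 1 by rewrite big1// => a; have := noI a.
  under eq_fun do rewrite r0; under [X in _ - Ex P X]eq_fun do rewrite r0.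
  rewrite !Ex_cst subrr normr0 /lindeberg_error.
  by rewrite addr_ge0// !mulr_ge0// ?exprn_ge0// addr_ge0// ?mulr_ge0 ?exprn_ge0 ?addr_ge0 ?sqrtr_ge0//
    sumr_ge0// => a; have := noI a.
(* [t] dominates all the increments at once. In its Gaussian counterpart [t'] the factor
   [1 + gauss_abs3] makes the square dominate [v / 2] and the cube dominate the remainder of
   [gsmooth_expand]. *)
pose t w := \sum_a `|X a w|; pose t' : R := (1 + gauss_abs3) * Num.sqrt v.
have Xt a w : `|X a w| <= t w by rewrite /t (bigD1 a)//= lerDl sumr_ge0.
have t0 w : 0 <= t w by rewrite sumr_ge0.
have t'0 : 0 <= t' by rewrite mulr_ge0 ?sqrtr_ge0// addr_ge0.
have PE w : `|\prod_(a <- s) p w a - \prod_(a <- s) al w a - expand1 (al w) (be w) s - expand2 (al w) (be w) (ga w) s|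
    <= n ^+ 3 * K ^+ #|I| * t w ^+ 3.
  rewrite /n -ss; apply: product_expansion => // a.
  - exact: (jet_bound (jf a)).
  - exact: (jet_bound (jf a)).
  - by rewrite normrM ler_pM// (jet_bound1 (jf a)).
  - rewrite !normrM (_ : `|2^-1 : R| = 2^-1); last by rewrite ger0_norm// invr_ge0.
    have b2 := jet_bound2 (jf a) (S a w).
    have bX : `|X a w| * `|X a w| <= t w ^+ 2 by rewrite expr2 ler_pM.
    have b0 : 0 <= `|X a w| * `|X a w| by rewrite mulr_ge0.
    exact: half_le (mulr_ge0 (normr_ge0 _) b0) (ler_pM (normr_ge0 _) b0 b2 bX).
  - rewrite (le_trans _ (_ : K * `|X a w| ^+ 3 <= _))// ?ler_wpM2l// ?lerXn2r ?nnegrE//.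
    exact: (jet_taylor (jf a)).
have PE' w : `|\prod_(a <- s) p' w a - \prod_(a <- s) al w a - expand1 (al w) (be0 w) s -
     expand2 (al w) (be0 w) (gag w) s| <= n ^+ 3 * K ^+ #|I| * t' ^+ 3.
  rewrite /n -ss; apply: product_expansion => // a.
  - by apply: gsmooth_bound; [exact: (jet_bound (jf a))|exact: (jet_meas (jf a))].
  - exact: (jet_bound (jf a)).
  - by rewrite normr0 mulr_ge0.
  - rewrite normrM [`|v / 2|]ger0_norm ?divr_ge0// mulrC ler_pM ?divr_ge0 ?(jet_bound2 (jf a))//.
    rewrite /t' exprMn sqr_sqrtr// half_le// ler_peMl// -[leLHS](expr1n _ 2) lerXn2r ?nnegrE ?addr_ge0//.
    by rewrite lerDl.
  - rewrite subr0 (le_trans (gsmooth_expand (S a w) v0 (jf a)))// ler_wpM2l// /t' exprMn.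
    rewrite ler_wpM2r ?exprn_ge0 ?sqrtr_ge0//; have := exprn_ge0 3 g3; have := sqr_ge0 (gauss_abs3 : R).
    rewrite (_ : (1 + gauss_abs3) ^+ 3 = 1 + 3 * gauss_abs3 + 3 * gauss_abs3 ^+ 2 + gauss_abs3 ^+ 3 :> R); last by ring.
    lra.
have e10 w : expand1 (al w) (be0 w) s = 0.
  by elim: (s) => [//|a s' IH] /=; rewrite IH mul0r mulr0 addr0.
have mp : measurable_fun setT (fun w => \prod_(a <- s) p w a).
  apply: measurable_prod => a _; apply: measurableT_comp; first exact: (jet_meas (jf a)).
  by apply: measurable_funD; [exact: (step_S stepX)|exact: (step_X stepX)].
have mp' : measurable_fun setT (fun w => \prod_(a <- s) p' w a).
  apply: measurable_prod => a _; apply: measurableT_comp; last exact: (step_S stepX).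
  by have [b _ _] := jet_bm (jf a); have [[]] := gsmooth_comp v0 (lexx 0) b.
have ip : integr P (fun w => \prod_(a <- s) p w a).
  apply: (@integr_bounded _ _ _ _ _ (K ^+ size s)) => // w.
  by apply: prod_bound => a; exact: (jet_bound (jf a)).
have ip' : integr P (fun w => \prod_(a <- s) p' w a).
  apply: (@integr_bounded _ _ _ _ _ (K ^+ size s)) => // w.
  by apply: prod_bound => a; apply: gsmooth_bound; [exact: (jet_bound (jf a))|exact: (jet_meas (jf a))].
have r1 (g : T -> R) : g = (fun w => 1 * g w) by apply/funext => w; rewrite mul1r.
have i0 : integr P (fun w => \prod_(a <- s) al w a).
  have := integr_past (past_prod s one_past); under eq_fun do rewrite mul1r; exact.
have [i1 _] := integr_expand1 s one_past; rewrite -r1 in i1.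
have i2 := integr_expand2 s one_past; rewrite -r1 in i2.
have i3 := integr_expand2_gauss s one_past; rewrite -r1 in i3.
have E1 := Ex_expand1 s one_past; rewrite -r1 in E1.
have E2 := Ex_expand2 (B := 1) us one_past; rewrite -!r1 in E2.
have n1 : `|1 : R| <= 1 by rewrite normr1.
have {}E2 := E2 (fun=> n1).
have it3 : integr P (fun w => n ^+ 3 * \sum_a `|X a w| ^+ 3).
  by apply: integrZ; apply: integr_sum => a _; exact: (step_X3 stepX).
pose c3 : R := n ^+ 3 * K ^+ #|I|; have c30 : 0 <= c3 by rewrite mulr_ge0// exprn_ge0.
have D : `|Ex P (fun w => \prod_(a <- s) p w a - \prod_(a <- s) al w a - expand1 (al w) (be w) s - expand2 (al w) (be w) (ga w) s)|
    <= c3 * (n ^+ 3 * \sum_a Ex P (fun w => `|X a w| ^+ 3)).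
  rewrite -Ex_sum; last by move=> a _; exact: (step_X3 stepX).
  rewrite -ExZ; last by apply: integr_sum => a _; exact: (step_X3 stepX).
  rewrite -ExZ//.
  apply: Ex_norm_le.
  - by apply: (integr_measurable (P := P)); do ?apply: integrB.
  - exact: integrZ.
  - move=> w; rewrite (le_trans (PE w))// ler_wpM2l//; apply: sum_cube => a; exact: normr_ge0.
have D' : `|Ex P (fun w => \prod_(a <- s) p' w a - \prod_(a <- s) al w a - expand2 (al w) (be0 w) (gag w) s)| <= c3 * t' ^+ 3.
  rewrite -[leRHS](Ex_cst P); apply: Ex_norm_le.
  - by apply: (integr_measurable (P := P)); do ?apply: integrB.
  - exact: integr_cst.
  - by move=> w; have := PE' w; rewrite e10 subr0.
move: D D'; rewrite !ExB//; do ?apply: integrB => //; rewrite E1 subr0 => D D'.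
rewrite ss mulr1 -/n in E2; rewrite /lindeberg_error -/c3 -/s.
have -> : (1 + gauss_abs3) ^+ 3 * Num.sqrt v ^+ 3 = t' ^+ 3 by rewrite exprMn.
rewrite (_ : n ^+ 2 * K ^+ #|I| * m = n ^+ 2 * m * K ^+ #|I|); last by ring.
move: D D' E2; rewrite !ler_norml mulrDr => /andP[D1 D2] /andP[D3 D4] /andP[D5 D6].
move: D1 D2 D3 D4 D5 D6; clear; move=> *; apply/andP; split; lra.
Qed.

End lindeberg.

Section lindeberg_sum.
Context {R : realType} {disp : measure_display} {T : measurableType disp} (P : probability T R).
Context {I : finType} (N : nat) (past : nat -> (T -> R) -> Prop) (X : nat -> I -> T -> R) (v m : nat -> R).
Context (K : R) (f f1 f2 : I -> R -> R).

Lemma telescope_ord (u : nat -> R) k : u k - u 0%N = \sum_(i < k) (u i.+1 - u i).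
Proof. by rewrite -(big_mkord xpredT (fun i => u i.+1 - u i)) telescope_sumr. Qed.

(** Telescoping: at stage [i] the first [i] summands are the given ones, and the others are
    represented by smoothing each [f a] with the remaining variance [W i]. As the Gaussian part sits
    in the functions, no auxiliary probability space has to be built. *)
Lemma lindeberg : 1 <= K -> (forall a, jet K (f a) (f1 a) (f2 a)) ->
  (forall i, (i < N)%N -> [/\ 0 <= v i, 0 <= m i &
     step_conditions P (past i) (fun a w => \sum_(j < i) X j a w) (X i) (v i) (m i)]) ->
  `|Ex P (fun w => \prod_a f a (\sum_(j < N) X j a w)) -
    \prod_a gsmooth (\sum_(j < N) v j) (f a) 0| <=
  \sum_(i < N) lindeberg_error P (X i) (v i) (m i) K.
Proof.
move=> K1 jf st; pose W i : R := \sum_(i <= j < N) v j.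
have W0 i : 0 <= W i.
  by rewrite /W big_nat_cond sumr_ge0// => j /andP[/andP[_ jN] _]; have [] := st j jN.
pose u i := Ex P (fun w => \prod_a gsmooth (W i) (f a) (\sum_(j < i) X j a w)).
have bf a : bounded_measurable (f a) by have [] := jet_bm (jf a).
have uN : u N = Ex P (fun w => \prod_a f a (\sum_(j < N) X j a w)).
  congr Ex; apply/funext => w; apply: eq_bigr => a _.
  by rewrite /W big_geq// gsmooth0.
have u0 : u 0%N = \prod_a gsmooth (\sum_(j < N) v j) (f a) 0.
  rewrite /u; under eq_fun do under eq_bigr do rewrite big_ord0.
  by rewrite Ex_cst /W big_mkord.
have ui i : (i < N)%N -> `|u i.+1 - u i| <= lindeberg_error P (X i) (v i) (m i) K.
  move=> iN; have [vi mi sti] := st i iN.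
  have -> : u i.+1 = Ex P (fun w => \prod_a gsmooth (W i.+1) (f a) (\sum_(j < i) X j a w + X i a w)).
    by rewrite /u; apply/(congr1 (Ex P))/funext => w; apply: eq_bigr => a _; rewrite big_ord_recr.
  have -> : u i = Ex P (fun w => \prod_a gsmooth (v i) (gsmooth (W i.+1) (f a)) (\sum_(j < i) X j a w)).
    rewrite /u; apply/(congr1 (Ex P))/funext => w; apply: eq_bigr => a _.
    have [_ ->] := gsmooth_comp (W0 i.+1) vi (bf a).
    by rewrite /W (big_ltn iN) addrC.
  exact: (lindeberg_step sti vi mi K1 (fun a => jet_gsmooth (W0 i.+1) (jf a))).
rewrite -uN -u0 telescope_ord (le_trans (ler_norm_sum _ _ _))//; apply: ler_sum => i _; exact: ui.
Qed.

End lindeberg_sum.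

(** * From smooth functions to laws *)

Section truncated_powers.
Context {R : realFieldType}.
Implicit Types x h : R.

Definition pospart x : R := Num.max x 0.

Lemma pospartP x : (x <= 0 /\ pospart x = 0) \/ (0 <= x /\ pospart x = x).
Proof. by rewrite /pospart; case: (leP x 0) => h; [left|right; rewrite ltW]. Qed.

Lemma pospart_cube_taylor x h :
  `|pospart (x + h) ^+ 3 - pospart x ^+ 3 - 3 * pospart x ^+ 2 * h - 3 * pospart x * h ^+ 2| <= `|h| ^+ 3.
Proof.
have n3 : `|h| ^+ 3 = `|h ^+ 3| by rewrite normrX.
have cube_le (a b : R) : 0 <= a -> a <= b -> a ^+ 3 <= b ^+ 3.
  by move=> a0 ab; rewrite lerXn2r ?nnegrE// (le_trans a0).
case: (pospartP x) => -[x0 ->]; case: (pospartP (x + h)) => -[y0 ->].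
- by rewrite !(expr0n, mulr0, mul0r, subr0)/= normr0 exprn_ge0.
- rewrite !(expr0n, mulr0, mul0r, subr0)/= ger0_norm ?exprn_ge0//.
  have h0 : 0 <= h by lra.
  by rewrite ger0_norm//; apply: cube_le => //; lra.
- rewrite n3 expr0n/= ler0_norm; last first.
    have : 0 <= x ^+ 2 by exact: sqr_ge0.
    have : 0 <= (- (x + h)) ^+ 3 by apply: exprn_ge0; lra.
    have : (- (x + h)) ^+ 3 <= (- h) ^+ 3 by apply: cube_le; lra.
    rewrite (_ : 0 - x ^+ 3 - _ - _ = - (- h) ^+ 3 + (- (x + h)) ^+ 3); last by ring.
    by lra.
  have : 0 <= (- (x + h)) ^+ 3 by apply: exprn_ge0; lra.
  have h0 : h <= 0 by lra.
  rewrite (_ : 0 - x ^+ 3 - _ - _ = - (- h) ^+ 3 + (- (x + h)) ^+ 3); last by ring.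
  rewrite -[h ^+ 3]opprK normrN (_ : - h ^+ 3 = (- h) ^+ 3); last by ring.
  have k0 : 0 <= (- h) ^+ 3 by apply: exprn_ge0; lra.
  by rewrite (ger0_norm k0); lra.
- rewrite n3 (_ : (x + h) ^+ 3 - x ^+ 3 - _ - _ = h ^+ 3)//; by ring.
Qed.

(** The integral of the quadratic B-spline: a twice continuously differentiable step from 0 to 1 on
    [[0, 3]]. As a combination of truncated cubes it inherits their Taylor bound, which is pure
    algebra. [spline] is the cubic B-spline, supported in [[0, 4]]. *)
Definition smoothstep x : R :=
  (pospart x ^+ 3 - 3 * pospart (x - 1) ^+ 3 + 3 * pospart (x - 2) ^+ 3 - pospart (x - 3) ^+ 3) / 6.

Definition smoothstep1 x : R :=
  (pospart x ^+ 2 - 3 * pospart (x - 1) ^+ 2 + 3 * pospart (x - 2) ^+ 2 - pospart (x - 3) ^+ 2) / 2.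

Definition smoothstep2 x : R :=
  pospart x - 3 * pospart (x - 1) + 3 * pospart (x - 2) - pospart (x - 3).

Definition spline x : R := smoothstep x - smoothstep (x - 1).

Lemma pospart0 x : x <= 0 -> pospart x = 0.
Proof. by move=> h; apply/max_idPr. Qed.

Lemma pospart_id x : 0 <= x -> pospart x = x.
Proof. by move=> h; apply/max_idPl. Qed.

Lemma smoothstep_left x : x <= 0 -> [/\ smoothstep x = 0, smoothstep1 x = 0 & smoothstep2 x = 0].
Proof.
move=> x0; rewrite /smoothstep /smoothstep1 /smoothstep2.
rewrite (pospart0 x0) (@pospart0 (x - 1)) ?(@pospart0 (x - 2)) ?(@pospart0 (x - 3)); [split; lra|lra..].
Qed.

Lemma smoothstep_right x : 3 <= x -> [/\ smoothstep x = 1, smoothstep1 x = 0 & smoothstep2 x = 0].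
Proof.
move=> x0; rewrite /smoothstep /smoothstep1 /smoothstep2.
rewrite (@pospart_id x) ?(@pospart_id (x - 1)) ?(@pospart_id (x - 2)) ?(@pospart_id (x - 3)); [split; lra|lra..].
Qed.

Lemma smoothstep_01 x : 0 <= x <= 1 -> smoothstep x = x ^+ 3 / 6.
Proof.
move=> /andP[x0 x1]; rewrite /smoothstep.
rewrite (@pospart_id x) ?(@pospart0 (x - 1)) ?(@pospart0 (x - 2)) ?(@pospart0 (x - 3)); [lra|lra..].
Qed.

Lemma smoothstep_12 x : 1 <= x <= 2 -> smoothstep x = (x ^+ 3 - 3 * (x - 1) ^+ 3) / 6.
Proof.
move=> /andP[x0 x1]; rewrite /smoothstep.
rewrite (@pospart_id x) ?(@pospart_id (x - 1)) ?(@pospart0 (x - 2)) ?(@pospart0 (x - 3)); [lra|lra..].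
Qed.

Lemma smoothstep_23 x : 2 <= x <= 3 -> smoothstep x = 1 - (3 - x) ^+ 3 / 6.
Proof.
move=> /andP[x0 x1]; rewrite /smoothstep.
rewrite (@pospart_id x) ?(@pospart_id (x - 1)) ?(@pospart_id (x - 2)) ?(@pospart0 (x - 3)); [lra|lra..].
Qed.

Lemma cube01 x : 0 <= x <= 1 -> 0 <= x ^+ 3 <= 1 /\ x ^+ 3 <= x ^+ 2 /\ x ^+ 2 <= x /\ 2 * x ^+ 2 - x <= x ^+ 3.
Proof.
move=> /andP[x0 x1]; rewrite exprn_ge0// exprn_ile1//; split => //.
split; first by rewrite [x ^+ 3]exprSr expr2 ler_piMr ?mulr_ge0.
split; first by rewrite expr2 ler_piMr.
by have := mulr_ge0 x0 (sqr_ge0 (x - 1)); rewrite (_ : x * _ = x ^+ 3 - 2 * x ^+ 2 + x); [lra|ring].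
Qed.

Lemma smoothstep_bound x : 0 <= smoothstep x <= 1.
Proof.
have [h0|h0] := leP x 0; first by have [-> _ _] := smoothstep_left h0; rewrite lexx ler01.
have [h3|h3] := leP 3 x; first by have [-> _ _] := smoothstep_right h3; rewrite lexx ler01.
have [h1|h1] := leP x 1.
  rewrite smoothstep_01 ?(ltW h0)//; have [] := @cube01 x; first by rewrite ltW.
  by move=> /andP[? ?] _; apply/andP; split; lra.
have [h2|h2] := leP x 2.
  rewrite smoothstep_12 ?(ltW h1)//; have [] := @cube01 (x - 1); first by apply/andP; split; lra.
  rewrite (_ : x ^+ 3 = (x - 1) ^+ 3 + 3 * (x - 1) ^+ 2 + 3 * (x - 1) + 1); last by ring.
  move: ((x - 1) ^+ 3) ((x - 1) ^+ 2) => a b /andP[? ?] [? [? ?]]; apply/andP; split; lra.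
rewrite smoothstep_23 ?(ltW h2) ?(ltW h3)//; have [] := @cube01 (3 - x); first by apply/andP; split; lra.
by move=> /andP[? ?] _; apply/andP; split; lra.
Qed.

Lemma spline_ge0 x : 0 <= spline x.
Proof.
rewrite /spline subr_ge0.
have [h0|h0] := leP x 1.
  by have [-> _ _] := @smoothstep_left (x - 1) ltac:(lra); case/andP: (smoothstep_bound x).
have [h3|h3] := leP 3 x.
  by have [-> _ _] := smoothstep_right h3; case/andP: (smoothstep_bound (x - 1)).
have [h2|h2] := leP x 2.
  rewrite (@smoothstep_12 x) ?(ltW h0)// smoothstep_01; last by apply/andP; split; lra.
  have [] := @cube01 (x - 1); first by apply/andP; split; lra.
  rewrite (_ : x ^+ 3 = (x - 1) ^+ 3 + 3 * (x - 1) ^+ 2 + 3 * (x - 1) + 1); last by ring.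
  move: ((x - 1) ^+ 3) ((x - 1) ^+ 2) => a b /andP[? ?] [? [? ?]]; lra.
rewrite (@smoothstep_23 x) ?(ltW h2) ?(ltW h3)// smoothstep_12; last by apply/andP; split; lra.
have [] := @cube01 (3 - x); first by apply/andP; split; lra.
rewrite (_ : (x - 1) ^+ 3 = - (3 - x) ^+ 3 + 6 * (3 - x) ^+ 2 - 12 * (3 - x) + 8); last by ring.
rewrite (_ : (x - 1 - 1) ^+ 3 = - (3 - x) ^+ 3 + 3 * (3 - x) ^+ 2 - 3 * (3 - x) + 1); last by ring.
move: ((3 - x) ^+ 3) ((3 - x) ^+ 2) => a b /andP[? ?] [? [? ?]]; lra.
Qed.

Lemma spline_support x : spline x != 0 -> 0 <= x <= 4.
Proof.
move=> h; apply/andP; split; rewrite leNgt; apply: contra h => h.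
  by rewrite /spline; have [-> _ _] := @smoothstep_left x (ltW h);
    have [-> _ _] := @smoothstep_left (x - 1) ltac:(lra); rewrite subrr.
by rewrite /spline; have [-> _ _] := @smoothstep_right x ltac:(lra);
    have [-> _ _] := @smoothstep_right (x - 1) ltac:(lra); rewrite subrr.
Qed.

Lemma spline_le1 x : spline x <= 1.
Proof.
by have /andP[? ?] := smoothstep_bound x; have /andP[? ?] := smoothstep_bound (x - 1); rewrite /spline; lra.
Qed.

Lemma smoothstep1_bound x : `|smoothstep1 x| <= 12.
Proof.
have [h0|h0] := leP x 0; first by have [_ -> _] := smoothstep_left h0; rewrite normr0.
have [h3|h3] := leP 3 x; first by have [_ -> _] := smoothstep_right h3; rewrite normr0.
have B y : y <= 3 -> 0 <= pospart y ^+ 2 <= 9.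
  by move=> y3; case: (pospartP y) => -[y0 ->]; apply/andP; split; nra.
have := B _ (ltW h3); have := B (x - 1) ltac:(lra); have := B (x - 2) ltac:(lra); have := B (x - 3) ltac:(lra).
have C y : y <= 2 -> 0 <= pospart y ^+ 2 <= 4.
  by move=> y3; case: (pospartP y) => -[y0 ->]; apply/andP; split; nra.
have := C (x - 1) ltac:(lra); have := C (x - 2) ltac:(lra).
rewrite /smoothstep1; move: (_ ^+ 2) (_ ^+ 2) (_ ^+ 2) (_ ^+ 2) => a b c d.
move=> /andP[? ?] /andP[? ?] /andP[? ?] /andP[? ?] /andP[? ?] /andP[? ?].
by rewrite ler_norml; apply/andP; split; lra.
Qed.

Lemma smoothstep2_bound x : `|smoothstep2 x| <= 12.
Proof.
have [h0|h0] := leP x 0; first by have [_ _ ->] := smoothstep_left h0; rewrite normr0.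
have [h3|h3] := leP 3 x; first by have [_ _ ->] := smoothstep_right h3; rewrite normr0.
have B y : y <= 3 -> 0 <= pospart y <= 3.
  by move=> y3; case: (pospartP y) => -[y0 ->]; apply/andP; split; lra.
have := B _ (ltW h3); have := B (x - 1) ltac:(lra); have := B (x - 2) ltac:(lra); have := B (x - 3) ltac:(lra).
rewrite /smoothstep2; move: (pospart _) (pospart _) (pospart _) (pospart _) => a b c d.
move=> /andP[? ?] /andP[? ?] /andP[? ?] /andP[? ?].
by rewrite ler_norml; apply/andP; split; lra.
Qed.

Lemma smoothstep_taylor x h :
  `|smoothstep (x + h) - smoothstep x - smoothstep1 x * h - smoothstep2 x * h ^+ 2 / 2| <= 2 * `|h| ^+ 3.
Proof.
have t0 := pospart_cube_taylor x h; have t1 := pospart_cube_taylor (x - 1) h.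
have t2 := pospart_cube_taylor (x - 2) h; have t3 := pospart_cube_taylor (x - 3) h.
rewrite /smoothstep /smoothstep1 /smoothstep2.
rewrite -![x - _ + h]addrAC in t1 t2 t3; move: t0 t1 t2 t3.
have : 0 <= `|h| ^+ 3 by rewrite exprn_ge0.
move: (`|h| ^+ 3) (pospart (x + h) ^+ 3) (pospart (x + h - 1) ^+ 3) (pospart (x + h - 2) ^+ 3) (pospart (x + h - 3) ^+ 3) => H A0 A1 A2 A3 H0.
move: (pospart x) (pospart (x - 1)) (pospart (x - 2)) (pospart (x - 3)) => p0 p1 p2 p3.
set E0 := A0 - _ - _ - _; set E1 := A1 - _ - _ - _; set E2 := A2 - _ - _ - _; set E3 := A3 - _ - _ - _.
rewrite (_ : _ - _ - _ - _ = (E0 - 3 * E1 + 3 * E2 - E3) / 6); last by rewrite /E0 /E1 /E2 /E3; field.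
move: E0 E1 E2 E3 => E0 E1 E2 E3.
rewrite !ler_norml => /andP[? ?] /andP[? ?] /andP[? ?] /andP[? ?]; apply/andP; split; lra.
Qed.

End truncated_powers.

Section jet_operations.
Context {R : realType}.

Lemma measurable_pospart c : measurable_fun setT (fun x : R => pospart (x - c)).
Proof.
by apply: measurable_maxr; [apply: measurable_funD => //|exact: measurable_cst].
Qed.

Lemma jet_smoothstep : jet 12 (smoothstep : R -> R) smoothstep1 smoothstep2.
Proof.
have mp c := measurable_pospart c.
have mp0 : measurable_fun setT (pospart : R -> R).
  by have := mp 0; under eq_fun do rewrite subr0.
split.
- by apply: measurable_funM => //; apply: measurable_funB; [apply: measurable_funD; [apply: measurable_funB|]|];
    do ?[apply: measurable_funM => //]; apply: measurable_funX.
- by apply: measurable_funM => //; apply: measurable_funB; [apply: measurable_funD; [apply: measurable_funB|]|];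
    do ?[apply: measurable_funM => //]; apply: measurable_funX.
- by apply: measurable_funB => //; apply: measurable_funD; [apply: measurable_funB => //|]; apply: measurable_funM.
- by move=> x; have /andP[a b] := smoothstep_bound x; rewrite ger0_norm//; lra.
- exact: smoothstep1_bound.
- exact: smoothstep2_bound.
- move=> x h; rewrite (le_trans (smoothstep_taylor x h))// ler_wpM2r ?exprn_ge0//; lra.
Qed.

(** With [1 <= s] the single constant [K * s ^+ 3] bounds the function and both derivatives besides
    the Taylor remainder. *)
Lemma jet_affine (K s c : R) f f1 f2 : 1 <= s -> jet K f f1 f2 ->
  jet (K * s ^+ 3) (fun x => f (s * x + c)) (fun x => s * f1 (s * x + c)) (fun x => s ^+ 2 * f2 (s * x + c)).
Proof.
move=> s1 [mf mf1 mf2 fK f1K f2K tay]; have K0 : 0 <= K by rewrite (le_trans _ (fK 0)).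
have s0 : 0 <= s by lra.
have ma : measurable_fun setT (fun x : R => s * x + c).
  by apply: measurable_funD => //; exact: measurable_funM.
have p1 k : 1 <= s ^+ k by exact: exprn_ege1.
split.
- exact: measurableT_comp.
- by apply: measurable_funM => //; exact: measurableT_comp.
- by apply: measurable_funM => //; exact: measurableT_comp.
- by move=> x; rewrite (le_trans (fK _))// ler_peMr.
- by move=> x; rewrite normrM (ger0_norm s0) mulrC ler_pM// exprS ler_peMr.
- by move=> x; rewrite normrM (ger0_norm (exprn_ge0 2 s0)) mulrC ler_pM ?exprn_ge0// [s ^+ 3]exprSr ler_peMr// exprn_ge0.
- move=> x h; have -> : K * s ^+ 3 * `|h| ^+ 3 = K * `|s * h| ^+ 3 by rewrite normrM (ger0_norm s0); ring.
  apply: le_trans (tay (s * x + c) (s * h)); rewrite le_eqVlt; apply/orP; left; apply/eqP; congr (`| _ |).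
  by rewrite (_ : s * (x + h) + c = s * x + c + s * h); ring.
Qed.

Lemma jet_sub (K : R) f f1 f2 g g1 g2 : jet K f f1 f2 -> jet K g g1 g2 ->
  jet (2 * K) (fun x => f x - g x) (fun x => f1 x - g1 x) (fun x => f2 x - g2 x).
Proof.
move=> [mf mf1 mf2 fK f1K f2K tay] [mg mg1 mg2 gK g1K g2K tayg].
split; do ?exact: measurable_funB.
- by move=> x; rewrite (le_trans (ler_normB _ _))//; have := fK x; have := gK x; lra.
- by move=> x; rewrite (le_trans (ler_normB _ _))//; have := f1K x; have := g1K x; lra.
- by move=> x; rewrite (le_trans (ler_normB _ _))//; have := f2K x; have := g2K x; lra.
- move=> x h; have := tay x h; have := tayg x h.
  set E := g _ - _ - _ - _; set F := f _ - _ - _ - _ => e1 e2.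
  rewrite (_ : _ - _ - _ - _ = F - E); last by rewrite /E /F; field.
  rewrite (le_trans (ler_normB _ _))//; lra.
Qed.

Lemma jet_one : jet 1 (fun=> 1 : R) (fun=> 0) (fun=> 0).
Proof.
split => //; do ?[by move=> x; rewrite ?normr1 ?normr0].
by move=> x h; rewrite subrr !mul0r !subr0 normr0 mul1r exprn_ge0.
Qed.

Lemma jet_mono (K K' : R) f f1 f2 : K <= K' -> jet K f f1 f2 -> jet K' f f1 f2.
Proof.
move=> KK [mf mf1 mf2 fK f1K f2K tay]; split => //; do ?[by move=> x; rewrite (le_trans _ KK)].
by move=> x h; rewrite (le_trans (tay x h))// ler_wpM2r ?exprn_ge0.
Qed.

End jet_operations.

(** * A smooth partition of unity on a grid *)

Section cells.
Context {R : realType} (m : nat) (s : R).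

(** A bump on the interval of length [4 / s] starting at [(j - m) / s]. The [2 * m] bumps telescope
    to [cells], which is 1 as long as [3 - m <= s * x <= m]: [s] is the resolution of the grid and
    [m] its range. *)
Definition cell (j : 'I_(2 * m)) (x : R) : R := spline (s * x + (m%:R - j%:R)).

Definition cells (x : R) : R := smoothstep (s * x + m%:R) - smoothstep (s * x - m%:R).

Lemma sum_cell x : \sum_j cell j x = cells x.
Proof.
have := telescope_ord (fun i => - smoothstep (s * x + m%:R - i%:R)) (2 * m).
rewrite opprK subr0 addrC (_ : s * x + m%:R - (2 * m)%:R = s * x - m%:R); last by rewrite mul2n -addnn natrD; ring.
rewrite -/(cells x) => ->; apply: eq_bigr => i _; rewrite /cell /spline opprK addrC addrA.
by congr (- smoothstep _ + _); rewrite -[i.+1%:R]natr1; ring.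
Qed.

Lemma cell_ge0 j x : 0 <= cell j x. Proof. exact: spline_ge0. Qed.

Lemma cells_ge0 x : 0 <= cells x.
Proof. by rewrite -sum_cell sumr_ge0// => j _; exact: cell_ge0. Qed.

Lemma cells_le1 x : cells x <= 1.
Proof.
by rewrite /cells; have /andP[_ a] := smoothstep_bound (s * x + m%:R);
  have /andP[b _] := smoothstep_bound (s * x - m%:R); lra.
Qed.

Lemma cell_near j x y : 0 < s -> cell j x != 0 -> cell j y != 0 -> `|x - y| <= 4 / s.
Proof.
move=> s0 /spline_support/andP[a b] /spline_support/andP[c e].
rewrite ler_pdivlMr// -[s in X in X <= _]gtr0_norm// -normrM ler_norml; apply/andP; split; nra.
Qed.

Lemma cell_jet j : 1 <= s -> exists f1 f2, jet (24 * s ^+ 3) (cell j) f1 f2.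
Proof.
move=> s1; have J c := jet_affine c s1 (jet_smoothstep (R := R)).
have := jet_sub (J (m%:R - j%:R)) (J (m%:R - j%:R - 1)).
rewrite (_ : 2 * (12 * s ^+ 3) = 24 * s ^+ 3); last by ring.
rewrite (_ : (fun x => smoothstep (s * x + (m%:R - j%:R)) - _) = cell j); first by eexists; eexists; eassumption.
by apply/funext => x; rewrite /cell /spline; congr (_ - smoothstep _); ring.
Qed.

Lemma cells_jet : 1 <= s -> exists f1 f2, jet (24 * s ^+ 3) cells f1 f2.
Proof.
move=> s1; have J c := jet_affine c s1 (jet_smoothstep (R := R)).
have := jet_sub (J m%:R) (J (- m%:R)).
rewrite (_ : 2 * (12 * s ^+ 3) = 24 * s ^+ 3); last by ring.
by move=> h; eexists; eexists; exact: h.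
Qed.

Lemma cell_bm j : 1 <= s -> bounded_measurable (cell j).
Proof. by move=> /(cell_jet j)[f1 [f2 /jet_bm[]]]. Qed.

Lemma cells_bm : 1 <= s -> bounded_measurable cells.
Proof. by move=> /cells_jet[f1 [f2 /jet_bm[]]]. Qed.

End cells.

Section grid.
Context {R : realType} {disp disp' : measure_display} {T : measurableType disp} {T' : measurableType disp'}.
Context (P : probability T R) (P' : probability T' R).
Context {I : finType} (S : I -> T -> R) (Z : I -> T' -> R).
Hypothesis mS : forall a, measurable_fun setT (S a).
Hypothesis mZ : forall a, measurable_fun setT (Z a).

Lemma integr_prod_bm {d : measure_display} {U : measurableType d} (Q : probability U R) (X : I -> U -> R) (f : I -> R -> R) :
  (forall a, measurable_fun setT (X a)) -> (forall a, bounded_measurable (f a)) ->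
  integr Q (fun w => \prod_a f a (X a w)).
Proof.
move=> mX bf; have [K fK] := choice (fun a => (bf a).2).
apply: (@integr_bounded _ _ _ _ _ (\prod_a K a)).
  by apply: measurable_prod => a _; apply: measurableT_comp (mX a); exact: (bf a).1.
by move=> w; rewrite normr_prod; apply: ler_prod => a _; rewrite normr_ge0 fK.
Qed.

Lemma grid_compare (m : nat) (s delta eta e : R) (A B : (I -> R) -> Prop) : 1 <= s -> 4 / s <= delta ->
  measurable [set w | A (fun a => S a w)] -> measurable [set w | B (fun a => Z a w)] ->
  (forall x y, A x -> (forall a, `|y a - x a| <= delta) -> B y) ->
  (forall KK : {set {ffun I -> 'I_(2 * m)}},
     \sum_(k in KK) Ex P (fun w => \prod_a cell s (k a) (S a w)) <=
     \sum_(k in KK) Ex P' (fun w => \prod_a cell s (k a) (Z a w)) + eta) ->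
  1 - e <= Ex P (fun w => \prod_a cells m s (S a w)) ->
  (P [set w | A (fun a => S a w)] <= P' [set w | B (fun a => Z a w)] + (eta + e)%:E)%E.
Proof.
move=> s1 sd mA mB AB cmp tail; have s0 : 0 < s by lra.
pose KK : {set {ffun I -> 'I_(2 * m)}} :=
  finset (fun k : {ffun I -> 'I_(2 * m)} => `[< exists2 x : I -> R, A x & forall a, cell s (k a) (x a) != 0 >]).
have ic (k : {ffun I -> 'I_(2 * m)}) : integr P (fun w => \prod_a cell s (k a) (S a w)).
  by apply: (integr_prod_bm P (f := fun a => cell s (k a)) mS) => a; exact: cell_bm.
have ic' (k : {ffun I -> 'I_(2 * m)}) : integr P' (fun w => \prod_a cell s (k a) (Z a w)).
  by apply: (integr_prod_bm P' (f := fun a => cell s (k a)) mZ) => a; exact: cell_bm.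
have ics : integr P (fun w => \prod_a cells m s (S a w)).
  by apply: (integr_prod_bm P (f := fun=> cells m s) mS) => a; exact: cells_bm.
have h1 : (P [set w | A (fun a => S a w)] <=
    (Ex P (fun w => \sum_(k in KK) \prod_a cell s (k a) (S a w) + (1 - \prod_a cells m s (S a w))))%:E)%E.
  apply: prob_le_Ex => //.
    by apply: integrD; [exact: integr_sum|apply: integrB => //; exact: integr_cst].
  move=> w; rewrite indicE.
  have pos (k : {ffun I -> 'I_(2 * m)}) : 0 <= \prod_a cell s (k a) (S a w).
    by apply: prodr_ge0 => a _; exact: cell_ge0.
  have [/set_mem/= Aw|_] := boolP (_ \in _); last first.
    rewrite addr_ge0 ?sumr_ge0// subr_ge0 -[leRHS](expr1n _ #|I|) -prodr_const.
    by apply: ler_prod => a _; rewrite cells_ge0 cells_le1.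
  have -> : \prod_a cells m s (S a w) = \sum_(k : {ffun I -> 'I_(2 * m)}) \prod_a cell s (k a) (S a w).
    by rewrite -(bigA_distr_bigA (fun a j => cell s j (S a w))); apply: eq_bigr => a _; rewrite sum_cell.
  rewrite -lerBlDl lerD2l lerN2 (bigID (mem KK))/= [X in _ + X]big1; first by rewrite addr0.
  move=> k kK; have nk : ~ exists2 x, A x & forall a, cell s (k a) (x a) != 0.
    by move=> h; move/negP: kK; apply; rewrite inE; apply/asboolP.
  apply/eqP/prodf_eq0.
  have [/forallP h|] := boolP [forall a, cell s (k a) (S a w) != 0].
    by exfalso; apply: nk; exists (fun a => S a w).
  by rewrite negb_forall => /existsP[a /negPn h]; exists a.
have h2 : ((Ex P' (fun w => \sum_(k in KK) \prod_a cell s (k a) (Z a w)))%:E <=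
    P' [set w | B (fun a => Z a w)])%E.
  apply: prob_ge_Ex => //; first exact: integr_sum.
  move=> w; rewrite indicE; have [_|nB] := boolP (_ \in _).
    rewrite (le_trans (_ : _ <= \sum_(k : {ffun I -> 'I_(2 * m)}) \prod_a cell s (k a) (Z a w)))//.
      rewrite [leRHS](bigID (mem KK))/= lerDl sumr_ge0// => k _.
      by apply: prodr_ge0 => a _; exact: cell_ge0.
    rewrite -(bigA_distr_bigA (fun a j => cell s j (Z a w))) -[leRHS](expr1n _ #|I|) -prodr_const.
    by apply: ler_prod => a _; rewrite sum_cell cells_ge0 cells_le1.
  rewrite big1// => k; rewrite inE => /asboolP[x Ax kx]; apply/eqP/prodf_eq0.
  have [/forallP h|] := boolP [forall a, cell s (k a) (Z a w) != 0].
    exfalso; move/negP: nB; apply; apply/mem_set; apply: (AB x) => // a.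
    by rewrite (le_trans _ sd)//; exact: cell_near (h a) (kx a).
  by rewrite negb_forall => /existsP[a /negPn h]; exists a.
apply: (le_trans h1); apply: le_trans (leeD h2 (le_refl _)); rewrite -EFinD lee_fin.
rewrite ExD; [|exact: integr_sum|by apply: integrB => //; exact: integr_cst].
rewrite ExB//; last exact: integr_cst.
rewrite Ex_cst Ex_sum// Ex_sum//; have := cmp KK; lra.
Qed.

End grid.

Section hybrid.
Context {R : realFieldType} {I J : finType}.

(** The marginals are exchanged one at a time. When coordinate [c] is exchanged, the difference is
    dominated by its positive part; this has product form over all index functions, and its factor
    at [c] sums to at most [d c]. The bound is therefore free of the number of cells. *)
Lemma product_tv (KK : {set {ffun I -> J}}) (p q : I -> J -> R) (d : I -> R) :
  (forall a j, 0 <= p a j) -> (forall a j, 0 <= q a j) ->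
  (forall a, \sum_j p a j <= 1) -> (forall a, \sum_j q a j <= 1) ->
  (forall a (U : {set J}), \sum_(j in U) (p a j - q a j) <= d a) ->
  \sum_(k in KK) \prod_a p a (k a) <= \sum_(k in KK) \prod_a q a (k a) + \sum_a d a.
Proof.
move=> p0 q0 p1 q1 pq.
pose hyb (s : seq I) a := if a \in s then q a else p a.
have hyb0 s a j : 0 <= hyb s a j by rewrite /hyb; case: ifP.
have hyb1 s a : \sum_j hyb s a j <= 1 by rewrite /hyb; case: ifP.
suff key s : uniq s -> \sum_(k in KK) \prod_a p a (k a) <=
    \sum_(k in KK) \prod_a hyb s a (k a) + \sum_(a <- s) d a.
  have := key _ (index_enum_uniq I); congr (_ <= _ + _).
  by apply: eq_bigr => k _; apply: eq_bigr => a _; rewrite /hyb mem_index_enum.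
elim: s => [|c s IH] /=.
  by rewrite big_nil addr0 => _; rewrite le_eqVlt; apply/orP; left; apply/eqP.
move=> /andP[cs us]; rewrite (le_trans (IH us))// big_cons addrA lerD2r.
rewrite -lerBlDl -sumrB.
pose r a j := if a == c then Num.max (p c j - q c j) 0 else hyb s a j.
have r0 a j : 0 <= r a j by rewrite /r; case: ifP => // _; rewrite le_max lexx orbT.
rewrite (le_trans (y := \sum_(k : {ffun I -> J}) \prod_a r a (k a)))//.
  rewrite [leRHS](bigID (mem KK))/= -[leLHS]addr0 lerD//; last first.
    by apply: sumr_ge0 => k _; exact: prodr_ge0.
  apply: ler_sum => k _; rewrite (bigD1 c)//= [in X in _ - X](bigD1 c)//= [leRHS](bigD1 c)//=.
  rewrite {1 3}/hyb (negbTE cs) inE eqxx /=.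
  have -> : \prod_(a | a != c) hyb (c :: s) a (k a) = \prod_(a | a != c) hyb s a (k a).
    by apply: eq_bigr => a /negbTE ac; rewrite /hyb inE ac.
  have -> : \prod_(a | a != c) r a (k a) = \prod_(a | a != c) hyb s a (k a).
    by apply: eq_bigr => a /negbTE ac; rewrite /r ac.
  by rewrite -mulrBl /r eqxx ler_wpM2r ?prodr_ge0// le_max lexx.
rewrite -bigA_distr_bigA (bigD1 c)//= -[leRHS]mulr1.
apply: ler_pM.
- by apply: sumr_ge0 => j _.
- by apply: prodr_ge0 => a _; apply: sumr_ge0.
- rewrite (le_trans _ (pq c [set j | 0 <= p c j - q c j]%SET))// big_mkcond [leRHS]big_mkcond/=.
  apply: ler_sum => j _; rewrite /r eqxx inE; case: (leP 0 (p c j - q c j)) => h.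
    by rewrite lexx.
  by rewrite lexx.
- rewrite -[leRHS](_ : \prod_(a | a != c) (1 : R) = 1); last by rewrite big1.
  apply: ler_prod => a /negbTE ac; apply/andP; split; first exact: sumr_ge0.
  by rewrite /r ac.
Qed.

End hybrid.

(** * Gaussian tilting and total variation *)

Section shift.
Context {R : realType}.
Notation g01 := (gauss 0 1 : probability R R).
Notation mu := (@lebesgue_measure R).

(** The one-dimensional Cameron-Martin formula: the exponential is the ratio of the shifted to the
    original density. *)
Lemma ge0_gauss_tilt (u : R) (f : R -> R) : measurable_fun setT f -> (forall x, 0 <= f x) ->
  (\int[g01]_y (f (y + u))%:E = \int[g01]_y (f y * expR (u * y - u ^+ 2 / 2))%:E)%E.
Proof.
move=> mf f0; have := @ge0_integral_gauss_affine R u 1 (EFin \o f) ltr01 _ (fun x => f0 x).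
rewrite /=; under eq_integral => y _ do rewrite mul1r (addrC u).
have mE : measurable_fun setT (fun y : R => expR (u * y - u ^+ 2 / 2)).
  by apply: measurableT_comp => //; apply: measurable_funB => //; exact: measurable_funM.
move=> ->; last exact/measurable_EFinP.
rewrite !ge0_integral_gauss; first last.
- by move=> x; rewrite lee_fin.
- exact/measurable_EFinP.
- by move=> x; rewrite lee_fin mulr_ge0// expR_ge0.
- by apply/measurable_EFinP; exact: measurable_funM.
apply: eq_integral => x _; rewrite -!EFinM; congr EFin; rewrite -mulrA; congr (_ * _).
rewrite !normal_pdfE ?oner_eq0// mulrCA; congr (_ * _); rewrite /normal_fun -expRD.
by congr expR; field.
Qed.

Lemma gauss_tilt (u : R) (f : R -> R) : bounded_measurable f -> (forall x, 0 <= f x) ->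
  integr g01 (fun y : R => f y * expR (u * y - u ^+ 2 / 2)) /\
  Ex g01 (fun y => f (y + u)) = Ex g01 (fun y => f y * expR (u * y - u ^+ 2 / 2)).
Proof.
move=> bf f0; have mf := bf.1; have T := ge0_gauss_tilt u mf f0.
have If : integr g01 (fun y : R => f (y + u)).
  have := bounded_measurable_affine u 1 bf.
  by rewrite (_ : (fun y => f (u + 1 * y)) = (fun y => f (y + u)))//; apply/funext => y; rewrite mul1r addrC.
split; last by rewrite /Ex /Rintegral T.
apply: integr_lty.
- apply: measurable_funM => //; apply: measurableT_comp => //; apply: measurable_funB => //; exact: measurable_funM.
- by move=> y; rewrite mulr_ge0// expR_ge0.
- by rewrite -T -(Ex_EFin If) ltry.
Qed.

Lemma gauss_ball (c : R) : 0 <= c -> (g01 [set y : R | (`|y| <= c)%R] <= (2 * c)%:E)%E.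
Proof.
move=> c0; rewrite (_ : [set y : R | _] = `[- c, c]%classic); last first.
  by apply/seteqP; split => y /=; rewrite in_itv/= ler_norml.
rewrite gaussE (le_trans (y := (\int[mu]_(x in `[(- c)%R, c%R]%classic) 1%:E)%E))//.
  apply: ge0_le_integral => //=.
  - by move=> x _; rewrite lee_fin; exact: normal_pdf_ge0.
  - by apply/measurable_EFinP/measurable_funTS; exact: measurable_normal_pdf.
  - move=> x _; rewrite lee_fin (le_trans (normal_pdf_ub _ _ _))// ?oner_neq0//.
    have pi2 : 1 <= pi *+ 2 :> R by rewrite mulr2n; have := pi_ge2 R; lra.
    rewrite /normal_peak expr1n mul1r invf_le1 ?sqrtr_gt0 ?(lt_le_trans _ pi2)//.
    by rewrite -[leLHS]sqrtr1 ler_sqrt// (le_trans _ pi2).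
rewrite integral_cst//= mul1e lebesgue_measure_itv/= lte_fin; case: ifP => _; rewrite ?lee_fin; last by lra.
lra.
Qed.

(** Neyman-Pearson: the difference is largest for the indicator [d] of the set where the likelihood
    ratio [L] is at most 1, a half-line unless [u = 0]. For [d] the shift changes the value only
    when [y] lies in a band of half-width [|u| / 2], of mass at most [|u|]. *)
Lemma gauss_tv (u : R) (g : R -> R) : measurable_fun setT g -> (forall x, 0 <= g x <= 1) ->
  Ex g01 g <= Ex g01 (fun y => g (y + u)) + `|u|.
Proof.
move=> mg g01_; pose D := [set x : R | u * x <= u ^+ 2 / 2].
have mD : measurable D.
  by apply: (measurable_le (f := fun x : R => u * x)); exact: measurable_funM.
pose d (x : R) : R := \1_D x.
have md : measurable_fun setT d by exact: measurable_indic.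
have d01 x : 0 <= d x <= 1 by rewrite /d indicE; case: (_ \in _); rewrite lexx ler01.
have bd : bounded_measurable d.
  by split=> //; exists 1 => x; have /andP[a b] := d01 x; rewrite ger0_norm.
have bg : bounded_measurable g.
  by split=> //; exists 1 => x; have /andP[a b] := g01_ x; rewrite ger0_norm.
have [id1 ed] := gauss_tilt u bd (fun x => proj1 (andP (d01 x))).
have [ig1 eg] := gauss_tilt u bg (fun x => proj1 (andP (g01_ x))).
have id0 : integr g01 d by apply: (@integr_bounded _ _ _ _ _ 1) => // x; have /andP[a b] := d01 x; rewrite ger0_norm.
have ig0 : integr g01 g by apply: (@integr_bounded _ _ _ _ _ 1) => // x; have /andP[a b] := g01_ x; rewrite ger0_norm.
pose L (x : R) := expR (u * x - u ^+ 2 / 2).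
have h1 : 0 <= Ex g01 (fun x => d x - d x * L x - (g x - g x * L x)).
  apply: Ex_ge0 => x.
  rewrite (_ : _ - _ = (d x - g x) * (1 - L x)); last by ring.
  have /andP[g0 g1] := g01_ x.
  rewrite /d indicE; have [/set_mem Dx|nD] := boolP (x \in D).
    apply: mulr_ge0; first by rewrite /= subr_ge0.
    by rewrite subr_ge0 /L -[leRHS]expR0 ler_expR; move: (Dx : u * x <= u ^+ 2 / 2); lra.
  rewrite sub0r mulNr -mulrN opprB mulr_ge0// subr_ge0 /L -[leLHS]expR0 ler_expR subr_ge0 ltW// ltNge.
  by apply/negP => Dx; move/negP: nD; apply; apply/mem_set.
have h2 : Ex g01 d <= Ex g01 (fun y => d (y + u)) + `|u|.
  have idu : integr g01 (fun y : R => d (y + u)).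
    apply: (@integr_bounded _ _ _ _ _ 1); first by apply: measurableT_comp => //; apply: measurable_funD.
    by move=> x; have /andP[a b] := d01 (x + u); rewrite ger0_norm.
  have mb : measurable [set y : R | `|y| <= `|u| / 2].
    by apply: (measurable_le (f := fun x : R => `|x|)); apply: measurableT_comp.
  rewrite (le_trans (y := Ex g01 (fun y => d (y + u) + \1_[set y : R | `|y| <= `|u| / 2] y)))//.
    apply: Ex_le => //; first by apply: integrD => //; exact: integr_indic.
    move=> y; rewrite /d !indicE; have [/set_mem Dy|//] := boolP (y \in D); last first.
      by rewrite addr_ge0.
    have [//|nD] := boolP (y + u \in D); first by rewrite lerDl.
    rewrite mem_set ?add0r//=; have Du : u ^+ 2 / 2 < u * (y + u).
      by rewrite ltNge; apply/negP => h; move/negP: nD; apply; apply/mem_set.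
    have [u00|u0] := eqVneq u 0; first by move: Du; rewrite u00 expr0n/= !mul0r ltxx.
    have u0' : 0 < `|u| by rewrite normr_gt0.
    rewrite -(ler_pM2l u0') -normrM (_ : `|u| * (`|u| / 2) = u ^+ 2 / 2); last first.
      by rewrite mulrA -normrM -expr2 ger0_norm// sqr_ge0.
    by move: Dy Du; rewrite /D/= ler_norml => a b; apply/andP; split => //; nra.
  rewrite ExD//; last exact: integr_indic.
  rewrite lerD2l -lee_fin Ex_indic// (le_trans (gauss_ball _))// ?divr_ge0//.
  by rewrite lee_fin; lra.
move: h1; rewrite !ExB//; do ?apply: integrB => //; rewrite -ed -eg; lra.
Qed.

End shift.

Section normal_comparison.
Context {R : realType} {I : finType}.
Notation g01 := (gauss 0 1 : probability R R).

(** Only products of one-variable functions are tested. Independence of the coordinates of the limit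
    is thus built in, and the limit law is described by one-dimensional integrals. *)
Definition approx_normal {disp : measure_display} {T : measurableType disp} (P : probability T R)
    (K eta : R) (S : I -> T -> R) : Prop :=
  forall f f1 f2 : I -> R -> R, (forall a, jet K (f a) (f1 a) (f2 a)) ->
  `|Ex P (fun w => \prod_a f a (S a w)) - \prod_a Ex g01 (f a)| <= eta.

Definition exact_normal {disp : measure_display} {T : measurableType disp} (P : probability T R)
    (Z : I -> T -> R) : Prop :=
  forall f : I -> R -> R, (forall a, bounded_measurable (f a)) ->
  Ex P (fun w => \prod_a f a (Z a w)) = \prod_a Ex g01 (f a).

Lemma exact_approx_normal {disp : measure_display} {T : measurableType disp} (P : probability T R)
    (K eta : R) (Z : I -> T -> R) : 0 <= eta -> exact_normal P Z -> approx_normal P K eta Z.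
Proof.
by move=> e0 h f f1 f2 jf; rewrite h ?subrr ?normr0// => a; have [] := jet_bm (jf a).
Qed.

Lemma cells_tail (s : R) : 1 <= s -> \prod_(a : I) Ex g01 (cells m s) @[m --> \oo] --> (1 : R).
Proof.
move=> s1; have s0 : 0 < s by lra.
have c1 : Ex g01 (cells m s) @[m --> \oo] --> (1 : R).
  have := @Ex_dct _ _ _ g01 (fun m => cells m s) (fun=> 1) (fun=> 1); rewrite Ex_cst; case => //.
  - by move=> m; exact: (cells_bm m s1).1.
  - move=> x; apply/cvgrPdist_le => e e0; near=> m; rewrite /cells.
    have h : 3 + s * `|x| <= m%:R by near: m; exact: nbhs_infty_ger.
    have : `|s * x| = s * `|x| by rewrite normrM (gtr0_norm s0).
    have := ler_norm (s * x); have := ler_norm (- (s * x)); rewrite normrN => ? ? ?.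
    have [-> _ _] := @smoothstep_right _ (s * x + m%:R) ltac:(lra).
    by have [-> _ _] := @smoothstep_left _ (s * x - m%:R) ltac:(lra); rewrite subr0 subrr normr0 ltW.
  - by move=> m x; rewrite ger0_norm ?cells_ge0 ?cells_le1.
  - exact: integr_cst.
under eq_fun do rewrite prodr_const; elim: #|_| => [|k IH].
  by under eq_fun do rewrite expr0; exact: cvg_cst.
by under eq_fun do rewrite exprS; have := cvgM c1 IH; rewrite mulr1; exact.
Unshelve. all: by end_near. Qed.

(** [K] and [eta] are found from [e], [delta] and the index set before the laws and the events are
    given; this order of the quantifiers is what a uniform level rests on. *)
Lemma normal_compare (e delta : R) : 0 < e -> 0 < delta -> exists K eta : R, [/\ 1 <= K, 0 < eta &
  forall (d1 d2 : measure_display) (T1 : measurableType d1) (T2 : measurableType d2)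
    (P1 : probability T1 R) (P2 : probability T2 R) (S : I -> T1 -> R) (Z : I -> T2 -> R)
    (A B : (I -> R) -> Prop),
    (forall a, measurable_fun setT (S a)) -> (forall a, measurable_fun setT (Z a)) ->
    approx_normal P1 K eta S -> approx_normal P2 K eta Z ->
    measurable [set w | A (fun a => S a w)] -> measurable [set w | B (fun a => Z a w)] ->
    (forall x y, A x -> (forall a, `|y a - x a| <= delta) -> B y) ->
    (P1 [set w | A (fun a => S a w)] <= P2 [set w | B (fun a => Z a w)] + e%:E)%E].
Proof.
move=> e0 d0; pose s : R := 1 + 4 / delta.
have s1 : 1 <= s by rewrite lerDl divr_ge0// ltW.
have s0 : 0 < s by lra.
have sd : 4 / s <= delta.
  by rewrite ler_pdivrMr// /s mulrDr mulrCA divff ?gt_eqF// mulr1 mulr1; lra.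
have [m hm] : exists m, 1 - e / 2 <= \prod_(a : I) Ex g01 (cells m s).
  have /cvgrPdist_le/(_ (e / 2)) := cells_tail s1; rewrite divr_gt0// => /(_ isT)[m _ /(_ m (leqnn m))] h.
  by exists m; move: h; rewrite /= ler_norml => /andP[]; lra.
pose N : R := #|{ffun I -> 'I_(2 * m)}|%:R; have N0 : 0 <= N by [].
have K1 : 1 <= 24 * s ^+ 3.
  by have : 1 <= s ^+ 3 := exprn_ege1 3 s1; lra.
(* Each of the at most [N] grid cells costs [2 * eta] and the outside of the grid costs
   [e / 2 + eta]; the total stays below [e]. *)
pose eta := e / (8 * (N + 1)).
have N8 : 0 < 8 * (N + 1) by rewrite mulr_gt0//; lra.
have eta0 : 0 < eta by rewrite divr_gt0.
have etaE : 8 * N * eta + 8 * eta = e by rewrite /eta; field; rewrite gt_eqF//; lra.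
exists (24 * s ^+ 3), eta; split => // d1 d2 T1 T2 P1 P2 S Z A B mS mZ aS aZ mA mB AB.
have Neta : 0 <= N * eta by rewrite mulr_ge0// ltW.
have cmp := @grid_compare R d1 d2 T1 T2 P1 P2 I S Z mS mZ m s delta (2 * N * eta) (e / 2 + eta) A B s1 sd mA mB AB.
apply: (le_trans (cmp _ _)); last by apply: leeD => //; rewrite lee_fin; lra.
- move=> KK; have [c1 h] := choice (fun j : 'I_(2 * m) => cell_jet j s1); have {h}[c2 jc] := choice h.
  rewrite (le_trans (y := \sum_(k in KK) (Ex P2 (fun w => \prod_a cell s (k a) (Z a w)) + 2 * eta)))//.
    apply: ler_sum => k _.
    have := aS (fun a => cell s (k a)) (fun a => c1 (k a)) (fun a => c2 (k a)) (fun a => jc (k a)).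
    have := aZ (fun a => cell s (k a)) (fun a => c1 (k a)) (fun a => c2 (k a)) (fun a => jc (k a)).
    by rewrite !ler_norml => /andP[? ?] /andP[? ?]; lra.
  rewrite big_split/= lerD2l sumr_const -[X in X <= _]mulr_natl.
  have : #|KK|%:R <= N by rewrite ler_nat max_card.
  by move=> h; have := ler_wpM2r (ltW eta0) h; lra.
- have [c1 [c2 jc]] := cells_jet m s1.
  have := aS (fun=> cells m s) (fun=> c1) (fun=> c2) (fun=> jc).
  by rewrite ler_norml => /andP[? ?]; lra.
Qed.

(** Both laws are products of Gaussian ones, so [product_tv] and [gauss_tv] bound the difference on
    the grid however fine and large it is. The mass outside the grid can then be sent to zero, and a
    bound linear in the shift remains. *)
Lemma gaussian_shift {disp : measure_display} {T : measurableType disp} (P : probability T R)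
    (Z : I -> T -> R) (u : I -> R) (delta : R) (A B : (I -> R) -> Prop) : 0 < delta ->
  (forall a, measurable_fun setT (Z a)) -> exact_normal P Z ->
  measurable [set w | A (fun a => Z a w)] -> measurable [set w | B (fun a => Z a w + u a)] ->
  (forall x y, A x -> (forall a, `|y a - x a| <= delta) -> B y) ->
  (P [set w | A (fun a => Z a w)] <= P [set w | B (fun a => (Z a w + u a)%R)] + (\sum_a `|u a|)%:E)%E.
Proof.
move=> d0 mZ nZ mA mB AB; apply/lee_addgt0Pr => e e0; pose s : R := 1 + 4 / delta.
have s1 : 1 <= s by rewrite lerDl divr_ge0// ltW.
have s0 : 0 < s by lra.
have sd : 4 / s <= delta.
  by rewrite ler_pdivrMr// /s mulrDr mulrCA divff ?gt_eqF// mulr1 mulr1; lra.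
have [m hm] : exists m, 1 - e <= \prod_(a : I) Ex g01 (cells m s).
  have /cvgrPdist_le/(_ e) := cells_tail s1; move=> /(_ e0)[m _ /(_ m (leqnn m))] h.
  by exists m; move: h; rewrite /= ler_norml => /andP[]; lra.
have mZu a : measurable_fun setT (fun w => Z a w + u a) by exact: measurable_funD.
rewrite -addeA -EFinD.
apply: (@grid_compare R _ _ T T P P I Z (fun a w => Z a w + u a) mZ mZu m s delta) => //; last first.
  by rewrite (nZ (fun=> cells m s))// => a; exact: cells_bm.
move=> KK.
have bmu j a : bounded_measurable (fun x => cell s (j : 'I_(2 * m)) (x + u a)).
  have [mc [K cK]] := cell_bm j s1; split; last by exists K.
  by apply: measurableT_comp mc _; apply: measurable_funD.
under eq_bigr do rewrite (nZ _ (fun a => cell_bm _ s1)).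
under [X in _ <= X + _]eq_bigr do rewrite (nZ _ (fun a => bmu _ a)).
have int1 (f : R -> R) : measurable_fun setT f -> (forall x, 0 <= f x <= 1) -> integr g01 f.
  move=> mf f01; apply: (@integr_bounded _ _ _ _ _ 1) => // x.
  by have /andP[? ?] := f01 x; rewrite ger0_norm.
have c01 (j : 'I_(2 * m)) x : 0 <= cell s j x <= 1 by rewrite cell_ge0 spline_le1.
apply: (product_tv KK (p := fun a j => Ex g01 (cell s j)) (q := fun a j => Ex g01 (fun y => cell s j (y + u a)))).
- by move=> a j; apply: Ex_ge0 => x; exact: cell_ge0.
- by move=> a j; apply: Ex_ge0 => x; exact: cell_ge0.
- move=> a; rewrite -Ex_sum; last by move=> j _; apply: int1 => //; exact: (cell_bm j s1).1.
  under eq_fun do rewrite sum_cell; rewrite -[leRHS](Ex_cst g01).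
  apply: Ex_le; [|exact: integr_cst|by move=> x; exact: cells_le1].
  by apply: int1; [exact: (cells_bm m s1).1|move=> x; rewrite cells_ge0 cells_le1].
- move=> a; rewrite -Ex_sum; last by move=> j _; apply: int1 => //; exact: (bmu j a).1.
  under eq_fun do rewrite sum_cell; rewrite -[leRHS](Ex_cst g01).
  apply: Ex_le; [|exact: integr_cst|by move=> x; exact: cells_le1].
  apply: int1; last by move=> x; rewrite cells_ge0 cells_le1.
  by apply: measurableT_comp (cells_bm m s1).1 _; apply: measurable_funD.
- move=> a U; pose g x := \sum_(j in U) cell s j x.
  have mg : measurable_fun setT g by apply: (integr_measurable (P := g01)); apply: integr_sum => j _; apply: int1 => //; exact: (cell_bm j s1).1.
  have g1 x : 0 <= g x <= 1.
    rewrite sumr_ge0 => [|j _]; last exact: cell_ge0.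
    rewrite (le_trans _ (cells_le1 m s x))// -sum_cell [leRHS](bigID (mem U))/= lerDl.
    by apply: sumr_ge0 => j _; exact: cell_ge0.
  have := gauss_tv (u a) mg g1; rewrite sumrB -!Ex_sum => [h|j _|j _].
  + by rewrite lerBlDl.
  + by apply: int1 => //; exact: (bmu j a).1.
  + by apply: int1 => //; exact: (cell_bm j s1).1.
Qed.

End normal_comparison.

(** * The weights *)

Section riemann_series.
Context {R : realType}.

(** The square of this kernel is the weight function. The kernel also dominates the derivatives of
    all the integrands below, so its primitive [atan] controls every Riemann sum. *)
Definition lorentz (x : R) : R := (1 + x ^+ 2)^-1.

Lemma lorentz_den (x : R) : 1 <= 1 + x ^+ 2. Proof. by rewrite lerDl sqr_ge0. Qed.

Lemma lorentz_gt0 x : 0 < lorentz x.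
Proof. by rewrite invr_gt0 (lt_le_trans _ (lorentz_den x)). Qed.

Lemma lorentz_le1 x : lorentz x <= 1.
Proof. by rewrite invf_le1 ?lorentz_den// (lt_le_trans _ (lorentz_den x)). Qed.

Lemma sqr_lorentz x : x ^+ 2 * lorentz x = 1 - lorentz x.
Proof. by rewrite /lorentz; field; rewrite gt_eqF// (lt_le_trans _ (lorentz_den x)). Qed.

Lemma is_deriveD1 (f g : R -> R) (x a b : R) : is_derive x 1 f a -> is_derive x 1 g b ->
  is_derive x 1 (fun y => f y + g y) (a + b).
Proof. exact: is_deriveD. Qed.

Lemma is_deriveM1 (f g : R -> R) (x a b : R) : is_derive x 1 f a -> is_derive x 1 g b ->
  is_derive x 1 (fun y => f y * g y) (a * g x + f x * b).
Proof. by move=> df dg; apply: (is_derive_eq (is_deriveM df dg)); rewrite /GRing.scale/= addrC mulrC. Qed.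

Lemma is_deriveZ1 (f : R -> R) (c x a : R) : is_derive x 1 f a -> is_derive x 1 (fun y => c * f y) (c * a).
Proof. exact: is_deriveZ. Qed.

Lemma is_derive_lorentz (x : R) : is_derive x 1 lorentz (- 2 * x * lorentz x ^+ 2).
Proof.
have d : is_derive x 1 (fun y : R => 1 + y ^+ 2) (2 * x).
  apply: (is_derive_eq (is_deriveD1 (is_derive_cst (1 : R) x 1)
    (is_deriveM1 (is_derive_id x (1 : R)) (is_derive_id x (1 : R))))); ring.
have n0 : 1 + x ^+ 2 != 0 by rewrite gt_eqF// (lt_le_trans _ (lorentz_den x)).
have h : is_derive x 1 lorentz (- (1 + x ^+ 2) ^- 2 *: (2 * x)) :=
  @is_deriveV R (fun y : R => 1 + y ^+ 2) x (2 * x) 1 n0 d.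
by apply: (is_derive_eq h); rewrite /lorentz /GRing.scale/= -exprVn; ring.
Qed.

(** Both [C * atan + f] and [C * atan - f] have a nonnegative derivative. *)
Lemma atan_increment_bound (f f' : R -> R) (C a b : R) : 0 <= C -> a <= b ->
  (forall x : R, is_derive x 1 f (f' x)) -> (forall x, `|f' x| <= C * lorentz x) ->
  `|f b - f a| <= C * (atan b - atan a).
Proof.
move=> C0 ab df bf.
have key (e : R) (g g' : R -> R) : (forall x : R, is_derive x 1 g (g' x)) -> (forall x, 0 <= g' x) -> g a <= g b.
  move=> dg g0; have cg : {within `[a, b], continuous g}.
    by apply: derivable_within_continuous => x _; have [] := dg x.
  have [c _ h] := MVT_segment ab (fun x _ => dg x) cg.
  by rewrite -subr_ge0 h mulr_ge0 ?g0// subr_ge0.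
have da (s : R) (x : R) : is_derive x 1 (fun y => C * atan y + s * f y) (C * lorentz x + s * f' x).
  exact: is_deriveD1 (is_deriveZ1 C (is_derive1_atan x)) (is_deriveZ1 s (df x)).
have h1 := key 1 _ _ (da 1) _; have h2 := key 1 _ _ (da (-1)) _.
have {h1}h1 := h1 (fun x => _); have {h2}h2 := h2 (fun x => _).
rewrite ler_norml; apply/andP; split.
  have := h1 ltac:(move=> x; have := bf x; rewrite ler_norml => /andP[]; lra); lra.
have := h2 ltac:(move=> x; have := bf x; rewrite ler_norml => /andP[]; lra); lra.
Qed.

Context (F f f' : R -> R) (C L h : R).
Hypothesis h0 : 0 < h.
Hypothesis dF : forall x : R, is_derive x 1 F (f x).
Hypothesis df : forall x : R, is_derive x 1 f (f' x).
Hypothesis f'C : forall x, `|f' x| <= C * lorentz x.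
Hypothesis f0 : forall x, 0 <= f x.
Hypothesis FL : F (n%:R * h) @[n --> \oo] --> L.

Let C0 : 0 <= C.
Proof.
by have := f'C 0; have := normr_ge0 (f' 0); rewrite /lorentz expr0n addr0 invr1 mulr1; exact: le_trans.
Qed.

Let part N := \sum_(1 <= j < N) h * f (j%:R * h).

(** On one cell the mean value theorem turns the error into an increment of [f], dominated by one of
    [C * atan]. These errors telescope, so the bound stays of order [h] on an infinite range. *)
Lemma riemann_partial N : `|part N.+1 - (F (N%:R * h) - F 0)| <= h * C * atan (N%:R * h).
Proof.
elim: N => [|N IH]; first by rewrite /part big_geq// mul0r subrr subr0 normr0 atan0 mulr0.
rewrite /part big_nat_recr//= -/(part N.+1).
set x := N%:R * h; set y := N.+1%:R * h.
have yx : y - x = h by rewrite /y /x -natr1; ring.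
have xy : x <= y by rewrite -subr_ge0 yx ltW.
have cF : {within `[x, y], continuous F}.
  by apply: derivable_within_continuous => z _; have [] := dF z.
have [c] := MVT_segment xy (fun z _ => dF z) cF; rewrite in_itv/= yx => /andP[xc cy] E.
have e1 := atan_increment_bound C0 cy df f'C.
have e2 : `|h * f y - (F y - F x)| <= h * (C * (atan y - atan x)).
  rewrite E mulrC -mulrBl normrM mulrC gtr0_norm// ler_pM2l// (le_trans e1)// ler_wpM2l// lerB//.
  exact: le_atan.
rewrite (_ : _ - _ = (part N.+1 - (F x - F 0)) + (h * f y - (F y - F x))); last by ring.
rewrite (le_trans (ler_normD _ _))// (le_trans (lerD IH e2))// le_eqVlt; apply/orP; left.
by apply/eqP; rewrite -/x; ring.
Qed.

Let bnd := h * C * 2.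

Let atan2 (x : R) : atan x <= 2.
Proof. by have := atan_ltpi2 x; have := pihalf_lt2 R; lra. Qed.

Lemma riemann_series : [/\ cvgn part, forall N, part N <= sum_ge1 (fun j => h * f (j%:R * h)) &
  `|sum_ge1 (fun j => h * f (j%:R * h)) - (L - F 0)| <= h * C * 2].
Proof.
have hC : 0 <= h * C by rewrite mulr_ge0// ltW.
have b N : `|part N.+1 - (F (N%:R * h) - F 0)| <= h * C * 2.
  by rewrite (le_trans (riemann_partial N))// ler_wpM2l.
have nd : nondecreasing_seq part.
  apply/nondecreasing_seqP => -[|N]; first by rewrite /part !big_geq.
  by rewrite /part [leRHS]big_nat_recr//= lerDl mulr_ge0// ltW.
have ub : has_ubound (range part).
  have /cvg_seq_bounded[B [_ hB]] := cvgP _ FL.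
  exists (h * C * 2 + (B + 1) - F 0) => _ [N _ <-].
  have := b N; have := nd N N.+1 (leqnSn _); have := hB (B + 1) ltac:(lra) N I.
  by rewrite /= !ler_norml => /andP[? ?] ? /andP[? ?]; lra.
have cv := nondecreasing_is_cvgn nd ub.
split => //; first by move=> N; exact: nondecreasing_cvgn_le.
have cv1 : `|part N.+1 - (F (N%:R * h) - F 0)| @[N --> \oo] --> `|limn part - (L - F 0)|.
  apply: cvg_norm; apply: cvgB; first by rewrite (@cvg_shiftS _ part (nbhs (limn part))).
  by apply: cvgB => //; exact: cvg_cst.
by apply: (cvgr_to_le cv1); apply: nearW => N.
Qed.

End riemann_series.

Section weights.
Context {R : realType}.
Local Notation q := (@lorentz R).

Definition s1 (x : R) := x * q x.

Lemma is_derive_s1 (x : R) : is_derive x 1 s1 (2 * q x ^+ 2 - q x).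
Proof.
apply: (is_derive_eq (is_deriveM1 (is_derive_id x (1 : R)) (is_derive_lorentz x))).
rewrite mul1r (_ : x * _ = - 2 * (x ^+ 2 * q x) * q x); last by ring.
by rewrite sqr_lorentz; ring.
Qed.

Lemma s1_bound (x : R) : `|s1 x| <= 1.
Proof.
rewrite -ler_sqr ?nnegrE// expr1n real_normK ?num_real// /s1 exprMn expr2 [q x ^+ 2]expr2.
have := sqr_lorentz x; have := lorentz_gt0 x; have := lorentz_le1 x.
rewrite expr2 mulrA => h1 h0 ->; nra.
Qed.

(** With [x = j / M], these are the weight, the weight times [x ^+ 2], and the square of the latter,
    freed of [x] by [x ^+ 2 * q x = 1 - q x]. [P0], [P1], [P2] are primitives vanishing at 0, with
    limits [pi / 4], [pi / 4] and [pi / 32] at infinity. *)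
Definition p0 (x : R) := q x * q x.
Definition p1 (x : R) := (1 - q x) * q x.
Definition p2 (x : R) := p1 x * p1 x.
Definition P0 (x : R) := 2^-1 * (s1 x + atan x).
Definition P1 (x : R) := 2^-1 * (atan x + -1 * s1 x).
Definition P2 (x : R) := 16^-1 * atan x + 48^-1 * (s1 x * (3 + q x * (-14 + 8 * q x))).

Lemma is_derive_P0 (x : R) : is_derive x 1 P0 (p0 x).
Proof.
apply: (is_derive_eq (is_deriveZ1 _ (is_deriveD1 (is_derive_s1 x) (is_derive1_atan x)))).
by rewrite -/(q x) /p0; field.
Qed.

Lemma is_derive_P1 (x : R) : is_derive x 1 P1 (p1 x).
Proof.
apply: (is_derive_eq (is_deriveZ1 _ (is_deriveD1 (is_derive1_atan x) (is_deriveZ1 (-1) (is_derive_s1 x))))).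
by rewrite -/(q x) /p1; field.
Qed.

Lemma is_derive_P2 (x : R) : is_derive x 1 P2 (p2 x).
Proof.
have dq := is_derive_lorentz x.
apply: (is_derive_eq (is_deriveD1 (is_deriveZ1 _ (is_derive1_atan x)) (is_deriveZ1 _
  (is_deriveM1 (is_derive_s1 x) (is_deriveD1 (is_derive_cst (3 : R) x 1)
    (is_deriveM1 dq (is_deriveD1 (is_derive_cst (-14 : R) x 1) (is_deriveZ1 8 dq)))))))).
rewrite -/(q x) /p2 /p1 /s1; have e := sqr_lorentz x; set y := q x in e *.
set D := (X in 48^-1 * X).
have -> : D = (2 * y ^+ 2 - y) * (3 + y * (-14 + 8 * y)) + (x ^+ 2 * y) * y ^+ 2 * (28 - 32 * y).
  by rewrite /D /cst; ring.
by rewrite e; field.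
Qed.

Definition p0' (x : R) := -4 * x * q x ^+ 3.
Definition p1' (x : R) := -2 * x * q x ^+ 2 * (1 - 2 * q x).
Definition p2' (x : R) := 2 * p1 x * p1' x.

Lemma is_derive_p0 (x : R) : is_derive x 1 p0 (p0' x).
Proof.
apply: (is_derive_eq (is_deriveM1 (is_derive_lorentz x) (is_derive_lorentz x))).
by rewrite /p0'; ring.
Qed.

Lemma is_derive_p1 (x : R) : is_derive x 1 p1 (p1' x).
Proof.
have := is_deriveM1 (is_deriveD1 (is_derive_cst (1 : R) x 1) (is_deriveZ1 (-1) (is_derive_lorentz x))) (is_derive_lorentz x).
rewrite (_ : (fun y => (1 + -1 * q y) * q y) = p1); last by apply/funext => y; rewrite /p1; ring.
by move=> h; apply: (is_derive_eq h); rewrite /p1' /cst; ring.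
Qed.

Lemma is_derive_p2 (x : R) : is_derive x 1 p2 (p2' x).
Proof.
by apply: (is_derive_eq (is_deriveM1 (is_derive_p1 x) (is_derive_p1 x))); rewrite /p2'; ring.
Qed.

Lemma p0'_bound (x : R) : `|p0' x| <= 4 * q x.
Proof.
have b := s1_bound x; have h0 := lorentz_gt0 x; have h1 := lorentz_le1 x.
rewrite /p0' (_ : _ * _ = -4 * s1 x * q x * q x); last by rewrite /s1; ring.
move: (s1 x) b => s b; rewrite !normrM normrN (gtr0_norm h0) (@ger0_norm _ 4)//.
by have := normr_ge0 s; move: `|s| b (q x) h0 h1 => u u1 w w0 w1 u0; have : u * w <= 1; nra.
Qed.

Lemma p1'_bound (x : R) : `|p1' x| <= 4 * q x.
Proof.
have b := s1_bound x; have h0 := lorentz_gt0 x; have h1 := lorentz_le1 x.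
rewrite /p1' (_ : _ * _ = -2 * s1 x * q x * (1 - 2 * q x)); last by rewrite /s1; ring.
move: (s1 x) b => s b; rewrite !normrM normrN (gtr0_norm h0) (@ger0_norm _ 2)//.
have v1 : `|1 - 2 * q x| <= 1 by rewrite ler_norml; apply/andP; split; lra.
move: (1 - 2 * q x) v1 => v v1.
have z1 : `|s| * `|v| <= 1 by rewrite mulr_ile1.
rewrite (_ : 2 * `|s| * q x * `|v| = 2 * q x * (`|s| * `|v|)); last by ring.
by move: (`|s| * `|v|) z1 (q x) h0 h1 => z z1 w w0 w1; nra.
Qed.

Lemma p1_01 (x : R) : 0 <= p1 x <= 1.
Proof. by have := lorentz_gt0 x; have := lorentz_le1 x; rewrite /p1 => *; apply/andP; split; nra. Qed.

Lemma p2'_bound (x : R) : `|p2' x| <= 8 * q x.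
Proof.
have b := p1'_bound x; have /andP[h0 h1] := p1_01 x.
rewrite /p2'; move: (p1 x) (p1' x) h0 h1 b => u v h0 h1 b.
by rewrite !normrM (@ger0_norm _ 2)// (ger0_norm h0); have := normr_ge0 v; nra.
Qed.

Lemma cvg_grid (h : R) : 0 < h -> (fun n : nat => n%:R * h) @ \oo --> +oo.
Proof.
move=> h0; apply/cvgryPge => A; near=> n.
by rewrite -ler_pdivrMr//; near: n; exact: nbhs_infty_ger.
Unshelve. all: by end_near. Qed.

Lemma cvg_grid_inv (h : R) : 0 < h -> (n%:R * h)^-1 @[n --> \oo] --> (0 : R).
Proof.
by move=> h0; apply/gtr0_cvgV0; [near=> n; rewrite mulr_gt0// ltr0n; near: n; exists 1%N|exact: cvg_grid].
Unshelve. all: by end_near. Qed.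

Lemma cvg_s1 (h : R) : 0 < h -> s1 (n%:R * h) @[n --> \oo] --> (0 : R).
Proof.
move=> h0; apply: (@squeeze_cvgr _ _ _ _ (fun=> 0) (fun n : nat => (n%:R * h)^-1)).
- near=> n; have n0 : 0 < n%:R * h by rewrite mulr_gt0// ltr0n; near: n; exists 1%N.
  rewrite /s1 mulr_ge0 ?(ltW n0) ?(ltW (lorentz_gt0 _))//=.
  rewrite -[leRHS]mul1r ler_pdivlMr// mulrAC -expr2 sqr_lorentz.
  by have := lorentz_gt0 (n%:R * h); lra.
- exact: cvg_cst.
- exact: cvg_grid_inv.
Unshelve. all: by end_near. Qed.

Lemma cvg_atan_grid (h : R) : 0 < h -> atan (n%:R * h) @[n --> \oo] --> (pi / 2 : R).
Proof. by move=> h0; apply: cvg_comp (cvg_grid h0) (cvgy_atan (R := R)). Qed.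

Lemma cvg_P0 (h : R) : 0 < h -> P0 (n%:R * h) @[n --> \oo] --> (pi / 4 : R).
Proof.
move=> h0; rewrite (_ : pi / 4 = 2^-1 * (0 + pi / 2)); last by field.
by apply: cvgMl_tmp; apply: cvgD; [exact: cvg_s1|exact: cvg_atan_grid].
Qed.

Lemma cvg_P1 (h : R) : 0 < h -> P1 (n%:R * h) @[n --> \oo] --> (pi / 4 : R).
Proof.
move=> h0; rewrite (_ : pi / 4 = 2^-1 * (pi / 2 + -1 * 0)); last by field.
by apply: cvgMl_tmp; apply: cvgD; [exact: cvg_atan_grid|apply: cvgMl_tmp; exact: cvg_s1].
Qed.

Lemma cvg_P2 (h : R) : 0 < h -> P2 (n%:R * h) @[n --> \oo] --> (pi / 32 : R).
Proof.
move=> h0.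
have z : s1 (n%:R * h) * (3 + q (n%:R * h) * (-14 + 8 * q (n%:R * h))) @[n --> \oo] --> (0 : R).
  apply/cvgrPdist_le => e e0; have /cvgrPdist_le/(_ (e / 25)) := cvg_s1 h0.
  rewrite divr_gt0// => /(_ isT) H; near=> n; rewrite sub0r normrN.
  have : `|s1 (n%:R * h)| <= e / 25.
    by rewrite -normrN -sub0r; near: n.
  have : `|3 + q (n%:R * h) * (-14 + 8 * q (n%:R * h))| <= 25.
    have := lorentz_gt0 (n%:R * h); have := lorentz_le1 (n%:R * h).
    by move: (q _) => y ? ?; rewrite ler_norml; apply/andP; split; nra.
  have := normr_ge0 (s1 (n%:R * h)); have := normr_ge0 (3 + q (n%:R * h) * (-14 + 8 * q (n%:R * h))).
  move: (s1 _) (3 + _) => u v; rewrite normrM; move: `|u| `|v| => a b ? ? ? ?; nra.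
rewrite (_ : pi / 32 = 16^-1 * (pi / 2) + 48^-1 * 0); last by field.
by apply: cvgD; apply: cvgMl_tmp => //; exact: cvg_atan_grid.
Unshelve. all: by end_near. Qed.

Definition A0 (M : R) := sum_ge1 (fun j => M^-1 * p0 (j%:R * M^-1)).
Definition A1 (M : R) := sum_ge1 (fun j => M^-1 * p1 (j%:R * M^-1)).
Definition A2 (M : R) := sum_ge1 (fun j => M^-1 * p2 (j%:R * M^-1)).

Let p00 x : 0 <= p0 x. Proof. by rewrite /p0 -expr2 sqr_ge0. Qed.
Let p10 x : 0 <= p1 x. Proof. by have /andP[] := p1_01 x. Qed.
Let p20 x : 0 <= p2 x. Proof. by rewrite mulr_ge0. Qed.

Lemma A0_facts (M : R) : 0 < M -> [/\ cvgn (fun N => \sum_(1 <= j < N) M^-1 * p0 (j%:R * M^-1)),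
  forall N, \sum_(1 <= j < N) M^-1 * p0 (j%:R * M^-1) <= A0 M & `|A0 M - pi / 4| <= 8 / M].
Proof.
move=> M0; have h0 : 0 < M^-1 by rewrite invr_gt0.
have := riemann_series h0 is_derive_P0 is_derive_p0 p0'_bound p00 (cvg_P0 h0).
have -> : P0 0 = 0 :> R by rewrite /P0 /s1 atan0 !(mul0r, mulr0, addr0).
by rewrite subr0 (_ : M^-1 * 4 * 2 = 8 / M)//; ring.
Qed.

Lemma A1_facts (M : R) : 0 < M -> [/\ cvgn (fun N => \sum_(1 <= j < N) M^-1 * p1 (j%:R * M^-1)),
  forall N, \sum_(1 <= j < N) M^-1 * p1 (j%:R * M^-1) <= A1 M & `|A1 M - pi / 4| <= 8 / M].
Proof.
move=> M0; have h0 : 0 < M^-1 by rewrite invr_gt0.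
have := riemann_series h0 is_derive_P1 is_derive_p1 p1'_bound p10 (cvg_P1 h0).
have -> : P1 0 = 0 :> R by rewrite /P1 /s1 atan0 !(mul0r, mulr0, addr0).
by rewrite subr0 (_ : M^-1 * 4 * 2 = 8 / M)//; ring.
Qed.

Lemma A2_facts (M : R) : 0 < M -> [/\ cvgn (fun N => \sum_(1 <= j < N) M^-1 * p2 (j%:R * M^-1)),
  forall N, \sum_(1 <= j < N) M^-1 * p2 (j%:R * M^-1) <= A2 M & `|A2 M - pi / 32| <= 16 / M].
Proof.
move=> M0; have h0 : 0 < M^-1 by rewrite invr_gt0.
have := riemann_series h0 is_derive_P2 is_derive_p2 p2'_bound p20 (cvg_P2 h0).
have -> : P2 0 = 0 :> R by rewrite /P2 /s1 atan0 !(mul0r, mulr0, addr0).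
by rewrite subr0 (_ : M^-1 * 8 * 2 = 16 / M)//; ring.
Qed.

Definition jweight (M : R) (j : nat) : R := weight M j * j%:R ^+ 2.

Lemma A0_gt0 (M : R) : 0 < M -> 0 < A0 M.
Proof.
move=> M0; have [_ /(_ 2) h _] := A0_facts M0; apply: lt_le_trans h.
by rewrite big_nat1 mulr_gt0 ?invr_gt0// /p0 mulr_gt0// lorentz_gt0.
Qed.

Lemma weightE (M : R) (j : nat) : weight M j = (A0 M)^-1 * (M^-1 * p0 (j%:R * M^-1)).
Proof.
have uE : unnormalized_weight M = fun j => M^-1 * p0 (j%:R * M^-1).
  by apply/funext => k; rewrite /unnormalized_weight /p0 /lorentz -expr2 exprVn exprMn exprVn.
by rewrite /weight /c_w uE.
Qed.

Lemma jweightE (M : R) (j : nat) : 0 < M -> jweight M j = (A0 M)^-1 * M * p1 (j%:R * M^-1).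
Proof.
move=> M0; have a0 := A0_gt0 M0; rewrite /jweight weightE /p1 -sqr_lorentz /p0 exprMn.
by field; rewrite !gt_eqF.
Qed.

Lemma weight_ge0 (M : R) (j : nat) : 0 < M -> 0 <= weight M j.
Proof. move=> M0; rewrite weightE; apply: mulr_ge0; first by rewrite invr_ge0 ltW// A0_gt0.
by apply: mulr_ge0 => //; rewrite invr_ge0 ltW. Qed.

Lemma jweight_ge0 (M : R) (j : nat) : 0 < M -> 0 <= jweight M j.
Proof. by move=> M0; rewrite mulr_ge0 ?weight_ge0// exprn_ge0. Qed.

Lemma weight_sum_le1 (M : R) (N : nat) : 0 < M -> \sum_(1 <= j < N) weight M j <= 1.
Proof.
move=> M0; under eq_bigr do rewrite weightE; rewrite -mulr_sumr.
by have [_ h _] := A0_facts M0; rewrite ler_pdivrMl ?A0_gt0// mulr1.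
Qed.

Lemma jweight_series (M : R) : 0 < M ->
  [/\ \sum_(1 <= j < N) jweight M j @[N --> \oo] --> B_w M,
      forall N, \sum_(1 <= j < N) jweight M j <= B_w M & B_w M = (A0 M)^-1 * M ^+ 2 * A1 M].
Proof.
move=> M0; have [cv le _] := A1_facts M0.
have E N : \sum_(1 <= j < N) jweight M j =
    (A0 M)^-1 * M ^+ 2 * \sum_(1 <= j < N) M^-1 * p1 (j%:R * M^-1).
  rewrite mulr_sumr; apply: eq_bigr => j _; rewrite jweightE//.
  by field; rewrite !gt_eqF ?A0_gt0.
have cv2 : \sum_(1 <= j < N) jweight M j @[N --> \oo] --> (A0 M)^-1 * M ^+ 2 * A1 M.
  by under eq_fun do rewrite E; apply: cvgMl_tmp; exact: cv.
have BE : B_w M = (A0 M)^-1 * M ^+ 2 * A1 M by exact: cvg_lim cv2.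
split => //; first by rewrite BE.
by move=> N; rewrite BE E ler_wpM2l// mulr_ge0 ?invr_ge0 ?exprn_ge0// ltW// A0_gt0.
Qed.

Definition jweight_var (M : R) : R := (A0 M)^-1 ^+ 2 * A2 M.

Lemma jweight_sq_series (M : R) : 0 < M ->
  \sum_(1 <= j < N) jweight M j ^+ 2 @[N --> \oo] --> M ^+ 3 * jweight_var M /\
  forall N, \sum_(1 <= j < N) jweight M j ^+ 2 <= M ^+ 3 * jweight_var M.
Proof.
move=> M0; have [cv le _] := A2_facts M0.
have E N : \sum_(1 <= j < N) jweight M j ^+ 2 =
    M ^+ 3 * (A0 M)^-1 ^+ 2 * \sum_(1 <= j < N) M^-1 * p2 (j%:R * M^-1).
  rewrite mulr_sumr; apply: eq_bigr => j _; rewrite jweightE// /p2.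
  by field; rewrite !gt_eqF ?A0_gt0.
rewrite /jweight_var mulrA; split.
  by under eq_fun do rewrite E; apply: cvgMl_tmp; exact: cv.
by move=> N; rewrite E ler_wpM2l// mulr_ge0 ?exprn_ge0 ?invr_ge0// ltW// A0_gt0.
Qed.

Lemma cvg_A (A : R -> R) (l C : R) : (forall M, 0 < M -> `|A M - l| <= C / M) ->
  A M @[M --> +oo] --> l.
Proof.
move=> h; apply/cvgrPdist_le => e e0.
have C0 : 0 <= C by have := h 1 ltr01; rewrite divr1; exact: le_trans.
have := nbhs_pinfty_ge (num_real (1 + C / e)); apply: filterS => M hM.
have Ce : 0 <= C / e by rewrite divr_ge0// ltW.
have M0 : 0 < M by rewrite (lt_le_trans _ hM)//; lra.
by rewrite distrC (le_trans (h M M0))// ler_pdivrMr// mulrC -ler_pdivrMr//; lra.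
Qed.

Lemma cvg_A0 : A0 M @[M --> +oo] --> pi / 4.
Proof. by apply: (@cvg_A _ _ 8) => M M0; have [] := A0_facts M0. Qed.

Lemma cvg_jweight_var : jweight_var M @[M --> +oo] --> (2 * pi)^-1.
Proof.
have pi0 := pi_gt0 R.
(* The normalisation of the weights enters squared through its limit [pi / 4], and [pi / 32] is the
   limit of [A2]. *)
have -> : (2 * pi)^-1 = (pi / 4)^-1 * (pi / 4)^-1 * (pi / 32) :> R.
  by move: (gt_eqF pi0); move: pi => x /negbT x0; field.
rewrite /jweight_var; under eq_fun do rewrite expr2.
have i0 : (A0 M)^-1 @[M --> +oo] --> (pi / 4)^-1.
  by apply: cvgV cvg_A0; rewrite gt_eqF// divr_gt0.
apply: cvgM; first exact: cvgM.
by apply: (@cvg_A _ _ 16) => M M0; have [] := A2_facts M0.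
Qed.

Lemma A0_inv_bound : \forall M \near (+oo : set_system R), (A0 M)^-1 <= 3 /\ A1 M <= 2.
Proof.
have pi2 := pi_ge2 R; have pi4 : pi <= 4 :> R by have := pihalf_lt2 R; lra.
near=> M; have M0 : 64 <= M by near: M; apply: nbhs_pinfty_ge; rewrite num_real.
have M1 : 0 < M by lra.
have b : 8 / M <= 8^-1 by rewrite ler_pdivrMr//; lra.
have [_ _] := A0_facts M1; have [_ _] := A1_facts M1; rewrite !ler_norml => /andP[? ?] /andP[? ?].
split; last by lra.
have a2 : 3^-1 <= A0 M by lra.
by rewrite -[leRHS]invrK lef_pV2 ?posrE ?invr_gt0 ?A0_gt0.
Unshelve. all: by end_near. Qed.

Lemma B_w_bound : \forall M \near (+oo : set_system R), B_w M <= 6 * M ^+ 2.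
Proof.
near=> M; have M0 : 0 < M by near: M; apply: nbhs_pinfty_gt; rewrite num_real.
have [a b] : (A0 M)^-1 <= 3 /\ A1 M <= 2 by near: M; exact: A0_inv_bound.
have [_ _ ->] := jweight_series M0.
have a0 : 0 <= (A0 M)^-1 by rewrite invr_ge0 ltW// A0_gt0.
have := sqr_ge0 M; move: (M ^+ 2) (A0 M)^-1 (A1 M) a b a0 => x y z ? ? ? ?.
have : y * z <= 6 by nra.
by rewrite (_ : y * x * z = x * (y * z)); [nra|ring].
Unshelve. all: by end_near. Qed.

(** Lyapunov's condition: the cubes add up to order [M ^+ 4], while the cube of the standard
    deviation is of order [M ^ (9/2)]. The constant is [3 ^+ 3 * 2], from the two bounds of
    [A0_inv_bound]. *)
Lemma jweight_cube_bound : \forall M \near (+oo : set_system R), forall N, \sum_(1 <= j < N) jweight M j ^+ 3 <= 54 * M ^+ 4.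
Proof.
near=> M; have M0 : 0 < M by near: M; apply: nbhs_pinfty_gt; rewrite num_real.
have [a b] : (A0 M)^-1 <= 3 /\ A1 M <= 2 by near: M; exact: A0_inv_bound.
have a0 : 0 <= (A0 M)^-1 by rewrite invr_ge0 ltW// A0_gt0.
have [_ le _] := A1_facts M0.
have M4 : 0 <= M ^+ 4 by rewrite exprn_ge0// ltW.
move=> N; apply: (@le_trans _ _ (27 * M ^+ 4 * \sum_(1 <= j < N) M^-1 * p1 (j%:R * M^-1))).
  rewrite mulr_sumr; apply: ler_sum => j _; rewrite jweightE//.
  have /andP[c0 c1] := p1_01 (j%:R * M^-1); set x := p1 _ in c0 c1 *.
  have x3 : x ^+ 3 <= x by rewrite exprS ler_piMr// exprn_ile1.
  rewrite (_ : 27 * M ^+ 4 * (M^-1 * x) = 3 ^+ 3 * (M ^+ 3 * x)); last by field; rewrite gt_eqF.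
  rewrite (_ : (_ * M * x) ^+ 3 = (A0 M)^-1 ^+ 3 * (M ^+ 3 * x ^+ 3)); last by ring.
  have M3 : 0 <= M ^+ 3 by rewrite exprn_ge0// ltW.
  have Mx : 0 <= M ^+ 3 * x ^+ 3 by apply: mulr_ge0 => //; exact: exprn_ge0.
  apply: ler_pM => //; first exact: exprn_ge0.
    by rewrite lerXn2r ?nnegrE.
  by rewrite ler_wpM2l.
have := le N; have := ler_wpM2l M4 (le_trans (le N) b); lra.
Unshelve. all: by end_near. Qed.

End weights.

(** * Convergence to the GOE *)

Section gaussian_variables.
Context {R : realType}.
Notation g01 := (gauss 0 1 : probability R R).

Lemma law_mfun {disp : measure_display} {T : measurableType disp} (P : probability T R)
    (F : {mfun T >-> R}) (h : R -> R) :
  (forall A, measurable A -> P (F @^-1` A) = g01 A) -> measurable_fun setT h -> integr g01 h ->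
  integr P (fun w => h (F w)) /\ Ex P (fun w => h (F w)) = Ex g01 h.
Proof.
move=> law mh Ih.
have E (k : R -> \bar R) : (\int[g01]_y k y = \int[distribution P F]_y k y)%E.
  by apply: eq_measure_integral => A mA _; apply/esym; exact: law.
have Id : P.-integrable setT ((EFin \o h) \o F).
  apply/integrableP; split; first by apply/measurable_EFinP; exact: measurableT_comp.
  have /integrableP[_] := Ih; rewrite E ge0_integral_distribution//.
  by apply/measurable_EFinP; exact: measurableT_comp.
split; first exact: Id.
by rewrite /Ex /Rintegral E integral_distribution//; exact/measurable_EFinP.
Qed.

Lemma centered_gaussian_law {disp : measure_display} {T : measurableType disp} (P : probability T R)
    (v : R) (X : T -> R) : 0 < v -> centered_gaussian P v X ->
  measurable_fun setT (fun w => (Num.sqrt v)^-1 * X w) /\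
  forall h, measurable_fun setT h -> integr g01 h ->
    integr P (fun w => h ((Num.sqrt v)^-1 * X w)) /\ Ex P (fun w => h ((Num.sqrt v)^-1 * X w)) = Ex g01 h.
Proof.
move=> v0 [mX lX]; have q0 : 0 < Num.sqrt v by rewrite sqrtr_gt0.
have mF : measurable_fun setT (fun w => (Num.sqrt v)^-1 * X w) by exact: measurable_funM.
split=> // h mh Ih.
apply: (@law_mfun _ _ P (HB.pack (fun w => (Num.sqrt v)^-1 * X w) (isMeasurableFun.Build _ _ _ _ _ mF))) => // A mA.
have mB : measurable ((fun y : R => (Num.sqrt v)^-1 * y) @^-1` A).
  by rewrite -[X in measurable X]setTI; have := @measurable_funM _ _ R setT (cst (Num.sqrt v)^-1) id; apply.
have E : P (X @^-1` ((fun y : R => (Num.sqrt v)^-1 * y) @^-1` A)) =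
    gauss 0 (Num.sqrt v) ((fun y : R => (Num.sqrt v)^-1 * y) @^-1` A) := lX _ mB.
rewrite (gauss_affine _ q0 mB) in E.
rewrite -[LHS]/(P (X @^-1` ((fun y : R => (Num.sqrt v)^-1 * y) @^-1` A))) E; congr (g01 _).
by apply/seteqP; split=> y /=; rewrite add0r mulKf ?gt_eqF.
Qed.

Lemma standard_gaussian_law {disp : measure_display} {T : measurableType disp} (P : probability T R)
    (X : T -> R) : centered_gaussian P 1 X -> forall h, measurable_fun setT h -> integr g01 h ->
    integr P (fun w => h (X w)) /\ Ex P (fun w => h (X w)) = Ex g01 h.
Proof.
move=> gX h mh Ih; have [_ /(_ h mh Ih)] := centered_gaussian_law ltr01 gX.
by under eq_fun do rewrite sqrtr1 invr1 mul1r.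
Qed.

Lemma adapted_cst {disp : measure_display} {T : measurableType disp} (I : eqType) (X : I -> T -> R) J (c : R) :
  adapted X J (fun=> c).
Proof. exact: measurable_cst. Qed.

Lemma bounded_integr (h : R -> R) : bounded_measurable h -> integr g01 h.
Proof. by move=> [mh [K hK]]; exact: (@integr_bounded _ _ _ _ _ K). Qed.

Lemma exact_normal_indep {disp : measure_display} {T : measurableType disp} (P : probability T R)
    (I : finType) (X : I -> T -> R) : (forall a, measurable_fun setT (X a)) -> mutually_independent P X ->
  (forall a h, measurable_fun setT h -> integr g01 h ->
     integr P (h \o X a) /\ Ex P (h \o X a) = Ex g01 h) -> exact_normal P X.
Proof.
move=> mX indX law f bf.
have := @Ex_prod_indep _ _ _ P _ X mX indX [::] (enum I) (fun=> 1) f.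
have a1 : adapted X [::] (fun=> 1 : R) by exact: adapted_cst.
rewrite cats0 enum_uniq => /(_ isT a1 (fun a => (bf a).1) (integr_cst _ _)).
case=> [a _|_ _]; first by have [] := law a _ (bf a).1 (bounded_integr (bf a)).
rewrite Ex_cst mul1r; under eq_fun do rewrite mul1r.
rewrite big_enum /= => E; rewrite -(eq_bigr _ (fun a _ => (law a _ (bf a).1 (bounded_integr (bf a))).2)) -E.
by congr Ex; apply/funext => w; rewrite big_enum.
Qed.

End gaussian_variables.

(** * Moments of Gaussian vectors *)

Section moments.
Context {R : realType}.
Notation g01 := (gauss 0 1 : probability R R).

Definition gauss_moment (k : nat) : R := Ex g01 (fun y => y ^+ k).

Lemma gauss_moment_rec k : gauss_moment k.+1 = k%:R * gauss_moment k.-1.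
Proof.
have := gauss_ibp (R := R) k; rewrite ExB; last 2 first.
- by apply: integrZ; exact: integr_gauss_power.
- exact: integr_gauss_power.
rewrite ExZ => [h|]; last exact: integr_gauss_power.
by apply/esym/eqP; rewrite -subr_eq0; apply/eqP.
Qed.

Lemma gauss_moment_0 : gauss_moment 0 = 1.
Proof. by rewrite /gauss_moment; under eq_fun do rewrite expr0; rewrite Ex_cst. Qed.

Context {m : nat}.
Implicit Types i k p q : 'I_m.

Definition moment (s : seq 'I_m) : R := \prod_i gauss_moment (count_mem i s).

(** Wick's recursion: the letter [i] is paired with each of its further occurrences, and all these
    pairings contribute the same. *)
Lemma moment_rec i s : moment (i :: s) = (count_mem i s)%:R * moment (rem i s).
Proof.
rewrite /moment (bigD1 i)//= [in RHS](bigD1 i)//= eqxx add1n gauss_moment_rec mulrA.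
congr (_ * _ * _).
  by case: (boolP (i \in s)) => h; [rewrite count_rem h /= eqxx subn1|rewrite rem_id// (count_memPn h)].
apply: eq_bigr => l li; rewrite eq_sym (negbTE li) add0n.
by case: (boolP (i \in s)) => h; [rewrite count_rem h/= eq_sym (negbTE li) subn0|rewrite rem_id].
Qed.

Lemma moment0 : moment [::] = 1.
Proof. by rewrite /moment big1// => i _; rewrite gauss_moment_0. Qed.

Lemma moment2 i k : moment [:: i; k] = (i == k)%:R.
Proof.
by rewrite moment_rec /= addn0 [in RHS]eq_sym; case: eqVneq => [_|_]; rewrite ?moment0 ?mulr1 ?mul0r.
Qed.

Lemma wick4 i k p q : moment [:: i; k; p; q] =
  ((i == k) && (p == q))%:R + ((i == p) && (k == q))%:R + ((i == q) && (k == p))%:R.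
Proof.
rewrite moment_rec /= addn0 (eq_sym k i) (eq_sym p i) (eq_sym q i).
case: (eqVneq i k) => [<-|ik] /=.
  rewrite moment2; case: (eqVneq i p) => [<-|ip] /=; first by case: (i == q) => /=; ring.
  by case: (eqVneq i q) => [<-|iq] /=; rewrite ?(eq_sym p i) ?(negbTE ip) /=; [|case: (p == q) => /=]; ring.
case: (eqVneq i p) => [<-|ip] /=.
  by rewrite moment2; case: (eqVneq i q) => [<-|iq] /=; case: (k == _) => /=; ring.
by case: (i == q) => /=; rewrite ?moment2 ?mul0r; [case: (k == _) => /=|]; ring.
Qed.

End moments.

Section clt.
Context {R : realType} {disp : measure_display} {T : measurableType disp} (P : probability T R).
Context {m : nat} (zeta : nat -> T -> 'cV[R]_m).
Hypothesis iidz : iid_standard_gaussian P zeta.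
Notation g01 := (gauss 0 1 : probability R R).

Let Y (ji : nat * 'I_m) (w : T) : R := zeta ji.1 w ji.2 0.

Lemma measurable_zeta ji : measurable_fun setT (Y ji).
Proof. by case: iidz => _ /(_ ji.1 ji.2)[]. Qed.

Let indY : mutually_independent P Y. Proof. by case: iidz. Qed.

Lemma zeta_law ji h : measurable_fun setT h -> integr g01 h ->
  integr P (h \o Y ji) /\ Ex P (h \o Y ji) = Ex g01 h.
Proof. by case: iidz => _ /(_ ji.1 ji.2) gY; exact: standard_gaussian_law gY h. Qed.

Definition indices (j : nat) : seq (nat * 'I_m) := [seq (l, i) | l <- iota 0 j, i <- enum 'I_m].

Lemma mem_indices j l i : ((l, i) \in indices j) = (l < j)%N.
Proof.
apply/allpairsP/idP => [[[l' i'] /= [h _ [-> _]]]|h]; first by move: h; rewrite mem_iota.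
by exists (l, i); split => //=; rewrite ?mem_iota ?mem_enum.
Qed.

Lemma prod_count (F : 'I_m -> R) s : \prod_i F i ^+ count_mem i s = \prod_(i <- s) F i.
Proof.
elim: s => [|i s IH]; first by rewrite big_nil big1.
rewrite big_cons -IH (bigD1 i)//= [in RHS](bigD1 i)//= mulrA eqxx -exprS; congr (_ * _).
by apply: eq_bigr => l li; rewrite eq_sym (negbTE li).
Qed.

Lemma Ex_monomial j (s : seq 'I_m) b (K : R) : adapted Y (indices j) b -> (forall w, `|b w| <= K) ->
  integr P (fun w => b w * \prod_(i <- s) Y (j, i) w) /\
  Ex P (fun w => b w * \prod_(i <- s) Y (j, i) w) = Ex P b * moment s.
Proof.
move=> ab bK; have mb := adapted_measurable measurable_zeta ab.
pose h (ji : nat * 'I_m) (y : R) := y ^+ count_mem ji.2 s.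
have uKJ : uniq ([seq (j, i) | i <- enum 'I_m] ++ indices j).
  rewrite cat_uniq map_inj_uniq ?enum_uniq/= => [|? ? []//]; apply/andP; split.
    by apply/hasPn => -[l i]; rewrite mem_indices => lj; apply/mapP => -[i' _ [e _]]; rewrite e ltnn in lj.
  by apply: allpairs_uniq; rewrite ?iota_uniq ?enum_uniq// => -[? ?] [? ?].
have mh i : measurable_fun setT (h i) by exact: measurable_power.
have Ih i : i \in [seq (j, i) | i <- enum 'I_m] -> integr P (h i \o Y i).
  by move=> _; have [] := zeta_law i (mh i) (integr_gauss_power _).
have [_] := Ex_prod_indep measurable_zeta indY uKJ ab mh (@integr_bounded _ _ _ P b K mb bK) Ih.
have E w : \prod_(i <- [seq (j, i) | i <- enum 'I_m]) h i (Y i w) = \prod_(i <- s) Y (j, i) w.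
  by rewrite big_map big_enum/=; exact: (prod_count (fun i => Y (j, i) w) s).
rewrite big_map big_enum/= => I1 E1; split; first by under eq_fun do rewrite -E.
under eq_fun do rewrite -E; rewrite E1; congr (_ * _); apply: eq_bigr => i _.
by have [_] := zeta_law (j, i) (mh (j, i)) (integr_gauss_power _).
Qed.

(* Normalised to have variance one. *)
Definition entry (a : {ij : 'I_m * 'I_m | (ij.1 <= ij.2)%N}) (v : 'cV[R]_m) : R :=
  (if (val a).1 == (val a).2 then (Num.sqrt 2)^-1 else 1) *
  (v (val a).1 0 * v (val a).2 0 - ((val a).1 == (val a).2)%:R).

Local Notation I := {ij : 'I_m * 'I_m | (ij.1 <= ij.2)%N}.

Let nu (a : I) : R := if (val a).1 == (val a).2 then (Num.sqrt 2)^-1 else 1.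

Let nu01 a : 0 <= nu a <= 1.
Proof.
rewrite /nu; case: ifP => _; last by rewrite ler01 lexx.
by rewrite invr_ge0 sqrtr_ge0/= invf_le1 ?sqrtr_gt0// -[leLHS]sqrtr1 ler_sqrt//; lra.
Qed.

Lemma measurable_entry j a : measurable_fun setT (fun w => entry a (zeta j w)).
Proof.
by apply: measurable_funM => //; apply: measurable_funB => //; apply: measurable_funM;
  [exact: (measurable_zeta (j, _))|exact: (measurable_zeta (j, _))].
Qed.

Lemma adapted_entry j a J : (forall i, (j, i) \in J) -> adapted Y J (fun w => entry a (zeta j w)).
Proof.
move=> jJ; have ad i : adapted Y J (fun w => zeta j w i 0).
  by apply: (@adapted_var _ _ _ _ Y J (j, i) id) => //; exact: jJ.
apply: measurable_funM; first exact: measurable_cst.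
by apply: measurable_funB; [apply: measurable_funM; exact: ad|exact: measurable_cst].
Qed.

(** Step [j] of the sum adds [zeta j.+1], since frequencies start at 1; what is known before it
    depends on the vectors of index at most [j]. *)
Definition past (j : nat) (b : T -> R) : Prop :=
  adapted Y (indices j.+1) b /\ exists K, forall w, `|b w| <= K.

Lemma past_integr j b : past j b -> integr P b.
Proof.
by move=> [ab [K bK]]; exact: (@integr_bounded _ _ _ P b K (adapted_measurable measurable_zeta ab) bK).
Qed.

Lemma Ex_past_entry j a b : past j b -> integr P (fun w => b w * entry a (zeta j.+1 w)) /\
  Ex P (fun w => b w * entry a (zeta j.+1 w)) = 0.
Proof.
move=> pb; have Ib := past_integr pb; case: pb => ab [K bK].
have [I1 E1] := Ex_monomial [:: (val a).1; (val a).2] ab bK.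
rewrite moment2 in E1; set D : R := (_ == _)%:R in E1.
rewrite (_ : (fun w => _) = fun w => nu a * (b w * \prod_(i <- [:: (val a).1; (val a).2]) Y (j.+1, i) w) - nu a * D * b w).
  split; first by apply: integrB; exact: integrZ.
  by rewrite ExB ?ExZ ?E1//; do ?[exact: integrZ]; ring.
by apply/funext => w; rewrite /entry -/(nu a) -/D !big_cons big_nil /Y/=; ring.
Qed.

Lemma Ex_past_entry2 j a c b : past j b ->
  integr P (fun w => b w * (entry a (zeta j.+1 w) * entry c (zeta j.+1 w))) /\
  Ex P (fun w => b w * (entry a (zeta j.+1 w) * entry c (zeta j.+1 w))) = (a == c)%:R * Ex P b.
Proof.
move=> pb; have Ib := past_integr pb; case: pb => ab [K bK].
have [I1 E1] := Ex_monomial [:: (val a).1; (val a).2] ab bK.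
have [I2 E2] := Ex_monomial [:: (val c).1; (val c).2] ab bK.
have [I4 E4] := Ex_monomial [:: (val a).1; (val a).2; (val c).1; (val c).2] ab bK.
rewrite moment2 in E1; set D1 : R := (_ == _)%:R in E1.
rewrite moment2 in E2; set D2 : R := (_ == _)%:R in E2.
rewrite wick4 in E4; set W : R := _%:R + _%:R + _%:R in E4.
rewrite (_ : (fun w => _) = fun w => nu a * nu c * (b w * \prod_(i <- [:: (val a).1; (val a).2; (val c).1; (val c).2]) Y (j.+1, i) w)
  - nu a * nu c * D2 * (b w * \prod_(i <- [:: (val a).1; (val a).2]) Y (j.+1, i) w)
  - nu a * nu c * D1 * (b w * \prod_(i <- [:: (val c).1; (val c).2]) Y (j.+1, i) w) + nu a * nu c * D1 * D2 * b w); last first.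
  by apply/funext => w; rewrite /entry -/(nu a) -/(nu c) -/D1 -/D2 !big_cons big_nil /Y/=; ring.
split; first by apply: integrD; [apply: integrB; [apply: integrB|]|]; exact: integrZ.
rewrite ExD ?ExB ?ExZ ?E1 ?E2 ?E4//; do ?[apply: integrB|apply: integrZ] => //.
(* What is left is the covariance of the normalised entries. The centring cancels the first pairing
   of [wick4]. For ordered pairs the two others vanish unless the entries coincide; then one
   survives off the diagonal and both do on it, which the factor [(Num.sqrt 2)^-1] compensates. *)
suff h : nu a * nu c * (W - D1 * D2) = (a == c)%:R.
  by rewrite -h; ring.
rewrite /W /D1 /D2 /nu; case: a c {I1 E1 I2 E2 I4 E4 W D1 D2} => [[i k] /= ik] [[p q] /= pq].
have -> : (exist _ (i, k) ik == exist _ (p, q) pq :> I) = (i == p) && (k == q) by rewrite -val_eqE /= xpair_eqE.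
have s2 : (Num.sqrt 2)^-1 * (Num.sqrt 2)^-1 = 2^-1 :> R.
  by rewrite -invfM -expr2 sqr_sqrtr.
case: (eqVneq i p) => [<-|ip] /=.
  case: (eqVneq k q) => [<-|kq] /=.
    by rewrite (eq_sym k i); case: (eqVneq i k) => _ /=; rewrite ?s2 ?mul1r; [field|ring].
  case: (eqVneq i k) => [ik'|ik'] /=; case: (eqVneq i q) => [iq'|iq'] /=; rewrite ?mulr0n; try ring.
    by move: kq; rewrite -ik' -iq' eqxx.
case: (eqVneq i q) => [iq|iq] /=; last first.
  by case: (i == k); case: (p == q) => /=; ring.
case: (eqVneq k p) => [kp|kp] /=; last by case: (i == k); case: (p == q) => /=; ring.
have e : i = p by apply/val_inj/eqP; rewrite eqn_leq /= -{1}kp ik /= iq pq.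
by rewrite e eqxx in ip.
Qed.

(** From [|x * y - 1| <= x ^+ 2 + y ^+ 2 + 1] and [(u + v + 1) ^+ 3 <= 9 * (u ^+ 3 + v ^+ 3 + 1)]
    for nonnegative [u] and [v]. *)
Definition entry_abs3 : R := 9 * (2 * gauss_moment 6 + 1).

Lemma Ex_entry_abs3 j a : integr P (fun w => `|entry a (zeta j w)| ^+ 3) /\
  Ex P (fun w => `|entry a (zeta j w)| ^+ 3) <= entry_abs3.
Proof.
have b w : `|entry a (zeta j w)| ^+ 3 <= 9 * (Y (j, (val a).1) w ^+ 6 + Y (j, (val a).2) w ^+ 6 + 1).
  rewrite /entry -/(nu a) /Y/=; move: (zeta j w (val a).1 0) (zeta j w (val a).2 0) => x y.
  have h1 : `|nu a * (x * y - ((val a).1 == (val a).2)%:R)| <= x ^+ 2 + y ^+ 2 + 1.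
    have /andP[n0 n1] := nu01 a; rewrite normrM (ger0_norm n0) (le_trans (ler_piMl _ n1))//.
    rewrite (le_trans (ler_normB _ _))// lerD//; last by case: (_ == _); rewrite ?normr1 ?normr0.
    by rewrite ler_norml; have := sqr_ge0 (x + y); have := sqr_ge0 (x - y);
      have := sqr_ge0 x; have := sqr_ge0 y; move=> *; apply/andP; split; nra.
  rewrite (le_trans (y := (x ^+ 2 + y ^+ 2 + 1) ^+ 3))//.
    by rewrite lerXn2r ?nnegrE// (le_trans _ h1).
  rewrite -[x ^+ 6]/(x ^+ (2 * 3)) -[y ^+ 6]/(y ^+ (2 * 3)) !(exprM _ 2 3).
  have := sqr_ge0 x; have := sqr_ge0 y; move: (x ^+ 2) (y ^+ 2) => u v v0 u0.
  have pm (s t : R) : 0 <= s -> 0 <= t -> 0 <= (s + t) * (s - t) ^+ 2.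
    by move=> s0 t0; rewrite mulr_ge0 ?addr_ge0// sqr_ge0.
  have := pm _ _ u0 v0; have := pm _ _ u0 ler01; have := pm _ _ v0 ler01.
  have : 0 <= (u + v + 1) * ((u - v) ^+ 2 + (u - 1) ^+ 2 + (v - 1) ^+ 2).
    by rewrite mulr_ge0// ?addr_ge0// ?sqr_ge0.
  nra.
have m6 i : integr P (fun w => Y (j, i) w ^+ 6) /\ Ex P (fun w => Y (j, i) w ^+ 6) = gauss_moment 6.
  exact: (zeta_law (j, i) (h := fun y => y ^+ 6) (measurable_power 6) (integr_gauss_power 6)).
have I9 : integr P (fun w => 9 * (Y (j, (val a).1) w ^+ 6 + Y (j, (val a).2) w ^+ 6 + 1)).
  by apply: integrZ; apply: integrD; [apply: integrD; [exact: (m6 _).1|exact: (m6 _).1]|exact: integr_cst].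
have I3 : integr P (fun w => `|entry a (zeta j w)| ^+ 3).
  apply: (integr_le _ _ I9); last by move=> w; rewrite ger0_norm// exprn_ge0.
  by apply: measurable_funX; apply: measurableT_comp => //; exact: measurable_entry.
split=> //; rewrite (le_trans (Ex_le I3 I9 b))// ExZ; last first.
  by apply: integrD; [apply: integrD; [exact: (m6 _).1|exact: (m6 _).1]|exact: integr_cst].
rewrite ExD ?ExD ?Ex_cst ?(m6 _).2 /entry_abs3//; do ?[exact: (m6 _).1|exact: integr_cst].
  by rewrite le_eqVlt; apply/orP; left; apply/eqP; ring.
by apply: integrD; exact: (m6 _).1.
Qed.

Definition clt_constant (K : R) : R :=
  #|{: I}|%:R ^+ 3 * K ^+ #|{: I}| * (#|{: I}|%:R ^+ 3 * (#|{: I}|%:R * entry_abs3) + (1 + gauss_abs3) ^+ 3).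

(** Given the past, the entries of a new centred outer product are exactly uncorrelated, so
    Lindeberg's bound holds with covariance defect 0 and only the third moments remain. *)
Lemma clt (K : R) (N : nat) (c : nat -> R) : 1 <= K -> (forall j, 0 <= c j) ->
  \sum_(j < N) c j ^+ 2 = 1 ->
  approx_normal P K (clt_constant K * \sum_(j < N) c j ^+ 3)
    (fun a w => \sum_(j < N) c j * entry a (zeta j.+1 w)).
Proof.
move=> K1 c0 c2 f f1 f2 jf.
have := @lindeberg _ _ _ P {: I} N past (fun j a w => c j * entry a (zeta j.+1 w)) (fun j => c j ^+ 2) (fun=> 0)
  K f f1 f2 K1 jf; rewrite c2 => H.
have g1 a : gsmooth 1 (f a) 0 = Ex g01 (f a).
  by rewrite /gsmooth sqrtr1; under eq_fun do rewrite add0r mul1r.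
under [X in _ - X]eq_bigr do rewrite -g1.
apply: le_trans (H _) _; last first.
  rewrite mulr_sumr; apply: ler_sum => j _; rewrite /lindeberg_error mulr0 addr0 /clt_constant -[leRHS]mulrA ler_wpM2l//.
    by rewrite mulr_ge0// exprn_ge0// (le_trans _ K1).
  rewrite mulrDl sqrtr_sqr (ger0_norm (c0 j)) lerD2r -mulrA ler_wpM2l ?exprn_ge0//.
  rewrite (le_trans (y := \sum_(a : I) c j ^+ 3 * entry_abs3))//.
    apply: ler_sum => a _; have [I3 E3] := Ex_entry_abs3 j.+1 a.
    under eq_fun do rewrite normrM (ger0_norm (c0 j)) exprMn.
    by rewrite ExZ// ler_wpM2l// exprn_ge0.
  rewrite sumr_const -[leLHS]mulr_natl le_eqVlt; apply/orP; left; apply/eqP.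
  by rewrite -[#|_|]/(#|{: I}|); ring.
move=> j _; split=> //; first exact: sqr_ge0.
have past_meas b : past j b -> measurable_fun setT b by case=> ab _; have := adapted_measurable measurable_zeta ab.
split.
- by move=> b pb; split; [exact: past_meas|case: pb].
- move=> b b' [ab [K' bK']] [ab' [K'' bK'']]; split; first exact: measurable_funM.
  by exists (K' * K'') => w; rewrite normrM ler_pM.
- move=> a h [mh [K' hK']]; split; last by exists K'.
  apply: (measurableT_comp mh).
  apply: measurable_sum => l; apply: measurable_funM; first exact: measurable_cst.
  by apply: adapted_entry => i; rewrite mem_indices ltnS.
- by move=> a; apply: measurable_sum => l; apply: measurable_funM => //; exact: measurable_entry.
- by move=> a; apply: measurable_funM => //; exact: measurable_entry.
- move=> a; under eq_fun do rewrite normrM exprMn; apply: integrZ; exact: (Ex_entry_abs3 _ _).1.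
- move=> b a pb; have [I1 E1] := Ex_past_entry a pb.
  by under eq_fun do rewrite mulrCA; rewrite ExZ// E1 mulr0.
- move=> b a a' K' pb bK'.
  rewrite (_ : (fun w => _) = fun w => c j ^+ 2 * (b w * (entry a (zeta j.+1 w) * entry a' (zeta j.+1 w)))); last first.
    by apply/funext => w; ring.
  have [I2 E2] := Ex_past_entry2 a a' pb.
  by rewrite mul0r ExZ// E2 mulrA subrr normr0.
Qed.

End clt.

Section goe.
Context {R : realType}.

Definition sym_index m := {ij : 'I_m * 'I_m | (ij.1 <= ij.2)%N}.

(** The diagonal of a GOE matrix has variance 2; it is divided by [Num.sqrt 2], as in [entry], so
    that all coordinates have variance one. *)
Definition goe_entry {m : nat} (a : sym_index m) (A : 'M[R]_m) : R :=
  (if (val a).1 == (val a).2 then (Num.sqrt 2)^-1 else 1) * A (val a).1 (val a).2.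

Lemma goe_exact_normal {disp : measure_display} {T : measurableType disp} (P : probability T R)
    (m : nat) (Z : T -> 'M[R]_m) : is_GOE P Z ->
  (forall a, measurable_fun setT (fun w => goe_entry a (Z w))) /\
  exact_normal P (fun a w => goe_entry a (Z w)).
Proof.
case=> sZ indZ dZ oZ.
have law a : measurable_fun setT (fun w => goe_entry a (Z w)) /\
  forall h, measurable_fun setT h -> integr (gauss 0 1) h ->
  integr P (h \o (fun w => goe_entry a (Z w))) /\ Ex P (h \o (fun w => goe_entry a (Z w))) = Ex (gauss 0 1) h.
  case: a => [[i k] /= ik]; rewrite /goe_entry /=; case: (eqVneq i k) => [<-|ne].
    by have := centered_gaussian_law (ltr0Sn R 1) (dZ i).
  have lik : (i < k)%N by rewrite ltn_neqAle ne.
  by have := centered_gaussian_law ltr01 (oZ i k lik); rewrite sqrtr1 invr1.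
have mZ a := (law a).1; split => //.
apply: exact_normal_indep => //; last by move=> a; exact: (law a).2.
move=> J A uJ mA.
pose nu (a : sym_index m) : R := if (val a).1 == (val a).2 then (Num.sqrt 2)^-1 else 1.
have mB a : measurable ((fun y : R => nu a * y) @^-1` A a).
  by rewrite -[X in measurable X]setTI; have := @measurable_funM _ _ R setT (cst (nu a)) id; apply.
have := indZ J (fun a => (fun y : R => nu a * y) @^-1` A a) uJ mB.
by move=> ->.
Qed.

End goe.

(** * Measurability of eigenvalues *)

Section measurability.
Context {R : realType} {disp : measure_display} {T : measurableType disp}.

(** Eigenvalues are accessible only as Lipschitz functions of the entries. The event [c < f X] is
    the countable union, over rational points [q] with [f q] above [c] by [L] times a radius, of the
    event that [X] lies within this radius of [q]. *)
Lemma measurable_lipschitz (I : finType) (f : (I -> R) -> R) (L : R) (X : I -> T -> R) : 0 < L ->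
  (forall x y e, (forall a, `|y a - x a| <= e) -> f x <= f y + L * e) ->
  (forall a, measurable_fun setT (X a)) -> measurable_fun setT (fun w => f (fun a => X a w)).
Proof.
move=> L0 lip mX; apply: (@measurability _ _ _ _ _ _ (@RGenOInfty.G R)).
  exact: RGenOInfty.measurableE.
move=> _ [_ [c ->] <-]; rewrite setTI.
pose F (k : nat * {ffun I -> rat}) : set T := if c + L * (k.1.+1%:R)^-1 < f (fun a => ratr (k.2 a))
  then \bigcap_(a in [set` [set: I]%SET]) [set w | `|X a w - ratr (k.2 a)| <= (k.1.+1%:R)^-1] else set0.
rewrite (_ : _ @^-1` _ = \bigcup_k F k).
  apply: countable_bigcupT_measurable => // k; rewrite /F; case: ifP => // _.
  apply: fin_bigcap_measurable; first exact: finite_finset.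
  move=> a _; apply: (measurable_le (f := fun w => `|X a w - ratr (k.2 a)|)).
  by apply: measurableT_comp => //; exact: measurable_funB.
have approx (x z : R) : 0 < z -> exists r : rat, `|x - ratr r| <= z.
  move=> z0; have /rat_in_itvoo[r] : x - z < x + z by lra.
  by rewrite in_itv/= => /andP[? ?]; exists r; rewrite ler_norml; apply/andP; split; lra.
have arith (u v z : R) : u <= v + L * z -> z * (L * 2) < u - c -> c + L * z < v by lra.
have arith2 (u v z : R) : c + L * z < u -> u <= v + L * z -> c < v by lra.
apply/seteqP; split => [w /=|w [[n q] _]]; rewrite ?in_itv/= ?andbT.
  move=> cf; have L0' : 0 < L * 2 by rewrite mulr_gt0.
  have [n hn] : exists n : nat, (n.+1%:R)^-1 < (f (fun a => X a w) - c) / (L * 2).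
    have := @cvg_harmonic R => /cvgrPdist_lt/(_ ((f (fun a => X a w) - c) / (L * 2))).
    rewrite divr_gt0 ?subr_gt0// => /(_ isT)[n _ /(_ n (leqnn n))]; rewrite /= sub0r normrN.
    by rewrite ger0_norm ?invr_ge0// => h; exists n.
  have n0 : 0 < (n.+1%:R)^-1 :> R by rewrite invr_gt0.
  have [q hq] : exists q : {ffun I -> rat}, forall a, `|X a w - ratr (q a)| <= (n.+1%:R)^-1.
    by have [g hg] := choice (fun a => approx (X a w) _ n0); exists [ffun a => g a] => a; rewrite ffunE.
  exists (n, q) => //; rewrite /F /= ifT; first by move=> a _ /=; exact: hq.
  move: hn; rewrite ltr_pdivlMr// => hn.
  have := lip (fun a => X a w) (fun a => ratr (q a)) (n.+1%:R)^-1.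
  move=> /(_ (fun a => _)) h; have {}h := h ltac:(by move=> a; rewrite distrC).
  exact: arith h hn.
rewrite /F /=; case: ifP => // cf h.
have := lip (fun a => ratr (q a)) (fun a => X a w) (n.+1%:R)^-1.
move=> /(_ (fun a => h a _)) h'; have {}h' := h' ltac:(by move=> a; rewrite /= inE).
by rewrite in_itv/= andbT; exact: arith2 cf h'.
Qed.

End measurability.

Section symmetric_matrices.
Context {R : realType} {m : nat}.
Local Notation I := (sym_index m).

Lemma qform_sum (A : 'M[R]_m) v : qform A v = \sum_i \sum_k A i k * (v i 0 * v k 0).
Proof.
rewrite /qform -mulmxA mxE; apply: eq_bigr => i _; rewrite !mxE mulr_sumr.
by apply: eq_bigr => k _; rewrite mulrCA.
Qed.

Lemma qformD (A B : 'M[R]_m) v : qform (A + B) v = qform A v + qform B v.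
Proof. by rewrite /qform mulmxDr mulmxDl mxE. Qed.

Lemma qformZ (a : R) (A : 'M[R]_m) v : qform (a *: A) v = a * qform A v.
Proof. by rewrite /qform -scalemxAr -scalemxAl mxE. Qed.

Lemma qform_scalar (a : R) v : qform (a%:M : 'M[R]_m) v = a * sqnorm v.
Proof. by rewrite /qform mul_mx_scalar -scalemxAl mxE sqnormE. Qed.

Lemma qform_entry_bound (A : 'M[R]_m) (e : R) v : (forall i k, `|A i k| <= e) ->
  qform A v <= m%:R * e * sqnorm v.
Proof.
move=> Ae; rewrite qform_sum.
have h i k : A i k * (v i 0 * v k 0) <= e / 2 * (v i 0 ^+ 2 + v k 0 ^+ 2).
  have e0 : 0 <= e by rewrite (le_trans _ (Ae i k)).
  have := Ae i k; rewrite ler_norml => /andP[].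
  move: (v i 0) (v k 0) (A i k) => x y a ? ?.
  have := sqr_ge0 (x + y); have := sqr_ge0 (x - y) => h1 h2.
  have : 0 <= (e - a) * (x + y) ^+ 2 by rewrite mulr_ge0// subr_ge0.
  have : 0 <= (e + a) * (x - y) ^+ 2 by rewrite mulr_ge0//; lra.
  nra.
rewrite (le_trans (ler_sum _ (fun i _ => ler_sum _ (fun k _ => h i k))))//.
rewrite le_eqVlt; apply/orP; left; apply/eqP.
under eq_bigr do rewrite -mulr_sumr big_split/= sumr_const card_ord.
rewrite -mulr_sumr big_split/= sumr_const card_ord sumrMnl -/(sqnorm v) -(mulr_natl (sqnorm v) m).
by move: (sqnorm v) (m%:R : R) => x y; field.
Qed.

(** The pair is put in increasing order before [insub], so the default of [odflt] is never
    reached. *)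
Definition sidx (i k : 'I_m) : I :=
  odflt (exist _ (i, i) (leqnn i)) (insub (if (i <= k)%N then (i, k) else (k, i))).

Lemma val_sidx i k : val (sidx i k) = if (i <= k)%N then (i, k) else (k, i).
Proof.
rewrite /sidx insubT /=; last by move=> h.
by case: ifP => //= /negbT; rewrite -ltnNge => /ltnW.
Qed.

(** Inverse of the normalisation in [goe_entry]: a symmetric matrix becomes a family of coordinates
    of variance one, the form in which laws are compared. *)
Definition sym_of (x : I -> R) : 'M[R]_m :=
  \matrix_(i, k) ((if i == k then Num.sqrt 2 else 1) * x (sidx i k)).

Lemma sym_of_sym x : (sym_of x)^T = sym_of x.
Proof.
apply/matrixP => i k; rewrite !mxE eq_sym; congr (_ * x _).
by apply: val_inj; rewrite !val_sidx; case: ltngtP => // /val_inj ->.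
Qed.

Lemma sqrt2_neq0 : Num.sqrt 2 != 0 :> R. Proof. by rewrite gt_eqF// sqrtr_gt0. Qed.

Lemma sym_ofK (A : 'M[R]_m) : A^T = A -> sym_of (fun a => goe_entry a A) = A.
Proof.
move=> As; apply/matrixP => i k; rewrite !mxE /goe_entry val_sidx.
have [->|ik] := eqVneq i k; first by rewrite leqnn/= eqxx mulrA divff ?sqrt2_neq0 ?mul1r.
by case: (leqP i k) => _ /=; rewrite ?[k == i]eq_sym (negbTE ik) !mul1r// -[in RHS]As mxE.
Qed.

Lemma sym_of_lipschitz x y (e : R) k : (forall a, `|y a - x a| <= e) ->
  (k < m)%N -> eigval (sym_of x) k.+1 <= eigval (sym_of y) k.+1 + m%:R * 2 * e.
Proof.
move=> xy km; apply: (@eigval_lipschitz _ _ _ _ (Ordinal km)); do ?exact: sym_of_sym.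
move=> v; rewrite -lerBlDl -[X in _ - X]mul1r -mulNr -qformZ -qformD -[m%:R * 2 * e]mulrA.
apply: qform_entry_bound => i l; rewrite !mxE mulN1r -mulrBr normrM distrC ler_pM//.
case: ifP => _; rewrite ?normr1 ?ger0_norm ?sqrtr_ge0//; last by lra.
by rewrite -[leRHS]ger0_norm// -sqrtr_sqr ler_sqrt//; lra.
Qed.

Lemma measurable_eigval {disp : measure_display} {T : measurableType disp} (A : T -> 'M[R]_m) k :
  (forall i l, measurable_fun setT (fun w => A w i l)) -> (forall w, (A w)^T = A w) -> (k < m)%N ->
  measurable_fun setT (fun w => eigval (A w) k.+1).
Proof.
move=> mA As km; rewrite (_ : (fun w => _) = (fun w => eigval (sym_of (fun a => goe_entry a (A w))) k.+1)).
  apply: (@measurable_lipschitz _ _ _ _ (fun x => eigval (sym_of x) k.+1) (m%:R * 2) (fun a w => goe_entry a (A w))).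
  - by rewrite mulr_gt0// ltr0n; case: (m) km.
  - by move=> x y e xy; exact: sym_of_lipschitz.
  - by move=> a; apply: measurable_funM => //; exact: mA.
by apply/funext => w; rewrite sym_ofK.
Qed.

End symmetric_matrices.

Section lambda_max_affine.
Context {R : realType} {m : nat}.

Lemma lambda_max_affine (A B : 'M[R]_m.+1) (b s : R) : 0 < s -> A^T = A -> B^T = B ->
  (forall v, qform B v = b * sqnorm v + s * qform A v) -> lambda_max B = b + s * lambda_max A.
Proof.
move=> s0 As Bs BA; apply/eqP; rewrite eq_le; apply/andP; split.
  by apply: lambda_max_le => // c c1; have := qform_le_lambda_max c As; rewrite BA c1 !mulr1 lerD2l ler_pM2l.
rewrite -lerBrDl -ler_pdivlMl//; apply: lambda_max_le => // c c1.
have := qform_le_lambda_max c Bs; rewrite BA c1 !mulr1 => h.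
by rewrite ler_pdivlMl//; lra.
Qed.

End lambda_max_affine.

Section gram.
Context {R : realType} {n : nat}.

Definition gram (a : nat -> R) (N : nat) (v : nat -> 'cV[R]_n) : 'M[R]_n :=
  \matrix_(i, k) \sum_(1 <= j < N.+1) a j * (v j *m (v j)^T) i k.

Lemma gram_sym a N v : (gram a N v)^T = gram a N v.
Proof.
apply/matrixP => i k; rewrite !mxE; apply: eq_bigr => j _; congr (_ * _).
by rewrite !mxE; apply: eq_bigr => l _; rewrite !mxE mulrC.
Qed.

Lemma qform_outer (v c : 'cV[R]_n) : qform (v *m v^T) c = (\sum_i v i 0 * c i 0) ^+ 2.
Proof.
rewrite /qform mulmxA -mulmxA mxE big_ord1 expr2; congr (_ * _); rewrite mxE.
  by apply: eq_bigr => i _; rewrite mxE mulrC.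
by apply: eq_bigr => i _; rewrite mxE.
Qed.

Lemma qform_gram a N v c :
  qform (gram a N v) c = \sum_(1 <= j < N.+1) a j * (\sum_i v j i 0 * c i 0) ^+ 2.
Proof.
rewrite qform_sum; under eq_bigr do under eq_bigr do rewrite mxE mulr_suml.
under eq_bigr do rewrite exchange_big/=; rewrite exchange_big/=; apply: eq_bigr => j _.
rewrite -qform_outer qform_sum mulr_sumr; apply: eq_bigr => i _.
by rewrite mulr_sumr; apply: eq_bigr => k _; rewrite -mulrA.
Qed.

End gram.

Section gram_comparison.
Context {R : realType} {m : nat}.
Local Notation n := m.+1.
Local Notation I := (sym_index n).

Definition gram_coord (c : nat -> R) (N : nat) (v : nat -> 'cV[R]_n) (a : I) : R :=
  \sum_(j < N) c j * entry a (v j.+1).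

(** Centring each outer product by the identity moves every eigenvalue by the sum of the weights.
    For the weights [jweight M] this sum tends to the term [B_w M] of the first critical value as
    [N] grows. *)
Lemma lambda_max_gram (a : nat -> R) (s : R) (N : nat) (v : nat -> 'cV[R]_n) : 0 < s ->
  lambda_max (gram a N v) = \sum_(1 <= j < N.+1) a j +
    s * lambda_max (sym_of (gram_coord (fun j => a j.+1 / s) N v)).
Proof.
move=> s0; apply: lambda_max_affine => //; [exact: sym_of_sym|exact: gram_sym|move=> u].
rewrite -qform_scalar -qformZ -qformD; congr qform; apply/matrixP => i k.
rewrite [RHS]mxE [in RHS]mxE [X in _ + X]mxE [X in _ * X]mxE [LHS]mxE /gram_coord !big_add1/= !big_mkord.
rewrite (_ : (if i == k then _ else _) * _ = \sum_(j < N) a j.+1 / s * ((v j.+1 *m (v j.+1)^T) i k - (i == k)%:R)).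
  rewrite mulr_sumr -[X in X + _]mulr_natr mulr_suml -big_split/=; apply: eq_bigr => j _.
  by field; rewrite gt_eqF.
rewrite mulr_sumr; apply: eq_bigr => j _; rewrite mulrCA; congr (_ * _).
rewrite /entry val_sidx mxE big_ord1 !mxE; have [->|ik] := eqVneq i k.
  by rewrite leqnn/= eqxx mulrA divff ?sqrt2_neq0 ?mul1r.
by case: (leqP i k) => _ /=; rewrite ?[k == i]eq_sym (negbTE ik) !mul1r// mulrC.
Qed.

Lemma lambda_max_shift (x : I -> R) (u : R) :
  lambda_max (sym_of (fun a => x a + (if (val a).1 == (val a).2 then u / Num.sqrt 2 else 0))) =
  lambda_max (sym_of x) + u.
Proof.
rewrite (@lambda_max_affine _ _ (sym_of x) _ u 1) ?ltr01 ?sym_of_sym//; first by rewrite mul1r addrC.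
move=> v; rewrite mul1r -qform_scalar -qformD; congr qform; apply/matrixP => i k.
rewrite !mxE val_sidx; have [->|ik] := eqVneq i k.
  by rewrite leqnn/= eqxx mulr1n; field; exact: sqrt2_neq0.
by case: (leqP i k) => _ /=; rewrite ?[k == i]eq_sym (negbTE ik) mulr0n add0r addr0.
Qed.

Context {disp1 : measure_display} {T1 : measurableType disp1} (P1 : probability T1 R) (Z : T1 -> 'M[R]_n).
Hypothesis goeZ : is_GOE P1 Z.

Let ZK w : sym_of (fun a => goe_entry a (Z w)) = Z w.
Proof. by apply: sym_ofK; case: goeZ. Qed.

Lemma lambda_max_goe_entry x : [set w | x < lambda_max (sym_of (fun a => goe_entry a (Z w)))] = [set w | x < lambda_max (Z w)].
Proof. by apply/seteqP; split => w /=; rewrite ZK. Qed.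

Let le_prob_congr {d d' : measure_display} {U : measurableType d} {U' : measurableType d'}
    (Q : probability U R) (Q' : probability U' R) (A A' : set U) (B B' : set U') (c : \bar R) :
  A = A' -> B = B' -> (Q A <= Q' B + c)%E -> (Q A' <= Q' B' + c)%E.
Proof. by move=> -> ->. Qed.

Let L : R := n%:R * 2.

Let L0 : 0 < L. Proof. by rewrite mulr_gt0. Qed.

Lemma lambda_max_lipschitz (x y : I -> R) e : (forall a, `|y a - x a| <= e) ->
  lambda_max (sym_of x) <= lambda_max (sym_of y) + L * e.
Proof. by move=> xy; exact: (sym_of_lipschitz xy (ltn0Sn m)). Qed.

Lemma measurable_lambda_sym {d : measure_display} {U : measurableType d} (X : I -> U -> R) :
  (forall a, measurable_fun setT (X a)) ->
  measurable_fun setT (fun w => lambda_max (sym_of (fun a => X a w))).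
Proof. by move=> mX; exact: (measurable_lipschitz (f := fun x => lambda_max (sym_of x)) L0 lambda_max_lipschitz mX). Qed.

Lemma measurable_lambda_goe : measurable_fun setT (fun w => lambda_max (Z w)).
Proof.
rewrite (_ : (fun w => _) = (fun w => lambda_max (sym_of (fun a => goe_entry a (Z w))))).
  exact: (measurable_lambda_sym (goe_exact_normal goeZ).1).
by apply/funext => w; rewrite ZK.
Qed.

Lemma goe_shift : exists2 C : R, 0 <= C & forall x u, 0 < u ->
  (P1 [set w | (x < lambda_max (Z w))%R] <= P1 [set w | (x + u < lambda_max (Z w))%R] + (C * u)%:E)%E.
Proof.
exists (#|{: I}|%:R * 2) => [|x u u0]; first by rewrite mulr_ge0.
have [mZ nZ] := goe_exact_normal goeZ.
(* The eigenvalue is lowered by [2 * u]: one [u] is the gain in the statement, the other pays for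
   the resolution [u / L] of the grid. *)
pose sh (a : I) : R := if (val a).1 == (val a).2 then - (2 * u) / Num.sqrt 2 else 0.
have d0 : 0 < u / L by rewrite divr_gt0.
have shE w : lambda_max (sym_of (fun a => goe_entry a (Z w) + sh a)) = lambda_max (Z w) - 2 * u.
  by rewrite lambda_max_shift ZK.
have mA (c : R) : measurable [set w | c < lambda_max (sym_of (fun a => goe_entry a (Z w)))].
  by apply: measurable_gt; exact: measurable_lambda_sym.
have mB (c : R) : measurable [set w | c < lambda_max (sym_of (fun a => goe_entry a (Z w) + sh a))].
  by apply: measurable_gt; apply: (measurable_lambda_sym (X := fun a w => goe_entry a (Z w) + sh a)) => a; exact: measurable_funD.
have := @gaussian_shift R {: I} _ _ P1 (fun a w => goe_entry a (Z w)) sh (u / L)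
  (fun s => x < lambda_max (sym_of s)) (fun s => x - u < lambda_max (sym_of s)) d0 mZ nZ (mA x) (mB (x - u)).
have near (s t : I -> R) : x < lambda_max (sym_of s) -> (forall a, `|t a - s a| <= u / L) -> x - u < lambda_max (sym_of t).
  move=> xs st; have := lambda_max_lipschitz st; rewrite mulrCA (divff (lt0r_neq0 L0)) mulr1 => le_t.
  by rewrite ltrBlDr; exact: lt_le_trans le_t.
have shE' : [set w | x - u < lambda_max (sym_of (fun a => goe_entry a (Z w) + sh a))] =
    [set w | x + u < lambda_max (Z w)].
  by apply/seteqP; split => w /=; rewrite shE; lra.
move=> /(_ near) /(le_prob_congr (lambda_max_goe_entry x) shE') {near mA mB mZ nZ shE shE'}.
move=> h; apply: (le_trans h); apply: leeD => //; rewrite lee_fin -mulrA.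
apply: (@le_trans _ _ (\sum_(a : I) 2 * u)); last by rewrite sumr_const -[leLHS]mulr_natl.
apply: ler_sum => a _; rewrite /sh; case: ifP => _; last by rewrite normr0; lra.
have s2 : 1 <= Num.sqrt 2 :> R by rewrite -[leLHS]sqrtr1 ler_sqrt//; lra.
have u2 : 0 <= 2 * u by lra.
rewrite normrM normrN (ger0_norm u2) (@ger0_norm _ (Num.sqrt 2)^-1) ?invr_ge0 ?sqrtr_ge0//.
by rewrite ler_pdivrMr ?(lt_le_trans _ s2)// ler_peMr//; lra.
Qed.

(** [tau], a bound on the Lyapunov ratio, is fixed before the probability space, the weights and
    [N]. Both directions are stated: the second test passes from one Wishart matrix to the GOE and
    back to another. *)
Lemma gram_compare (e delta : R) : 0 < e -> 0 < delta -> exists2 tau : R, 0 < tau &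
  forall (d : measure_display) (T : measurableType d) (P : probability T R) (zeta : nat -> T -> 'cV[R]_n)
    (a : nat -> R) (N : nat) (s : R), iid_standard_gaussian P zeta -> (forall j, 0 <= a j) -> 0 < s ->
    \sum_(1 <= j < N.+1) a j ^+ 2 = s ^+ 2 -> \sum_(1 <= j < N.+1) a j ^+ 3 <= tau * s ^+ 3 ->
  let b := \sum_(1 <= j < N.+1) a j in
  [/\ measurable_fun setT (fun w => lambda_max (gram a N (fun j => zeta j w))),
   forall x, (P [set w | (b + s * x < lambda_max (gram a N (fun j => zeta j w)))%R] <=
     P1 [set w | (x - delta < lambda_max (Z w))%R] + e%:E)%E &
   forall x, (P1 [set w | (x < lambda_max (Z w))%R] <=
     P [set w | (b + s * (x - delta) < lambda_max (gram a N (fun j => zeta j w)))%R] + e%:E)%E].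
Proof.
move=> e0 d0; have dL : 0 < delta / L by rewrite divr_gt0.
have [K [eta [K1 eta0 H]]] := normal_compare (I := {: I}) e0 dL.
have cc0 : 0 <= clt_constant (m := n) K.
  have g3 : 0 <= gauss_abs3 :> R by apply: Ex_ge0 => y; exact: exprn_ge0.
  have g6 : 0 <= gauss_moment 6 :> R by apply: Ex_ge0 => y; rewrite -[6%N]/(2 * 3)%N exprM exprn_ge0// sqr_ge0.
  rewrite /clt_constant /entry_abs3 !mulr_ge0 ?exprn_ge0 ?(le_trans _ K1)// addr_ge0 ?exprn_ge0 ?addr_ge0//.
  by rewrite !mulr_ge0 ?exprn_ge0// addr_ge0// mulr_ge0.
have cc1 : 0 < clt_constant (m := n) K + 1 by lra.
exists (eta / (clt_constant (m := n) K + 1)); first by rewrite divr_gt0.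
move=> d T P zeta a N s iz a0 s0 s2 s3 b.
pose c j := a j.+1 / s.
have sn : s != 0 by rewrite gt_eqF.
have c0 j : 0 <= c j by rewrite divr_ge0// ltW.
have c2 : \sum_(j < N) c j ^+ 2 = 1.
  move: s2; rewrite big_add1/= big_mkord => s2.
  by under eq_bigr do rewrite exprMn; rewrite -mulr_suml s2 exprVn divff// expf_eq0.
have c3 : clt_constant (m := n) K * \sum_(j < N) c j ^+ 3 <= eta.
  move: s3; rewrite big_add1/= big_mkord => s3.
  under eq_bigr do rewrite exprMn; rewrite -mulr_suml exprVn mulrA ler_pdivrMr ?exprn_gt0//.
  rewrite (le_trans (ler_wpM2l cc0 s3))// mulrA ler_wpM2r ?exprn_ge0 ?ltW//.
  by rewrite mulrCA gtr_pMr// ltr_pdivrMr//; lra.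
pose X (i : I) w := gram_coord c N (fun j => zeta j w) i.
have mX i : measurable_fun setT (X i).
  by apply: measurable_sum => j; apply: measurable_funM => //; exact: (measurable_entry iz).
have aX : approx_normal P K eta X.
  by move=> f f1 f2 jf; apply: le_trans c3; exact: (clt iz K1 c0 c2 jf).
have lamE w : lambda_max (gram a N (fun j => zeta j w)) = b + s * lambda_max (sym_of (fun i => X i w)).
  by rewrite (lambda_max_gram a N _ s0).
have mlX := measurable_lambda_sym mX.
have [mZ nZ] := goe_exact_normal goeZ.
have aZ : approx_normal P1 K eta (fun a w => goe_entry a (Z w)) by apply: exact_approx_normal => //; exact: ltW.
have mA (x : R) : measurable [set w | x < lambda_max (sym_of (fun i => X i w))] by exact: measurable_gt.
have mB (x : R) : measurable [set w | x < lambda_max (sym_of (fun a => goe_entry a (Z w)))].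
  by apply: measurable_gt; exact: measurable_lambda_sym.
have near x (u t : I -> R) : x < lambda_max (sym_of u) -> (forall a, `|t a - u a| <= delta / L) ->
    x - delta < lambda_max (sym_of t).
  move=> xs st; have := lambda_max_lipschitz st; rewrite mulrCA (divff (lt0r_neq0 L0)) mulr1 => le_t.
  by rewrite ltrBlDr; exact: lt_le_trans le_t.
have setE x : [set w | b + s * x < lambda_max (gram a N (fun j => zeta j w))] =
    [set w | x < lambda_max (sym_of (fun i => X i w))].
  by apply/seteqP; split => w /=; rewrite lamE ltrD2l ltr_pM2l.
split.
- under eq_fun do rewrite lamE; apply: measurable_funD => //; exact: measurable_funM.
- move=> x; apply: (le_prob_congr (esym (setE x)) (lambda_max_goe_entry _)).
  have := H _ _ _ _ P P1 X (fun a w => goe_entry a (Z w)) (fun u => x < lambda_max (sym_of u))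
    (fun u => x - delta < lambda_max (sym_of u)) mX mZ aX aZ (mA x) (mB _) (near x).
  exact.
- move=> x; apply: (le_prob_congr (lambda_max_goe_entry x) (esym (setE _))).
  have := H _ _ _ _ P1 P (fun a w => goe_entry a (Z w)) X (fun u => x < lambda_max (sym_of u))
    (fun u => x - delta < lambda_max (sym_of u)) mZ mX aZ aX (mB x) (mA _) (near x).
  exact.
Qed.

End gram_comparison.

(** * Brownian integrals of cosines are i.i.d. Gaussian *)

Section normal_linear.
Context {R : realType} {disp : measure_display} {T : measurableType disp} (P : probability T R).
Context {Q I : finType} (N : nat) (Y : 'I_N.+1 * Q -> T -> R) (a : I -> Q -> R) (m : R).
Notation g01 := (gauss 0 1 : probability R R).
Hypothesis mY : forall i, measurable_fun setT (Y i).
Hypothesis indY : mutually_independent P Y.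
Hypothesis lawY : forall i h, measurable_fun setT h -> integr g01 h ->
  integr P (h \o Y i) /\ Ex P (h \o Y i) = Ex g01 h.
Hypothesis m0 : 0 <= m.
Hypothesis gram_a : forall b c, `|\sum_q a b q * a c q - (b == c)%:R| <= m.

Let sN : R := (Num.sqrt N.+1%:R)^-1.

Let sN2 : sN ^+ 2 = N.+1%:R^-1.
Proof. by rewrite exprVn sqr_sqrtr. Qed.

Let X (nu : nat) (b : I) (w : T) : R := sN * \sum_q a b q * Y (inord nu, q) w.

Definition before (nu : nat) : seq ('I_N.+1 * Q) :=
  seq.filter (fun i : 'I_N.+1 * Q => (val i.1 < nu)%N) (enum {: 'I_N.+1 * Q}).

Lemma mem_before nu (i : 'I_N.+1 * Q) : (i \in before nu) = (val i.1 < nu)%N.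
Proof. by rewrite mem_filter mem_enum andbT. Qed.

Lemma before_uniq nu : uniq (before nu).
Proof. by rewrite filter_uniq// enum_uniq. Qed.

Definition known (nu : nat) (b : T -> R) : Prop :=
  adapted Y (before nu) b /\ exists K, forall w, `|b w| <= K.

Lemma known_measurable nu b : known nu b -> measurable_fun setT b.
Proof. by case=> ab _; have := adapted_measurable mY ab. Qed.

Lemma known_integr nu b : known nu b -> integr P b.
Proof. by move=> kb; have mb := known_measurable kb; case: kb => _ [K bK]; exact: (@integr_bounded _ _ _ P b K mb bK). Qed.

Lemma Ex_known1 nu b q : (nu < N.+1)%N -> known nu b ->
  integr P (fun w => b w * Y (inord nu, q) w) /\ Ex P (fun w => b w * Y (inord nu, q) w) = 0.
Proof.
move=> nN kb; have Ib := known_integr kb; case: kb => ab _.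
have uk : uniq ((inord nu, q) :: before nu) by rewrite /= before_uniq mem_before/= inordK// ltnn.
have i1 : integr g01 (fun y : R => y) := integr_gauss_power 1.
have [I1 E1] := lawY (inord nu, q) (measurable_power 1) i1.
have [J1 ->] := Ex_adapted_mul (h := idfun) mY indY uk ab (measurable_power 1) Ib I1.
by split=> //; rewrite -[Ex P (idfun \o _)]/(Ex P ((fun y => y ^+ 1) \o Y (inord nu, q))) E1 gauss_moment1 mulr0.
Qed.

Lemma Ex_known2 nu b q q' : (nu < N.+1)%N -> known nu b ->
  integr P (fun w => b w * (Y (inord nu, q) w * Y (inord nu, q') w)) /\
  Ex P (fun w => b w * (Y (inord nu, q) w * Y (inord nu, q') w)) = (q == q')%:R * Ex P b.
Proof.
move=> nN kb; have Ib := known_integr kb; case: kb => ab _.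
have i1 : integr g01 (fun y : R => y) := integr_gauss_power 1.
have [<-|qq] := eqVneq q q'.
  have uk : uniq ((inord nu, q) :: before nu) by rewrite /= before_uniq mem_before/= inordK// ltnn.
  have [I1 E1] := lawY (inord nu, q) (measurable_power 2) (integr_gauss_power 2).
  have [J1 E] := Ex_adapted_mul mY indY uk ab (measurable_power 2) Ib I1.
  by rewrite mul1r; split; [exact: J1|rewrite -[LHS]/(Ex P (fun w => b w * Y (inord nu, q) w ^+ 2)) E E1 gauss_moment2 mulr1].
have uk : uniq ([:: (inord nu, q); (inord nu, q')] ++ before nu).
  by rewrite /= !inE !mem_before/= inordK// ltnn before_uniq xpair_eqE eqxx (negbTE qq).
have [_ J1 E] := Ex_prod_indep (h := fun _ => idfun) mY indY uk ab (fun _ => measurable_power 1) Ib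
  (fun i _ => (lawY i (measurable_power 1) i1).1).
rewrite (_ : (fun w => b w * _) = fun w => b w * \prod_(i <- [:: (inord nu, q); (inord nu, q')]) Y i w); last first.
  by apply/funext => w; rewrite !big_cons big_nil mulr1.
split; first exact: J1.
rewrite -[LHS]/(Ex P (fun w => b w * \prod_(i <- [:: (inord nu, q); (inord nu, q')]) idfun (Y i w))) E !big_cons.
have -> : Ex P (idfun \o Y (inord nu, q)) = 0.
  by rewrite -[LHS]/(Ex P ((fun y => y ^+ 1) \o Y (inord nu, q))) (lawY _ (measurable_power 1) i1).2 gauss_moment1.
by rewrite !mul0r mulr0.
Qed.

Let B3 : R := #|Q|%:R ^+ 3 * \sum_b \sum_q `|a b q| ^+ 3 * gauss_abs3.

Lemma Ex_linear_abs3 nu b : integr P (fun w => `|X nu b w| ^+ 3) /\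
  Ex P (fun w => `|X nu b w| ^+ 3) <= sN ^+ 3 * (#|Q|%:R ^+ 3 * \sum_q `|a b q| ^+ 3 * gauss_abs3).
Proof.
have sN0 : 0 <= sN by rewrite invr_ge0 sqrtr_ge0.
have m3 : measurable_fun setT (fun y : R => `|y| ^+ 3) by apply: measurable_funX; exact: normr_measurable.
have law3 q := lawY (inord nu, q) m3 integr_gauss_abs3.
have mX : measurable_fun setT (X nu b).
  by apply: measurable_funM => //; apply: measurable_sum => q; exact: measurable_funM.
pose g w := sN ^+ 3 * (#|Q|%:R ^+ 3 * \sum_q `|a b q| ^+ 3 * `|Y (inord nu, q) w| ^+ 3).
have Ig1 : integr P (fun w => \sum_q `|a b q| ^+ 3 * `|Y (inord nu, q) w| ^+ 3).
  by apply: integr_sum => q _; apply: integrZ; exact: (law3 q).1.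
have Ig : integr P g by do 2!apply: integrZ.
have bg w : `|X nu b w| ^+ 3 <= g w.
  rewrite /X /g normrM (ger0_norm sN0) exprMn ler_wpM2l ?exprn_ge0//.
  have -> : \sum_q `|a b q| ^+ 3 * `|Y (inord nu, q) w| ^+ 3 = \sum_q `|a b q * Y (inord nu, q) w| ^+ 3.
    by apply: eq_bigr => q _; rewrite normrM exprMn.
  rewrite (le_trans _ (sum_cube _))// lerXn2r ?nnegrE ?sumr_ge0//.
  exact: ler_norm_sum.
have I3 : integr P (fun w => `|X nu b w| ^+ 3).
  by apply: (integr_le _ _ Ig); [apply: measurable_funX; exact: measurableT_comp|move=> w; rewrite ger0_norm// exprn_ge0].
split=> //; rewrite (le_trans (Ex_le I3 Ig bg))// /g !ExZ//; last exact: integrZ.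
rewrite Ex_sum; last by move=> q _; apply: integrZ; exact: (law3 q).1.
rewrite le_eqVlt; apply/orP; left; apply/eqP; congr (_ * (_ * _)); apply: eq_bigr => q _.
by rewrite ExZ; [congr (_ * _); exact: (law3 q).2|exact: (law3 q).1].
Qed.

(** Stability of the normal law under linear maps. Each of the Gaussian variables indexed by [Q] is
    a normalised sum of [N.+1] independent ones, so Lindeberg's bound applies with an error of order
    [sN], which vanishes as [N] grows. The defect [m] of orthonormality of the rows of [a] is kept,
    since it vanishes only in a later limit. *)
Lemma normal_linear (K : R) (f f1 f2 : I -> R -> R) : 1 <= K -> (forall b, jet K (f b) (f1 b) (f2 b)) ->
  `|Ex P (fun w => \prod_b f b (\sum_q a b q * (sN * \sum_(nu < N.+1) Y (nu, q) w))) - \prod_b Ex g01 (f b)| <=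
  #|I|%:R ^+ 3 * K ^+ #|I| * (#|I|%:R ^+ 3 * B3 + (1 + gauss_abs3) ^+ 3) * sN + #|I|%:R ^+ 2 * K ^+ #|I| * m.
Proof.
move=> K1 jf; have sN0 : 0 <= sN by rewrite invr_ge0 sqrtr_ge0.
have sNN : N.+1%:R * sN ^+ 2 = 1 by rewrite sN2 divff.
have st nu : (nu < N.+1)%N -> [/\ 0 <= sN ^+ 2, 0 <= sN ^+ 2 * m &
     step_conditions P (known nu) (fun b w => \sum_(j < nu) X j b w) (X nu) (sN ^+ 2) (sN ^+ 2 * m)].
  move=> nN; split; [exact: sqr_ge0|by rewrite mulr_ge0// sqr_ge0|].
  have mX l b : measurable_fun setT (X l b).
    by apply: measurable_funM => //; apply: measurable_sum => q; exact: measurable_funM.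
  split.
  - by move=> b kb; split; [exact: known_measurable kb|case: kb].
  - move=> b b' [ab [K' bK']] [ab' [K'' bK'']]; split; first exact: measurable_funM.
    by exists (K' * K'') => w; rewrite normrM ler_pM.
  - move=> b h [mh [K' hK']]; split; last by exists K'.
    apply: (measurableT_comp mh); apply: measurable_sum => l.
    apply: measurable_funM; first exact: measurable_cst.
    apply: measurable_sum => q; apply: measurable_funM; first exact: measurable_cst.
    apply: (@adapted_var _ _ _ _ Y (before nu) (inord l, q) idfun); first exact: (measurable_power 1).
    by rewrite mem_before/= inordK// (leq_trans (ltn_ord l))// ltnW.
  - by move=> b; apply: measurable_sum => l; exact: mX.
  - by move=> b; exact: mX.
  - by move=> b; exact: (Ex_linear_abs3 nu b).1.
  - move=> b c kb; rewrite (_ : (fun w => _) = fun w => \sum_q (sN * a c q) * (b w * Y (inord nu, q) w)).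
      rewrite Ex_sum; last by move=> q _; apply: integrZ; exact: (Ex_known1 q nN kb).1.
      rewrite big1// => q _; rewrite ExZ; last exact: (Ex_known1 q nN kb).1.
      by rewrite (Ex_known1 q nN kb).2 mulr0.
    by apply/funext => w; rewrite /X mulr_sumr mulr_sumr; apply: eq_bigr => q _; ring.
  - move=> b c c' K' kb bK'.
    rewrite (_ : (fun w => _) = fun w => \sum_q \sum_q' (sN ^+ 2 * (a c q * a c' q')) * (b w * (Y (inord nu, q) w * Y (inord nu, q') w))); last first.
      apply/funext => w; rewrite /X.
      rewrite (_ : b w * _ = b w * sN ^+ 2 * ((\sum_q a c q * Y (inord nu, q) w) * (\sum_q a c' q * Y (inord nu, q) w))); last by ring.
      rewrite mulr_suml mulr_sumr; apply: eq_bigr => q _; rewrite mulr_sumr mulr_sumr.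
      by apply: eq_bigr => q' _; ring.
    have I2 q q' := (Ex_known2 q q' nN kb).1; have E2 q q' := (Ex_known2 q q' nN kb).2.
    rewrite Ex_sum; last by move=> q _; apply: integr_sum => q' _; exact: integrZ.
    have EE q : Ex P (fun w => \sum_q' (sN ^+ 2 * (a c q * a c' q')) * (b w * (Y (inord nu, q) w * Y (inord nu, q') w))) =
        \sum_q' (sN ^+ 2 * (a c q * a c' q')) * ((q == q')%:R * Ex P b).
      by rewrite Ex_sum => [|q' _]; [apply: eq_bigr => q' _; rewrite ExZ// E2|exact: integrZ].
    under eq_bigr do rewrite EE.
    have -> : \sum_q \sum_q' sN ^+ 2 * (a c q * a c' q') * ((q == q')%:R * Ex P b) =
        sN ^+ 2 * (\sum_q a c q * a c' q) * Ex P b.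
      rewrite mulr_sumr mulr_suml; apply: eq_bigr => q _; rewrite (bigD1 q)//= eqxx big1 ?addr0 ?mul1r//.
      by move=> q' qq'; rewrite eq_sym (negbTE qq') mul0r mulr0.
    rewrite -mulrBl -mulrBr normrM normrM ger0_norm ?sqr_ge0//.
    apply: ler_pM; rewrite ?mulr_ge0 ?sqr_ge0 ?ler_wpM2l ?sqr_ge0//.
    rewrite -[leRHS](Ex_cst P); apply: Ex_norm_le; [exact: known_measurable kb|exact: integr_cst|exact: bK'].
have := @lindeberg _ _ _ P I N.+1 known X (fun=> sN ^+ 2) (fun=> sN ^+ 2 * m) K f f1 f2 K1 jf st.
have -> : \sum_(j < N.+1) sN ^+ 2 = 1 by rewrite sumr_const card_ord -[LHS]mulr_natl.
have -> : (fun w => \prod_b f b (\sum_q a b q * (sN * \sum_(nu < N.+1) Y (nu, q) w))) =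
   fun w => \prod_b f b (\sum_(j < N.+1) X j b w).
  apply/funext => w; apply: eq_bigr => b _; congr (f b _); rewrite /X -mulr_sumr exchange_big/= mulr_sumr.
  by apply: eq_bigr => q _; rewrite mulrCA mulr_sumr; congr (_ * _); apply: eq_bigr => nu _; rewrite inord_val.
have g1 b : gsmooth 1 (f b) 0 = Ex g01 (f b).
  by rewrite /gsmooth sqrtr1; under eq_fun do rewrite add0r mul1r.
under [X in `|_ - X| <= _ -> _]eq_bigr do rewrite g1.
move=> H; apply: (le_trans H).
have K0 : 0 <= K by rewrite (le_trans _ K1).
rewrite (le_trans (y := \sum_(nu < N.+1) (#|I|%:R ^+ 3 * K ^+ #|I| * (#|I|%:R ^+ 3 * B3 + (1 + gauss_abs3) ^+ 3) * sN ^+ 3 + #|I|%:R ^+ 2 * K ^+ #|I| * (sN ^+ 2 * m))))//; last first.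
  rewrite sumr_const card_ord -[leLHS]mulr_natl le_eqVlt; apply/orP; left; apply/eqP.
  move: sNN; move: (#|I|%:R ^+ 3 * _ * _) (#|I|%:R ^+ 2 * _) (N.+1%:R : R) sN => u v M s sNN.
  by rewrite (_ : M * _ = u * s * (M * s ^+ 2) + v * m * (M * s ^+ 2)); [rewrite sNN; ring|ring].
apply: ler_sum => nu _; rewrite /lindeberg_error lerD2r -[leRHS]mulrA ler_wpM2l ?mulr_ge0 ?exprn_ge0//.
rewrite sqrtr_sqr ger0_norm// mulrDl lerD2r -[leRHS]mulrA ler_wpM2l ?exprn_ge0//.
rewrite /B3 mulrC mulr_sumr mulr_sumr; apply: ler_sum => b _; exact: (Ex_linear_abs3 nu b).2.
Qed.

End normal_linear.

Section iid_from_jets.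
Context {R : realType} {disp : measure_display} {T : measurableType disp} (P : probability T R).
Context {I : eqType} (X : I -> T -> R).
Notation g01 := (gauss 0 1 : probability R R).
Hypothesis mX : forall i, measurable_fun setT (X i).
Hypothesis jetX : forall (J : seq I) (K : R) (f f1 f2 : I -> R -> R), uniq J -> 1 <= K ->
  (forall i, jet K (f i) (f1 i) (f2 i)) ->
  Ex P (fun w => \prod_(i <- J) f i (X i w)) = \prod_(i <- J) Ex g01 (f i).

Definition step_down (n : nat) (x y : R) : R := 1 - smoothstep (n.+1%:R * y + - (n.+1%:R * x)).

Lemma step_down_jet n (x : I -> R) : exists K f1 f2, 1 <= K /\
  forall i, jet K (step_down n (x i)) (f1 i) (f2 i).
Proof.
have s1 : 1 <= n.+1%:R :> R by rewrite ler1n.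
have K1 : 1 <= 12 * n.+1%:R ^+ 3 :> R by have := exprn_ege1 3 s1; lra.
have K2 : 1 <= 2 * (12 * n.+1%:R ^+ 3) :> R by lra.
pose J i := jet_sub (jet_mono K1 (jet_one (R := R))) (jet_affine (- (n.+1%:R * x i)) s1 (jet_smoothstep (R := R))).
eexists; eexists; eexists; split; first exact: K2.
by move=> i; exact: (J i).
Qed.

Lemma step_down_cvg (x y : R) : step_down n x y @[n --> \oo] --> (\1_(`]-oo, x]%classic) y : R).
Proof.
apply/cvgrPdist_le => e e0; rewrite indicE.
have [yx|xy] := leP y x.
  rewrite mem_set/= ?in_itv//=; near=> n; rewrite /step_down.
  have hl : n.+1%:R * y + - (n.+1%:R * x) <= 0 by rewrite -mulrN -mulrDr mulr_ge0_le0//; lra.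
  by have [-> _ _] := smoothstep_left hl; rewrite subr0 subrr normr0 ltW.
rewrite memNset/=; last by rewrite in_itv/= leNgt xy.
near=> n; rewrite /step_down.
have yx0 : 0 < y - x by lra.
have hr : 3 <= n.+1%:R * y + - (n.+1%:R * x).
  rewrite -mulrN -mulrDr -ler_pdivrMr//; near: n.
  have [k _ hk] := nbhs_infty_ger (3 / (y - x)); exists k => // n /hk/= h.
  by rewrite (le_trans h)// ler_nat.
by have [-> _ _] := smoothstep_right hr; rewrite subrr subr0 normr0 ltW.
Unshelve. all: by end_near. Qed.

Lemma step_down_bound n x y : `|step_down n x y| <= 1.
Proof.
have /andP[a b] := smoothstep_bound (n.+1%:R * y + - (n.+1%:R * x)).
by rewrite /step_down ler_norml; apply/andP; split; lra.
Qed.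

Lemma cvg_prod_seq (J : seq I) (u : nat -> I -> R) (l : I -> R) :
  (forall i, u n i @[n --> \oo] --> l i) -> \prod_(i <- J) u n i @[n --> \oo] --> \prod_(i <- J) l i.
Proof.
move=> ul; elim: J => [|i J IH].
  by under eq_fun do rewrite big_nil; rewrite big_nil; exact: cvg_cst.
by under eq_fun do rewrite big_cons; rewrite big_cons; exact: cvgM.
Qed.

Lemma Ex_halflines (J : seq I) (x : I -> R) : uniq J ->
  Ex P (fun w => \prod_(i <- J) \1_(`]-oo, x i]%classic) (X i w)) = \prod_(i <- J) Ex g01 (\1_(`]-oo, x i]%classic)).
Proof.
move=> uJ.
have md n i : measurable_fun setT (step_down n (x i)).
  by have [K [f1 [f2 [_ /(_ i) j]]]] := step_down_jet n x; exact: jet_meas j.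
have c1 : Ex P (fun w => \prod_(i <- J) step_down n (x i) (X i w)) @[n --> \oo] -->
    Ex P (fun w => \prod_(i <- J) \1_(`]-oo, x i]%classic) (X i w)).
  have [//|w|n w||_ //] := @Ex_dct _ _ _ P (fun n w => \prod_(i <- J) step_down n (x i) (X i w))
    (fun w => \prod_(i <- J) \1_(`]-oo, x i]%classic) (X i w)) (fun=> 1).
  - by move=> n; apply: measurable_prod => i _; exact: measurableT_comp.
  - by apply: cvg_prod_seq => i; exact: step_down_cvg.
  - rewrite normr_prod -[leRHS](big1_eq (op := *%R) J xpredT).
    by apply: ler_prod => i _; rewrite normr_ge0 step_down_bound.
  - exact: integr_cst.
have c2 : \prod_(i <- J) Ex g01 (step_down n (x i)) @[n --> \oo] --> \prod_(i <- J) Ex g01 (\1_(`]-oo, x i]%classic)).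
  apply: (@cvg_prod_seq J (fun n i => Ex g01 (step_down n (x i)))) => i.
  have [//|w|n w||_ //] := @Ex_dct _ _ _ g01 (fun n => step_down n (x i)) (\1_(`]-oo, x i]%classic)) (fun=> 1).
  - exact: step_down_cvg.
  - exact: step_down_bound.
  - exact: integr_cst.
have E : (fun n => Ex P (fun w => \prod_(i <- J) step_down n (x i) (X i w))) =
  (fun n => \prod_(i <- J) Ex g01 (step_down n (x i))).
  apply/funext => n; have [K [f1 [f2 [K1 j]]]] := step_down_jet n x.
  by rewrite (jetX uJ K1 j).
by rewrite E in c1; rewrite -(cvg_lim (@Rhausdorff R) c1) -(cvg_lim (@Rhausdorff R) c2).
Qed.

Lemma prod_indic (J : seq I) (C : I -> set R) w :
  \prod_(i <- J) \1_(C i) (X i w) = \1_(\bigcap_(i in [set` J]) X i @^-1` C i) w :> R.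
Proof.
rewrite [RHS]indicE; have [/set_mem h|h] := boolP (w \in _).
  rewrite big_seq big1// => i iJ; rewrite indicE mem_set//; exact: (h i iJ).
have [i /andP[iJ ni]] : exists i, (i \in J) && (X i w \notin C i).
  apply/not_existsP => H; move/negP: h; apply; apply/mem_set => i /= iJ.
  apply: contrapT => nC; apply: (H i); rewrite iJ/=; apply/negP => /set_mem; exact: nC.
have z : \1_(C i) (X i w) = 0 :> R by rewrite indicE (negbTE ni).
by rewrite (perm_big _ (perm_to_rem iJ)) big_cons z; exact: mul0r.
Qed.

Let mcap (J : seq I) (C : I -> set R) : (forall i, measurable (C i)) ->
  measurable (\bigcap_(i in [set` J]) X i @^-1` C i).
Proof.
move=> mC; apply: fin_bigcap_measurable; first exact: finite_seq.
by move=> i _; rewrite -[X in measurable X]setTI; exact: mX.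
Qed.

Lemma prob_halflines (J : seq I) (x : I -> R) : uniq J ->
  P (\bigcap_(i in [set` J]) X i @^-1` `]-oo, x i]%classic) = (\prod_(i <- J) g01 `]-oo, x i]%classic)%E.
Proof.
move=> uJ; have := Ex_halflines x uJ.
have -> : (fun w => \prod_(i <- J) \1_(`]-oo, x i]%classic) (X i w)) =
    (\1_(\bigcap_(i in [set` J]) X i @^-1` `]-oo, x i]%classic) : T -> R).
  by apply/funext => w; rewrite (prod_indic J (fun i => `]-oo, x i]%classic)).
move=> E; rewrite -Ex_indic ?E; last by apply: mcap.
by rewrite -prodEFin; apply: eq_bigr => i _; rewrite -Ex_indic.
Qed.

(** [s] lists the coordinates where [C] is arbitrary; elsewhere it is a half-line. The sets are
    generalised one coordinate at a time: as functions of the set at [c], both sides are finite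
    measures that agree on half-lines. *)
Lemma prob_borel (s J : seq I) (C : I -> set R) : uniq J -> (forall i, measurable (C i)) ->
  (forall i, i \notin s -> exists x : R, C i = `]-oo, x]%classic) ->
  P (\bigcap_(i in [set` J]) X i @^-1` C i) = (\prod_(i <- J) g01 (C i))%E.
Proof.
elim: s J C => [|c s IH] J C uJ mC hC.
  have [x hx] := choice (fun i => hC i isT).
  have -> : C = fun i => `]-oo, x i]%classic by apply/funext.
  exact: prob_halflines.
pose C' A i : set R := if i == c then A else C i.
have mC' A : measurable A -> forall i, measurable (C' A i) by move=> mA i; rewrite /C'; case: ifP.
have hC' a i : i \notin s -> exists x : R, C' `]-oo, a]%classic i = `]-oo, x]%classic.
  move=> is_; rewrite /C'; case: eqVneq => [_|ic]; first by exists a.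
  by apply: hC; rewrite inE negb_or ic.
have CE : C = C' (C c) by apply/funext => i; rewrite /C'; case: eqP => // ->.
have [cJ|cJ] := boolP (c \in J); last first.
  have E i : i \in J -> C i = C' `]-oo, 0]%classic i.
    by move=> iJ; rewrite /C'; case: eqP => // ic; rewrite -ic iJ in cJ.
  rewrite (eq_bigcapr (G := fun i => X i @^-1` C' `]-oo, 0]%classic i)); last by move=> i /= /E ->.
  rewrite big_seq (eq_bigr (fun i => g01 (C' `]-oo, 0]%classic i))); last by move=> i /E ->.
  by rewrite -big_seq; apply: IH => //; [exact: mC'|exact: hC'].
pose E := \bigcap_(i in [set` rem c J]) X i @^-1` C i.
have mE : measurable E by exact: mcap.
have remc i : (i \in rem c J) = (i != c) && (i \in J) by rewrite mem_rem_uniq// inE.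
have capE A : \bigcap_(i in [set` J]) X i @^-1` C' A i = X c @^-1` A `&` E.
  apply/seteqP; split => [w h|w [hA hE] i /= iJ].
    split; first by have := h c cJ; rewrite /C' eqxx.
    by move=> i /=; rewrite remc => /andP[ic iJ]; have := h i iJ; rewrite /C' (negbTE ic).
  rewrite /C'; case: eqVneq => [->//|ic]; apply: hE => /=; by rewrite remc ic.
pose r := (\prod_(i <- rem c J) g01 (C i))%E.
have prodE A : (\prod_(i <- J) g01 (C' A i) = g01 A * r)%E.
  rewrite (perm_big _ (perm_to_rem cJ)) big_cons /C' eqxx; congr (_ * _)%E.
  by rewrite big_seq [RHS]big_seq; apply: eq_bigr => i; rewrite remc => /andP[/negbTE ->].
have r0 : (0 <= r)%E by apply: prode_ge0 => i _; exact: measure_ge0.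
have rfin : r \is a fin_num.
  rewrite /r; elim: (rem c J) => [|i s' IHs]; first by rewrite big_nil.
  by rewrite big_cons fin_numM// fin_num_measure.
pose F : {mfun T >-> R} := HB.pack (X c) (isMeasurableFun.Build _ _ _ _ _ (mX c)).
have rr : 0 <= fine r by exact: fine_ge0.
pose m1 : {measure set R -> \bar R} := pushforward (mrestr P mE) F.
pose m2 : {measure set R -> \bar R} := mscale (NngNum rr) g01.
have m1E A : m1 (mX c) A = P (X c @^-1` A `&` E) by [].
have m2E A : m2 A = (g01 A * r)%E.
  by rewrite -[LHS]/((fine r)%:E * g01 A)%E fineK// muleC.
rewrite CE capE prodE -m1E -m2E.
apply: measure_eq_halfline => //.
  rewrite m1E (le_lt_trans (probability_le1 _ _))// ?ltry//.
  by rewrite preimage_setT setTI.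
by move=> a; rewrite m1E m2E -capE -prodE; apply: IH => //; [exact: mC'|exact: hC'].
Qed.

Lemma iid_from_jets : mutually_independent P X /\ forall i, centered_gaussian P 1 (X i).
Proof.
have law i A : measurable A -> P (X i @^-1` A) = g01 A.
  move=> mA; have := @prob_borel [:: i] [:: i] (fun k => if k == i then A else `]-oo, 0]%classic) isT.
  rewrite big_seq1 eqxx => <-.
  - congr (P _); apply/seteqP; split => w /=; first by move=> Aw k /=; rewrite inE => /eqP ->; rewrite eqxx.
    by move=> /(_ i) /=; rewrite inE eqxx; apply.
  - by move=> k; case: ifP.
  - by move=> k; rewrite inE => /negbTE ->; exists 0.
split; last by move=> i; split=> // A mA; rewrite sqrtr1; exact: law.
(* Outside [J] the sets do not affect the intersection; half-lines put there bring the family into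
   the form of [prob_borel]. *)
move=> J A uJ mA; rewrite (eq_bigcapr (G := fun i => X i @^-1` (if i \in J then A i else `]-oo, 0]%classic))); last by move=> i /= ->.
rewrite (@prob_borel J J (fun i => if i \in J then A i else `]-oo, 0]%classic))//.
- rewrite big_seq [RHS]big_seq; apply: eq_bigr => i iJ; by rewrite iJ law.
- by move=> i; case: ifP.
- by move=> i /negbTE ->; exists 0.
Qed.

End iid_from_jets.

(** * Riemann-Stieltjes integrals and the cosine basis *)

Section riemann_stieltjes.
Context {R : realType}.
Local Notation mu := (@lebesgue_measure R).
Implicit Types (g a b : R -> R).

Lemma uniformly_continuous01 g : {within `[0, 1], continuous g} -> forall e : R, 0 < e ->
  exists2 d : R, 0 < d & forall x y, 0 <= x <= 1 -> 0 <= y <= 1 -> `|x - y| <= d -> `|g x - g y| <= e.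
Proof.
move=> cg e e0.
have cpt : compact `[(0 : R), 1] by exact: segment_compact.
have /compact_near_coveringP cov := cpt.
pose Q (n : nat) (x : R) := 0 <= x <= 1 -> forall y : R, 0 <= y <= 1 -> `|x - y| <= n.+1%:R^-1 -> `|g x - g y| <= e.
have [|n _ hn] := @cov nat \oo Q _.
  move=> x x01; have /subspace_continuousP/(_ x x01) := cg.
  move=> /cvgrPdist_le/(_ (e / 2)); rewrite divr_gt0// => /(_ isT).
  rewrite near_withinE => /nbhs_ballP[d /= d0 hd].
  have [N _ hN] : \forall n \near \oo, n.+1%:R^-1 <= d / 2 :> R.
    have := @cvg_harmonic R => /cvgrPdist_le/(_ (d / 2)); rewrite divr_gt0// => /(_ isT)[N _ hN].
    by exists N => // n /hN; rewrite /= sub0r normrN ger0_norm// invr_ge0.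
  exists (ball x (d / 2), [set n | (N <= n)%N]).
    by split; [apply: nbhsx_ballx; rewrite divr_gt0|exists N].
  move=> [x' n] [/= bx Nn] x'01 y y01 xy.
  have hx : `|g x - g x'| <= e / 2.
    apply: hd; last by rewrite /= in_itv.
    by move: bx; rewrite /ball/= => h; rewrite (lt_le_trans h)//; lra.
  have hy : `|g x - g y| <= e / 2.
    apply: hd; last by rewrite /= in_itv.
    have := hN n Nn; move: bx; rewrite /ball/= => h1 h2.
    by rewrite -[x](subrK x') -addrA (le_lt_trans (ler_normD _ _))//; have := le_trans xy h2; lra.
  by rewrite -[g x'](subrK (g x)) -addrA (le_trans (ler_normD _ _))// distrC; lra.
exists (n.+1%:R^-1); first by rewrite invr_gt0.
move=> x y x01 y01 xy; apply: (hn n) => //=; by rewrite in_itv.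
Qed.

Lemma bounded01 g : {within `[0, 1], continuous g} ->
  exists2 K : R, 0 <= K & forall x, 0 <= x <= 1 -> `|g x| <= K.
Proof.
move=> cg; have cn : {within `[0, 1], continuous (fun x => `|g x|)}.
  by move=> x; apply: continuous_comp; [exact: cg|exact: norm_continuous].
have [c _ hc] := EVT_max ler01 cn; exists `|g c| => // x x01; apply: hc; by rewrite in_itv.
Qed.

Lemma continuous01_interior g (x : R) : {within `[0, 1], continuous g} -> 0 < x < 1 -> {for x, continuous g}.
Proof.
move=> /(continuous_within_itvP _ ltr01)[cg _ _] x01; apply: cg; by rewrite in_itv.
Qed.

Lemma integral_mean_value g (x y : R) : {within `[0, 1], continuous g} -> 0 <= x -> x < y -> y <= 1 ->
  exists2 c, x <= c <= y & \int[mu]_(s in `[0, y]) g s - \int[mu]_(s in `[0, x]) g s = g c * (y - x).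
Proof.
move=> cg x0 xy y1.
have Ig : mu.-integrable `[0, 1] (EFin \o g) by apply: continuous_compact_integrable => //; exact: segment_compact.
pose V u := \int[mu]_(s in `[0, u]) g s.
have cV : {within `[x, y], continuous V}.
  have sub : `[x, y] `<=` `[0, 1].
    by move=> z /=; rewrite !in_itv/= => /andP[? ?]; apply/andP; split; lra.
  exact: (continuous_subspaceW sub (parameterized_integral_continuous ler01 Ig)).
have dV z : z \in `]x, y[ -> is_derive z 1 V (g z).
  rewrite in_itv/= => /andP[xz zy].
  have z1 : z < 1 by lra. have z0 : 0 < z by lra.
  have z01 : 0 < z < 1 by rewrite z0 z1.
  have [d1 d2] := continuous_FTC1_closed z1 Ig z0 (continuous01_interior cg z01).
  by apply: DeriveDef; [exact: d1|rewrite -derive1E; exact: d2].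
have [c cxy ->] := MVT xy dV cV; exists c => //.
by move: cxy; rewrite in_itv/= => /andP[? ?]; apply/andP; split; lra.
Qed.

Context (t h : R).
Hypothesis t0 : 0 <= t.
Hypothesis h0 : 0 < h.
Hypothesis th1 : t + h <= 1.

Definition node (k l : nat) : R := t + l%:R * h / k%:R.

Lemma node_step k l : (0 < k)%N -> node k l.+1 - node k l = h / k%:R.
Proof. by move=> k0; rewrite /node -natr1; field; rewrite pnatr_eq0 -lt0n. Qed.

Lemma node_range k l : (l <= k)%N -> (0 < k)%N -> t <= node k l <= t + h.
Proof.
move=> lk k0; rewrite /node lerDl mulr_ge0 ?invr_ge0 ?mulr_ge0 ?(ltW h0)//= lerD2l.
by rewrite ler_pdivrMr ?ltr0n// mulrC ler_pM2l// ler_nat.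
Qed.

Lemma node_lt k l : (0 < k)%N -> node k l < node k l.+1.
Proof. by move=> k0; rewrite -subr_gt0 node_step// divr_gt0// ltr0n. Qed.

Lemma node_01 k l : (l <= k)%N -> (0 < k)%N -> 0 <= node k l <= 1.
Proof. by move=> lk k0; have /andP[? ?] := node_range lk k0; move: (t0) (th1) => ? ?; apply/andP; split; lra. Qed.

Definition tags (p : nat -> nat -> R) : Prop :=
  forall k l, (0 < k)%N -> (l < k)%N -> node k l <= p k l <= node k l.+1.

(** The integral over the window as a difference of integrals from 0, which is how the drift of the
    observation presents it. *)
Definition area a b : R := \int[mu]_(s in `[0, t + h]) (a s * b s) - \int[mu]_(s in `[0, t]) (a s * b s).

Lemma tag_01 p k l : tags p -> (l < k)%N -> 0 <= p k l <= 1.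
Proof.
move=> tp lk; have k0 : (0 < k)%N by apply: leq_ltn_trans lk.
have /andP[? ?] := tp k l k0 lk; have /andP[? _] := node_01 (ltnW lk) k0; have /andP[_ ?] := node_01 lk k0.
by apply/andP; split; lra.
Qed.

Lemma tag_dist p q k l : tags p -> tags q -> (l < k)%N -> `|p k l - q k l| <= h / k%:R.
Proof.
move=> tp tq lk; have k0 : (0 < k)%N by apply: leq_ltn_trans lk.
have /andP[? ?] := tp k l k0 lk; have /andP[? ?] := tq k l k0 lk; have := node_step l k0.
by move=> <-; rewrite ler_norml; apply/andP; split; lra.
Qed.

Lemma mean_value_tags g : {within `[0, 1], continuous g} ->
  exists2 c, tags c & forall k l, (0 < k)%N -> (l < k)%N ->
    \int[mu]_(s in `[0, node k l.+1]) g s - \int[mu]_(s in `[0, node k l]) g s = g (c k l) * (h / k%:R).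
Proof.
move=> cg.
have H k : exists ck : nat -> R, forall l, (0 < k)%N -> (l < k)%N -> node k l <= ck l <= node k l.+1 /\
    \int[mu]_(s in `[0, node k l.+1]) g s - \int[mu]_(s in `[0, node k l]) g s = g (ck l) * (h / k%:R).
  pose Q l (x : R) := (0 < k)%N -> (l < k)%N -> node k l <= x <= node k l.+1 /\
    \int[mu]_(s in `[0, node k l.+1]) g s - \int[mu]_(s in `[0, node k l]) g s = g x * (h / k%:R).
  suff H : forall l, exists x : R, Q l x by have [ck hck] := choice H; exists ck.
  move=> l.
  have [lk|lk] := boolP ((0 < k)%N && (l < k)%N); last by exists 0 => k0 lk'; rewrite k0 lk' in lk.
  move: lk => /andP[k0 lk].
  have /andP[x0 _] := node_01 (ltnW lk) k0; have /andP[_ y1] := node_01 lk k0.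
  have [c hc E] := integral_mean_value cg x0 (node_lt l k0) y1.
  by exists c => _ _; split => //; rewrite E node_step.
have [c hc] := choice H; exists c => k l k0 lk; by have [] := hc k l k0 lk.
Qed.

Lemma nodek k : (0 < k)%N -> node k k = t + h.
Proof. by move=> k0; rewrite /node; field; rewrite pnatr_eq0 -lt0n. Qed.

Lemma node0 k : node k 0 = t. Proof. by rewrite /node !mul0r addr0. Qed.

(** The two factors may be evaluated at different points of a cell: summation by parts followed by
    the mean value theorem produces exactly such products. *)
Lemma riemann_sum_cvg a b p q : {within `[0, 1], continuous a} -> {within `[0, 1], continuous b} ->
  tags p -> tags q ->
  \sum_(l < k) a (p k l) * b (q k l) * (h / k%:R) @[k --> \oo] --> area a b.
Proof.
move=> ca cb tp tq.
have cab : {within `[0, 1], continuous (fun s => a s * b s)} by move=> x; apply: continuousM; [exact: ca|exact: cb].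
have [c tc Ec] := mean_value_tags cab.
have [Ka Ka0 aK] := bounded01 ca; have [Kb Kb0 bK] := bounded01 cb.
apply/cvgrPdist_le => e e0.
pose e' := e / (Ka + Kb + 1).
have Kp : 0 < Ka + Kb + 1 by lra.
have e'0 : 0 < e' by rewrite divr_gt0.
have [da da0 hda] := uniformly_continuous01 ca e'0; have [db db0 hdb] := uniformly_continuous01 cb e'0.
have d0 : 0 < Num.min da db by rewrite lt_min da0 db0.
have [N _ hN] := nbhs_infty_ger (h / Num.min da db).
near=> k; have k0 : (0 < k)%N by near: k; exists 1%N.
have kd : h / k%:R <= Num.min da db.
  have : h / Num.min da db <= k%:R by near: k; exists N => // k /hN.
  by rewrite ler_pdivrMr// => hk; rewrite ler_pdivrMr ?ltr0n// mulrC.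
have -> : area a b = \sum_(l < k) a (c k l) * b (c k l) * (h / k%:R).
  rewrite /area -(nodek k0) -{1}(node0 k).
  rewrite -(telescope_sumr (fun l => \int[mu]_(s in `[0, node k l]) (a s * b s)) (leq0n k)) big_mkord.
  by apply: eq_bigr => l _; exact: Ec.
rewrite -sumrB (le_trans (ler_norm_sum _ _ _))//.
rewrite (le_trans (y := \sum_(l < k) e / k%:R))//; last first.
  by rewrite sumr_const card_ord -[leLHS]mulr_natl mulrCA divff ?mulr1// pnatr_eq0 -lt0n.
apply: ler_sum => l _; rewrite -mulrBl normrM [X in _ * X]ger0_norm ?divr_ge0 ?(ltW h0)//.
have l1 : (l < k)%N by [].
have d1 : `|a (c k l) - a (p k l)| <= e'.
  apply: hda; [exact: tag_01|exact: tag_01|].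
  by rewrite (le_trans (tag_dist tc tp l1))// (le_trans kd)// ge_min lexx.
have d2 : `|b (c k l) - b (q k l)| <= e'.
  apply: hdb; [exact: tag_01|exact: tag_01|].
  by rewrite (le_trans (tag_dist tc tq l1))// (le_trans kd)// ge_min lexx orbT.
have A : `|a (c k l) * b (c k l) - a (p k l) * b (q k l)| <= e.
  rewrite (_ : _ - _ = (a (c k l) - a (p k l)) * b (c k l) + a (p k l) * (b (c k l) - b (q k l))); last by ring.
  rewrite (le_trans (ler_normD _ _))// !normrM.
  have := ler_pM (normr_ge0 _) (normr_ge0 _) d1 (bK _ (tag_01 tc l1)).
  have := ler_pM (normr_ge0 _) (normr_ge0 _) (aK _ (tag_01 tp l1)) d2.
  have : e' * (Ka + Kb + 1) = e by rewrite /e' divfK// gt_eqF.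
  by have := ltW e'0; lra.
have h1 : h <= 1 by move: (t0) (th1) => ? ?; lra.
apply: ler_pM => //; first by rewrite divr_ge0// ltW.
by rewrite ler_piMl ?invr_ge0.
Unshelve. all: by end_near. Qed.

Lemma left_tags : tags node.
Proof. by move=> k l k0 _; rewrite lexx ltW ?node_lt. Qed.

Lemma right_tags : tags (fun k l => node k l.+1).
Proof. by move=> k l k0 _; rewrite lexx ltW ?node_lt. Qed.

Lemma integral_sum_cvg a b : {within `[0, 1], continuous a} -> {within `[0, 1], continuous b} ->
  \sum_(l < k) a (node k l) *
    (\int[mu]_(s in `[0, node k l.+1]) b s - \int[mu]_(s in `[0, node k l]) b s) @[k --> \oo] --> area a b.
Proof.
move=> ca cb; have [c tc Ec] := mean_value_tags cb.
have := riemann_sum_cvg ca cb left_tags tc; apply: cvg_trans; apply: near_eq_cvg.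
near=> k; have k0 : (0 < k)%N by near: k; exists 1%N.
by apply: eq_bigr => -[l lk] _ /=; rewrite Ec// -mulrA.
Unshelve. all: by end_near. Qed.

Lemma derive_tags (F f : R -> R) : (forall s : R, is_derive s 1 F (f s)) ->
  exists2 c, tags c & forall k l, (0 < k)%N -> (l < k)%N ->
    F (node k l.+1) - F (node k l) = f (c k l) * (h / k%:R).
Proof.
move=> dF.
have H k : exists ck : nat -> R, forall l, (0 < k)%N -> (l < k)%N -> node k l <= ck l <= node k l.+1 /\
    F (node k l.+1) - F (node k l) = f (ck l) * (h / k%:R).
  pose Q l (x : R) := (0 < k)%N -> (l < k)%N -> node k l <= x <= node k l.+1 /\
    F (node k l.+1) - F (node k l) = f x * (h / k%:R).
  suff H : forall l, exists x : R, Q l x by have [ck hck] := choice H; exists ck.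
  move=> l.
  have [k0|k0] := posnP k; first by exists 0; rewrite /Q k0.
  have cF : {within `[node k l, node k l.+1], continuous F}.
    by apply: continuous_subspaceT => s; apply/differentiable_continuous/derivable1_diffP; have [] := dF s.
  have [c ci E] := MVT (node_lt l k0) (fun x _ => dF x) cF.
  exists c => _ lk; split; last by rewrite E node_step.
  by move: ci; rewrite in_itv/= => /andP[/ltW-> /ltW->].
have [c hc] := choice H; exists c => k l k0 lk; by have [] := hc k l k0 lk.
Qed.

Definition stieltjes (F f x : R -> R) : R := F (t + h) * x (t + h) - F t * x t - area f x.

(** Abel summation moves the increments from [x], whose variation may be infinite, to the smooth
    [F], where the mean value theorem makes them terms of a Riemann sum. Left sums of [F] yield
    right values of [x], and conversely. *)
Lemma stieltjes_cvg (F f x : R -> R) : (forall s : R, is_derive s 1 F (f s)) ->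
  {within `[0, 1], continuous f} -> {within `[0, 1], continuous x} ->
  \sum_(l < k) F (node k l) * (x (node k l.+1) - x (node k l)) @[k --> \oo] --> stieltjes F f x /\
  \sum_(l < k) F (node k l.+1) * (x (node k l.+1) - x (node k l)) @[k --> \oo] --> stieltjes F f x.
Proof.
move=> dF cf cx; have [c tc Ec] := derive_tags dF.
have L := cvgB (cvg_cst (F (t + h) * x (t + h) - F t * x t)) (riemann_sum_cvg cf cx tc left_tags).
have Rr := cvgB (cvg_cst (F (t + h) * x (t + h) - F t * x t)) (riemann_sum_cvg cf cx tc right_tags).
have T k : (0 < k)%N -> F (t + h) * x (t + h) - F t * x t =
    \sum_(l < k) (F (node k l.+1) * x (node k l.+1) - F (node k l) * x (node k l)).
  move=> k0; rewrite -(nodek k0) -(node0 k).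
  by rewrite -(telescope_sumr (fun l => F (node k l) * x (node k l)) (leq0n k)) big_mkord.
split.
  apply: cvg_trans (Rr _ _); apply: near_eq_cvg; near=> k; have k0 : (0 < k)%N by near: k; exists 1%N.
  rewrite /= -[LHS]/(_ - _) (T k k0) -sumrB; apply: eq_bigr => l _.
  rewrite mulrAC -(Ec k l)//; ring.
apply: cvg_trans (L _ _); apply: near_eq_cvg; near=> k; have k0 : (0 < k)%N by near: k; exists 1%N.
rewrite /= -[LHS]/(_ - _) (T k k0) -sumrB; apply: eq_bigr => l _.
rewrite mulrAC -(Ec k l)//; ring.
Unshelve. all: by end_near. Qed.

Definition cosine (j : nat) (s : R) : R := cos (j%:R * pi * (s - t) / h).
Definition sine (j : nat) (s : R) : R := sin (j%:R * pi * (s - t) / h).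

Lemma is_derive_phase (j : nat) (s : R) :
  is_derive s 1 (fun s : R => j%:R * pi * (s - t) / h) (j%:R * pi / h).
Proof.
have D := is_deriveM1 (is_deriveD1 (is_derive_id s (1 : R)) (is_derive_cst (- t) s 1)) (is_derive_cst (j%:R * pi / h) s 1).
have E : (fun s : R => j%:R * pi * (s - t) / h) = (fun y => (y + cst (- t) y) * cst (j%:R * pi / h) y).
  by apply/funext => y /=; ring.
by rewrite E; apply: (is_derive_eq D); rewrite mulr0 !addr0 mul1r.
Qed.

Lemma is_derive_cosine (j : nat) (s : R) : is_derive s 1 (cosine j) (- (j%:R * pi / h) * sine j s).
Proof.
apply: (is_derive_eq (is_derive1_comp (is_derive_cos _) (is_derive_phase j s))).
by rewrite /sine mulNr mulNr mulrC.
Qed.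

Lemma is_derive_sine (j : nat) (s : R) : is_derive s 1 (sine j) (j%:R * pi / h * cosine j s).
Proof.
apply: (is_derive_eq (is_derive1_comp (is_derive_sin _) (is_derive_phase j s))).
by rewrite /cosine mulrC.
Qed.

Lemma continuous_cosine (j : nat) : continuous (cosine j).
Proof.
by move=> s; apply/differentiable_continuous/derivable1_diffP; have [] := is_derive_cosine j s.
Qed.

Lemma continuous_sine (j : nat) : continuous (sine j).
Proof.
by move=> s; apply/differentiable_continuous/derivable1_diffP; have [] := is_derive_sine j s.
Qed.

Lemma derive1_Phi (j : nat) (s : R) :
  derive1 (Phi t h j) s = j%:R * pi / h * (Num.sqrt (2 / h) * cosine j s).
Proof.
have D := is_deriveZ1 (Num.sqrt (2 / h)) (is_derive_sine j s).
by rewrite derive1E /Phi; have [_ ->] := D; rewrite mulrCA.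
Qed.

Lemma sine_ends (j : nat) : sine j t = 0 /\ sine j (t + h) = 0.
Proof.
rewrite /sine subrr mulr0 mul0r sin0 addrAC subrr add0r mulfK ?gt_eqF//; split=> //.
elim: j => [|j IH]; first by rewrite mul0r sin0.
by rewrite -natr1 mulrDl mul1r sinDpi IH oppr0.
Qed.

Definition cos_basis (j : nat) (s : R) : R := (if j == 0%N then (Num.sqrt h)^-1 else Num.sqrt (2 / h)) * cosine j s.
Definition sine_basis (j : nat) (s : R) : R := Num.sqrt (2 / h) * sine j s.

Definition cos_integral {d : nat} (j : nat) (x : R -> 'cV[R]_d) : 'cV[R]_d := \col_i limn (fun k =>
  \sum_(l < k) cos_basis j (node k l) * (x (node k l.+1) i 0 - x (node k l) i 0)).
Definition sin_integral {d : nat} (j : nat) (x : R -> 'cV[R]_d) : 'cV[R]_d := \col_i limn (fun k =>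
  \sum_(l < k) sine_basis j (node k l.+1) * (x (node k l.+1) i 0 - x (node k l) i 0)).

Lemma continuous_cos_basis (j : nat) : continuous (cos_basis j).
Proof. by move=> s; apply: cvgM; [exact: cvg_cst|exact: continuous_cosine]. Qed.

Section path.
Context (d : nat) (x : R -> 'cV[R]_d) (i : 'I_d).
Hypothesis cx : {within `[0, 1], continuous (fun s => x s i 0)}.

Lemma cos_integral_cvg (j : nat) :
  \sum_(l < k) cos_basis j (node k l) * (x (node k l.+1) i 0 - x (node k l) i 0) @[k --> \oo] --> cos_integral j x i 0.
Proof.
rewrite mxE; set c := if j == 0%N then (Num.sqrt h)^-1 else Num.sqrt (2 / h).
have dC (s : R) : is_derive s 1 (cos_basis j) (c * (- (j%:R * pi / h) * sine j s)).
  exact: (is_deriveZ1 c (is_derive_cosine j s)).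
have cg : {within `[0, 1], continuous (fun s => c * (- (j%:R * pi / h) * sine j s))}.
  apply: continuous_subspaceT => s.
  by apply: cvgM; [exact: cvg_cst|apply: cvgM; [exact: cvg_cst|exact: continuous_sine]].
have [sW _] := stieltjes_cvg dC cg cx.
by rewrite (cvg_lim _ sW).
Qed.

(** The sine vanishes at both ends of the window, so integration by parts leaves no boundary term:
    the level of [X] disappears, and its increments, which the bound on [Sigma] controls, remain. *)
Lemma sin_integral_area (j : nat) : (0 < j)%N ->
  \sum_(l < k) sine_basis j (node k l.+1) * (x (node k l.+1) i 0 - x (node k l) i 0) @[k --> \oo] -->
    sin_integral j x i 0 /\
  - sin_integral j x i 0 = area (fun s => j%:R * pi / h * cos_basis j s) (fun s => x s i 0).
Proof.
rewrite mxE lt0n => /negbTE j0.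
have dF (s : R) : is_derive s 1 (sine_basis j) (j%:R * pi / h * cos_basis j s).
  rewrite /cos_basis j0.
  by apply: (is_derive_eq (is_deriveZ1 (Num.sqrt (2 / h)) (is_derive_sine j s))); rewrite mulrCA.
have cf : {within `[0, 1], continuous (fun s => j%:R * pi / h * cos_basis j s)}.
  by apply: continuous_subspaceT => s; apply: cvgM; [exact: cvg_cst|exact: continuous_cos_basis].
have [_ sX] := stieltjes_cvg dF cf cx.
rewrite (cvg_lim _ sX)//; split=> //.
have [s0 sh] := sine_ends j.
by rewrite /stieltjes /sine_basis s0 sh !mulr0 !mul0r subrr sub0r opprK.
Qed.

End path.

(* Integrating by parts replaces the drift of the observation by the increments of X. *)
Lemma S_stat_decomposition (d : nat) (X W y : R -> 'cV[R]_d) (cn : R) (j : nat) : (0 < j)%N ->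
  (forall i, {within `[0, 1], continuous (fun s => X s i 0)}) ->
  (forall i, {within `[0, 1], continuous (fun s => W s i 0)}) ->
  (forall u i, y u i 0 = \int[mu]_(s in `[0, u]) X s i 0 + cn * W u i 0) ->
  S_stat t h y j = - sin_integral j X + (cn * (j%:R * pi / h)) *: cos_integral j W.
Proof.
move=> j0 cX cW Ey; apply/colP => i; rewrite [LHS]mxE !mxE -[limn _]/(limn _).
have [_ eX] := sin_integral_area (cX i) j0.
have sW := cos_integral_cvg (j := j) (cW i).
have cf : {within `[0, 1], continuous (fun s => j%:R * pi / h * cos_basis j s)}.
  by apply: continuous_subspaceT => s; apply: cvgM; [exact: cvg_cst|exact: continuous_cos_basis].
have iX := integral_sum_cvg cf (cX i).
have L := cvgD iX (cvgM (cvg_cst (cn * (j%:R * pi / h))) sW).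
move: eX sW L; rewrite !mxE => eX sW L; rewrite eX.
apply: cvg_lim => //.
apply: cvg_trans (L _ _ _); apply: near_eq_cvg; near=> k.
rewrite /= -[LHS]/(_ + _ * _) mulr_sumr -big_split/=; apply: eq_bigr => l _.
rewrite -/(node k l.+1) -/(node k l) !Ey derive1_Phi /cos_basis (gtn_eqF j0); ring.
Unshelve. all: by end_near. Qed.

Lemma area_antiderivative (a b F : R -> R) : {within `[0, 1], continuous a} -> {within `[0, 1], continuous b} ->
  (forall s : R, is_derive s 1 F (a s * b s)) -> area a b = F (t + h) - F t.
Proof.
move=> ca cb dF; have [c tc Ec] := derive_tags dF.
have L := riemann_sum_cvg ca cb tc tc.
have L' : (fun=> F (t + h) - F t) @ \oo --> area a b.
  apply: cvg_trans L; apply: near_eq_cvg; near=> k; have k0 : (0 < k)%N by near: k; exists 1%N.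
  rewrite -(nodek k0) -(node0 k) -(telescope_sumr (fun l => F (node k l)) (leq0n k)) big_mkord.
  by apply: eq_bigr => -[l lk] _ /=; rewrite -Ec.
exact: (cvg_unique _ L' (cvg_cst _)).
Unshelve. all: by end_near. Qed.

Definition cosine_primitive (j : nat) (s : R) : R := if j == 0%N then s else h / (j%:R * pi) * sine j s.

Lemma is_derive_cosine_primitive (j : nat) (s : R) : is_derive s 1 (cosine_primitive j) (cosine j s).
Proof.
rewrite /cosine_primitive; case: (posnP j) => [->|j0].
  rewrite /= /cosine !mul0r cos0; exact: is_derive_id.
apply: (is_derive_eq (is_deriveZ1 _ (is_derive_sine j s))).
have p0 : (pi : R) != 0 by rewrite gt_eqF ?pi_gt0.
have jn : (j%:R : R) != 0 by rewrite gt_eqF ?ltr0n.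
have hn : h != 0 by rewrite gt_eqF.
have a0 : (j%:R * pi : R) != 0 by rewrite mulf_neq0.
by rewrite mulrA (mulrA (h / _)) divfK// divff// mul1r.
Qed.

Lemma cosine_primitive_ends (j : nat) : cosine_primitive j (t + h) - cosine_primitive j t = h * (j == 0%N)%:R.
Proof.
rewrite /cosine_primitive; have [-> ->] := sine_ends j.
by case: (j == 0%N); rewrite ?mulr0 ?subrr// mulr1 addrAC subrr add0r.
Qed.

(** With truncated subtraction, [j - k + (k - j)] is the distance between [j] and [k]. *)
Lemma cosine_mul (j k : nat) (s : R) :
  cosine j s * cosine k s = (cosine (j - k + (k - j)) s + cosine (j + k) s) / 2.
Proof.
wlog jk : j k / (k <= j)%N => [H|].
  by case: (leqP k j) => [/H//|/ltnW/H]; rewrite mulrC => ->; rewrite addnC [(k + j)%N]addnC.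
rewrite (eqP (_ : k - j == 0)%N) ?subn_eq0// addn0 /cosine natrD natrB//.
rewrite (_ : (j%:R - k%:R) * pi * (s - t) / h = j%:R * pi * (s - t) / h - k%:R * pi * (s - t) / h); last by ring.
rewrite (_ : (j%:R + k%:R) * pi * (s - t) / h = j%:R * pi * (s - t) / h + k%:R * pi * (s - t) / h); last by ring.
by rewrite cosB cosD; field.
Qed.

Lemma cos_basis_orthonormal (j k : nat) : area (cos_basis j) (cos_basis k) = (j == k)%:R.
Proof.
set c := fun j : nat => if j == 0%N then (Num.sqrt h)^-1 else Num.sqrt (2 / h).
pose F s := c j * c k / 2 * (cosine_primitive (j - k + (k - j)) s + cosine_primitive (j + k) s).
have dF (s : R) : is_derive s 1 F (cos_basis j s * cos_basis k s).
  apply: (is_derive_eq (is_deriveZ1 _ (is_deriveD1 (is_derive_cosine_primitive _ s) (is_derive_cosine_primitive _ s)))).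
  rewrite (_ : cos_basis j s * cos_basis k s = c j * c k * (cosine j s * cosine k s)); last by rewrite /cos_basis -/(c j) -/(c k); ring.
  by rewrite cosine_mul; ring.
rewrite (area_antiderivative _ _ dF); do ?[exact: continuous_subspaceT (@continuous_cos_basis _)].
rewrite /F -mulrBr [X in _ * X](_ : _ = h * ((j - k + (k - j) == 0)%N%:R + (j + k == 0)%N%:R)); last first.
  by rewrite mulrDr -!cosine_primitive_ends; ring.
have -> : (j - k + (k - j) == 0)%N = (j == k) by lia.
case: eqP => [->|jk]; last by rewrite (_ : (j + k == 0)%N = false); [rewrite addr0 !mulr0|lia].
have [->|k0] := posnP k.
  by rewrite /c /= -invfM -expr2 sqr_sqrtr ?ltW//; field; rewrite gt_eqF.
rewrite /c (gtn_eqF k0) (_ : (k + k == 0)%N = false) ?addr0; last by lia.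
rewrite -expr2 sqr_sqrtr; last by rewrite divr_ge0// ltW.
by field; rewrite gt_eqF.
Qed.

End riemann_stieltjes.

Section coordinates.
Context {R : realType} {disp : measure_display} {T : measurableType disp} (P : probability T R).
Notation g01 := (gauss 0 1 : probability R R).

Lemma jet_lipschitz (K : R) (f f1 f2 : R -> R) (x y : R) : jet K f f1 f2 -> `|y - x| <= 1 -> `|f y - f x| <= 3 * K * `|y - x|.
Proof.
case=> _ _ _ _ f1K f2K tay; have := tay x (y - x); rewrite addrCA subrr addr0 => H.
have K0 : 0 <= K by rewrite (le_trans (normr_ge0 _) (f1K 0)).
rewrite (_ : f y - f x = (f y - f x - f1 x * (y - x) - f2 x * (y - x) ^+ 2 / 2) + (f1 x * (y - x) + f2 x / 2 * (y - x) ^+ 2)); last by ring.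
have H2 : `|f1 x * (y - x) + f2 x / 2 * (y - x) ^+ 2| <= `|f1 x| * `|y - x| + `|f2 x| * `|2^-1| * `|y - x| ^+ 2.
  by rewrite -normrX -!normrM; exact: ler_normD.
move=> y1.
apply: (le_trans (ler_normD _ _)); apply: (le_trans (lerD H H2)); move: {H H2} y1.
have n0 := normr_ge0 (y - x); move: (`|y - x|) n0 => u u0 u1.
have a1 : `|f1 x| * u <= K * u by rewrite ler_wpM2r.
have u2 : u ^+ 2 <= u by rewrite expr2 ler_piMl.
have u3 : u ^+ 3 <= u by rewrite exprS (le_trans _ u2)// expr2 ler_wpM2l.
have a2 : `|f2 x| * `|2^-1| * u ^+ 2 <= K * u.
  by rewrite ger0_norm ?invr_ge0// ler_pM ?mulr_ge0 ?invr_ge0 ?sqr_ge0// (le_trans _ (f2K x))// ler_piMr//; lra.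
have a3 : K * u ^+ 3 <= K * u by rewrite ler_wpM2l.
lra.
Qed.

Lemma jet_continuous (K : R) (f f1 f2 : R -> R) : jet K f f1 f2 -> continuous f.
Proof.
move=> jf x; apply/cvgrPdist_le => e e0.
have K0 : 0 <= K by have [_ _ _ fK _ _ _] := jf; rewrite (le_trans (normr_ge0 _) (fK 0)).
have Kp : 0 < 3 * K + 1 by lra.
have d0 : 0 < Num.min 1 (e / (3 * K + 1)) by rewrite lt_min ltr01 divr_gt0.
apply/nbhs_ballP; exists (Num.min 1 (e / (3 * K + 1))) => // y; rewrite /ball/= lt_min => /andP[y1 ye].
rewrite distrC in y1 ye; rewrite distrC (le_trans (jet_lipschitz jf (ltW y1)))//.
move: ye; rewrite ltr_pdivlMr// => ye; rewrite (le_trans _ (ltW ye))// mulrC ler_wpM2l//; lra.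
Qed.

Lemma mutually_independent_comp (I I' : eqType) (X : I -> T -> R) (phi : I' -> I) (psi : I -> I') (g : I' -> R -> R) :
  cancel phi psi -> (forall i, measurable_fun setT (g i)) -> mutually_independent P X ->
  mutually_independent P (fun i w => g i (X (phi i) w)).
Proof.
move=> phiK mg ind J A uJ mA.
have mgA i : measurable (g i @^-1` A i) by rewrite -[X in measurable X]setTI; exact: mg.
have u' : uniq (map phi J) by rewrite map_inj_uniq//; exact: can_inj phiK.
have := ind (map phi J) (fun i => g (psi i) @^-1` A (psi i)) u' (fun i => mgA (psi i)).
rewrite big_map; under [X in _ = X -> _]eq_bigr do rewrite phiK.
move=> <-; congr (P _); apply/seteqP; split => w /= H i /=.
  by move=> /mapP[j jJ ->]; rewrite phiK; exact: (H j jJ).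
by move=> iJ; have := H (phi i) (map_f phi iJ); rewrite /= phiK.
Qed.

Lemma cvg_sum_seq (I : Type) (J : seq I) (u : nat -> I -> R) (l : I -> R) :
  (forall i, u n i @[n --> \oo] --> l i) -> \sum_(i <- J) u n i @[n --> \oo] --> \sum_(i <- J) l i.
Proof.
move=> ul; elim: J => [|i J IH].
  by under eq_fun do rewrite big_nil; rewrite big_nil; exact: cvg_cst.
by under eq_fun do rewrite big_cons; rewrite big_cons; exact: cvgD.
Qed.

Lemma le_of_sqrt_decay (x y c : R) : (forall N, x <= c / Num.sqrt N.+1%:R + y) -> x <= y.
Proof.
move=> H; apply/ler_addgt0Pr => e e0.
have [N _ /(_ N (leqnn N)) hN] := nbhs_infty_ger ((c / e) ^+ 2).
rewrite (le_trans (H N))// addrC lerD2l ler_pdivrMr ?sqrtr_gt0// mulrC -ler_pdivrMr//.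
rewrite (le_trans (ler_norm _))// -sqrtr_sqr ler_sqrt// (le_trans hN)// ler_nat//.
Qed.

Context {d m : nat} (W : R -> T -> 'cV[R]_d) (t h : R) (U : 'M[R]_(d, m)).
Hypothesis bW : brownian_motion P W.
Hypothesis t0 : 0 <= t.
Hypothesis h0 : 0 < h.
Hypothesis th1 : t + h <= 1.
Hypothesis UU : U^T *m U = 1%:M.

Definition noise_vector (j : nat) (w : T) : 'cV[R]_m := U^T *m cos_integral t h j (fun s => W s w).

Definition noise_sum (k : nat) (a : nat * 'I_m) (w : T) : R := \sum_(q : 'I_k * 'I_d)
  cos_basis t h a.1 (node t h k q.1) * U q.2 a.2 * (W (node t h k q.1.+1) w q.2 0 - W (node t h k q.1) w q.2 0).

Lemma noise_sum_cvg (a : nat * 'I_m) w : noise_sum k a w @[k --> \oo] --> noise_vector a.1 w a.2 0.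
Proof.
have [_ _ cW _] := bW.
rewrite /noise_vector mxE.
have L : \sum_p U p a.2 * \sum_(l < k) cos_basis t h a.1 (node t h k l) * (W (node t h k l.+1) w p 0 - W (node t h k l) w p 0)
    @[k --> \oo] --> \sum_p U^T a.2 p * cos_integral t h a.1 (fun s => W s w) p 0.
  apply: cvg_sum_seq => p; rewrite mxE; apply: cvgM; first exact: cvg_cst.
  exact: (cos_integral_cvg (x := fun s => W s w) t0 h0 th1 (cW w p)).
apply: cvg_trans L; apply: near_eq_cvg; near=> k.
rewrite /noise_sum -(pair_bigA _ (fun (l : 'I_k) (p : 'I_d) => cos_basis t h a.1 (node t h k l) * U p a.2 * (W (node t h k l.+1) w p 0 - W (node t h k l) w p 0)))/=.
rewrite exchange_big/=; apply: eq_bigr => p _; rewrite mulr_sumr; apply: eq_bigr => l _; ring.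
Unshelve. all: by end_near. Qed.

Lemma measurable_W (s : R) (p : 'I_d) : 0 <= s <= 1 -> measurable_fun setT (fun w => W s w p 0).
Proof. by move=> s01; have [mW _ _ _] := bW; exact: mW. Qed.

Lemma measurable_noise_sum k a : measurable_fun setT (noise_sum k a).
Proof.
apply: measurable_sum => -[[l lk] p]; apply: measurable_funM => //=.
have k0 : (0 < k)%N by apply: leq_ltn_trans lk.
by apply: measurable_funB; apply: measurable_W; apply: node_01 => //; exact: ltnW.
Qed.

Lemma measurable_noise_vector j i : measurable_fun setT (fun w => noise_vector j w i 0).
Proof.
apply: (measurable_fun_cvg (fun k => measurable_noise_sum k (j, i))) => w _.
by have := @noise_sum_cvg (j, i) w.
Qed.

Definition gram_error (k : nat) (a b : nat * 'I_m) : R :=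
  `|(a.2 == b.2)%:R * \sum_(l < k) cos_basis t h a.1 (node t h k l) * cos_basis t h b.1 (node t h k l) * (h / k%:R) - (a == b)%:R|.

Lemma gram_error_cvg a b : gram_error k a b @[k --> \oo] --> (0 : R).
Proof.
have cb j : {within `[0, 1], continuous (cos_basis t h j)} by apply: continuous_subspaceT; exact: continuous_cos_basis.
have := riemann_sum_cvg t0 h0 th1 (cb a.1) (cb b.1) (left_tags t h0) (left_tags t h0).
rewrite cos_basis_orthonormal// => L.
rewrite (_ : 0 = `|(a.2 == b.2)%:R * (a.1 == b.1)%:R - (a == b)%:R| :> R); last first.
  by rewrite -natrM mulnb andbC -pair_eqE subrr normr0.
apply: cvg_norm; apply: cvgB; last exact: cvg_cst.
by apply: cvgM; [exact: cvg_cst|exact: L].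
Qed.

(* Subdividing each increment into N + 1 further ones turns the Gaussian sum into a normalised sum of many
   small terms, to which the Lindeberg bound applies. *)
Lemma noise_sum_jets (k : nat) (J : seq (nat * 'I_m)) (K : R) (f f1 f2 : nat * 'I_m -> R -> R) :
  (0 < k)%N -> uniq J -> 1 <= K -> (forall i, jet K (f i) (f1 i) (f2 i)) ->
  `|Ex P (fun w => \prod_(a <- J) f a (noise_sum k a w)) - \prod_(a <- J) Ex g01 (f a)| <=
  (size J)%:R ^+ 2 * K ^+ (size J) * \sum_(a <- J) \sum_(b <- J) gram_error k a b.
Proof.
move=> k0 uJ K1 jf.
pose n := size J; pose e (b : 'I_n) := tnth (in_tuple J) b.
have e_inj b c : (e b == e c) = (b == c).
  by rewrite /e !(tnth_nth (e b))/= nth_uniq.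
pose a (b : 'I_n) (q : 'I_k * 'I_d) := Num.sqrt (h / k%:R) * (cos_basis t h (e b).1 (node t h k q.1) * U q.2 (e b).2).
pose er := \sum_(a <- J) \sum_(b <- J) gram_error k a b.
have er0 : 0 <= er by apply: sumr_ge0 => b _; apply: sumr_ge0 => c _; exact: normr_ge0.
have hk : 0 < h / k%:R by rewrite divr_gt0// ltr0n.
have gram_a b c : `|\sum_q a b q * a c q - (b == c)%:R| <= er.
  have -> : \sum_q a b q * a c q = ((e b).2 == (e c).2)%:R *
      \sum_(l < k) cos_basis t h (e b).1 (node t h k l) * cos_basis t h (e c).1 (node t h k l) * (h / k%:R).
    have -> : ((e b).2 == (e c).2)%:R = \sum_p U p (e b).2 * U p (e c).2.
      have := congr1 (fun A : 'M[R]_m => A (e b).2 (e c).2) UU; rewrite !mxE => <-.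
      by apply: eq_bigr => p _; rewrite mxE.
    rewrite mulr_sumr -(pair_bigA _ (fun (l : 'I_k) (p : 'I_d) => a b (l, p) * a c (l, p)))/=.
    apply: eq_bigr => l _; rewrite mulr_suml; apply: eq_bigr => p _.
    rewrite /a /= -{3}(sqr_sqrtr (ltW hk)); ring.
  rewrite -e_inj -[X in X <= _]/(gram_error k (e b) (e c)) /er.
  rewrite (big_rem (e b)) ?mem_tnth//= (big_rem (e c)) ?mem_tnth//= -addrA lerDl.
  by apply: addr_ge0; [|apply: sumr_ge0 => ? _]; apply: sumr_ge0 => ? _; exact: normr_ge0.
rewrite big_tnth.
have -> : (fun w => \prod_(a <- J) f a (noise_sum k a w)) = fun w => \prod_b f (e b) (noise_sum k (e b) w).
  by apply/funext => w; rewrite big_tnth.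
(* The left-hand side does not involve the refinement [N]; letting it grow leaves only the defect of
   orthonormality on the grid of [k] cells. *)
apply: (@le_of_sqrt_decay _ _ (n%:R ^+ 3 * K ^+ n *
  (n%:R ^+ 3 * (#|{: 'I_k * 'I_d}|%:R ^+ 3 * \sum_b \sum_q `|a b q| ^+ 3 * gauss_abs3) + (1 + gauss_abs3) ^+ 3))) => N.
pose KK := (k * N.+1)%N.
have KK0 : (0 < KK)%N by rewrite muln_gt0 k0.
pose u l := node t h KK l.
have hKK : 0 < h / KK%:R by rewrite divr_gt0// ltr0n.
have [_ _ _ incW] := bW.
have u01 l : (l <= KK)%N -> 0 <= u l <= 1 by move=> lK; exact: node_01.
have [indW lawW] := incW KK u (proj1 (andP (u01 0%N isT))) (proj2 (andP (u01 KK (leqnn _)))) (fun l _ => node_lt t h0 l KK0).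
have step l : u l.+1 - u l = h / KK%:R by exact: node_step.
have idx (nu : 'I_N.+1) (l : 'I_k) : (l * N.+1 + nu < KK)%N.
  rewrite (@leq_trans (l.+1 * N.+1))// ?leq_mul2r ?ltn_ord ?orbT//.
  by rewrite mulSn addnC ltn_add2r ltn_ord.
pose phi (i : 'I_N.+1 * ('I_k * 'I_d)) : 'I_d * 'I_KK := (i.2.2, Ordinal (idx i.1 i.2.1)).
have idy (l : 'I_KK) : (l %/ N.+1 < k)%N by rewrite ltn_divLR// ltn_ord.
pose psi (i : 'I_d * 'I_KK) : 'I_N.+1 * ('I_k * 'I_d) := (inord (i.2 %% N.+1), (Ordinal (idy i.2), i.1)).
have phiK : cancel phi psi.
  move=> [nu [l p]]; rewrite /phi /psi /=; congr (_, (_, _)); apply: val_inj => /=.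
    by rewrite modnMDl modn_small ?ltn_ord// inordK ?ltn_ord.
  by rewrite divnMDl// divn_small ?ltn_ord// addn0.
pose Y (i : 'I_N.+1 * ('I_k * 'I_d)) (w : T) := (Num.sqrt (h / KK%:R))^-1 *
  (W (u (phi i).2.+1) w (phi i).1 0 - W (u (phi i).2) w (phi i).1 0).
have gY i := centered_gaussian_law hKK (eq_rect _ (fun v => centered_gaussian P v _) (lawW (phi i).1 (phi i).2) _ (step (phi i).2)).
have mY i : measurable_fun setT (Y i) by exact: (gY i).1.
have indY : mutually_independent P Y.
  have mg (i : 'I_N.+1 * ('I_k * 'I_d)) : measurable_fun setT (fun x : R => (Num.sqrt (h / KK%:R))^-1 * x).
    exact: measurable_funM.
  exact: (mutually_independent_comp phiK mg indW).
have lawY i (g : R -> R) : measurable_fun setT g -> integr g01 g -> integr P (g \o Y i) /\ Ex P (g \o Y i) = Ex g01 g.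
  exact: (gY i).2.
have := normal_linear mY indY lawY er0 gram_a K1 (fun b => jf (e b)).
rewrite card_ord; apply: le_trans; rewrite le_eqVlt; apply/orP; left; apply/eqP; congr (`| _ - _|).
congr (Ex P _); apply/funext => w; apply: eq_bigr => b _; congr (f _ _).
apply: eq_bigr => -[l p] _; rewrite /a /=.
have -> : \sum_(nu < N.+1) Y (nu, (l, p)) w = (Num.sqrt (h / KK%:R))^-1 * (W (node t h k l.+1) w p 0 - W (node t h k l) w p 0).
  have nodeE l' : node t h k l' = u (l' * N.+1)%N.
    rewrite /u /node /KK !natrM; congr (_ + _).
    have E (x y z v : R) : y != 0 -> v != 0 -> x * z / y = x * v * z / (y * v) by move=> y0 v0; field; rewrite y0 v0.
    by apply: E; rewrite pnatr_eq0 -?lt0n.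
  rewrite /Y -mulr_sumr; congr (_ * _); rewrite /= !nodeE mulSn addnC.
  pose v nu := W (u (l * N.+1 + nu)%N) w p 0.
  rewrite (_ : W (u (l * N.+1)%N) w p 0 = v 0%N); last by rewrite /v addn0.
  rewrite -[X in _ = X - _]/(v N.+1) telescope_ord.
  by apply: eq_bigr => nu _; rewrite /v addnS.
have -> : Num.sqrt (h / k%:R) = Num.sqrt N.+1%:R * Num.sqrt (h / KK%:R).
  have E (x y v : R) : y != 0 -> v != 0 -> x / y = v * (x / (y * v)) by move=> y0 v0; field; rewrite y0 v0.
  by rewrite -sqrtrM// /KK natrM; congr (Num.sqrt _); apply: E; rewrite pnatr_eq0 -?lt0n.
have sN : Num.sqrt N.+1%:R != 0 :> R by rewrite gt_eqF// sqrtr_gt0.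
have sK : Num.sqrt (h / KK%:R) != 0 :> R by rewrite gt_eqF// sqrtr_gt0.
by field; rewrite sN sK.
Qed.

(** The sums over [k] cells are tested against jets. Dominated convergence identifies one limit in
    [k]. The other is the Gaussian product, because the discrete Gram matrix of the cosine basis
    converges to the identity. *)
Lemma noise_iid : iid_standard_gaussian P noise_vector.
Proof.
pose X (a : nat * 'I_m) w := noise_vector a.1 w a.2 0.
suff [ind law] : mutually_independent P X /\ forall a, centered_gaussian P 1 (X a).
  by split=> // j i; exact: (law (j, i)).
apply: iid_from_jets; first by move=> a; exact: measurable_noise_vector.
move=> J K f f1 f2 uJ K1 jf.
have mf a : measurable_fun setT (f a) by have [] := jf a.
have K0 : 0 <= K by apply: le_trans K1.
have [_ L1] : integr P (fun w => \prod_(i <- J) f i (X i w)) /\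
    Ex P (fun w => \prod_(a <- J) f a (noise_sum k a w)) @[k --> \oo] --> Ex P (fun w => \prod_(i <- J) f i (X i w)).
  apply: (Ex_dct (g := fun=> K ^+ size J)); last exact: integr_cst.
  - move=> k; elim: (J) => [|a J' IH]; first by under eq_fun do rewrite big_nil; exact: measurable_cst.
    under eq_fun do rewrite big_cons; apply: measurable_funM => //.
    exact: (measurableT_comp (mf a) (measurable_noise_sum k a)).
  - move=> w; apply: cvg_prod_seq => a.
    have cf := jet_continuous (jf a) (x := X a w).
    exact: (@cvg_comp _ _ _ (fun k => noise_sum k a w) (f a) _ _ _ (noise_sum_cvg (a := a) (w := w)) cf).
  - move=> k w; elim: (J) => [|a J' IH]; first by rewrite big_nil normr1.
    by rewrite big_cons normrM exprS ler_pM//; have [_ _ _ + _ _ _] := jf a; apply.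
have L2 : Ex P (fun w => \prod_(a <- J) f a (noise_sum k a w)) @[k --> \oo] --> \prod_(a <- J) Ex g01 (f a).
  apply/cvgrPdist_le => eps eps0.
  have G : (size J)%:R ^+ 2 * K ^+ (size J) * \sum_(a <- J) \sum_(b <- J) gram_error k a b @[k --> \oo] -->
      (size J)%:R ^+ 2 * K ^+ (size J) * \sum_(a <- J) \sum_(b <- J) (0 : R).
    apply: cvgM; first exact: cvg_cst.
    by apply: cvg_sum_seq => a; apply: cvg_sum_seq => b; exact: gram_error_cvg.
  rewrite big1 ?mulr0 in G; last by move=> a _; rewrite big1.
  have /cvgrPdist_le/(_ _ eps0)[N _ hN] := G.
  near=> k; rewrite distrC; apply: le_trans (noise_sum_jets _ uJ K1 jf) _; first by near: k; exists 1%N.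
  have : (N <= k)%N by near: k; exists N.
  by move=> /hN /=; rewrite sub0r normrN; apply: le_trans; exact: ler_norm.
exact: cvg_unique L1 L2.
Unshelve. all: by end_near. Qed.

End coordinates.

(** * The signal in mean square *)

Section square_mean.
Context {R : realType} {disp : measure_display} {T : measurableType disp} (P : probability T R).
Implicit Types (f g : T -> R).

(** Extended-valued, so that a mean square can be bounded first and found finite afterwards. *)
Definition sqmean f : \bar R := (\int[P]_w ((f w) ^+ 2)%:E)%E.

Lemma measurable_sqr f : measurable_fun setT f -> measurable_fun setT (fun w => ((f w) ^+ 2)%:E).
Proof. by move=> mf; apply/measurable_EFinP; exact: measurable_funX. Qed.

Lemma sqmean_ge0 f : (0 <= sqmean f)%E.
Proof. by apply: integral_ge0 => w _; rewrite lee_fin sqr_ge0. Qed.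

Lemma young_sqr (th x y : R) : 0 < th -> (x + y) ^+ 2 <= (1 + th) * x ^+ 2 + (1 + th^-1) * y ^+ 2.
Proof.
move=> th0; rewrite -subr_ge0.
rewrite (_ : _ - _ = th^-1 * (th * x - y) ^+ 2); first by rewrite mulr_ge0 ?sqr_ge0 ?invr_ge0 ?ltW.
by field; rewrite gt_eqF.
Qed.

Lemma sqmean_young (th : R) f g : 0 < th -> measurable_fun setT f -> measurable_fun setT g ->
  (sqmean (fun w => (f w + g w)%R) <= (1 + th)%:E * sqmean f + (1 + th^-1)%:E * sqmean g)%E.
Proof.
move=> th0 mf mg; have t1 : 0 <= 1 + th by rewrite addr_ge0// ltW.
have t2 : 0 <= 1 + th^-1 by rewrite addr_ge0// invr_ge0 ltW.
have m1 := measurable_sqr mf; have m2 := measurable_sqr mg.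
have m1' : measurable_fun setT (fun w => ((1 + th)%:E * ((f w) ^+ 2)%:E)%E) by exact: measurable_funeM.
have m2' : measurable_fun setT (fun w => ((1 + th^-1)%:E * ((g w) ^+ 2)%:E)%E) by exact: measurable_funeM.
have sq0 (k : T -> R) w : setT w -> (0 <= ((k w) ^+ 2)%:E)%E by rewrite lee_fin sqr_ge0.
have e1 : (0 <= (1 + th)%:E)%E by rewrite lee_fin.
have e2 : (0 <= (1 + th^-1)%:E)%E by rewrite lee_fin.
rewrite /sqmean -ge0_integralZl//; last by move=> w; exact: sq0.
rewrite -ge0_integralZl//; last by move=> w; exact: sq0.
rewrite -ge0_integralD//; do ?[by move=> w _; rewrite mule_ge0// lee_fin ?sqr_ge0].
apply: ge0_le_integral => //.
- by move=> w _; rewrite lee_fin sqr_ge0.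
- by apply: measurable_sqr; exact: measurable_funD.
- exact: emeasurable_funD.
- by move=> w _; rewrite -!EFinM -EFinD lee_fin young_sqr.
Qed.

Lemma sqmeanZ (c : R) f : measurable_fun setT f -> (sqmean (fun w => c * f w)%R = (c ^+ 2)%:E * sqmean f)%E.
Proof.
move=> mf; rewrite /sqmean -ge0_integralZl//; last 3 first.
- exact: measurable_sqr.
- by move=> w _; rewrite lee_fin sqr_ge0.
- by rewrite lee_fin sqr_ge0.
by apply: eq_integral => w _; rewrite exprMn EFinM.
Qed.

Lemma sqmean_ae f g : measurable_fun setT f -> measurable_fun setT g -> {ae P, forall w, f w = g w} ->
  sqmean f = sqmean g.
Proof.
move=> mf mg fg; apply: ge0_ae_eq_integral => //; do ?[exact: measurable_sqr]; do ?[by move=> w _; rewrite lee_fin sqr_ge0].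
by apply: filterS fg => w /= -> _.
Qed.

Lemma sqmean_Ex f : integr P (fun w => f w ^+ 2) -> sqmean f = (Ex P (fun w => f w ^+ 2))%:E.
Proof. by move=> If; rewrite Ex_EFin. Qed.

(** Fatou's lemma: upper bounds on mean squares survive pointwise limits. *)
Lemma sqmean_lim (F : nat -> T -> R) f (b : \bar R) : (forall k, measurable_fun setT (F k)) ->
  (forall w, F k w @[k --> \oo] --> f w) -> (forall k, (sqmean (F k) <= b)%E) -> (sqmean f <= b)%E.
Proof.
move=> mF cF Fb.
have sq0 (k : nat) (w : T) : setT w -> (0 <= ((F k w) ^+ 2)%:E)%E by rewrite lee_fin sqr_ge0.
have := @fatou _ _ _ P setT measurableT _ (fun k => measurable_sqr (mF k)) sq0.
have E w : limn_einf (fun k => ((F k w) ^+ 2)%:E) = ((f w) ^+ 2)%:E.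
  apply: (cvg_limn_einf_sup _).1; apply: cvg_EFin; first by near=> k.
  by rewrite expr2; under eq_fun do rewrite expr2; apply: cvgM; exact: cF.
under eq_integral do rewrite E; move=> H; apply: (le_trans H).
rewrite limn_einf_lim; apply: lime_le; first exact: is_cvg_einfs.
near=> k; apply: le_trans (Fb k); apply: ereal_inf_lbound; exists k => //=.
Unshelve. all: by end_near. Qed.

End square_mean.

Section small.
Context {R : realType}.
Implicit Types (u v : nat -> \bar R).

(** For nonnegative sequences this is convergence to 0. As an inequality it is stable under sums and
    multiples without finiteness conditions on extended reals. *)
Definition small u := forall e : R, 0 < e -> \forall n \near \oo, (u n <= e%:E)%E.

Lemma small_cvg u : u @ \oo --> 0%E -> (forall n, (0 <= u n)%E) -> small u.
Proof.
move=> u0 up e e0; have /fine_cvgP[fin /cvgrPdist_le/(_ _ e0) H] := u0.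
near=> n; have un : u n \is a fin_num by near: n.
rewrite -(fineK un) lee_fin (le_trans (ler_norm _))// -normrN -sub0r; near: n; exact: H.
Unshelve. all: by end_near. Qed.

Lemma small_le u v : (forall n, (u n <= v n)%E) -> small v -> small u.
Proof. by move=> uv sv e e0; apply: filterS (sv e e0) => n; apply: le_trans. Qed.

Lemma smallD u v : small u -> small v -> small (fun n => u n + v n)%E.
Proof.
move=> su sv e e0; have e2 : 0 < e / 2 by rewrite divr_gt0.
near=> n; rewrite [e in leRHS]splitr EFinD; apply: leeD; near: n; [exact: su|exact: sv].
Unshelve. all: by end_near. Qed.

Lemma smallZ (c : R) u : 0 <= c -> small u -> small (fun n => c%:E * u n)%E.
Proof.
move=> c0 su e e0; have c1 : 0 < c + 1 by lra.
have := su (e / (c + 1)); rewrite divr_gt0// => /(_ isT); apply: filterS => n H.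
have c0' : (0 <= c%:E)%E by rewrite lee_fin.
apply: (le_trans (lee_wpmul2l c0' H)); rewrite -EFinM lee_fin mulrCA ger_pMr// ler_pdivrMr// mul1r; lra.
Qed.

Lemma small0 : small (fun=> 0%E).
Proof. by move=> e e0; near=> n; rewrite lee_fin ltW. Unshelve. all: by end_near. Qed.

Lemma small_sum (I : Type) (s : seq I) (u : I -> nat -> \bar R) : (forall i, small (u i)) ->
  small (fun n => \sum_(i <- s) u i n)%E.
Proof.
move=> su; elim: s => [|i s IH]; first by under eq_fun do rewrite big_nil; exact: small0.
by under eq_fun do rewrite big_cons; exact: smallD.
Qed.

Lemma small_sqmean_sum {disp : measure_display} {T : measurableType disp} (P : probability T R)
    (I : Type) (s : seq I) (c : I -> R) (f : I -> nat -> T -> R) :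
  (forall i n, measurable_fun setT (f i n)) -> (forall i, small (fun n => sqmean P (f i n))) ->
  small (fun n => sqmean P (fun w => \sum_(i <- s) c i * f i n w)).
Proof.
move=> mf sf; elim: s => [|i s IH].
  have E n : sqmean P (fun w => \sum_(i <- [::]) c i * f i n w) = 0%E.
    by rewrite /sqmean integral0_eq// => w _; rewrite big_nil expr0n.
  by under eq_fun do rewrite E; exact: small0.
apply: (small_le _ (smallD (smallZ (ler0n R 2) (smallZ (sqr_ge0 (c i)) (sf i))) (smallZ (ler0n R 2) IH))).
move=> n; have m1 := mf i n; have m2 : measurable_fun setT (fun w => \sum_(i <- s) c i * f i n w).
  by apply: measurable_sum => j; exact: measurable_funM.
have := @sqmean_young _ _ _ P 1 (fun w => c i * f i n w) (fun w => \sum_(i <- s) c i * f i n w) ltr01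
  (measurable_funM (measurable_cst _) m1) m2.
rewrite invr1 -[1 + 1]/(2%:R) sqmeanZ//.
by rewrite (_ : (fun w => \sum_(j <- i :: s) c j * f j n w) = fun w => c i * f i n w + \sum_(j <- s) c j * f j n w)//;
  apply/funext => w; rewrite big_cons.
Qed.

(** Passage to the limit in an inequality of mean squares. Young's inequality with a free parameter
    [th] plays the part of the triangle inequality: [n] is chosen after [th], and [th] is small. *)
Lemma le_of_approximation (A B : \bar R) (A' B' a b : nat -> \bar R) : (0 <= B)%E ->
  (forall th n, 0 < th -> (A <= (1 + th)%:E * A' n + (1 + th^-1)%:E * a n)%E) ->
  (forall n, (A' n <= B' n)%E) ->
  (forall th n, 0 < th -> (B' n <= (1 + th)%:E * B + (1 + th^-1)%:E * b n)%E) ->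
  small a -> small b -> (A <= B)%E.
Proof.
move=> B0 HA HAB HB sa sb.
have [->|Binf] := eqVneq B +oo%E; first by rewrite leey.
have Bfin : B \is a fin_num by rewrite ge0_fin_numE// lt_neqAle Binf leey.
rewrite -(fineK Bfin) in B0 HB *; move: (fine B) B0 HB => {Bfin Binf}B; rewrite lee_fin => B0 HB.
apply/lee_addgt0Pr => e e0.
(* For [th <= 1], two applications of Young's inequality enlarge [B] by at most
   [th * (3 * B + 2)]. *)
pose th := Num.min 1 (e / (3 * B + 2)).
have B2 : 0 < 3 * B + 2 by lra.
have th0 : 0 < th by rewrite lt_min ltr01 divr_gt0.
have th1 : th <= 1 by rewrite ge_min lexx.
have the : th * (3 * B + 2) <= e by rewrite -ler_pdivlMr// ge_min lexx orbT.
pose q := 1 + th^-1; have q0 : 0 < q by rewrite addr_gt0// invr_gt0.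
pose e' := th / (2 * q); have e'0 : 0 < e' by rewrite divr_gt0// mulr_gt0.
have [n [an bn]] : exists n, (a n <= e'%:E)%E /\ (b n <= e'%:E)%E.
  have [n Hn] : exists n, (fun n => (a n <= e'%:E)%E /\ (b n <= e'%:E)%E) n.
    apply: (@filter_ex _ (\oo : set_system nat)).
    by near=> n; split; near: n; [exact: sa|exact: sb].
  by exists n.
have qe : q * e' = th / 2 by rewrite /e'; field; rewrite gt_eqF.
have t1 : 0 <= 1 + th by lra.
have q0' : (0 <= q%:E)%E by rewrite lee_fin ltW.
have t0' : (0 <= (1 + th)%:E)%E by rewrite lee_fin.
have Hb : (q%:E * b n <= (th / 2)%:E)%E by rewrite -qe EFinM lee_wpmul2l.
have Ha : (q%:E * a n <= (th / 2)%:E)%E by rewrite -qe EFinM lee_wpmul2l.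
have H1 : (B' n <= ((1 + th) * B + th / 2)%:E)%E.
  by apply: (le_trans (HB th n th0)); rewrite (EFinD ((1 + th) * B)) (EFinM (1 + th)) leeD2l.
apply: (le_trans (HA th n th0)).
have H2 := le_trans (HAB n) H1.
apply: (@le_trans _ _ ((1 + th) * ((1 + th) * B + th / 2) + th / 2)%:E).
  by rewrite (EFinD ((1 + th) * _)) (EFinM (1 + th)) leeD// lee_wpmul2l.
rewrite -EFinD lee_fin.
have p1 : th * th <= th by rewrite ler_piMl// ltW.
have p2 : th * th * B <= th * B by rewrite ler_wpM2r.
nra.
Unshelve. all: by end_near. Qed.

End small.

Section uniform.
Context {R : realType}.
Local Notation mu := (@lebesgue_measure R).

(* As for [gauss], the uniform law is moved to the Borel sigma-algebra carried by R itself. *)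
Definition unif : probability R R := distribution (uniform_prob (@ltr01 R)) (idfun : measurableTypeR R -> R).

Lemma ge0_integral_unif (f : R -> \bar R) : measurable_fun setT f -> (forall x, 0 <= f x)%E ->
  (\int[unif]_x f x = \int[mu]_(x in `[0%R, 1%R]) f x)%E.
Proof.
move=> mf f0; rewrite /unif ge0_integral_distribution//.
by rewrite -[LHS]/(\int[uniform_prob _]_x f x)%E integral_uniform// subr0 invr1 mul1e.
Qed.

Lemma Ex_unif_indic (s : R) : 0 <= s <= 1 -> Ex unif (\1_(`]0, s]%classic)) = s.
Proof.
move=> /andP[s0 s1]; apply: EFin_inj; rewrite Ex_indic//.
have m : measurable_fun setT (fun x : R => (\1_(`]0, s]%classic) x : R)%:E) by apply/measurable_EFinP; exact: measurable_indic.
rewrite -[X in unif X]setIT -integral_indic// ge0_integral_unif//.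
rewrite integral_indic//= setIidl; last by move=> x /=; rewrite !in_itv/= => /andP[x0 xs]; rewrite (ltW x0) (le_trans xs).
by rewrite lebesgue_measure_itv/= lte_fin; case: ltP => [_|s0']; rewrite ?sube0//; congr EFin; apply/eqP; rewrite eq_le s0 s0'.
Qed.

End uniform.

(** * The Ito isometry *)

Section isometry.
Context {R : realType} {disp : measure_display} {T : measurableType disp} (P : probability T R).
Context {p : nat} (B : R -> T -> 'cV[R]_p).
Hypothesis bB : brownian_motion P B.
Notation g01 := (gauss 0 1 : probability R R).

Lemma increment_covariance (k : nat) (u : nat -> R) (a b : 'I_p * 'I_k) : 0 <= u 0%N -> u k <= 1 ->
  (forall l, (l < k)%N -> u l < u l.+1) ->
  integr P (fun w => (B (u a.2.+1) w a.1 0 - B (u a.2) w a.1 0) * (B (u b.2.+1) w b.1 0 - B (u b.2) w b.1 0)) /\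
  Ex P (fun w => (B (u a.2.+1) w a.1 0 - B (u a.2) w a.1 0) * (B (u b.2.+1) w b.1 0 - B (u b.2) w b.1 0)) =
    (a == b)%:R * (u a.2.+1 - u a.2).
Proof.
move=> u0 u1 us; have [mB _ _ incB] := bB; have [indB lawB] := incB k u u0 u1 us.
pose X (a : 'I_p * 'I_k) w := B (u a.2.+1) w a.1 0 - B (u a.2) w a.1 0.
have v0 (c : 'I_p * 'I_k) : 0 < u c.2.+1 - u c.2 by rewrite subr_gt0; exact: us.
have q0 (c : 'I_p * 'I_k) : Num.sqrt (u c.2.+1 - u c.2) != 0 by rewrite gt_eqF// sqrtr_gt0.
have XE c w : X c w = Num.sqrt (u c.2.+1 - u c.2) * ((Num.sqrt (u c.2.+1 - u c.2))^-1 * X c w) by rewrite mulVKf.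
have L c := centered_gaussian_law (v0 c) (lawB c.1 c.2).
have mX c : measurable_fun setT (X c) by have [] := lawB c.1 c.2.
have X1 c : integr P (X c) /\ Ex P (X c) = 0.
  have [_ /(_ (fun y => y ^+ 1))[]] := L c; first exact: measurable_power.
    exact: integr_gauss_power.
  move=> I1 E1; split.
    rewrite (_ : X c = fun w => Num.sqrt (u c.2.+1 - u c.2) * ((Num.sqrt (u c.2.+1 - u c.2))^-1 * X c w)); last by apply/funext => w; exact: XE.
    exact: integrZ.
  rewrite (_ : X c = fun w => Num.sqrt (u c.2.+1 - u c.2) * ((Num.sqrt (u c.2.+1 - u c.2))^-1 * X c w)); last by apply/funext => w; exact: XE.
  by rewrite ExZ// [X in _ * X]E1 gauss_moment1 mulr0.
have X2 c : integr P (fun w => X c w * X c w) /\ Ex P (fun w => X c w * X c w) = u c.2.+1 - u c.2.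
  have [_ /(_ (fun y => y ^+ 2))[]] := L c; first exact: measurable_power.
    exact: integr_gauss_power.
  have -> : (fun w => X c w * X c w) = (fun w => (u c.2.+1 - u c.2) * ((Num.sqrt (u c.2.+1 - u c.2))^-1 * X c w) ^+ 2).
    by apply/funext => w; rewrite exprMn exprVn sqr_sqrtr ?ltW// mulrA divff ?mul1r ?expr2// gt_eqF.
  by move=> I2 E2; split; [exact: integrZ|rewrite ExZ// [X in _ * X]E2 gauss_moment2 mulr1].
have [<-|ab] := eqVneq a b; first by rewrite mul1r; exact: X2.
have [] := @Ex_adapted_mul _ _ _ P _ X mX indB [:: a] b (X a) idfun.
- by rewrite /= inE eq_sym ab.
- have A : adapted X [:: a] (idfun \o X a) by apply: adapted_var => //; rewrite ?mem_head//; exact: measurable_id.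
  exact: A.
- exact: measurable_id.
- exact: (X1 a).1.
- exact: (X1 b).1.
by move=> I E; split; [exact: I|rewrite [LHS]E (X1 a).2 !mul0r].
Qed.

(** For [s <= s'] the later value is the earlier one plus an independent increment. The cases
    [s = 0] and [s = s'] are apart because increments are described along strictly increasing
    times. *)
Lemma bm_covariance (s s' : R) (i i' : 'I_p) : 0 <= s <= 1 -> 0 <= s' <= 1 ->
  integr P (fun w => B s w i 0 * B s' w i' 0) /\
  Ex P (fun w => B s w i 0 * B s' w i' 0) = (i == i')%:R * Num.min s s'.
Proof.
wlog ss : s s' i i' / s <= s' => [H s01 s'01|].
  have /orP[ss|ss] := le_total s s'; first exact: H.
  have := H s' s i' i ss s'01 s01.
  by rewrite minC eq_sym; under eq_fun do rewrite mulrC.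
move=> /andP[s0 s1] /andP[s'0 s'1]; have [_ B0 _ _] := bB.
have B00 w j : B 0 w j 0 = 0 by rewrite B0 mxE.
rewrite min_l//.
have [<-|sn] := eqVneq 0 s.
  by under eq_fun do rewrite B00 mul0r; rewrite mulr0; split; [exact: integr_cst|exact: Ex_cst].
have {s0 sn} s0 : 0 < s by rewrite lt_neqAle sn.
move: ss; rewrite le_eqVlt => /orP[/eqP <-|ss].
  pose u (l : nat) : R := nth 0 [:: 0; s] l.
  have [] := @increment_covariance 1 u (i, ord0) (i', ord0) (lexx 0) s1.
    by case.
  rewrite /u /= subr0 => I E; split.
    by move: I; under eq_fun do rewrite !B00 !subr0.
  by move: E; under eq_fun do rewrite !B00 !subr0; rewrite xpair_eqE andbT.
pose u (l : nat) : R := nth 0 [:: 0; s; s'] l.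
have us l : (l < 2)%N -> u l < u l.+1 by case: l => [|[|]].
have [I1 E1] := @increment_covariance 2 u (i, ord0) (i', ord0) (lexx 0) s'1 us.
have [I2 E2] := @increment_covariance 2 u (i, ord0) (i', lift ord0 ord0) (lexx 0) s'1 us.
have -> : (fun w => B s w i 0 * B s' w i' 0) = fun w =>
    (B (u 1%N) w i 0 - B (u 0%N) w i 0) * (B (u 1%N) w i' 0 - B (u 0%N) w i' 0) +
    (B (u 1%N) w i 0 - B (u 0%N) w i 0) * (B (u 2%N) w i' 0 - B (u 1%N) w i' 0).
  by apply/funext => w; rewrite /u /= !B00; ring.
split; first exact: (integrD I1 I2).
rewrite (ExD I1 I2) [X in X + _]E1 [X in _ + X]E2 !xpair_eqE /= andbT andbF mul0r addr0 /u /= subr0//.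
Qed.

(* A finite combination of values of B is listed as (coefficient, (coordinate, time)). *)
Definition bm_comb (g : seq (R * ('I_p * R))) (w : T) : R := \sum_(q <- g) q.1 * B q.2.2 w q.2.1 0.
Definition comb_step (g : seq (R * ('I_p * R))) (i : 'I_p) (s : R) : R :=
  \sum_(q <- g) (q.1 * (q.2.1 == i)%:R) * \1_(`]0, q.2.2]%classic) s.

Lemma sqr_sum (K : Type) (s : seq K) (F : K -> R) : (\sum_(q <- s) F q) ^+ 2 = \sum_(q <- s) \sum_(q' <- s) F q * F q'.
Proof. by rewrite expr2 mulr_suml; apply: eq_bigr => q _; rewrite mulr_sumr. Qed.

Lemma Ex_double_sum {disp' : measure_display} {T' : measurableType disp'} (Q : probability T' R) (K : eqType)
    (s : seq K) (F : K -> K -> T' -> R) (E : K -> K -> R) :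
  (forall q q', q \in s -> q' \in s -> integr Q (F q q') /\ Ex Q (F q q') = E q q') ->
  integr Q (fun w => \sum_(q <- s) \sum_(q' <- s) F q q' w) /\
  Ex Q (fun w => \sum_(q <- s) \sum_(q' <- s) F q q' w) = \sum_(q <- s) \sum_(q' <- s) E q q'.
Proof.
move=> H.
have I1 q : q \in s -> integr Q (fun w => \sum_(q' <- s) F q q' w).
  by move=> qs; under eq_fun do rewrite big_seq; apply: integr_sum => q' q's; exact: (H q q' qs q's).1.
split; first by under eq_fun do rewrite big_seq; exact: integr_sum.
under eq_fun do rewrite big_seq.
rewrite Ex_sum// [RHS]big_seq; apply: eq_bigr => q qs.
under eq_fun do rewrite big_seq.
rewrite Ex_sum; last by move=> q' q's; exact: (H q q' qs q's).1.
by rewrite [RHS]big_seq; apply: eq_bigr => q' q's; exact: (H q q' qs q's).2.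
Qed.

(** Both sides are the same quadratic form: [Num.min s s'] is the covariance of Brownian motion and
    also the scalar product of the indicators of []0, s]] and []0, s']]. *)
Lemma bm_isometry (g : seq (R * ('I_p * R))) : (forall q, q \in g -> 0 <= q.2.2 <= 1) ->
  sqmean P (bm_comb g) = (\sum_i sqmean unif (comb_step g i))%E.
Proof.
move=> g01.
have [I1 E1] : integr P (fun w => bm_comb g w ^+ 2) /\ Ex P (fun w => bm_comb g w ^+ 2) =
    \sum_(q <- g) \sum_(q' <- g) q.1 * q'.1 * ((q.2.1 == q'.2.1)%:R * Num.min q.2.2 q'.2.2).
  rewrite (_ : (fun w => bm_comb g w ^+ 2) = fun w => \sum_(q <- g) \sum_(q' <- g)
      q.1 * q'.1 * (B q.2.2 w q.2.1 0 * B q'.2.2 w q'.2.1 0)); last first.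
    apply/funext => w; rewrite /bm_comb sqr_sum; apply: eq_bigr => q _; apply: eq_bigr => q' _; ring.
  apply: Ex_double_sum => q q' qg q'g.
  have [I E] := bm_covariance q.2.1 q'.2.1 (g01 q qg) (g01 q' q'g).
  by split; [exact: integrZ|rewrite ExZ// E].
have H i : integr unif (fun s => comb_step g i s ^+ 2) /\ Ex unif (fun s => comb_step g i s ^+ 2) =
    \sum_(q <- g) \sum_(q' <- g) q.1 * q'.1 * ((q.2.1 == i)%:R * (q'.2.1 == i)%:R * Num.min q.2.2 q'.2.2).
  rewrite (_ : (fun s => comb_step g i s ^+ 2) = fun s => \sum_(q <- g) \sum_(q' <- g)
      q.1 * q'.1 * ((q.2.1 == i)%:R * (q'.2.1 == i)%:R) * \1_(`]0, Num.min q.2.2 q'.2.2]%classic) s); last first.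
    apply/funext => s; rewrite /comb_step sqr_sum; apply: eq_bigr => q _; apply: eq_bigr => q' _.
    have -> : \1_(`]0, Num.min q.2.2 q'.2.2]%classic) s = \1_(`]0, q.2.2]%classic) s * \1_(`]0, q'.2.2]%classic) s :> R.
      rewrite !indicE !mem_setE -natrM mulnb !in_itv/= le_min; case: (0 < s) => //=.
    ring.
  apply: Ex_double_sum => q q' qg q'g.
  have m01 : 0 <= Num.min q.2.2 q'.2.2 <= 1.
    have /andP[? ?] := g01 q qg; have /andP[? ?] := g01 q' q'g.
    by rewrite le_min ge_min; apply/andP; split; [apply/andP|apply/orP; left].
  have I := integr_indic unif (measurable_itv `]0, Num.min q.2.2 q'.2.2]).
  by split; [exact: integrZ|rewrite ExZ// Ex_unif_indic// !mulrA].
rewrite sqmean_Ex// E1 [RHS](eq_bigr _ (fun i _ => etrans (sqmean_Ex (H i).1) (congr1 EFin (H i).2))).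
rewrite sumEFin; congr EFin; rewrite [RHS]exchange_big/=; apply: eq_bigr => q _.
rewrite [RHS]exchange_big/=; apply: eq_bigr => q' _.
rewrite -mulr_sumr; congr (_ * _); rewrite -mulr_suml; congr (_ * _).
rewrite (bigD1 q.2.1)//= eqxx mul1r big1 ?addr0; first by rewrite eq_sym.
by move=> i /negbTE qi; rewrite [q.2.1 == i]eq_sym qi mul0r.
Qed.

End isometry.

Section wiener_isometry.
Context {R : realType} {disp : measure_display} {T : measurableType disp} (P : probability T R).
Context {p : nat} (B : R -> T -> 'cV[R]_p).
Hypothesis bB : brownian_motion P B.
Local Notation mu := (@lebesgue_measure R).

Definition cut (f : R -> R) (v s : R) : R := f s * \1_(`[0, v]%classic) s.

Lemma measurable_cut f v : measurable_fun (`[0, 1] : set R) f -> v <= 1 -> measurable_fun setT (cut f v).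
Proof.
move=> mf v1; have -> : cut f v = f \_ (`[0, v] : set R) by rewrite patch_indic.
apply/(measurable_restrictT _ (measurable_itv _)).
by apply: measurable_funS mf => // s /=; rewrite !in_itv/= => /andP[-> h]; exact: le_trans h v1.
Qed.

Lemma measurable_step_fun (g : seq (R * (R * R))) : measurable_fun setT (step_fun g).
Proof.
apply: measurable_sum => q; apply: measurable_funM; first exact: measurable_cst.
exact: measurable_indic.
Qed.

Lemma measurable_sum_mem {d' : measure_display} {T' : measurableType d'} (I : eqType) (s : seq I) (F : I -> T' -> R) :
  (forall i, i \in s -> measurable_fun setT (F i)) -> measurable_fun setT (fun w => \sum_(i <- s) F i w).
Proof.
move=> mF; under eq_fun do rewrite big_seq big_mkcond/=.
by apply: measurable_sum => i; case: (boolP (i \in s)) => [/mF//|_]; exact: measurable_cst.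
Qed.

Lemma sqmean_unif_cut f (v : R) (g : seq (R * (R * R))) : measurable_fun (`[0, 1] : set R) f -> 0 <= v <= 1 ->
  (forall q, q \in g -> 0 <= q.2.1 /\ q.2.1 <= q.2.2 <= v) ->
  (sqmean unif (fun s => step_fun g s - cut f v s)%R = \int[mu]_(s in `[0%R, v]) ((f s - step_fun g s) ^+ 2)%:E)%E.
Proof.
move=> mf /andP[v0 v1] gv.
have m1 := measurable_funB (measurable_step_fun g) (measurable_cut mf v1).
rewrite /sqmean ge0_integral_unif; last 2 first.
- exact: measurable_sqr.
- by move=> s; rewrite lee_fin sqr_ge0.
rewrite integral_mkcond [RHS]integral_mkcond; apply: eq_integral => s _.
rewrite /patch; case: ifPn => [s1|s1]; last first.
  rewrite ifF//; apply/negbTE; apply: contra s1; rewrite !mem_setE !in_itv/= => /andP[-> h]; exact: le_trans h v1.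
rewrite /cut indicE; case: ifPn => sv; first by rewrite mulr1 -sqrrN opprB.
rewrite mulr0 subr0 /step_fun big_seq big1 ?expr0n// => q qg.
have [q0 /andP[q1 q2]] := gv q qg.
rewrite indicE (_ : _ \in _ = false) ?mulr0//; apply/negbTE; apply: contra sv.
by rewrite !mem_setE !in_itv/= => /andP[h1 h2]; apply/andP; split; [lra|exact: le_trans h2 q2].
Qed.

Variables (J : finType) (c v : J -> R) (f : J -> R -> R) (ka : J -> 'I_p) (Z : J -> T -> R).
Hypothesis v01 : forall j, 0 <= v j <= 1.
Hypothesis mf : forall j, measurable_fun (`[0, 1] : set R) (f j).
Hypothesis WZ : forall j, wiener_integral P (fun s w => B s w (ka j) 0) (f j) (v j) (Z j).

(** Every increment is split into two values of [B]; the step integrals of all [j] then form a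
    single combination to which [bm_isometry] applies. *)
Definition comb_of (g : J -> seq (R * (R * R))) : seq (R * ('I_p * R)) :=
  flatten [seq flatten [seq [:: (c j * q.1, (ka j, q.2.2)); (- (c j * q.1), (ka j, q.2.1))] | q <- g j] | j <- enum J].

Lemma big_comb_of g (H : R * ('I_p * R) -> R) :
  \sum_(x <- comb_of g) H x = \sum_j \sum_(q <- g j) (H (c j * q.1, (ka j, q.2.2)) + H (- (c j * q.1), (ka j, q.2.1))).
Proof.
rewrite /comb_of big_flatten/= big_map big_enum/=; apply: eq_bigr => j _.
by rewrite big_flatten/= big_map; apply: eq_bigr => q _; rewrite big_cons big_seq1.
Qed.

Lemma bm_comb_of g w : bm_comb B (comb_of g) w = \sum_j c j * step_integral (fun s w => B s w (ka j) 0) (g j) w.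
Proof.
rewrite /bm_comb big_comb_of; apply: eq_bigr => j _; rewrite mulr_sumr; apply: eq_bigr => q _ /=; ring.
Qed.

Lemma comb_step_of g i s : (forall j q, q \in g j -> 0 <= q.2.1 /\ q.2.1 <= q.2.2 <= v j) ->
  comb_step (comb_of g) i s = \sum_j (c j * (ka j == i)%:R) * step_fun (g j) s.
Proof.
move=> gv; rewrite /comb_step big_comb_of; apply: eq_bigr => j _; rewrite mulr_sumr big_seq [RHS]big_seq.
apply: eq_bigr => q qg /=; have [q0 /andP[q1 _]] := gv j q qg.
have -> : \1_(`]q.2.1, q.2.2]%classic) s = \1_(`]0, q.2.2]%classic) s - \1_(`]0, q.2.1]%classic) s :> R.
  rewrite !indicE !mem_setE !in_itv/=.
  have [s1|s1] := ltP q.2.1 s.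
    by rewrite (le_lt_trans q0 s1) andbF subr0.
  by rewrite /= (le_trans s1 q1) subrr.
ring.
Qed.

(** The isometry holds for the approximating step functions, and [le_of_approximation] passes to the
    limit on both sides. The combination is kept whole because a bound on [o^T Sigma o] would be
    lost if the coordinates were estimated separately. *)
Lemma wiener_isometry_le : (sqmean P (fun w => \sum_j c j * Z j w)%R <=
  \sum_i sqmean unif (fun s => \sum_j (c j * (ka j == i)%:R) * cut (f j) (v j) s)%R)%E.
Proof.
have mZ j : measurable_fun setT (Z j) by have [] := WZ j.
have H j : exists g : nat -> seq (R * (R * R)),
    [/\ forall k q, q \in g k -> 0 <= q.2.1 /\ q.2.1 <= q.2.2 <= v j,
        (\int[mu]_(s in `[0%R, v j]) ((f j s - step_fun (g k) s) ^+ 2)%:E)%E @[k --> \oo] --> 0%E &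
        'E_P[(fun w => (Z j w - step_integral (fun s w => B s w (ka j) 0) (g k) w) ^+ 2)%R]%E
          @[k --> \oo] --> 0%E].
  by have [] := WZ j.
have [g Hg] := choice H.
have gv k j q : q \in g j k -> 0 <= q.2.1 /\ q.2.1 <= q.2.2 <= v j by have [h _ _] := Hg j; exact: h.
have gv1 k j q : q \in g j k -> 0 <= q.2.1 <= 1 /\ 0 <= q.2.2 <= 1.
  by move=> /gv[h0 /andP[h1 h2]]; have /andP[_ h3] := v01 j; split; apply/andP; split; lra.
pose pl k := comb_of (g^~ k).
have mI j k : measurable_fun setT (step_integral (fun s w => B s w (ka j) 0) (g j k)).
  have [mB _ _ _] := bB.
  apply: measurable_sum_mem => q /gv1[q1 q2]; apply: measurable_funM => //.
  by apply: measurable_funB; exact: mB.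
have mc j : measurable_fun setT (cut (f j) (v j)) by apply: measurable_cut => //; have /andP[] := v01 j.
have mG : measurable_fun setT (fun w => \sum_j c j * Z j w).
  by apply: measurable_sum => j; exact: measurable_funM.
have mGk k : measurable_fun setT (bm_comb B (pl k)).
  rewrite (_ : bm_comb B (pl k) = fun w => \sum_j c j * step_integral (fun s w => B s w (ka j) 0) (g j k) w); last first.
    by apply/funext => w; exact: bm_comb_of.
  by apply: measurable_sum => j; exact: measurable_funM.
pose psi i s := \sum_j (c j * (ka j == i)%:R) * cut (f j) (v j) s.
have mpsi i : measurable_fun setT (psi i) by apply: measurable_sum => j; exact: measurable_funM.
have mstep k i : measurable_fun setT (comb_step (pl k) i).
  apply: measurable_sum => q; apply: measurable_funM; [exact: measurable_cst|exact: measurable_indic].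
apply: (@le_of_approximation _ _ _ (fun k => sqmean P (bm_comb B (pl k)))
  (fun k => (\sum_i sqmean unif (comb_step (pl k) i))%E)
  (fun k => sqmean P (fun w => \sum_j c j * (Z j w - step_integral (fun s w => B s w (ka j) 0) (g j k) w)))
  (fun k => (\sum_i sqmean unif (fun s => \sum_j (c j * (ka j == i)%:R) * (step_fun (g j k) s - cut (f j) (v j) s))%R)%E)).
- by apply: sume_ge0 => i _; exact: sqmean_ge0.
- move=> th k th0.
  rewrite (_ : (fun w => \sum_j c j * Z j w) = fun w => bm_comb B (pl k) w +
      \sum_j c j * (Z j w - step_integral (fun s w => B s w (ka j) 0) (g j k) w)).
    apply: sqmean_young => //; apply: measurable_sum => j; apply: measurable_funM => //; exact: measurable_funB.
  apply/funext => w; rewrite bm_comb_of -big_split/=; apply: eq_bigr => j _; ring.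
- move=> k; rewrite bm_isometry//.
  move=> x /flattenP[_ /mapP[j _ ->]] /flattenP[_ /mapP[q qg ->]].
  by have [q1 q2] := gv1 _ _ _ qg; rewrite !inE => /orP[] /eqP ->.
- move=> th k th0; have t1 : (0 <= (1 + th)%:E)%E by rewrite lee_fin addr_ge0// ltW.
  have t2 : (0 <= (1 + th^-1)%:E)%E by rewrite lee_fin addr_ge0// invr_ge0 ltW.
  rewrite ge0_sume_distrr; last by move=> i _; exact: sqmean_ge0.
  rewrite ge0_sume_distrr; last by move=> i _; exact: sqmean_ge0.
  rewrite -big_split/=; apply: lee_sum => i _.
  rewrite (_ : comb_step (pl k) i = fun s => psi i s +
      \sum_j (c j * (ka j == i)%:R) * (step_fun (g j k) s - cut (f j) (v j) s)).
    apply: sqmean_young => //; apply: measurable_sum => j; apply: measurable_funM => //.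
    by apply: measurable_funB => //; exact: measurable_step_fun.
  apply/funext => s; rewrite comb_step_of; last by move=> j q; exact: gv.
  rewrite -big_split/=; apply: eq_bigr => j _; ring.
- apply: small_sqmean_sum => [j k|j]; first exact: measurable_funB.
  apply: small_cvg => [|k]; last exact: sqmean_ge0.
  by have [_ _ ] := Hg j; rewrite unlock.
- apply: small_sum => i; apply: small_sqmean_sum => [j k|j].
    by apply: measurable_funB => //; exact: measurable_step_fun.
  apply: small_cvg => [|k]; last exact: sqmean_ge0.
  have [_ + _] := Hg j; apply: cvg_trans; apply: near_eq_cvg; near=> k.
  by rewrite sqmean_unif_cut//; exact: gv.
Unshelve. all: by end_near. Qed.

End wiener_isometry.

Section signal.
Context {R : realType} {disp : measure_display} {T : measurableType disp} (P : probability T R).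
Context {d p : nat} (sigma : R -> 'M[R]_(d, p)) (B : R -> T -> 'cV[R]_p) (X : R -> T -> 'cV[R]_d).
Hypothesis sqs : square_integrable sigma.
Hypothesis bB : brownian_motion P B.
Hypothesis rX : random_vectors X.
Hypothesis cX : continuous_paths X.
Hypothesis wX : wiener_driven P sigma B X.
Context (t h : R).
Hypothesis t0 : 0 <= t.
Hypothesis h0 : 0 < h.
Hypothesis th1 : t + h <= 1.
Context (o : 'cV[R]_d) (b : R).
Hypothesis ob : forall s, t <= s <= t + h -> qform (sigma s *m (sigma s)^T) o <= b.
Local Notation u := (node t h).

Let window (s : R) : R := \1_(`]0, t + h]%classic) s - \1_(`]0, t]%classic) s.

Lemma windowE s : window s = \1_(`[0, t + h]%classic) s - \1_(`[0, t]%classic) s.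
Proof.
rewrite /window !indicE !mem_setE !in_itv/=.
have [s0|s0|<-] := ltgtP 0 s; rewrite ?subrr//.
by rewrite t0 addr_ge0 ?(ltW h0)// subrr.
Qed.

Lemma window_01 s : window s = (t < s <= t + h)%R%:R.
Proof.
rewrite /window !indicE !mem_setE !in_itv/=.
have [st|ts] := leP s t; first by rewrite andbT (le_trans st) ?andbT ?subrr// lerDl ltW.
by rewrite andbF subr0 (le_lt_trans t0 ts).
Qed.

Lemma Ex_window : integr unif window /\ Ex unif window = h.
Proof.
have i1 := integr_indic unif (measurable_itv `]0, t + h]).
have i2 := integr_indic unif (measurable_itv `]0, t]).
split; first exact: (integrB i1 i2).
rewrite /window (ExB i1 i2) !Ex_unif_indic.
- by rewrite addrAC subrr add0r.
- by rewrite t0/= (le_trans _ th1)// lerDl ltW.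
- by rewrite th1 andbT addr_ge0// ltW.
Qed.

Lemma qform_outer_sigma s : qform (sigma s *m (sigma s)^T) o = \sum_k (\sum_i o i 0 * sigma s i k) ^+ 2.
Proof.
rewrite /qform -mulmxA -mulmxA mulmxA.
have -> : (sigma s)^T *m o = (o^T *m sigma s)^T by rewrite trmx_mul trmxK.
rewrite mxE; apply: eq_bigr => k _; rewrite !mxE expr2.
have -> : \sum_j o^T 0 j * sigma s j k = \sum_i o i 0 * sigma s i k by apply: eq_bigr => i _; rewrite mxE.
by [].
Qed.

(** The initial value, which may depend on [B], cancels in the increments. By the isometry the mean
    square is the integral of [a s ^+ 2] times [o^T Sigma s o], where the step function [a] takes
    the values [phi l] and vanishes off the window. *)
Lemma increments_sqmean (k : nat) (phi : nat -> R) (c : R) : (0 < k)%N -> (forall l, `|phi l| <= c) ->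
  (sqmean P (fun w => \sum_(l < k) phi l * \sum_i o i 0 * (X (u k l.+1) w i 0 - X (u k l) w i 0))%R <=
   (c ^+ 2 * b * h)%:E)%E.
Proof.
move=> k0 phic.
have u01 l : (l <= k)%N -> 0 <= u k l <= 1 by move=> lk; exact: node_01.
have lek (l : 'I_k) (e : bool) : (l + e <= k)%N by case: e; rewrite ?addn1 ?addn0 ?ltn_ord// ltnW.
(* One Wiener integral for each cell, coordinate of [X], coordinate of [B] and end of the cell, the
   Boolean marking the right end. *)
pose J : finType := ('I_k * 'I_d * 'I_p * bool)%type.
pose pt (j : J) := u k (j.1.1.1 + j.2).
pose co (j : J) : R := (if j.2 then 1 else -1) * phi j.1.1.1 * o j.1.1.2 0.
have pt01 j : 0 <= pt j <= 1.
  by apply: u01; exact: lek.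
have HZ (j : J) : exists Z : T -> R, wiener_integral P (fun s w => B s w j.1.2 0) (fun s => sigma s j.1.1.2 j.1.2) (pt j) Z.
  by have [Z [HZ _]] := wX j.1.1.2 (pt01 j); exists (Z j.1.2).
have HZ' (q : 'I_k * 'I_d * bool) : exists Z : 'I_p -> T -> R,
    (forall ka, wiener_integral P (fun s w => B s w ka 0) (fun s => sigma s q.1.2 ka) (u k (q.1.1 + q.2)) (Z ka)) /\
    {ae P, forall w, X (u k (q.1.1 + q.2)) w q.1.2 0 = X 0 w q.1.2 0 + \sum_ka Z ka w}.
  by apply: wX; apply: u01; exact: lek.
have [Z {HZ'}HZ'] := choice HZ'.
pose ZJ (j : J) := Z (j.1.1, j.2) j.1.2.
have WZ (j : J) : wiener_integral P (fun s w => B s w j.1.2 0) (fun s => sigma s j.1.1.2 j.1.2) (pt j) (ZJ j).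
  exact: (HZ' (j.1.1, j.2)).1.
have mZ j : measurable_fun setT (ZJ j) by have [] := WZ j.
have mf (j : J) : measurable_fun (`[0, 1] : set R) (fun s => sigma s j.1.1.2 j.1.2) by have [] := sqs j.1.1.2 j.1.2.
have pairE (A A' : finType) (G : A * A' -> R) : \sum_q G q = \sum_x \sum_y G (x, y).
  by rewrite pair_bigA; apply: eq_bigr => -[].
have sumJ (F : J -> R) : \sum_j F j = \sum_(l < k) \sum_i \sum_ka (F (l, i, ka, true) + F (l, i, ka, false)).
  by rewrite !pairE; do 3!apply: eq_bigr => ? _; rewrite big_bool.
have mX l i : (l <= k)%N -> measurable_fun setT (fun w => X (u k l) w i 0) by move=> lk; apply: rX; exact: u01.
rewrite (@sqmean_ae _ _ _ P _ (fun w => \sum_j co j * ZJ j w)); last 3 first.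
- apply: measurable_sum => -[l lk]; apply: measurable_funM => //; apply: measurable_sum => i.
  by apply: measurable_funM => //=; apply: measurable_funB; apply: mX => //; exact: ltnW.
- by apply: measurable_sum => j; exact: measurable_funM.
- have : {ae P, forall w, forall q : 'I_k * 'I_d * bool, X (u k (q.1.1 + q.2)) w q.1.2 0 = X 0 w q.1.2 0 + \sum_ka Z q ka w}.
    by apply: filter_forall => q; have [] := HZ' q.
  apply: filterS => w Hw; rewrite sumJ; apply: eq_bigr => l _; rewrite mulr_sumr; apply: eq_bigr => i _.
  have := Hw (l, i, true); have := Hw (l, i, false); rewrite /= addn0 addn1 => -> ->.
  have -> : phi l * (o i 0 * (X 0 w i 0 + \sum_ka Z (l, i, true) ka w - (X 0 w i 0 + \sum_ka Z (l, i, false) ka w))) =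
     phi l * o i 0 * (\sum_ka Z (l, i, true) ka w - \sum_ka Z (l, i, false) ka w) by ring.
  rewrite -sumrB mulr_sumr; apply: eq_bigr => ka _; rewrite /co /ZJ /=; ring.
apply: (le_trans (wiener_isometry_le bB co pt01 mf WZ)).
pose a (s : R) := \sum_(l < k) phi l * (\1_(`[0, u k l.+1]%classic) s - \1_(`[0, u k l]%classic) s).
pose st ka s := \sum_i o i 0 * sigma s i ka.
have psiE i s : \sum_j (co j * (j.1.2 == i)%:R) * cut (fun s => sigma s j.1.1.2 j.1.2) (pt j) s = a s * st i s.
  rewrite sumJ /a mulr_suml; apply: eq_bigr => l _; rewrite /st mulr_sumr; apply: eq_bigr => e _.
  rewrite (bigD1 i)//= big1 ?addr0; last first.
    by move=> ka /negbTE kai; rewrite /= kai !mulr0 !mul0r addr0.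
  by rewrite /co /cut /pt eqxx /= addn0 addn1; ring.
have aw s : `|a s| <= c * window s.
  have step l : (0 : R) <= \1_(`[0, u k l.+1]%classic) s - \1_(`[0, u k l]%classic) s.
    rewrite subr_ge0 !indicE !mem_setE !in_itv/= ler_nat.
    have := node_lt t h0 l k0; case: (0 <= s) => //=.
    by case: (leP s (u k l)) => //= h1 h2; rewrite (le_trans h1 (ltW h2)).
  rewrite (le_trans (ler_norm_sum _ _ _))//.
  have -> : c * window s = \sum_(l < k) c * (\1_(`[0, u k l.+1]%classic) s - \1_(`[0, u k l]%classic) s).
    rewrite -mulr_sumr windowE -(nodek t h k0) -{2}(node0 t h k); congr (_ * _).
    by rewrite (telescope_ord (fun l => \1_(`[0, u k l]%classic) s : R)).
  by apply: ler_sum => l _; rewrite normrM (ger0_norm (step l)) ler_wpM2r.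
have c0 : 0 <= c by rewrite (le_trans (normr_ge0 _) (phic 0%N)).
have mpsi i : measurable_fun setT (fun s => \sum_j (co j * (j.1.2 == i)%:R) * cut (fun s => sigma s j.1.1.2 j.1.2) (pt j) s).
  by apply: measurable_sum => j; apply: measurable_funM => //; apply: measurable_cut => //; have /andP[] := pt01 j.
rewrite /sqmean -ge0_integral_sum//; last 2 first.
- by move=> i; exact: measurable_sqr.
- by move=> i s _; rewrite lee_fin sqr_ge0.
have [Iw Ew] := Ex_window.
rewrite -Ew -ExZ// Ex_EFin; last exact: integrZ.
apply: ge0_le_integral => //.
- by move=> s _; apply: sume_ge0 => i _; rewrite lee_fin sqr_ge0.
- by apply: emeasurable_sum => i; exact: measurable_sqr.
- by apply/measurable_EFinP; apply: (integr_measurable (P := unif)); exact: integrZ.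
move=> s _; rewrite sumEFin lee_fin.
under eq_bigr do rewrite psiE exprMn; rewrite -mulr_sumr -qform_outer_sigma.
have := aw s; rewrite window_01; case: (boolP (t < s <= t + h)) => [/andP[ts sh]|_].
  rewrite !mulr1 => ac; rewrite ler_pM ?sqr_ge0//.
  - by rewrite qform_outer_sigma; apply: sumr_ge0 => i _; exact: sqr_ge0.
  - by rewrite -real_normK ?num_real// lerXn2r ?nnegrE.
  - by apply: ob; rewrite (ltW ts).
by rewrite !mulr0 normr_le0 => /eqP ->; rewrite expr0n mul0r.
Qed.

(** The squared amplitude [2 / h] of the sine basis cancels the length of the window. The bound
    holds along the sums over [k.+1] cells and passes to their limit by [sqmean_lim]. *)
Lemma signal_sqmean (j : nat) : (0 < j)%N ->
  (sqmean P (fun w => (o^T *m sin_integral t h j (fun s => X s w)) 0 0)%R <= (2 * b)%:E)%E.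
Proof.
move=> j0.
pose F k w := \sum_(l < k.+1) sine_basis t h j (u k.+1 l.+1) * \sum_i o i 0 * (X (u k.+1 l.+1) w i 0 - X (u k.+1 l) w i 0).
apply: (@sqmean_lim _ _ _ P F).
- move=> k; apply: measurable_sum => -[l lk]; apply: measurable_funM => //; apply: measurable_sum => i.
  apply: measurable_funM => //=; apply: measurable_funB; apply: rX; apply: node_01 => //; exact: ltnW.
- move=> w.
  have L : \sum_i o i 0 * \sum_(l < k) sine_basis t h j (u k l.+1) * (X (u k l.+1) w i 0 - X (u k l) w i 0)
      @[k --> \oo] --> \sum_i o i 0 * sin_integral t h j (fun s => X s w) i 0.
    apply: cvg_sum_seq => i; apply: cvgM; first exact: cvg_cst.
    have [H _] := sin_integral_area (x := fun s => X s w) t0 h0 th1 (@cX w i) j0; exact: H.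
  have E : (o^T *m sin_integral t h j (fun s => X s w)) 0 0 = \sum_i o i 0 * sin_integral t h j (fun s => X s w) i 0.
    by rewrite mxE; apply: eq_bigr => i _; rewrite mxE.
  rewrite E; have := L; rewrite -(cvg_shiftn 1).
  apply: cvg_trans; apply: near_eq_cvg; near=> k.
  rewrite /F /= addn1; under [RHS]eq_bigr do rewrite mulr_sumr.
  rewrite exchange_big/=; apply: eq_bigr => i _; rewrite mulr_sumr; apply: eq_bigr => l _; ring.
move=> k; have bound l : `|sine_basis t h j (u k.+1 l.+1)| <= Num.sqrt (2 / h).
  by rewrite /sine_basis normrM ger0_norm ?sqrtr_ge0// ler_piMr ?sqrtr_ge0// /sine ler_norml sin_geN1 sin_le1.
have H := increments_sqmean (k := k.+1) (phi := fun l => sine_basis t h j (u k.+1 l.+1)) isT bound.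
apply: (le_trans H).
rewrite lee_fin sqr_sqrtr; last by rewrite divr_ge0// ltW.
by rewrite le_eqVlt; apply/orP; left; apply/eqP; field; rewrite gt_eqF.
Unshelve. all: by end_near. Qed.

End signal.

(** * Comparison of the statistic with a weighted Wishart matrix *)

Section limits.
Context {R : realType} {disp : measure_display} {T : measurableType disp} (P : probability T R).

(** Cauchy's criterion with countable quantifiers only, so that the set of convergence is seen to be
    measurable. *)
Lemma cvgn_cauchy (u : nat -> R) : cvgn u <->
  forall k : nat, exists N : nat, forall n, (N <= n)%N -> `|u N - u n| <= k.+1%:R^-1.
Proof.
split=> [cu k|H].
  have k0 : 0 < k.+1%:R^-1 / 2 :> R by rewrite divr_gt0.
  have /cvgrPdist_le/(_ _ k0)[N _ hN] := cu.
  exists N => n Nn; have := hN N (leqnn N); have := hN n Nn; rewrite /= => h1 h2.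
  rewrite -(subrK (limn u) (u N)) -addrA (le_trans (ler_normD _ _))// distrC.
  by move: h1 h2; move: (k.+1%:R^-1) => e; lra.
apply: cauchy_cvg; apply: cauchy_exP => e e0.
have [k _ hk] : \forall n \near \oo, n.+1%:R^-1 <= e / 2 :> R.
  have e2 : 0 < e / 2 by rewrite divr_gt0.
  have := @cvg_harmonic R => /cvgrPdist_le/(_ _ e2)[N _ hN].
  by exists N => // n /hN; rewrite /= sub0r normrN ger0_norm// invr_ge0.
have [N hN] := H k; exists (u N), N => // n /= Nn.
rewrite /ball/= (le_lt_trans (hN n Nn))// (le_lt_trans (hk k (leqnn k)))//; lra.
Qed.

(** The series of the statistic may diverge at some outcomes. There [limn] has the default value
    [point]; on the measurable set [C] of convergence it is a limit of measurable functions. *)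
Lemma measurable_limn (u : nat -> T -> R) : (forall n, measurable_fun setT (u n)) ->
  measurable_fun setT (fun w => limn (fun n => u n w)).
Proof.
move=> mu.
pose C := [set w | cvgn (fun n => u n w)].
have CE : C = \bigcap_k \bigcup_N \bigcap_(n in [set n | (N <= n)%N]) [set w | `|u N w - u n w| <= k.+1%:R^-1].
  apply/seteqP; split=> w /=.
    by move=> /cvgn_cauchy H k _; have [N hN] := H k; exists N.
  by move=> H; apply/cvgn_cauchy => k; have [N _ hN] := H k Logic.I; exists N.
have mC : measurable C.
  rewrite CE; apply: bigcap_measurable => // k _; apply: bigcup_measurable => N _.
  apply: bigcap_measurable => [|n _]; first by exists N => /=.
  by apply: measurable_le; apply: measurableT_comp => //; exact: measurable_funB.
pose g (n : nat) (w : T) : R := u n w * \1_C w + (point : R) * \1_(~` C) w.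
have mg n : measurable_fun setT (g n).
  apply: measurable_funD; apply: measurable_funM => //; apply: measurable_indic => //; exact: measurableC.
apply: (measurable_fun_cvg mg) => w _.
rewrite /g !indicE in_setC; have [wC|wC] := boolP (w \in C).
  under eq_fun do rewrite mulr1 mulr0 addr0; by move: wC; rewrite inE.
rewrite mulr1 (_ : limn _ = point); last by apply: dvgP => H; move: wC; rewrite notin_setE; apply; exact: H.
by under eq_fun do rewrite mulr0 add0r; exact: cvg_cst.
Qed.

(** The error terms of all frequencies are gathered in one variable [F], whose mean Tonelli's
    theorem bounds. It is then finite off a single null set, and Markov's inequality is applied to
    it once. *)
Lemma series_ae (e : nat -> T -> R) (c : nat -> R) (K : R) :
  (forall j, measurable_fun setT (e j)) -> (forall j w, 0 <= e j w) ->
  (forall j, (\int[P]_w (e j w)%:E <= (c j)%:E)%E) -> (forall N, \sum_(j < N) c j <= K) ->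
  exists F : T -> \bar R, [/\ measurable_fun setT F, (forall w, 0 <= F w)%E, (\int[P]_w F w <= K%:E)%E,
    {ae P, forall w, F w \is a fin_num} & forall w N, ((\sum_(j < N) e j w)%:E <= F w)%E].
Proof.
move=> me e0 ec cK.
have e0' (j : nat) w : setT w -> (0 <= (e j w)%:E)%E by rewrite lee_fin.
have me' (j : nat) : measurable_fun setT (fun w => (e j w)%:E) by apply/measurable_EFinP.
pose F w := (\sum_(0 <= j <oo) (e j w)%:E)%E.
have F0 w : (0 <= F w)%E by apply: nneseries_ge0 => j _ _; rewrite lee_fin.
have mF : measurable_fun setT F by apply: ge0_emeasurable_sum => // *; rewrite lee_fin.
have IF : (\int[P]_w F w <= K%:E)%E.
  rewrite integral_nneseries//; apply: lime_le.
    by apply: is_cvg_nneseries => j _ _; apply: integral_ge0 => w _; rewrite lee_fin.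
  near=> N; rewrite big_mkord; apply: (@le_trans _ _ (\sum_(j < N) (c j)%:E)%E).
    by apply: lee_sum => j _; exact: ec.
  by rewrite sumEFin lee_fin.
have Iint : P.-integrable setT F.
  apply/integrableP; split=> //; under eq_integral do rewrite gee0_abs//.
  by rewrite (le_lt_trans IF)// ltry.
exists F; split=> //.
  by apply: filterS (integrable_ae measurableT Iint) => w /=; exact.
move=> w N; rewrite -sumEFin -(big_mkord xpredT (fun j => (e j w)%:E)); apply: nneseries_lim_ge => j _ _; by rewrite lee_fin.
Unshelve. all: by end_near. Qed.

Lemma markov_integral (F : T -> \bar R) (K u : R) : measurable_fun setT F -> (forall w, 0 <= F w)%E ->
  (\int[P]_w F w <= K%:E)%E -> 0 < u -> measurable [set w | u%:E <= F w]%E /\ (P [set w | u%:E <= F w]%E <= (K / u)%:E)%E.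
Proof.
move=> mF F0 IF u0.
have mA : measurable [set w | u%:E <= F w]%E.
  by rewrite -[X in measurable X]setTI; exact: emeasurable_fun_c_infty.
split=> //.
rewrite -(@lee_pmul2l _ u%:E) ?lte_fin// -EFinM mulrCA divff ?mulr1 ?gt_eqF//.
apply: le_trans IF.
rewrite -[X in P X]setIT -integral_indic// -ge0_integralZl//; last 2 first.
- by apply/measurable_EFinP; exact: measurable_indic.
- by rewrite lee_fin ltW.
apply: ge0_le_integral => //.
- by move=> w _; rewrite -EFinM lee_fin mulr_ge0// ltW.
- by apply: measurable_funeM; apply/measurable_EFinP; exact: measurable_indic.
move=> w _; rewrite indicE; case: (boolP (w \in _)) => [|_]; last by rewrite mule0.
by rewrite inE /= mule1.
Qed.

End limits.

Section weighted_gram.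
Context {R : realType}.

Lemma sqr_dot_le {m : nat} (v c : 'cV[R]_m) : sqnorm c = 1 -> (\sum_i v i 0 * c i 0) ^+ 2 <= sqnorm v.
Proof.
move=> c1.
have E (s : R) : \sum_i (v i 0 - s * c i 0) ^+ 2 = sqnorm v - 2 * s * (\sum_i v i 0 * c i 0) + s ^+ 2 * sqnorm c.
  by rewrite /sqnorm !mulr_sumr -sumrB -big_split/=; apply: eq_bigr => i _; ring.
set s := \sum_i v i 0 * c i 0.
have : 0 <= \sum_i (v i 0 - s * c i 0) ^+ 2 by apply: sumr_ge0 => i _; exact: sqr_ge0.
by rewrite E c1 -/s; move: (sqnorm v) s => x s; rewrite expr2; lra.
Qed.

Lemma cvgn_dominated (x y : nat -> R) (L : R) : (forall j, `|x j| <= y j) -> (forall N, \sum_(j < N) y j <= L) ->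
  cvgn (fun N => \sum_(j < N) x j).
Proof.
move=> xy yL.
have cv (z : nat -> R) (L' : R) : (forall j, 0 <= z j) -> (forall N, \sum_(j < N) z j <= L') ->
    cvgn (fun N => \sum_(j < N) z j).
  move=> z0 zL; apply: nondecreasing_is_cvgn; last by exists L' => _ [N _ <-].
  apply/nondecreasing_seqP => N; by rewrite big_ord_recr/= lerDl.
have y0 j : 0 <= y j by apply: le_trans (xy j).
have c1 : cvgn (fun N => \sum_(j < N) (x j + y j)).
  apply: (cv (fun j => x j + y j) (2 * L)) => [j|N].
    by have := xy j; rewrite ler_norml => /andP[]; lra.
  rewrite (le_trans (y := \sum_(j < N) 2 * y j))//; last by rewrite -mulr_sumr ler_wpM2l.
  by apply: ler_sum => j _; have := xy j; rewrite ler_norml => /andP[]; lra.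
have c2 := cv _ _ y0 yL.
rewrite (_ : (fun N => _) = (fun N => \sum_(j < N) (x j + y j)) \- (fun N => \sum_(j < N) y j)).
  exact: is_cvgB.
by apply/funext => N /=; rewrite -sumrB; apply: eq_bigr => j _; ring.
Qed.

Lemma cvgn_from1 (x : nat -> R) : cvgn (fun N => \sum_(j < N) x j.+1) -> cvgn (fun N => \sum_(1 <= j < N) x j).
Proof.
move=> /cvg_ex[l H]; apply/cvg_ex; exists l; rewrite -(cvg_shiftn 1).
apply: cvg_trans H; apply: near_eq_cvg; near=> N.
by rewrite /= addn1 big_add1/= big_mkord.
Unshelve. all: by end_near. Qed.

Lemma weighted_gram_sym {m : nat} (a : nat -> R) (v : nat -> 'cV[R]_m) : (weighted_gram a v)^T = weighted_gram a v.
Proof.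
apply/matrixP => i k; rewrite !mxE; congr (sum_ge1 _); apply/funext => j; congr (_ * _).
by rewrite !mxE; apply: eq_bigr => l _; rewrite !mxE mulrC.
Qed.

Lemma qform_weighted_gram {m : nat} (a : nat -> R) (v : nat -> 'cV[R]_m) (L : R) (x : 'cV[R]_m) :
  (forall j, 0 <= a j) -> (forall N, \sum_(j < N) a j.+1 * sqnorm (v j.+1) <= L) ->
  \sum_(1 <= j < N) a j * (\sum_i v j i 0 * x i 0) ^+ 2 @[N --> \oo] --> qform (weighted_gram a v) x.
Proof.
move=> a0 aL.
have cv i k : cvgn (fun N => \sum_(1 <= j < N) a j * (v j *m (v j)^T) i k).
  apply: cvgn_from1; apply: (@cvgn_dominated (fun j => a j.+1 * (v j.+1 *m (v j.+1)^T) i k) (fun j => a j.+1 * sqnorm (v j.+1)) L) => // j.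
  rewrite normrM ger0_norm// ler_wpM2l//.
  rewrite mxE big_ord1 mxE normrM.
  have h (l : 'I_m) : `|v j.+1 l 0| ^+ 2 <= sqnorm (v j.+1).
    rewrite real_normK ?num_real// /sqnorm (bigD1 l)//= lerDl; apply: sumr_ge0 => ? _; exact: sqr_ge0.
  have := h i; have := h k; move: `|_ i 0| `|_ k 0| => p q h1 h2.
  have : 0 <= (p - q) ^+ 2 by exact: sqr_ge0.
  rewrite sqrrB; lra.
rewrite qform_sum.
have E N : \sum_(1 <= j < N) a j * (\sum_i v j i 0 * x i 0) ^+ 2 =
    \sum_i \sum_k (\sum_(1 <= j < N) a j * (v j *m (v j)^T) i k) * (x i 0 * x k 0).
  rewrite (eq_bigr (fun j => \sum_i \sum_k a j * (v j *m (v j)^T) i k * (x i 0 * x k 0))); last first.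
    move=> j _; rewrite -qform_outer qform_sum mulr_sumr; apply: eq_bigr => i _; rewrite mulr_sumr.
    by apply: eq_bigr => k _; rewrite mulrA.
  rewrite exchange_big/=; apply: eq_bigr => i _; rewrite exchange_big/=; apply: eq_bigr => k _.
  by rewrite mulr_suml.
under eq_fun do rewrite E.
apply: cvg_sum_seq => i; apply: cvg_sum_seq => k; apply: cvgM; last exact: cvg_cst.
by rewrite mxE; exact: cv.
Qed.

Lemma measurable_weighted_gram {disp : measure_display} {T : measurableType disp} {m : nat} (a : nat -> R)
    (v : nat -> T -> 'cV[R]_m) i k : (forall j l, (0 < j)%N -> measurable_fun setT (fun w => v j w l 0)) ->
  measurable_fun setT (fun w => weighted_gram a (fun j => v j w) i k).
Proof.
move=> mv; under eq_fun do rewrite mxE.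
apply: measurable_limn => N.
apply: measurable_sum_mem => j; rewrite mem_index_iota => /andP[j0 _].
under eq_fun do rewrite mxE big_ord1 mxE.
by apply: measurable_funM => //; apply: measurable_funM; exact: mv.
Qed.

Lemma sum_above (F : nat -> R) (n N : nat) : \sum_(1 <= j < n) (N < j)%N%:R * F j = \sum_(N.+1 <= j < n) F j.
Proof.
rewrite (@big_nat_widenl _ _ _ N.+1 1)//= [RHS]big_mkcond/=; apply: eq_bigr => j _.
by case: ltnP => _; rewrite ?mul1r ?mul0r.
Qed.

End weighted_gram.

Section rejection.
Context {R : realType} {disp : measure_display} {T : measurableType disp} (P : probability T R).
Context {d r m : nat} (M : R) (N : nat) (ep be Ks : R).
Context (S : nat -> T -> 'cV[R]_d) (a zeta : nat -> T -> 'cV[R]_m.+1) (U : 'M[R]_(d, m.+1)).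
Hypothesis rd : (r < d)%N.
Hypothesis dm : (d <= m.+1 + r)%N.
Hypothesis M1 : 1 <= M.
Hypothesis ep0 : 0 < ep.
Hypothesis UU : U^T *m U = 1%:M.
Hypothesis mS : forall j i, (0 < j)%N -> measurable_fun setT (fun w => S j w i 0).
Hypothesis ma : forall j i, (0 < j)%N -> measurable_fun setT (fun w => a j w i 0).
Hypothesis iidz : iid_standard_gaussian P zeta.
Hypothesis US : forall j w, (0 < j)%N -> U^T *m S j w = a j w + (ep * j%:R) *: zeta j w.
Hypothesis S2 : forall j i, (0 < j)%N -> (sqmean P (fun w => S j w i 0)%R <= (Ks * (1 + j%:R ^+ 2))%:E)%E.
Hypothesis a2 : forall j i, (0 < j)%N -> (sqmean P (fun w => a j w i 0)%R <= (be * ep ^+ 2)%:E)%E.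
Hypothesis tail : forall n, \sum_(N.+1 <= j < n) jweight M j <= 1.

Let M0 : 0 < M. Proof. exact: lt_le_trans ltr01 M1. Qed.

Lemma integral_sqnorm {k : nat} (v : T -> 'cV[R]_k) (c x : R) : (forall i, measurable_fun setT (fun w => v w i 0)) ->
  0 <= c -> (forall i, (sqmean P (fun w => v w i 0)%R <= x%:E)%E) ->
  (\int[P]_w (c * sqnorm (v w))%R%:E <= (c * (k%:R * x))%:E)%E.
Proof.
move=> mv c0 vx.
have E : (\int[P]_w (c * sqnorm (v w))%:E = c%:E * \sum_i sqmean P (fun w => v w i 0)%R)%E.
  rewrite -ge0_integral_sum//; last 2 first.
  - by move=> i; exact: measurable_sqr.
  - by move=> i w _; rewrite lee_fin sqr_ge0.
  rewrite -ge0_integralZl//; last 2 first.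
  - by apply: emeasurable_sum => i; exact: measurable_sqr.
  - by move=> w _; apply: sume_ge0 => i _; rewrite lee_fin sqr_ge0.
  by apply: eq_integral => w _; rewrite sumEFin EFinM.
rewrite E EFinM lee_wpmul2l ?lee_fin//.
apply: (@le_trans _ _ (\sum_(i < k) x%:E)%E); first by apply: lee_sum => i _; exact: vx.
by rewrite sumEFin sumr_const card_ord mulr_natl.
Qed.

Lemma measurable_sqnorm {k : nat} (v : T -> 'cV[R]_k) : (forall i, measurable_fun setT (fun w => v w i 0)) ->
  measurable_fun setT (fun w => sqnorm (v w)).
Proof. by move=> mv; apply: measurable_sum => i; exact: measurable_funX. Qed.

Lemma sqmean_zeta j i : sqmean P (fun w => zeta j w i 0) = 1%:E.
Proof.
have [_ /(_ j i) gz] := iidz.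
have [] := standard_gaussian_law gz (measurable_power 2) (integr_gauss_power 2).
by move=> I E; rewrite sqmean_Ex// E gauss_moment2.
Qed.

Lemma measurable_rejection (kappa : R) :
  measurable [set w | kappa < eigval (weighted_gram (weight M) (fun j => S j w)) r.+1].
Proof.
apply: measurable_gt; apply: measurable_eigval => // [i k|w]; last exact: weighted_gram_sym.
exact: measurable_weighted_gram.
Qed.

(** Young's inequality with parameter [1 / M]: the noise gains a factor [1 + 1 / M] and the signal a
    factor [1 + M]. As [B_w M] is of order [M ^+ 2], both errors are of order [M] in mean, below the
    fluctuations of order [M ^ (3/2)]. For [N < j] the summand 2 covers the whole noise term. *)
Let excess_weight (j : nat) : R := jweight M j * (M^-1 + 2 * (N < j)%N%:R).
Let signal_weight (j : nat) : R := weight M j * (1 + M) / ep ^+ 2.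

Lemma excess_weight_ge0 j : 0 <= excess_weight j.
Proof. by rewrite mulr_ge0 ?jweight_ge0// addr_ge0 ?invr_ge0 ?(ltW M0)// mulr_ge0. Qed.

Lemma signal_weight_ge0 j : 0 <= signal_weight j.
Proof.
apply: divr_ge0; last exact: sqr_ge0.
by apply: mulr_ge0; [exact: weight_ge0|rewrite addr_ge0// ltW].
Qed.

(* Young's inequality separates the signal part; beyond the index N the noise is also treated as an error. *)
Lemma statistic_bound (c : 'cV[R]_m.+1) j w : (0 < j)%N -> sqnorm c = 1 ->
  weight M j * (\sum_i S j w i 0 * (U *m c) i 0) ^+ 2 <=
  ep ^+ 2 * ((j <= N)%N%:R * (jweight M j * (\sum_i zeta j w i 0 * c i 0) ^+ 2) +
     (excess_weight j * sqnorm (zeta j w) + signal_weight j * sqnorm (a j w))).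
Proof.
move=> j0 c1.
have cs (v : 'cV[R]_m.+1) := sqr_dot_le v c1.
have -> : \sum_i S j w i 0 * (U *m c) i 0 = (ep * j%:R) * (\sum_i zeta j w i 0 * c i 0) + \sum_i a j w i 0 * c i 0.
  have -> : \sum_i S j w i 0 * (U *m c) i 0 = ((S j w)^T *m (U *m c)) 0 0.
    by rewrite [RHS]mxE; apply: eq_bigr => i _; rewrite [in RHS]mxE.
  have -> : (S j w)^T *m (U *m c) = (U^T *m S j w)^T *m c by rewrite trmx_mul trmxK mulmxA.
  rewrite US// mxE mulr_sumr -big_split/=; apply: eq_bigr => i _; rewrite !mxE; ring.
have := cs (zeta j w); have := cs (a j w).
move: (\sum_i zeta j w i 0 * c i 0) (\sum_i a j w i 0 * c i 0) (sqnorm _) (sqnorm _) => z y nz na ya zn.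
have w0 := weight_ge0 j M0; have jw0 := jweight_ge0 j M0.
have Mi0 : 0 < M^-1 by rewrite invr_gt0.
have := young_sqr (ep * j%:R * z) y Mi0; rewrite invrK => H.
apply: (le_trans (ler_wpM2l w0 H)).
have -> : weight M j * ((1 + M^-1) * (ep * j%:R * z) ^+ 2 + (1 + M) * y ^+ 2) =
    ep ^+ 2 * (jweight M j * (1 + M^-1) * z ^+ 2 + signal_weight j * y ^+ 2).
  by rewrite /signal_weight /jweight; field; rewrite gt_eqF//= gt_eqF.
rewrite ler_wpM2l ?sqr_ge0// addrA; apply: lerD; last by rewrite ler_wpM2l ?signal_weight_ge0.
rewrite /excess_weight; have jz : jweight M j * z ^+ 2 <= jweight M j * nz by rewrite ler_wpM2l.
have jz' : M^-1 * (jweight M j * z ^+ 2) <= M^-1 * (jweight M j * nz) by rewrite ler_wpM2l// ltW.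
have q0 : 0 <= jweight M j * z ^+ 2 by rewrite mulr_ge0 ?sqr_ge0.
have -> : jweight M j * (1 + M^-1) * z ^+ 2 = jweight M j * z ^+ 2 + M^-1 * (jweight M j * z ^+ 2) by ring.
have -> : jweight M j * (M^-1 + 2 * (N < j)%N%:R) * nz = M^-1 * (jweight M j * nz) + 2 * (N < j)%N%:R * (jweight M j * nz) by ring.
move: jz jz' q0; move: (jweight M j * z ^+ 2) (jweight M j * nz) => x1 x2 h1 h2 h3.
by case: (leqP j N) => _ /=; lra.
Qed.

Lemma partial_sum_bound (c : 'cV[R]_m.+1) w n : (N < n)%N -> sqnorm c = 1 ->
  \sum_(1 <= j < n) weight M j * (\sum_i S j w i 0 * (U *m c) i 0) ^+ 2 <=
  ep ^+ 2 * (lambda_max (gram (jweight M) N (fun j => zeta j w)) +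
     \sum_(j < n.-1) (excess_weight j.+1 * sqnorm (zeta j.+1 w) + signal_weight j.+1 * sqnorm (a j.+1 w))).
Proof.
move=> Nn c1; have n0 : (0 < n)%N by apply: leq_ltn_trans Nn.
apply: (@le_trans _ _ (\sum_(1 <= j < n) ep ^+ 2 * ((j <= N)%N%:R * (jweight M j * (\sum_i zeta j w i 0 * c i 0) ^+ 2) +
     (excess_weight j * sqnorm (zeta j w) + signal_weight j * sqnorm (a j w))))).
  by rewrite big_nat [leRHS]big_nat; apply: ler_sum => j /andP[j0 _]; exact: statistic_bound.
rewrite -mulr_sumr ler_wpM2l ?sqr_ge0// big_split/=; apply: lerD; last first.
  by rewrite big_add1/= big_mkord.
have -> : \sum_(1 <= j < n) (j <= N)%N%:R * (jweight M j * (\sum_i zeta j w i 0 * c i 0) ^+ 2) =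
    qform (gram (jweight M) N (fun j => zeta j w)) c.
  rewrite qform_gram (@big_cat_nat _ _ _ N.+1)//=.
  have -> : \sum_(N.+1 <= j < n) (j <= N)%N%:R * (jweight M j * (\sum_i zeta j w i 0 * c i 0) ^+ 2) = 0.
    by rewrite big_nat big1// => j /andP[Nj _]; rewrite leqNgt Nj mul0r.
  by rewrite addr0; apply: eq_big_nat => j /andP[_]; rewrite ltnS => ->; rewrite mul1r.
by rewrite (le_trans (qform_le_lambda_max _ (gram_sym _ _ _)))// c1 mulr1.
Qed.

Lemma measurable_lambda_gram : measurable_fun setT (fun w => lambda_max (gram (jweight M) N (fun j => zeta j w))).
Proof.
apply: measurable_eigval => // [i k|w]; last exact: gram_sym.
under eq_fun do rewrite mxE; apply: measurable_sum => j; under eq_fun do rewrite mxE big_ord1 mxE.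
by apply: measurable_funM => //; apply: measurable_funM; exact: (measurable_zeta iidz (j, _)).
Qed.

(** The direction provided by Courant-Fischer depends on the outcome, so the errors must be
    controlled for all unit vectors at once; this is why they are measured by [sqnorm] of the
    vectors. Markov's inequality for their sum produces the last term. *)
Lemma rejection_bound (tau u : R) : 0 < u ->
  (P [set w | (tau * ep ^+ 2 < eigval (weighted_gram (weight M) (fun j => S j w)) r.+1)%R] <=
   P [set w | (tau - u < lambda_max (gram (jweight M) N (fun j => zeta j w)))%R] +
   (m.+1%:R * (B_w M / M + 2 + (1 + M) * be) / u)%:E)%E.
Proof.
move=> u0; have mz j i : measurable_fun setT (fun w => zeta j w i 0) by exact: (measurable_zeta iidz (j, i)).
have [_ Bw _] := jweight_series M0.
pose e j w := excess_weight j.+1 * sqnorm (zeta j.+1 w) + signal_weight j.+1 * sqnorm (a j.+1 w).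
pose c j := excess_weight j.+1 * (m.+1%:R * 1) + signal_weight j.+1 * (m.+1%:R * (be * ep ^+ 2)).
have e1 j w : 0 <= excess_weight j.+1 * sqnorm (zeta j.+1 w) by rewrite mulr_ge0 ?excess_weight_ge0 ?sqnorm_ge0.
have e2 j w : 0 <= signal_weight j.+1 * sqnorm (a j.+1 w) by rewrite mulr_ge0 ?signal_weight_ge0 ?sqnorm_ge0.
have me1 j : measurable_fun setT (fun w => excess_weight j.+1 * sqnorm (zeta j.+1 w)).
  by apply: measurable_funM => //; exact: measurable_sqnorm.
have me2 j : measurable_fun setT (fun w => signal_weight j.+1 * sqnorm (a j.+1 w)).
  by apply: measurable_funM => //; apply: measurable_sqnorm => i; exact: ma.
have me j : measurable_fun setT (e j) by exact: measurable_funD.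
have e0 j w : 0 <= e j w by rewrite addr_ge0.
have ec j : (\int[P]_w (e j w)%:E <= (c j)%:E)%E.
  rewrite (eq_integral (fun w => (excess_weight j.+1 * sqnorm (zeta j.+1 w))%R%:E + (signal_weight j.+1 * sqnorm (a j.+1 w))%R%:E)%E)//.
  rewrite ge0_integralD//; do ?[by move=> w _; rewrite lee_fin]; do ?[by apply/measurable_EFinP].
  rewrite EFinD; apply: leeD.
    by apply: integral_sqnorm => //; [exact: excess_weight_ge0|move=> i; rewrite sqmean_zeta].
  by apply: integral_sqnorm => [i||i]; [exact: ma|exact: signal_weight_ge0|exact: a2].
have be0 : 0 <= be * ep ^+ 2.
  by rewrite -lee_fin (le_trans (sqmean_ge0 _ _) (a2 ord0 (ltn0Sn 0))).
have be0' : 0 <= be by move: be0; rewrite pmulr_lge0// exprn_gt0.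
have cK n : \sum_(j < n) c j <= m.+1%:R * (B_w M / M + 2 + (1 + M) * be).
  have S1 : \sum_(j < n) excess_weight j.+1 <= B_w M / M + 2.
    have -> : \sum_(j < n) excess_weight j.+1 = \sum_(1 <= j < n.+1) excess_weight j by rewrite big_add1/= big_mkord.
    have -> : \sum_(1 <= j < n.+1) excess_weight j = M^-1 * (\sum_(1 <= j < n.+1) jweight M j) +
        2 * (\sum_(1 <= j < n.+1) (N < j)%N%:R * jweight M j).
      by rewrite !mulr_sumr -big_split/=; apply: eq_bigr => j _; rewrite /excess_weight; ring.
    rewrite sum_above mulrC; apply: lerD; first by rewrite ler_wpM2r ?invr_ge0 ?(ltW M0).
    by rewrite -[leRHS]mulr1 ler_wpM2l.
  have S2' : \sum_(j < n) signal_weight j.+1 <= (1 + M) / ep ^+ 2.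
    have -> : \sum_(j < n) signal_weight j.+1 = (\sum_(1 <= j < n.+1) weight M j) * ((1 + M) / ep ^+ 2).
      by rewrite big_add1/= big_mkord mulr_suml; apply: eq_bigr => j _; rewrite /signal_weight mulrA.
    rewrite ler_piMl ?weight_sum_le1// divr_ge0 ?sqr_ge0// addr_ge0// ltW//.
  have -> : \sum_(j < n) c j = m.+1%:R * (\sum_(j < n) excess_weight j.+1) +
      m.+1%:R * ((be * ep ^+ 2) * \sum_(j < n) signal_weight j.+1).
    by rewrite !mulr_sumr -big_split/=; apply: eq_bigr => j _; rewrite /c; ring.
  rewrite mulrDr lerD ?ler_wpM2l// (le_trans (ler_wpM2l be0 S2'))//.
  by rewrite le_eqVlt; apply/orP; left; apply/eqP; field; rewrite gt_eqF.
have [F [mF F0 IF Ffin eF]] := series_ae me e0 ec cK.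
(* The second moments [S2] only serve to make the series of the statistic converge almost surely, so
   that its quadratic forms are limits of partial sums; [Ks] does not enter the bound. *)
pose s j w := weight M j.+1 * sqnorm (S j.+1 w).
have ms j : measurable_fun setT (s j) by apply: measurable_funM => //; apply: measurable_sqnorm => i; exact: mS.
have s0 j w : 0 <= s j w by rewrite mulr_ge0 ?weight_ge0 ?sqnorm_ge0.
have sc j : (\int[P]_w (s j w)%:E <= (weight M j.+1 * (d%:R * (`|Ks| * (1 + j.+1%:R ^+ 2))))%:E)%E.
  apply: integral_sqnorm => [i||i]; [exact: mS|exact: weight_ge0|].
  apply: le_trans (S2 i (ltn0Sn j)) _; rewrite lee_fin ler_wpM2r ?ler_norm// addr_ge0// sqr_ge0.
have sK n : \sum_(j < n) weight M j.+1 * (d%:R * (`|Ks| * (1 + j.+1%:R ^+ 2))) <= d%:R * `|Ks| * (1 + B_w M).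
  have -> : \sum_(j < n) weight M j.+1 * (d%:R * (`|Ks| * (1 + j.+1%:R ^+ 2))) =
      d%:R * `|Ks| * (\sum_(1 <= j < n.+1) weight M j + \sum_(1 <= j < n.+1) jweight M j).
    rewrite -big_split/= big_add1/= big_mkord mulr_sumr; apply: eq_bigr => j _; rewrite /jweight; ring.
  by rewrite ler_wpM2l ?mulr_ge0// lerD ?weight_sum_le1.
have [G [mG G0 IG Gfin sG]] := series_ae ms s0 sc sK.
have [mA2 PA2] := markov_integral mF F0 IF u0.
have [N0 [mN0 PN0 sub0]] := filterI Ffin Gfin.
have mA1 : measurable [set w | tau - u < lambda_max (gram (jweight M) N (fun j => zeta j w))].
  by apply: measurable_gt; exact: measurable_lambda_gram.
have mr := measurable_rejection (tau * ep ^+ 2).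
have sub : [set w | tau * ep ^+ 2 < eigval (weighted_gram (weight M) (fun j => S j w)) r.+1] `<=`
   ([set w | tau - u < lambda_max (gram (jweight M) N (fun j => zeta j w))] `|` [set w | u%:E <= F w]%E) `|` N0.
  move=> w /= rej; have [wN|wN] := pselect (N0 w); first by right.
  have [fF fG] : F w \is a fin_num /\ G w \is a fin_num by apply: contrapT => H; apply: wN; exact: sub0.
  left; have [uF|Fu] := leP u (fine (F w)); first by right; rewrite /= -(fineK fF) lee_fin.
  left => /=; have [b b1 Hb] := eigval_gt_qform (weighted_gram_sym _ _) dm rd UU rej.
  have sL n : \sum_(j < n) weight M j.+1 * sqnorm (S j.+1 w) <= fine (G w).
    by rewrite -lee_fin fineK//; exact: sG.
  have cv := qform_weighted_gram (v := fun j => S j w) (x := U *m b) (fun j => weight_ge0 j M0) sL.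
  have ub : qform (weighted_gram (weight M) (fun j => S j w)) (U *m b) <=
      ep ^+ 2 * (lambda_max (gram (jweight M) N (fun j => zeta j w)) + fine (F w)).
    rewrite -(cvg_lim _ cv)//; apply: limr_le; first by apply/cvg_ex; eexists; exact: cv.
    near=> n.
    have Nn : (N < n)%N by near: n; exists N.+1.
    rewrite (le_trans (partial_sum_bound _ Nn b1))// ler_wpM2l ?sqr_ge0// lerD2l.
    by rewrite -lee_fin fineK//; exact: (eF w n.-1).
  have := lt_le_trans Hb ub; rewrite mulrC ltr_pM2l ?exprn_gt0//; lra.
apply: (@le_trans _ _ (P (([set w | (tau - u < lambda_max (gram (jweight M) N (fun j => zeta j w)))%R] `|`
  [set w | u%:E <= F w]%E) `|` N0))).
  by apply: le_measure; rewrite ?inE//; apply: measurableU => //; exact: measurableU.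
have H1 := measureU2 P (measurableU _ _ mA1 mA2) mN0; have H2 := measureU2 P mA1 mA2.
apply: (le_trans H1); rewrite [X in (_ + X)%E](_ : _ = 0%E)// adde0.
by apply: (le_trans H2); rewrite leeD2l.
Unshelve. all: by end_near. Qed.

End rejection.

(** * The signal under the null hypothesis *)

Section null_hypothesis.
Context {R : realType} {d : nat} (r : nat) (beta L lam t h : R) (Sigma : R -> 'M[R]_d).
Hypothesis rd : (r < d)%N.
Hypothesis beta0 : 0 < beta.
Hypothesis L0 : 0 < L.
Hypothesis h0 : 0 < h.
Hypothesis lam0 : 0 <= lam.
Hypothesis H0S : H0 r `[t, t + h] beta L lam Sigma.

Let delta : R := L * h `^ beta.

Lemma delta_ge0 : 0 <= delta. Proof. by rewrite mulr_ge0 ?powR_ge0// ltW. Qed.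

Lemma interval_psd s : t <= s <= t + h -> psd (Sigma s).
Proof. by move=> s1; have [[H _] _] := H0S; apply: H; rewrite /= in_itv. Qed.

Lemma left_end : t <= t <= t + h. Proof. by rewrite lexx lerDl ltW. Qed.

Lemma increment_norm s (v : 'cV[R]_d) : t <= s <= t + h -> sqnorm v = 1 ->
  sqnorm ((Sigma s - Sigma t) *m v) <= delta ^+ 2.
Proof.
move=> s1 v1; have [[_ H] _] := H0S.
have := H t s; rewrite /= !in_itv/= s1 left_end => /(_ isT isT) H'.
have sp0 : 0 <= spectral_norm (Sigma s - Sigma t) by exact: sqrtr_ge0.
rewrite (le_trans (sqnorm_spectral_norm _ _))// v1 mulr1 lerXn2r ?nnegrE ?delta_ge0//.
rewrite (le_trans H')// ler_wpM2l ?(ltW L0)// ge0_ler_powR ?nnegrE ?(ltW beta0) ?(ltW h0)//.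
by move: s1 => /andP[s1 s2]; rewrite ger0_norm; lra.
Qed.

Lemma qform_dot (S : 'M[R]_d) (v : 'cV[R]_d) : qform S v = \sum_i (S *m v) i 0 * v i 0.
Proof. by rewrite /qform -mulmxA mxE; apply: eq_bigr => i _; rewrite mxE mulrC. Qed.

Lemma qform_le_norm (S : 'M[R]_d) (v : 'cV[R]_d) (x : R) : 0 <= x -> sqnorm v = 1 -> sqnorm (S *m v) <= x ^+ 2 ->
  qform S v <= x.
Proof.
move=> x0 v1 Sx; have := le_trans (sqr_dot_le (S *m v) v1) Sx; rewrite -qform_dot => H.
have [q0|q0] := leP (qform S v) 0; first exact: le_trans q0 x0.
by rewrite -(@ler_pXn2r _ 2) ?nnegrE// ltW.
Qed.

(** Since [o] is in the kernel of [Sigma t], the vector [Sigma s *m o] equals the increment of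
    [Sigma] applied to [o] and has norm at most [delta]. Cauchy-Schwarz gives the first order bound,
    [psd_eigval_gap] the second order one. *)
Lemma direction_bound s (o : 'cV[R]_d) : t <= s <= t + h -> sqnorm o = 1 -> Sigma t *m o = 0 ->
  qform (Sigma s) o <= bias0 r beta L lam h.
Proof.
move=> s1 o1 to0; have Sp := interval_psd s1; have [_ /(_ s)] := H0S.
rewrite /= in_itv/= => /(_ s1)[rk lamr].
have E : (Sigma s - Sigma t) *m o = Sigma s *m o by rewrite mulmxBl to0 subr0.
have := increment_norm s1 o1; rewrite E => Sd.
have q1 := qform_le_norm delta_ge0 o1 Sd.
have q2 : qform (Sigma s) o <= 2 * L * h `^ beta by rewrite (le_trans q1)// -mulrA ler_peMl ?delta_ge0// ler1n.
rewrite /bias0; case: eqVneq => [//|lamn]; rewrite le_min q2/=.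
have lamp : 0 < lam by rewrite lt_neqAle eq_sym lamn.
have hE : h `^ (2 * beta) = (h `^ beta) ^+ 2 by rewrite mulrC powRrM powR_mulrn// powR_ge0.
have dE : L ^+ 2 * h `^ (2 * beta) = delta ^+ 2 by rewrite hE exprMn.
rewrite -[_ * L ^+ 2 * _]mulrA dE.
(* For [r = 0] there is no eigenvalue condition, but the rank forces [Sigma s = 0]. *)
have [r0|r0] := posnP r.
  have S0 : Sigma s = 0 by move: rk; rewrite r0 leqn0 mxrank_eq0 => /eqP.
  by rewrite /qform S0 mulmx0 mul0mx mxE divr_ge0// mulr_ge0 ?sqr_ge0// addr_ge0.
have rd' : (0 < r <= d)%N by rewrite r0 ltnW.
have := psd_eigval_gap o Sp rk rd' (lamr r0) => H.
rewrite ler_pdivlMr// mulrC (le_trans H)// (le_trans Sd)// ler_peMl ?sqr_ge0//.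
by rewrite -natrD ler1n addnC.
Qed.

(** The constant depends on [Sigma]. It is used only for the almost sure convergence of the series
    of the statistic, not for the level. *)
Lemma uniform_bound : exists2 K : R, 0 <= K & forall s (v : 'cV[R]_d), t <= s <= t + h -> sqnorm v = 1 -> qform (Sigma s) v <= K.
Proof.
exists (`|lambda_max (Sigma t)| + delta); first by rewrite addr_ge0 ?delta_ge0.
move=> s v s1 v1.
have -> : Sigma s = Sigma t + (Sigma s - Sigma t) by rewrite addrC subrK.
rewrite qformD lerD//; last exact: (qform_le_norm delta_ge0 v1 (increment_norm s1 v1)).
have [St _] := interval_psd left_end.
by rewrite (le_trans (qform_le_lambda_max v St))// v1 mulr1 ler_norm.
Qed.

End null_hypothesis.

(** * From the model to the weighted Wishart matrix *)

Section model.
Context {R : realType} {disp : measure_display} {T : measurableType disp} (P : probability T R).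
Context {d p r m : nat} (sigma : R -> 'M[R]_(d, p)) (B : R -> T -> 'cV[R]_p) (X W : R -> T -> 'cV[R]_d).
Context (beta L lam t h eta C M : R) (n N : nat) (Sigma : R -> 'M[R]_d).
Hypothesis model : signal_noise_model P sigma B X W.
Hypothesis rd : (r < d)%N.
Hypothesis rm : (d - r)%N = m.+1.
Hypothesis beta0 : 0 < beta.
Hypothesis L0 : 0 < L.
Hypothesis eta0 : 0 < eta.
Hypothesis n0 : (0 < n)%N.
Hypothesis t0 : 0 <= t.
Hypothesis h01 : 0 < h <= 1 - t.
Hypothesis lam0 : 0 <= lam.
Hypothesis bias : bias0 r beta L lam h <= C * eps eta n h ^+ 2.
Hypothesis H0S : H0 r `[t, t + h] beta L lam Sigma.
Hypothesis sS : forall s, t <= s <= t + h -> sigma s *m (sigma s)^T = Sigma s.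
Hypothesis M1 : 1 <= M.
Hypothesis tail : forall k, \sum_(N.+1 <= j < k) jweight M j <= 1.

Let h0 : 0 < h. Proof. by case/andP: h01. Qed.
Let th1 : t + h <= 1. Proof. by case/andP: h01 => _; rewrite lerBrDl. Qed.

Lemma eps_gt0 : 0 < eps eta n h.
Proof. by rewrite /eps !mulr_gt0 ?pi_gt0 ?invr_gt0// powR_gt0// ltr0n. Qed.

Lemma measurable_sin_integral j i : (0 < j)%N -> measurable_fun setT (fun w => sin_integral t h j (fun s => X s w) i 0).
Proof.
case: model => _ _ rX cX _ _ _ j0.
pose F k w := \sum_(l < k) sine_basis t h j (node t h k l.+1) * (X (node t h k l.+1) w i 0 - X (node t h k l) w i 0).
have mF k : measurable_fun setT (F k).
  apply: measurable_sum => -[l lk]; apply: measurable_funM => //=; apply: measurable_funB; apply: rX.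
    by apply: node_01 => //; exact: leq_ltn_trans lk.
  by apply: node_01 => //; [exact: ltnW|exact: leq_ltn_trans lk].
apply: (measurable_fun_cvg mF) => w _.
by have [H _] := sin_integral_area (x := fun s => X s w) t0 h0 th1 (@cX w i) j0.
Qed.

Lemma measurable_cos_integral j i : measurable_fun setT (fun w => cos_integral t h j (fun s => W s w) i 0).
Proof.
case: model => _ _ _ _ _ bW _.
have := measurable_noise_vector 1%:M bW t0 h0 th1 j i.
by rewrite /noise_vector; under eq_fun do rewrite trmx1 mul1mx.
Qed.

Lemma sqmean_cos_integral j i : sqmean P (fun w => cos_integral t h j (fun s => W s w) i 0) = 1%:E.
Proof.
case: model => _ _ _ _ _ bW _.
have U1 : (1%:M : 'M[R]_d)^T *m 1%:M = 1%:M by rewrite trmx1 mulmx1.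
have [_ gz] := noise_iid bW t0 h0 th1 U1.
have := gz j i; rewrite /noise_vector; under eq_fun do rewrite trmx1 mul1mx.
move=> gji; have [I E] := standard_gaussian_law gji (measurable_power 2) (integr_gauss_power 2).
by rewrite sqmean_Ex// E gauss_moment2.
Qed.

Lemma sqmean_sin_integral (o : 'cV[R]_d) (b : R) j : (0 < j)%N ->
  (forall s, t <= s <= t + h -> qform (Sigma s) o <= b) ->
  (sqmean P (fun w => (o^T *m sin_integral t h j (fun s => X s w)) 0 0)%R <= (2 * b)%:E)%E.
Proof.
case: model => sqs bB rX cX wX _ _ j0 ob.
apply: (signal_sqmean sqs bB rX cX wX t0 h0 th1 _ j0) => s s1.
by rewrite sS//; exact: ob.
Qed.

Definition stat (j : nat) (w : T) : 'cV[R]_d := S_stat t h (fun u => observation eta n X W u w) j.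

Lemma statE j w : (0 < j)%N ->
  stat j w = - sin_integral t h j (fun s => X s w) + (eps eta n h * j%:R) *: cos_integral t h j (fun s => W s w).
Proof.
case: model => _ _ _ cX _ bW _ j0; have [_ _ cW _] := bW.
rewrite /stat (S_stat_decomposition (X := fun s => X s w) (W := fun s => W s w) (cn := eta * n%:R `^ (- 2^-1)) t0 h0 th1 j0).
- congr (_ + _ *: _); rewrite /eps; field; by rewrite gt_eqF.
- by move=> i; exact: (@cX w i).
- by move=> i; exact: (@cW w i).
- by move=> u i; rewrite /observation mxE.
Qed.

Lemma stat_entry j w i : (0 < j)%N -> stat j w i 0 =
  -1 * sin_integral t h j (fun s => X s w) i 0 + (eps eta n h * j%:R) * cos_integral t h j (fun s => W s w) i 0.
Proof.
move=> j0; rewrite statE//; move: (sin_integral _ _ _ _) (cos_integral _ _ _ _) => A D.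
by rewrite !mxE mulN1r.
Qed.

(** [zeta] depends on the model through the directions [U], its law does not; the error term is free
    of [Sigma] too. The supremum over the null hypothesis is thereby reduced to a statement about
    i.i.d. Gaussian vectors. *)
Lemma model_rejection (tau u : R) : 0 < u ->
  exists2 zeta : nat -> T -> 'cV[R]_m.+1, iid_standard_gaussian P zeta &
  (P [set w | rejects r t h M (tau * eps eta n h ^+ 2) (fun v => observation eta n X W v w)] <=
   P [set w | (tau - u < lambda_max (gram (jweight M) N (fun j => zeta j w)))%R] +
   (m.+1%:R * (B_w M / M + 2 + (1 + M) * (2 * C)) / u)%:E)%E.
Proof.
move=> u0; have [_ rk] := H0S.
have [rkt _] : (\rank (Sigma t) <= r)%N /\ ((0 < r)%N -> lam <= eigval (Sigma t) r).
  by apply: rk; rewrite /= in_itv/= left_end.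
have [U UU tU] : exists2 U : 'M[R]_(d, m.+1), U^T *m U = 1%:M & Sigma t *m U = 0.
  by rewrite -rm; apply: kernel_orthonormal => //; exact: (interval_psd H0S (left_end t h0)).
have bW : brownian_motion P W by case: model.
exists (noise_vector W t h U); first exact: noise_iid.
have [K K0 HK] := uniform_bound beta0 L0 h0 H0S.
have ep0 := eps_gt0; have cU i : sqnorm (col i U) = 1.
  have := congr1 (fun A : 'M[R]_m.+1 => A i i) UU; rewrite !mxE eqxx /= mulr1n => E.
  by rewrite -[RHS]E; apply: eq_bigr => l _; rewrite !mxE expr2.
have tcU i : Sigma t *m col i U = 0 by apply/colP => l; have := congr1 (fun A : 'M[R]_(d, m.+1) => A l i) tU; rewrite !mxE => E0; rewrite -[RHS]E0; apply: eq_bigr => k _; rewrite !mxE.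
have mS j i : (0 < j)%N -> measurable_fun setT (fun w => stat j w i 0).
  move=> j0; under eq_fun do rewrite stat_entry//.
  apply: measurable_funD; first by apply: measurable_funM => //; exact: measurable_sin_integral.
  by apply: measurable_funM => //; exact: measurable_cos_integral.
pose a j w := - (U^T *m sin_integral t h j (fun s => X s w)).
have aE j w i : a j w i 0 = -1 * ((col i U)^T *m sin_integral t h j (fun s => X s w)) 0 0.
  by rewrite /a !mxE mulN1r; congr (- _); apply: eq_bigr => l _; rewrite !mxE.
have mo j i : (0 < j)%N -> measurable_fun setT (fun w => ((col i U)^T *m sin_integral t h j (fun s => X s w)) 0 0).
  move=> j0; under eq_fun do rewrite mxE; apply: measurable_sum => l.
  by apply: measurable_funM => //; exact: measurable_sin_integral.
have ma j i : (0 < j)%N -> measurable_fun setT (fun w => a j w i 0).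
  by move=> j0; under eq_fun do rewrite aE; apply: measurable_funM => //; exact: mo.
have a2 j i : (0 < j)%N -> (sqmean P (fun w => a j w i 0)%R <= (2 * C * eps eta n h ^+ 2)%:E)%E.
  move=> j0; rewrite (_ : (fun w => a j w i 0) = fun w => -1 * ((col i U)^T *m sin_integral t h j (fun s => X s w)) 0 0); last by apply/funext => w; exact: aE.
  rewrite sqmeanZ; last exact: mo.
  rewrite sqrrN expr1n mul1e.
  apply: (le_trans (sqmean_sin_integral j0 (fun s s1 => direction_bound rd beta0 L0 h0 lam0 H0S s1 (cU i) (tcU i)))).
  by rewrite lee_fin -mulrA ler_wpM2l.
have US j w : (0 < j)%N -> U^T *m stat j w = a j w + (eps eta n h * j%:R) *: noise_vector W t h U j w.
  by move=> j0; rewrite statE// mulmxDr mulmxN scalemxAr.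
have S2 j i : (0 < j)%N -> (sqmean P (fun w => stat j w i 0)%R <= ((4 * K + 2 * eps eta n h ^+ 2) * (1 + j%:R ^+ 2))%:E)%E.
  move=> j0; pose e : 'cV[R]_d := \col_l (l == i)%:R.
  have eA (A : 'cV[R]_d) : (e^T *m A) 0 0 = A i 0.
    rewrite mxE (bigD1 i)//= big1 ?addr0; first by rewrite !mxE eqxx mul1r.
    by move=> l /negbTE li; rewrite !mxE li mul0r.
  have e1 : sqnorm e = 1.
    by rewrite /sqnorm (bigD1 i)//= big1 ?addr0 ?mxE ?eqxx ?expr1n// => l /negbTE li; rewrite mxE li expr0n.
  have H := sqmean_sin_integral j0 (fun s s1 => HK s e s1 e1).
  have E1 : (fun w => (e^T *m sin_integral t h j (fun s => X s w)) 0 0) = (fun w => sin_integral t h j (fun s => X s w) i 0).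
    by apply/funext => w; exact: eA.
  rewrite E1 in H.
  have mA := measurable_sin_integral i j0; have mD := measurable_cos_integral j i.
  have mA' : measurable_fun setT (fun w => -1 * sin_integral t h j (fun s => X s w) i 0) by exact: measurable_funM.
  have mD' : measurable_fun setT (fun w => (eps eta n h * j%:R) * cos_integral t h j (fun s => W s w) i 0) by exact: measurable_funM.
  have -> : (fun w => stat j w i 0) = fun w => -1 * sin_integral t h j (fun s => X s w) i 0 +
      (eps eta n h * j%:R) * cos_integral t h j (fun s => W s w) i 0.
    by apply/funext => w; rewrite stat_entry.
  have Y := @sqmean_young _ _ _ P 1 _ _ ltr01 mA' mD'.
  apply: (le_trans Y).
  rewrite sqmeanZ// sqmeanZ// sqmean_cos_integral sqrrN expr1n mul1e mule1 invr1 -EFinM.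
  apply: (@le_trans _ _ ((1 + 1)%:E * (2 * K)%:E + ((1 + 1) * (eps eta n h * j%:R) ^+ 2)%:E)%E).
    by rewrite leeD2r// lee_wpmul2l// lee_fin.
  rewrite -EFinM -EFinD lee_fin exprMn.
  have := sqr_ge0 (eps eta n h); have : 0 <= j%:R ^+ 2 :> R by exact: sqr_ge0.
  move: (eps eta n h ^+ 2) (j%:R ^+ 2 : R) => x y y0 x0.
  have : 0 <= K * y by rewrite mulr_ge0.
  lra.
have dm : (d <= m.+1 + r)%N by rewrite -rm subnK// ltnW.
exact: (@rejection_bound _ _ _ P d r m M N (eps eta n h) (2 * C) _ stat a (noise_vector W t h U) U rd dm M1 ep0 UU mS ma
  (noise_iid bW t0 h0 th1 UU) US S2 a2 tail tau u u0).
Qed.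

End model.

(** * Quantiles and the level of the tests *)

Section quantile.
Context {R : realType} {disp : measure_display} {T : measurableType disp} (P : probability T R).

Lemma prob_le_large (V : T -> R) (a : R) : measurable_fun setT V -> a < 1 ->
  exists x : R, (a%:E <= P [set w | (V w <= x)%R])%E.
Proof.
move=> mV a1; pose F (n : nat) := [set w | V w <= n%:R].
have mF n : measurable (F n) by exact: measurable_le.
have FT : \bigcup_n F n = setT.
  apply/seteqP; split=> // w _; have [n _ /(_ n (leqnn n)) hn] := nbhs_infty_ger (V w).
  by exists n.
have incr : {homo F : n k / (n <= k)%N >-> (n <= k)%O}.
  by move=> n k nk; apply/subsetPset => w /= h; rewrite /F /= (le_trans h)// ler_nat.
have mU : measurable (\bigcup_n F n) by rewrite FT.
have cv : (P \o F) x @[x --> \oo] --> 1%E.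
  by rewrite -(probability_setT P) -FT; exact: nondecreasing_cvg_mu.
have [n Hn] : exists n, (a%:E <= P (F n))%E.
  apply: contrapT => H.
  have le n : (P (F n) <= a%:E)%E.
    by have [|/ltW//] := leP a%:E (P (F n)) => h; exfalso; apply: H; exists n.
  have : ((1 : R)%:E <= a%:E)%E.
    rewrite -(cvg_lim _ cv)//; apply: lime_le; first by apply/cvg_ex; eexists; exact: cv.
    by near=> n; exact: le.
  by rewrite lee_fin leNgt a1.
by exists n%:R.
Unshelve. all: by end_near. Qed.

(** Whether the infimum is attained is left open: the event that [V] exceeds [q] is the increasing
    union of the events that [V] exceeds [q + 1 / (n + 1)], each of probability at most [alpha].
    [has_inf] ensures that [inf] is not a default value. *)
Lemma quantile_level (V : T -> R) (alpha : R) : measurable_fun setT V -> 0 < alpha < 1 ->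
  (P [set w | (quantile P V (1 - alpha) < V w)%R] <= alpha%:E)%E.
Proof.
move=> mV /andP[a0 a1]; set q := quantile P V (1 - alpha).
pose A := [set x : R | ((1 - alpha)%:E <= P [set w | (V w <= x)%R])%E].
have mle (x : R) : measurable [set w | V w <= x] by exact: measurable_le.
have mgt (x : R) : measurable [set w | x < V w] by exact: measurable_gt.
have compl (x : R) : P [set w | x < V w]%R = (1 - P [set w | V w <= x]%R)%E.
  rewrite -probability_setC//; congr (P _); apply/seteqP; split => w /=; first by rewrite ltNge => /negP.
  by move=> /negP; rewrite -ltNge.
have Amem x : A x -> (P [set w | x < V w]%R <= alpha%:E)%E.
  rewrite /A /= compl => H; have -> : alpha%:E = (1 - (1 - alpha)%:E)%E :> \bar R by rewrite -EFinB opprB addrC subrK.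
  exact: leeB.
have hA : has_inf A.
  split.
    by have [|x Hx] := @prob_le_large V (1 - alpha) mV; [lra|exists x].
  have mN : measurable_fun setT (fun w => - V w) by exact: measurableT_comp.
  have [|x Hx] := @prob_le_large (fun w => - V w) (1 - (1 - alpha) / 2) mN; first by lra.
  exists (- x) => y Ay; rewrite leNgt; apply/negP => yx.
  have S1 : (P [set w | - V w <= x]%R <= P [set w | y < V w]%R)%E.
    apply: le_measure; rewrite ?inE//; first exact: measurable_le.
    by move=> w /= h; lra.
  have := le_trans Hx (le_trans S1 (Amem y Ay)); rewrite lee_fin; lra.
have gtq n : (P [set w | q + n.+1%:R^-1 < V w]%R <= alpha%:E)%E.
  have n0 : 0 < n.+1%:R^-1 :> R by rewrite invr_gt0.
  have [y Ay yq] := inf_adherent n0 hA.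
  apply: le_trans (Amem y Ay); apply: le_measure; rewrite ?inE// => w /=.
  by apply: lt_trans.
have U : [set w | q < V w] = \bigcup_n [set w | q + n.+1%:R^-1 < V w].
  apply/seteqP; split => w /=; last by move=> [n _ /=]; apply: lt_trans; rewrite ltrDl invr_gt0.
  move=> qV; have vq : 0 < V w - q by rewrite subr_gt0.
  have := @cvg_harmonic R => /cvgrPdist_lt/(_ _ vq)[n _ /(_ n (leqnn n))].
  by rewrite /= sub0r normrN ger0_norm ?invr_ge0// => h; exists n => //=; rewrite addrC -ltrBrDr.
have cv := @nondecreasing_cvg_mu _ _ _ P (fun n => [set w | q + n.+1%:R^-1 < V w]) (fun n => mgt _).
rewrite -U in cv; have {}cv := cv (mgt q).
have incr : {homo (fun n : nat => [set w | q + n.+1%:R^-1 < V w]) : n k / (n <= k)%N >-> (n <= k)%O}.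
  move=> n k nk; apply/subsetPset => w /= h; apply: le_lt_trans h.
  by rewrite lerD2l lef_pV2 ?posrE// ler_nat.
have {}cv := cv incr.
rewrite -(cvg_lim _ cv)//; apply: lime_le; first by apply/cvg_ex; eexists; exact: cv.
by near=> n; exact: gtq.
Unshelve. all: by end_near. Qed.

End quantile.

Section scales.
Context {R : realType}.

Definition gauss_scale : R := (2 * pi) `^ (- 2^-1).

Lemma gauss_scale_gt0 : 0 < gauss_scale.
Proof. by rewrite powR_gt0// mulr_gt0 ?pi_gt0. Qed.

Lemma gauss_scale_sqr : gauss_scale ^+ 2 = (2 * pi)^-1.
Proof.
have p0 : 0 <= 2 * pi :> R by rewrite mulr_ge0 ?pi_ge0.
by rewrite -powR_mulrn ?powR_ge0// -powRrM mulNr mulVf// powRN powRr1.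
Qed.

Lemma power_scale_sqr (M : R) : 0 <= M -> (M `^ (3 / 2)) ^+ 2 = M ^+ 3.
Proof. by move=> M0; rewrite -powR_mulrn ?powR_ge0// -powRrM divfK// powR_mulrn. Qed.

Lemma jweight_tail (M : R) : 0 < M -> \forall N \near \oo, forall k, \sum_(N.+1 <= j < k) jweight M j <= 1.
Proof.
move=> M0; have [cv le _] := jweight_series M0.
have /cvgrPdist_le/(_ _ ltr01)[N0 _ HN] := cv.
exists N0 => // N /= N0N k.
have [kN|Nk] := leqP k N.+1; first by rewrite big_geq.
have := HN N.+1 (leq_trans N0N (leqnSn N)); rewrite /= => H.
have := le k; rewrite (@big_cat_nat _ _ _ N.+1)//=; last exact: ltnW.
by move: H; rewrite ler_norml => /andP[_]; lra.
Qed.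

(** [N] depends on [M]; it is taken so large that the truncated sum of squares, divided by [M ^+ 3],
    is close to its limit and the remaining weights add up to at most 1. *)
Lemma truncated_scale (rho : R) : 0 < rho -> \forall M \near (+oo : set_system R), exists N (s : R),
  [/\ 0 < s, \sum_(1 <= j < N.+1) jweight M j ^+ 2 = s ^+ 2, `|s / M `^ (3 / 2) - gauss_scale| <= rho &
   forall k, \sum_(N.+1 <= j < k) jweight M j <= 1].
Proof.
move=> rho0; have g0 := gauss_scale_gt0.
(* The first term yields accuracy [rho] for the square roots, after division by [x + gauss_scale];
   the second keeps the truncated sum of squares positive. *)
have e0 : 0 < Num.min (rho * gauss_scale / 2) (gauss_scale ^+ 2 / 4).
  by rewrite lt_min !divr_gt0 ?mulr_gt0 ?exprn_gt0.
near=> M; have M0 : 0 < M by near: M; apply: nbhs_pinfty_gt; rewrite num_real.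
have vM : `|(2 * pi)^-1 - jweight_var M| <= Num.min (rho * gauss_scale / 2) (gauss_scale ^+ 2 / 4).
  by near: M; have /cvgrPdist_le/(_ _ e0) := @cvg_jweight_var R.
have M3 : 0 < M ^+ 3 by rewrite exprn_gt0.
have [cv _] := jweight_sq_series M0.
have e0' : 0 < M ^+ 3 * Num.min (rho * gauss_scale / 2) (gauss_scale ^+ 2 / 4) by rewrite mulr_gt0.
have /cvgrPdist_le/(_ _ e0')[N1 _ H1] := cv.
have [N2 _ H2] := jweight_tail M0.
pose N := maxn N1 N2.
set S := \sum_(1 <= j < N.+1) jweight M j ^+ 2.
have HS : `|M ^+ 3 * jweight_var M - S| <= M ^+ 3 * Num.min (rho * gauss_scale / 2) (gauss_scale ^+ 2 / 4).
  by apply: H1; rewrite /= /N (leq_trans (leq_maxl N1 N2)).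
have {}HS : `|jweight_var M - S / M ^+ 3| <= Num.min (rho * gauss_scale / 2) (gauss_scale ^+ 2 / 4).
  rewrite -(ler_pM2l M3) -{1}(gtr0_norm M3) -normrM mulrBr [M ^+ 3 * (S / _)]mulrCA divff ?mulr1// gt_eqF//.
have D : `|gauss_scale ^+ 2 - S / M ^+ 3| <= Num.min (rho * gauss_scale / 2) (gauss_scale ^+ 2 / 4) * 2.
  rewrite -gauss_scale_sqr in vM; rewrite -[X in `|X - _|](subrK (jweight_var M)) -addrA (le_trans (ler_normD _ _))//.
  by rewrite mulr_natr mulr2n lerD.
have D1 : `|gauss_scale ^+ 2 - S / M ^+ 3| <= rho * gauss_scale.
  rewrite (le_trans D)// -ler_pdivlMr// ge_min lexx//.
have D2 : `|gauss_scale ^+ 2 - S / M ^+ 3| <= gauss_scale ^+ 2 / 2.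
  by rewrite (le_trans D)// -ler_pdivlMr// ge_min; apply/orP; right; lra.
have S0 : 0 < S / M ^+ 3.
  by move: D2; rewrite ler_norml => /andP[_]; have : 0 < gauss_scale ^+ 2 by [rewrite exprn_gt0]; lra.
have Sp : 0 < S by move: S0; rewrite pmulr_lgt0// invr_gt0.
have gM0 : 0 < M `^ (3 / 2) by exact: powR_gt0.
exists N, (Num.sqrt S); split.
- by rewrite sqrtr_gt0.
- by rewrite sqr_sqrtr// ltW.
- set x := Num.sqrt S / M `^ (3 / 2).
  have x0 : 0 <= x by rewrite divr_ge0 ?sqrtr_ge0// ltW.
  have xE : x ^+ 2 = S / M ^+ 3 by rewrite /x exprMn exprVn sqr_sqrtr ?(ltW Sp)// power_scale_sqr// ltW.
  have xg : 0 < x + gauss_scale by rewrite ltr_wpDl.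
  have : `|x - gauss_scale| * (x + gauss_scale) <= rho * (x + gauss_scale).
    rewrite -[X in _ * X <= _](gtr0_norm xg) -normrM -subr_sqr xE distrC (le_trans D1)//.
    by rewrite ler_wpM2l ?(ltW rho0)// lerDr.
  by rewrite ler_pM2r.
- by apply: H2; rewrite /= /N leq_maxr.
Unshelve. all: by end_near. Qed.

End scales.

Section levels.
Context {R : realType} {m : nat}.
Context {disp1 : measure_display} {T1 : measurableType disp1} (P1 : probability T1 R) (Z : T1 -> 'M[R]_m.+1).
Hypothesis goeZ : is_GOE P1 Z.
Context {disp2 : measure_display} {T2 : measurableType disp2} (P2 : probability T2 R) (zeta2 : nat -> T2 -> 'cV[R]_m.+1).
Hypothesis iid2 : iid_standard_gaussian P2 zeta2.
Context (alpha : R).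
Hypothesis alpha01 : 0 < alpha < 1.

Lemma measurable_Lambda (M : R) : measurable_fun setT (Lambda zeta2 M).
Proof.
apply: measurable_eigval => // [i k|w]; last exact: weighted_gram_sym.
apply: measurable_weighted_gram => j l _; exact: (measurable_zeta iid2 (j, l)).
Qed.

(** Dropping the nonnegative terms beyond [N] lowers every quadratic form, and [series_ae] makes the
    full series converge almost surely. The quantile of the untruncated [Lambda] thus also controls
    the truncated matrix. *)
Lemma gram_le_Lambda (M : R) (N : nat) (x : R) : 0 < M ->
  (P2 [set w | (x < lambda_max (gram (jweight M) N (fun j => zeta2 j w)))%R] <= P2 [set w | (x < Lambda zeta2 M w)%R])%E.
Proof.
move=> M0; have [_ Bw _] := jweight_series M0.
have mz j i : measurable_fun setT (fun w => zeta2 j w i 0) by exact: (measurable_zeta iid2 (j, i)).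
pose s j w := jweight M j.+1 * sqnorm (zeta2 j.+1 w).
have ms j : measurable_fun setT (s j) by apply: measurable_funM => //; exact: measurable_sqnorm.
have s0 j w : 0 <= s j w by rewrite mulr_ge0 ?jweight_ge0 ?sqnorm_ge0.
have sc j : (\int[P2]_w (s j w)%:E <= (jweight M j.+1 * (m.+1%:R * 1))%:E)%E.
  apply: integral_sqnorm => [//||i]; [exact: jweight_ge0|by rewrite (sqmean_zeta iid2)].
have sK n : \sum_(j < n) jweight M j.+1 * (m.+1%:R * 1) <= B_w M * m.+1%:R.
  by rewrite -mulr_suml mulr1 ler_wpM2r//; have := Bw n.+1; rewrite big_add1/= big_mkord.
have [G [mG G0 IG [N0 [mN0 PN0 sub0]] sG]] := series_ae ms s0 sc sK.
have mA : measurable [set w | x < lambda_max (gram (jweight M) N (fun j => zeta2 j w))].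
  by apply: measurable_gt; exact: measurable_lambda_gram iid2.
have mL : measurable [set w | x < Lambda zeta2 M w] by apply: measurable_gt; exact: measurable_Lambda.
have sub : [set w | x < lambda_max (gram (jweight M) N (fun j => zeta2 j w))] `<=` [set w | x < Lambda zeta2 M w] `|` N0.
  move=> w /= xw; have [wN|wN] := pselect (N0 w); first by right.
  have fG : G w \is a fin_num by apply: contrapT => H; apply: wN; exact: sub0.
  left; apply: (lt_le_trans xw); apply: lambda_max_le; first exact: gram_sym.
  move=> c c1; have Ls := weighted_gram_sym (jweight M) (fun j => zeta2 j w).
  have sL n : \sum_(j < n) jweight M j.+1 * sqnorm (zeta2 j.+1 w) <= fine (G w).
    by rewrite -lee_fin fineK//; exact: sG.
  have cv := qform_weighted_gram (v := fun j => zeta2 j w) (x := c) (fun j => jweight_ge0 j M0) sL.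
  apply: (@le_trans _ _ (qform (weighted_gram (jweight M) (fun j => zeta2 j w)) c)); last first.
    by have := qform_le_lambda_max c Ls; rewrite c1 mulr1.
  rewrite -(cvg_lim _ cv)//; apply: limr_ge; first by apply/cvg_ex; eexists; exact: cv.
  near=> n; have Nn : (N < n)%N by near: n; exists N.+1.
  rewrite qform_gram [leRHS](@big_cat_nat _ _ _ N.+1)//= lerDl; apply: sumr_ge0 => j _.
  by rewrite mulr_ge0 ?jweight_ge0 ?sqr_ge0.
have H := measureU2 P2 mL mN0.
apply: (@le_trans _ _ (P2 ([set w | (x < Lambda zeta2 M w)%R] `|` N0))).
  by apply: le_measure; rewrite ?inE; [exact: mA|exact: measurableU|exact: sub].
by apply: (le_trans H); rewrite [X in (_ + X)%E](_ : _ = 0%E)// adde0.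
Unshelve. all: by end_near. Qed.

Let qGOE : R := quantile P1 (fun w => lambda_max (Z w)) (1 - alpha).
Let qLambda (M : R) : R := quantile P2 (Lambda zeta2 M) (1 - alpha).

Lemma noise_level (e : R) : 0 < e -> exists2 delta : R, 0 < delta &
  \forall M \near (+oo : set_system R), exists2 N : nat, (forall k, \sum_(N.+1 <= j < k) jweight M j <= 1) &
  forall (d : measure_display) (T : measurableType d) (P : probability T R) (zeta : nat -> T -> 'cV[R]_m.+1),
    iid_standard_gaussian P zeta ->
    (P [set w | (B_w M + gauss_scale * M `^ (3 / 2) * qGOE - delta * M `^ (3 / 2) <
        lambda_max (gram (jweight M) N (fun j => zeta j w)))%R] <= (alpha + 3 * e)%:E)%E /\
    (P [set w | (qLambda M - delta * M `^ (3 / 2) <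
        lambda_max (gram (jweight M) N (fun j => zeta j w)))%R] <= (alpha + 3 * e)%:E)%E.
Proof.
move=> e0; have sg0 := gauss_scale_gt0 (R := R).
have [Cs Cs0 shift] := goe_shift goeZ.
(* The shift on the scale of the GOE; by [goe_shift] a displacement by [3 * d1] changes a
   probability by at most [e]. *)
pose d1 : R := e / (3 * Cs + 1).
have d10 : 0 < d1 by rewrite divr_gt0// ltr_wpDl// mulr_ge0.
have Cd1 : Cs * (3 * d1) <= e.
  have H : (3 * Cs + 1) * d1 = e by rewrite mulrC divfK// gt_eqF// ltr_wpDl// mulr_ge0.
  by move: H d10; nra.
have [tau tau0 cmp] := gram_compare goeZ e0 d10.
(* The same shift on the scale [M ^ (3/2)], halved because the truncated scale [s] is only bounded
   below by [gauss_scale / 2] times it. *)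
pose delta := gauss_scale * d1 / 2.
have delta0 : 0 < delta by rewrite divr_gt0// mulr_gt0.
exists delta => //.
(* The first bound keeps [s] above half of its limit; the second makes the error from replacing [s]
   by its limit, multiplied by [|qGOE| + d1], at most [delta]. *)
pose rho := Num.min (gauss_scale / 2) (delta / (`|qGOE| + d1)).
have qd0 : 0 < `|qGOE| + d1 by rewrite ltr_wpDl.
have rho0 : 0 < rho by rewrite lt_min (divr_gt0 sg0)// (divr_gt0 delta0).
near=> M; have M0 : 0 < M by near: M; apply: nbhs_pinfty_gt; rewrite num_real.
have [N [s [s0 s2 sr tail]]] : exists N (s : R),
  [/\ 0 < s, \sum_(1 <= j < N.+1) jweight M j ^+ 2 = s ^+ 2, `|s / M `^ (3 / 2) - gauss_scale| <= rho &
   forall k, \sum_(N.+1 <= j < k) jweight M j <= 1] by near: M; exact: truncated_scale.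
exists N => //.
set g := M `^ (3 / 2) in sr *; have g0 : 0 < g by exact: powR_gt0.
have g2 : g ^+ 2 = M ^+ 3 by apply: power_scale_sqr; exact: ltW.
pose eta := s / g - gauss_scale.
have sE : s = g * (gauss_scale + eta) by rewrite /eta addrC subrK mulrC divfK// gt_eqF.
have eta1 : `|eta| <= gauss_scale / 2 by rewrite (le_trans sr)// ge_min lexx.
have eta2 : `|eta| * (`|qGOE| + d1) <= delta.
  by rewrite -ler_pdivlMr// (le_trans sr)// ge_min lexx orbT.
have sg : gauss_scale / 2 * g <= s.
  by rewrite sE mulrC ler_pM2l//; move: eta1; rewrite ler_norml => /andP[+ _]; lra.
have s3 : \sum_(1 <= j < N.+1) jweight M j ^+ 3 <= tau * s ^+ 3.
  have H54 : \sum_(1 <= j < N.+1) jweight M j ^+ 3 <= 54 * M ^+ 4.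
    suff H : forall N, \sum_(1 <= j < N) jweight M j ^+ 3 <= 54 * M ^+ 4 by exact: H.
    by near: M; exact: jweight_cube_bound.
  apply: (le_trans H54).
  have g3 : (gauss_scale / 2 * g) ^+ 3 <= s ^+ 3 by rewrite lerXn2r ?nnegrE ?(ltW s0)// ltW// mulr_gt0 ?divr_gt0.
  rewrite (le_trans _ (ler_wpM2l (ltW tau0) g3))// exprMn.
  (* Since [g ^+ 3] is [M ^ (9/2)], the Lyapunov ratio decays like [M ^ (- 1/2)], and
     [M >= (54 / c) ^+ 2] makes it at most [tau]. *)
  pose c := tau * (gauss_scale / 2) ^+ 3; have c0 : 0 < c by rewrite mulr_gt0// exprn_gt0// divr_gt0.
  have Mc : (54 / c) ^+ 2 <= M by near: M; apply: nbhs_pinfty_ge; rewrite num_real.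
  have c54 : 0 <= 54 / c by rewrite divr_ge0// ltW.
  have key : 54 / c * M ^+ 4 <= g ^+ 3.
    have l0 : 0 <= 54 / c * M ^+ 4 by rewrite mulr_ge0// exprn_ge0// ltW.
    rewrite -(@ler_pXn2r _ 2) ?nnegrE ?exprn_ge0 ?(ltW g0)// -exprM mulnC exprM g2.
    rewrite (_ : (M ^+ 3) ^+ 3 = M * (M ^+ 4) ^+ 2); last by ring.
    by rewrite exprMn ler_wpM2r// sqr_ge0.
  have -> : tau * ((gauss_scale / 2) ^+ 3 * g ^+ 3) = c * g ^+ 3 by rewrite /c mulrA.
  have -> : 54 * M ^+ 4 = c * (54 / c * M ^+ 4) by field; rewrite gt_eqF.
  by rewrite ler_wpM2l// ltW.
set b := \sum_(1 <= j < N.+1) jweight M j.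
have bB : b <= B_w M by have [_ H _] := jweight_series M0; exact: H.
have [mg2 cmp2a cmp2b] := cmp _ _ P2 zeta2 (jweight M) N s iid2 (fun j => jweight_ge0 j M0) s0 s2 s3.
have mlZ := measurable_lambda_goe goeZ.
have mLZ (x : R) : measurable [set w | x < lambda_max (Z w)] by exact: measurable_gt.
move=> d T P zeta iz.
have [mg cmpa cmpb] := cmp _ _ P zeta (jweight M) N s iz (fun j => jweight_ge0 j M0) s0 s2 s3.
have mono (x y : R) : y <= x -> (P [set w | (x < lambda_max (gram (jweight M) N (fun j => zeta j w)))%R] <=
    P [set w | (y < lambda_max (gram (jweight M) N (fun j => zeta j w)))%R])%E.
  move=> yx; apply: le_measure; rewrite ?inE; [exact: measurable_gt|exact: measurable_gt|].
  by move=> w /=; exact: le_lt_trans.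
split.
  have xle : b + s * (qGOE - d1) <= B_w M + gauss_scale * g * qGOE - delta * g.
    rewrite -addrA lerD// sE.
    have p1 : `|eta * (qGOE - d1)| <= delta.
      rewrite normrM (le_trans _ eta2)// ler_wpM2l// (le_trans (ler_normB _ _))// (gtr0_norm d10)//.
    have p2 : eta * (qGOE - d1) <= delta by apply: le_trans p1; exact: ler_norm.
    have -> : g * (gauss_scale + eta) * (qGOE - d1) = gauss_scale * g * qGOE + g * (eta * (qGOE - d1) - gauss_scale * d1) by ring.
    rewrite lerD2l -[- (delta * g)]mulNr [g * _]mulrC ler_pM2r//.
    by move: p2; rewrite /delta; lra.
  apply: (le_trans (mono _ _ xle)); apply: (le_trans (cmpa _)).
  have d2 : 0 < 2 * d1 by rewrite mulr_gt0.
  have := shift (qGOE - d1 - d1) (2 * d1) d2.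
  rewrite (_ : qGOE - d1 - d1 + 2 * d1 = qGOE); last by ring.
  move=> H; apply: (@le_trans _ _ (alpha%:E + (Cs * (2 * d1))%:E + e%:E)%E).
    by rewrite leeD2r// (le_trans H)// leeD2r//; exact: quantile_level.
  rewrite -!EFinD lee_fin.
  have : 0 <= Cs * d1 by rewrite mulr_ge0// ltW.
  by move: Cd1; lra.
(* For the second test the GOE is an intermediary: from the law of [zeta] to the GOE, a displacement
   by [3 * d1] there, and back to the law of [zeta2], whose quantile is used. The two comparisons
   and the displacement cost [e] each. *)
pose x := (qLambda M - delta * g - b) / s.
have xE : b + s * x = qLambda M - delta * g by rewrite /x mulrC divfK ?gt_eqF// addrC subrK.
rewrite -xE; apply: (le_trans (cmpa x)).
have d3 : 0 < 3 * d1 by rewrite mulr_gt0.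
have H := shift (x - d1) (3 * d1) d3.
have H' := cmp2b (x - d1 + 3 * d1).
have qle : qLambda M <= b + s * (x - d1 + 3 * d1 - d1).
  have -> : b + s * (x - d1 + 3 * d1 - d1) = b + s * x + d1 * s by ring.
  rewrite xE -addrA lerDl addrC subr_ge0 /delta.
  by rewrite (_ : gauss_scale * d1 / 2 * g = d1 * (gauss_scale / 2 * g)) ?ler_pM2l//; ring.
have H2 : (P2 [set w | (b + s * (x - d1 + 3 * d1 - d1) < lambda_max (gram (jweight M) N (fun j => zeta2 j w)))%R] <= alpha%:E)%E.
  apply: (@le_trans _ _ (P2 [set w | (qLambda M < lambda_max (gram (jweight M) N (fun j => zeta2 j w)))%R])).
    apply: le_measure; rewrite ?inE; [exact: measurable_gt|exact: measurable_gt|].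
    by move=> w /=; exact: le_lt_trans.
  apply: (le_trans (gram_le_Lambda N (qLambda M) M0)).
  by apply: quantile_level; [exact: measurable_Lambda|exact: alpha01].
apply: (@le_trans _ _ (alpha%:E + e%:E + (Cs * (3 * d1))%:E + e%:E)%E).
  by rewrite leeD2r// (le_trans H)// leeD2r// (le_trans H')// leeD2r.
by rewrite -!EFinD lee_fin; move: Cd1; lra.
Unshelve. all: by end_near. Qed.

End levels.

Lemma limf_esup_le {R : realType} (f : R -> \bar R) (a : R) :
  (forall e : R, 0 < e -> \forall M \near (+oo : set_system R), (f M <= (a + e)%:E)%E) ->
  (limf_esup f (pinfty_nbhs R) <= a%:E)%E.
Proof.
move=> H; apply/lee_addgt0Pr => e e0; rewrite -EFinD.
apply: (@le_trans _ _ (ereal_sup [set f M | M in [set M | (f M <= (a + e)%:E)%E]])).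
  by apply: ereal_inf_lbound; exists [set M | (f M <= (a + e)%:E)%E] => //; exact: H.
by apply: ge_ereal_sup => _ [M /= h <-].
Qed.

Section test_size.
Context {R : realType} {d r m : nat} (beta L eta t C : R) (n : R -> nat) (h lam : R -> R).
Hypothesis rd : (r < d)%N.
Hypothesis rm : (d - r)%N = m.+1.
Hypothesis beta0 : 0 < beta.
Hypothesis L0 : 0 < L.
Hypothesis eta0 : 0 < eta.
Hypothesis t0 : 0 <= t.
Hypothesis hn : forall M, 1 <= M -> (0 < n M)%N.
Hypothesis hh : forall M, 1 <= M -> 0 < h M <= 1 - t.
Hypothesis hlam : forall M, 1 <= M -> 0 <= lam M.
Hypothesis hbias : forall M, 1 <= M -> bias0 r beta L (lam M) (h M) <= C * eps eta (n M) (h M) ^+ 2.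
Hypothesis C0 : 0 < C.

(** The numerator is of order [M], because [B_w M] is of order [M ^+ 2], while the denominator grows
    like [M ^ (3/2)]. *)
Lemma remainder_small (e delta : R) : 0 < e -> 0 < delta -> \forall M \near (+oo : set_system R),
  m.+1%:R * (B_w M / M + 2 + (1 + M) * (2 * C)) / (delta * M `^ (3 / 2)) <= e.
Proof.
move=> e0 d0; pose c : R := m.+1%:R * (8 + 4 * C); have c0 : 0 < c by rewrite mulr_gt0// addr_gt0// mulr_gt0.
near=> M; have M1 : 1 <= M by near: M; apply: nbhs_pinfty_ge; rewrite num_real.
have M0 : 0 < M by apply: lt_le_trans M1.
have Bw : B_w M <= 6 * M ^+ 2 by near: M; exact: B_w_bound.
have g0 : 0 < M `^ (3 / 2) by exact: powR_gt0.
have Mc : (c / (e * delta)) ^+ 2 <= M by near: M; apply: nbhs_pinfty_ge; rewrite num_real.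
rewrite ler_pdivrMr ?mulr_gt0//.
apply: (@le_trans _ _ (c * M)).
  rewrite /c -mulrA ler_wpM2l//.
  have B1 : B_w M / M <= 6 * M by rewrite ler_pdivrMr// -mulrA -expr2.
  have CM : C <= C * M by rewrite ler_peMr// ltW.
  lra.
have ed : 0 < e * delta by rewrite mulr_gt0.
rewrite mulrA -ler_pdivrMl// mulrA -(@ler_pXn2r _ 2) ?nnegrE ?(ltW g0)//; last first.
  by apply: mulr_ge0; rewrite ?(ltW M0)//; apply: mulr_ge0; rewrite ?(ltW c0)// invr_ge0 ltW.
rewrite power_scale_sqr ?(ltW M0)// exprMn [X in X ^+ 2 * _]mulrC (exprS _ 2) ler_wpM2r// sqr_ge0//.
Unshelve. all: by end_near. Qed.

(** The critical value is a parameter [tau], so both tests are instances. The hypothesis covers all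
    probability spaces because the supremum in [size_of_test] runs over all realisations of the
    model. *)
Lemma size_le (tau : R -> R) (alpha e delta : R) : 0 < e -> 0 < delta ->
  (\forall M \near (+oo : set_system R), exists2 N : nat, (forall k, \sum_(N.+1 <= j < k) jweight M j <= 1) &
    forall (disp : measure_display) (T : measurableType disp) (P : probability T R) (zeta : nat -> T -> 'cV[R]_m.+1),
      iid_standard_gaussian P zeta ->
      (P [set w | (tau M - delta * M `^ (3 / 2) <
         lambda_max (gram (jweight M) N (fun j => zeta j w)))%R] <= alpha%:E)%E) ->
  \forall M \near (+oo : set_system R),
    (size_of_test d r eta beta L (n M) t (h M) (lam M) M (tau M * eps eta (n M) (h M) ^+ 2) <= (alpha + e)%:E)%E.
Proof.
move=> e0 d0 H; near=> M; have M1 : 1 <= M by near: M; apply: nbhs_pinfty_ge; rewrite num_real.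
have M0 : 0 < M by apply: lt_le_trans M1.
have [N tail HN] : exists2 N : nat, (forall k, \sum_(N.+1 <= j < k) jweight M j <= 1) &
    forall (disp : measure_display) (T : measurableType disp) (P : probability T R) (zeta : nat -> T -> 'cV[R]_m.+1),
      iid_standard_gaussian P zeta ->
      (P [set w | (tau M - delta * M `^ (3 / 2) <
         lambda_max (gram (jweight M) N (fun j => zeta j w)))%R] <= alpha%:E)%E by near: M.
have rem : m.+1%:R * (B_w M / M + 2 + (1 + M) * (2 * C)) / (delta * M `^ (3 / 2)) <= e.
  by near: M; exact: remainder_small.
have u0 : 0 < delta * M `^ (3 / 2) by rewrite mulr_gt0// powR_gt0.
apply: ge_ereal_sup => _ [Sigma HS [p [disp [T [P [sigma [B [X [W [model sS ->]]]]]]]]]].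
have sS' s : t <= s <= t + h M -> sigma s *m (sigma s)^T = Sigma s by move=> s1; apply: sS; rewrite /= in_itv.
have [zeta iz Hz] := model_rejection model rd rm beta0 L0 eta0 (hn M1) t0 (hh M1) (hlam M1) (hbias M1) HS sS' M1 tail (tau M) u0.
apply: (le_trans Hz); rewrite EFinD leeD ?lee_fin//; exact: HN.
Unshelve. all: by end_near. Qed.

End test_size.

Theorem theorem3p6 (R : realType) (d r : nat) (hr : (r < d)%N)
    (alpha beta L eta t C : R)
    (halpha : 0 < alpha < 1) (hbeta : 0 < beta <= 1) (hL : 0 < L)
    (heta : 0 < eta) (ht : 0 <= t < 1) (hC : 0 < C)
    (n : R -> nat) (h lam : R -> R)
    (hn : forall M, 1 <= M -> (0 < n M)%N)
    (hh : forall M, 1 <= M -> 0 < h M <= 1 - t)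
    (hlam : forall M, 1 <= M -> 0 <= lam M)
    (hbias : forall M, 1 <= M ->
       bias0 r beta L (lam M) (h M) <= C * eps eta (n M) (h M) ^+ 2)
    (disp1 : measure_display) (T1 : measurableType disp1)
    (P1 : probability T1 R) (Z : T1 -> 'M[R]_(d - r)) (hZ : is_GOE P1 Z)
    (disp2 : measure_display) (T2 : measurableType disp2)
    (P2 : probability T2 R) (zeta : nat -> T2 -> 'cV[R]_(d - r))
    (hzeta : iid_standard_gaussian P2 zeta) :
  let qGOE := quantile P1 (fun w => lambda_max (Z w)) (1 - alpha) in
  let qLambda M := quantile P2 (Lambda zeta M) (1 - alpha) in
  (limf_esup (fun M : R =>
     size_of_test d r eta beta L (n M) t (h M) (lam M) M
       (kappa1 eta (n M) (h M) M qGOE)) (pinfty_nbhs R) <= alpha%:E)%E /\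
  (limf_esup (fun M : R =>
     size_of_test d r eta beta L (n M) t (h M) (lam M) M
       (kappa2 eta (n M) (h M) (qLambda M))) (pinfty_nbhs R) <= alpha%:E)%E.
Proof.
have [m rm] : exists m, (d - r)%N = m.+1 by exists (d - r).-1; rewrite prednK// subn_gt0.
move: {+}rm Z hZ zeta hzeta; rewrite rm => _ Z hZ zeta hzeta qGOE qLambda.
case/andP: hbeta => beta0 _; case/andP: ht => t0 _.
have level (e : R) : 0 < e -> exists2 delta : R, 0 < delta & _ := @noise_level R m _ _ P1 Z hZ _ _ P2 zeta hzeta alpha halpha e.
(* Three quarters of [e] go to [noise_level] and the last one to the remainder in [size_le]. *)
split; apply: limf_esup_le => e e0; have e4 : 0 < e / 4 by rewrite divr_gt0.
- have [delta d0 H] := level _ e4.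
  have -> : alpha + e = alpha + 3 * (e / 4) + e / 4 by lra.
  apply: (size_le hr rm beta0 hL heta t0 hn hh hlam hbias hC
    (tau := fun M => B_w M + gauss_scale * M `^ (3 / 2) * qGOE) e4 d0).
  apply: filterS H => M [N tail H]; exists N => // disp T P z iz; exact: (H _ _ P z iz).1.
- have [delta d0 H] := level _ e4.
  have -> : alpha + e = alpha + 3 * (e / 4) + e / 4 by lra.
  apply: (size_le hr rm beta0 hL heta t0 hn hh hlam hbias hC (tau := qLambda) e4 d0).
  apply: filterS H => M [N tail H]; exists N => // disp T P z iz; exact: (H _ _ P z iz).2.
Qed.
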